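(* Let $p\in[2,\infty)$, $T>0$, let $\rho_0\in\mathscr P_p(\mathbb{R})$ and $v_0\in L^p(\mathbb{R},\rho_0)$, and let $M^0$ be the right-continuous cumulative distribution function of $\rho_0$, with right-continuous generalized inverse $X^0(m)=\inf\{x:M^0(x)>m\}$. Consider a flux $\mathcal U(t,m)=\sum_{i=0}^nB_i(t)\mathcal F_i(m)$ where $\mathcal F_0(m)=\mathcal V^0(m)=\int_0^m v_0(X^0(\omega))\,d\omega$, $B_0\equiv1$, and for $i=1,\dots,n$: $\mathcal F_i(m)=\int_0^mF_i(\omega)\,d\omega$ with $F_i\in L^p(0,1)$, $B_i(t)=\int_0^tb_i(s)\,ds$ with $b_i\in L^1(0,T)$; write $F_0=v_0\circ X^0$. Let $M$, with $M(t,\cdot)\in\mathscr R_p$, be the entropy solution of $\partial_tM+\partial_x\mathcal U(t,M)=0$ with initial datum $M^0$. Define $\rho(t,\cdot)=\partial_xM(t,\cdot)$ and $v(t,\cdot)=\mathcal U'_M(t,\cdot)$. Then $(\rho(t,\cdot),v(t,\cdot))\in\mathscr T_p(\mathbb{R})$ for $t\in(0,T)$ and $(\rho,v)$ is a distributional solution on $(0,T)\times\mathbb{R}$ of $$\partial_t\rho+\partial_x(\rho v)=0,\qquad\partial_t(\rho v)+\partial_x(\rho v^2)=f[\rho],\qquad f[\rho]=\sum_{i=1}^nb_i(t)\,\partial_x\mathcal F_i(M).$$ Moreover $\rho(t)\in\mathscr P_p(\mathbb{R})$ and $v(t,\cdot)\in L^p(\mathbb{R},\rho(t))$ for every $t>0$,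 and (i) $\|v(t,\cdot)\|_{L^p(\mathbb{R},\rho(t))}\le\sum_{i=0}^n|B_i(t)|\,\|F_i\|_{L^p(0,1)}$ for a.e. $t>0$; (ii) $d_{\mathscr W_p}(\rho(t),\rho(s))\le|t-s|\sum_{i=0}^n\|F_i\|_{L^p(0,1)}\|B_i\|_{L^\infty(0,T)}$ for $0\le s\le t\le T$.
   Context: $\mathscr P_p(\mathbb{R})$ is the set of Borel probability measures with finite $p$-th moment, $d_{\mathscr W_p}$ the $p$-Wasserstein distance, and $\mathscr T_p(\mathbb{R})=\{(\mu,v):\mu\in\mathscr P_p(\mathbb{R}),v\in L^p(\mathbb{R},\mu)\}$. $\mathscr R$ is the set of nondecreasing right-continuous functions $\mathbb{R}\to\mathbb{R}$ with limits $0$ at $-\infty$ and $1$ at $+\infty$; $\mathscr R_p$ those whose derivative has finite $p$-th moment. For a cumulative distribution function $M(t,\cdot)$, $\mathcal U'_M(t,\cdot)$ denotes the Radon–Nikodym derivative of the measure $\partial_x\mathcal U(t,M(t,\cdot))$ with respect to $\partial_xM(t,\cdot)$; it equals $\sum_iB_i(t)F_i(M(t,x))$ where $M(t,\cdot)$ has no jump and $(\mathcal U(t,M(t,x))-\mathcal U(t,M(t,x-)))/(M(t,x)-M(t,x-))$ at a jump. An entropy solution with initial datum $M^0$ is $M\in L^\infty((0,T)\times\mathbb{R})\cap C([0,T];L^1_{\mathrm{loc}}(\mathbb{R}))$ with $\int_0^T\!\int(|M-k|\varphi_t+\operatorname{sgn}(M-k)(\mathcal U(t,M)-\mathcal U(t,k))\varphi_x)\,dx\,dt+\int|M^0-k|\varphi(0,x)\,dx\ge0$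 for all $k$ in a dense subset of $\mathbb{R}$ and all nonnegative $\varphi\in C_c^\infty([0,T)\times\mathbb{R})$. *)

(* Defs.v *)
From HB Require Import structures.
From mathcomp Require Import all_boot all_order all_algebra.
From mathcomp Require Import all_classical all_reals all_analysis.
Import numFieldNormedType.Exports.
Import Order.TTheory GRing.Theory Num.Theory.

Set Implicit Arguments.
Unset Strict Implicit.
Unset Printing Implicit Defensive.

Local Open Scope classical_set_scope.
Local Open Scope ring_scope.

Section Defs.
Context {R : realType}.

Notation RR := (measurableTypeR R).
Notation leb := (@lebesgue_measure R).

Definition lint_on (A : set R) (f : R -> R) : \bar R :=
  (\int[leb]_(x in A) (f x)%:E)%E.

Definition is_prob (mu : {measure set RR -> \bar R}) : Prop :=
  mu [set: RR] = 1%E.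

Definition inPp (p : R) (mu : {measure set RR -> \bar R}) : Prop :=
  is_prob mu /\ (\int[mu]_(x in [set: RR]) ((`|x| `^ p)%:E) < +oo)%E.

Definition inLp (p : R) (mu : {measure set RR -> \bar R}) (v : R -> R) : Prop :=
  measurable_fun [set: RR] (v : RR -> R) /\
  (\int[mu]_(x in [set: RR]) ((`|v x| `^ p)%:E) < +oo)%E.

Definition inTp (p : R) (mu : {measure set RR -> \bar R}) (v : R -> R) : Prop :=
  inPp p mu /\ inLp p mu v.

Definition inLp01 (p : R) (F : R -> R) : Prop :=
  measurable_fun (`]0, 1[%classic : set RR) (F : RR -> R) /\
  (\int[leb]_(x in (`]0%R, 1%R[%classic : set RR)) ((`|F x| `^ p)%:E) < +oo)%E.

Definition inL1 (T : R) (b : R -> R) : Prop :=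
  measurable_fun (`]0, T[%classic : set RR) (b : RR -> R) /\
  (\int[leb]_(x in (`]0%R, T[%classic : set RR)) (`|b x|%:E) < +oo)%E.

Definition cdf_of (mu : {measure set RR -> \bar R}) (x : R) : R :=
  fine (mu `]-oo, x]%classic).

Definition ginv (M : R -> R) (m : R) : R := inf [set x : R | m < M x].

Definition inR (M : R -> R) : Prop :=
  {homo M : x y / x <= y} /\
  (forall x, (M y @[y --> x^'+] --> M x)) /\
  (M x @[x --> -oo] --> (0 : R)) /\
  (M x @[x --> +oo] --> (1 : R)).

(** the measure rho is the distributional derivative d_x M, i.e. the
    (Lebesgue--Stieltjes) measure with rho(]-oo,x]) = M(x) *)
Definition is_deriv_measure (M : R -> R) (rho : {measure set RR -> \bar R}) :=
  forall x : R, rho `]-oo, x]%classic = (M x)%:E.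

Definition inRp (p : R) (M : R -> R) : Prop :=
  inR M /\
  forall rho : {measure set RR -> \bar R}, is_deriv_measure M rho ->
    (\int[rho]_(x in [set: RR]) ((`|x| `^ p)%:E) < +oo)%E.

Definition ext01 (F : R -> R) (w : R) : R :=
  if (0 < w) && (w < 1) then F w else 0.

Definition primitive01 (F : R -> R) (m : R) : R :=
  if 0 <= m then fine (lint_on `[0, m]%classic (ext01 F))
  else - fine (lint_on `[m, 0]%classic (ext01 F)).

Definition Fi (v0 : R -> R) (M0 : R -> R) (F : nat -> R -> R) (i : nat) :
  R -> R := if i is 0 then v0 \o ginv M0 else F i.

Definition Bi (b : nat -> R -> R) (i : nat) (t : R) : R :=
  if i is 0 then 1 else
  if 0 <= t then fine (lint_on `[0, t]%classic (b i))
  else - fine (lint_on `[t, 0]%classic (b i)).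

Definition fluxU (n : nat) (v0 M0 : R -> R) (F b : nat -> R -> R)
    (t m : R) : R :=
  \sum_(i < n.+1) Bi b i t * primitive01 (Fi v0 M0 F i) m.

Definition pdt (phi : R -> R -> R) (t x : R) : R := derive1 (fun s => phi s x) t.
Definition pdx (phi : R -> R -> R) (t x : R) : R := derive1 (fun y => phi t y) x.

Fixpoint iter_pd (s : seq bool) (phi : R -> R -> R) : R -> R -> R :=
  match s with
  | [::] => phi
  | c :: s' => if c then pdt (iter_pd s' phi) else pdx (iter_pd s' phi)
  end.

Definition smooth2 (phi : R -> R -> R) : Prop :=
  forall s : seq bool,
    (forall t x, derivable (fun u => iter_pd s phi u x) t 1 /\
                 derivable (fun y => iter_pd s phi t y) x 1) /\
    continuous (fun z : R * R => iter_pd s phi z.1 z.2).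

(** phi in C_c^oo([0,T) x R) (restriction of a smooth function vanishing
    outside a compact subset of (-oo,T) x R) *)
Definition test0T (T : R) (phi : R -> R -> R) : Prop :=
  smooth2 phi /\
  exists tau r : R, tau < T /\
    forall t x, (tau <= t \/ r <= `|t| \/ r <= `|x|) -> phi t x = 0.

Definition testO (T : R) (phi : R -> R -> R) : Prop :=
  smooth2 phi /\
  exists a c r : R, 0 < a /\ c < T /\
    forall t x, (t <= a \/ c <= t \/ r <= `|x|) -> phi t x = 0.

Definition sgnR (y : R) : R := Num.sg y.

Definition entropy_solution (T : R) (U : R -> R -> R) (M0 : R -> R)
    (M : R -> R -> R) : Prop :=
  (measurable_fun ((`]0, T[%classic : set RR) `*` [set: RR])
      (fun z : RR * RR => M z.1 z.2) /\
   exists C : R, forall t x, 0 < t < T -> `|M t x| <= C) /\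
  (forall t, 0 <= t <= T -> measurable_fun [set: RR] (M t : RR -> R)) /\
  (forall r s : R, 0 < r -> 0 <= s <= T -> forall e : R, 0 < e ->
     exists d : R, 0 < d /\ forall t, 0 <= t <= T -> `|t - s| < d ->
       (lint_on `[(- r)%R, r]%classic (fun x => `|M t x - M s x|%R) < e%:E)%E) /\
  exists D : set R, dense D /\
    forall k, D k -> forall phi, test0T T phi -> (forall t x, 0 <= phi t x) ->
      (0 <= \int[leb]_(t in (`]0%R, T[%classic : set RR))
               (\int[leb]_(x in [set: RR])
                 ((`|M t x - k| * pdt phi t x
                   + sgnR (M t x - k) * (U t (M t x) - U t k) * pdx phi t x)%R)%:E)
          + \int[leb]_(x in [set: RR]) ((`|M0 x - k| * phi 0 x)%R)%:E)%E.

(** v = d(d_x U(t, M(t,.))) / d(d_x M(t,.)), i.e. v is rho-integrable on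
    bounded intervals and int_{]a,b]} v d rho = U(t,M(t,b)) - U(t,M(t,a)). *)
Definition is_RN_flux (rho : {measure set RR -> \bar R}) (g : R -> R)
    (v : R -> R) : Prop :=
  forall a b : R, a < b ->
    rho.-integrable `]a, b]%classic (fun x => (v x)%:E) /\
    (\int[rho]_(x in `]a, b]%classic) (v x)%:E = (g b - g a)%:E)%E.

Definition coupling (mu nu : {measure set RR -> \bar R})
    (g : {measure set (RR * RR)%type -> \bar R}) : Prop :=
  forall A : set RR, measurable A ->
    g (A `*` [set: RR]) = mu A /\ g ([set: RR] `*` A) = nu A.

Definition wasserstein (p : R) (mu nu : {measure set RR -> \bar R}) : \bar R :=
  poweR (ereal_inf [set (\int[g]_(z in [set: (RR * RR)%type])
                           ((`|z.1 - z.2| `^ p)%:E))%E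
                   | g in [set g | coupling mu nu g]]) p^-1.

Definition normLp (p : R) (mu : {measure set RR -> \bar R}) (v : R -> R) :=
  Lnorm mu p%:E (EFin \o v).

Definition normLp01 (p : R) (F : R -> R) : \bar R :=
  Lnorm leb p%:E (EFin \o ext01 F).

Definition normLinf0T (T : R) (B : R -> R) : \bar R :=
  Lnorm leb +oo%E (fun t => (B t * \1_(`]0, T[%classic) t)%:E).

Definition pair_mass (T : R) (rho : R -> {measure set RR -> \bar R})
    (v : R -> R -> R) (phi : R -> R -> R) : \bar R :=
  (- (\int[leb]_(t in (`]0%R, T[%classic : set RR))
         (\int[rho t]_(x in [set: RR]) (pdt phi t x)%:E)
      + \int[leb]_(t in (`]0%R, T[%classic : set RR))
         (\int[rho t]_(x in [set: RR]) (v t x * pdx phi t x)%:E)))%E.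

Definition pair_momentum (T : R) (rho : R -> {measure set RR -> \bar R})
    (v : R -> R -> R) (phi : R -> R -> R) : \bar R :=
  (- (\int[leb]_(t in (`]0%R, T[%classic : set RR))
         (\int[rho t]_(x in [set: RR]) (v t x * pdt phi t x)%:E)
      + \int[leb]_(t in (`]0%R, T[%classic : set RR))
         (\int[rho t]_(x in [set: RR]) (v t x ^+ 2 * pdx phi t x)%:E)))%E.

(** < f[rho], phi > with f[rho] = sum_{i=1}^n b_i(t) d_x calF_i(M):
    = - int_0^T sum_i b_i(t) int calF_i(M(t,x)) d_x phi(t,x) pdx pdt *)
Definition pair_force (T : R) (n : nat) (F b : nat -> R -> R)
    (M : R -> R -> R) (phi : R -> R -> R) : \bar R :=
  (- \int[leb]_(t in (`]0%R, T[%classic : set RR))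
        (\int[leb]_(x in [set: RR])
           (\sum_(1 <= i < n.+1) b i t * primitive01 (F i) (M t x) * pdx phi t x)%:E))%E.

Definition distributional_solution (T : R) (n : nat) (F b : nat -> R -> R)
    (M : R -> R -> R) (rho : R -> {measure set RR -> \bar R})
    (v : R -> R -> R) : Prop :=
  forall phi, testO T phi ->
    (pair_mass T rho v phi = 0%E) /\
    (pair_momentum T rho v phi = pair_force T n F b M phi).

End Defs.

(* Main.v *)
(* Let X(t, m) be the generalized inverse of M(t, .), so that rho(t) is the law of X(t, .)
   under Lebesgue measure on (0,1), and let G(t, m) = sum_i B_i(t) F_i(m).  The
   Radon-Nikodym velocity satisfies v(t, X(t, .)) = E[G(t, .) | X(t, .)], whence (i) by
   Jensen's and Minkowski's inequalities.

   The entropy inequality with k < 0 and k > 1 gives the weak form of the conservation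
   law.  Tested against mollifiers and rewritten by the layer-cake formula, it says that
     M_e(t, x) = int_0^1 S((x - X(t, m)) / e) dm + e x        (S a smooth step)
   has time derivative - J_e with J_e(t, x) = int_0^1 G(t, m) eta_e(x - X(t, m)) dm.  Since
   d_x M_e >= e, the inverse Y_e(t, .) of M_e(t, .) is the flow of the velocity field
   v_e = J_e / d_x M_e.  By Jensen's inequality g |-> v_e[g](Y_e) is a contraction of
   L^p(0,1), so ||Y_e(t) - Y_e(s)||_p is at most |t - s| sup_r ||G(r)||_p, and e -> 0
   bounds ||X(t) - X(s)||_p, the cost of the coupling (X(t), X(s)): this is (ii).

   The same contraction in L^2, with the density of Lipschitz functions, yields
   v_e(Y_e) -> v(X).  Passing to the limit along the flow shows, for F in L^2(0,1),
     d/dt int F phi(t, X) dm = int F (phi_t(t, X) + v(t, X) phi_x(t, X)) dm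
   in integrated form.  F = 1 is the continuity equation; the momentum equation follows by
   taking F = F_i, multiplying by B_i, and integrating by parts in time. *)
Require Import Defs.
From HB Require Import structures.
From mathcomp Require Import all_boot all_order all_algebra.
From mathcomp Require Import all_classical all_reals all_analysis.
From mathcomp Require Import measurable_realfun borel_hierarchy ess_sup_inf ring lra.
Import numFieldNormedType.Exports.
Import Order.TTheory GRing.Theory Num.Theory.

Set Implicit Arguments.
Unset Strict Implicit.
Unset Printing Implicit Defensive.

Local Open Scope classical_set_scope.
Local Open Scope ring_scope.

(** * Integration *)

Section integral_tools.
Context d (T : measurableType d) (R : realType) (mu : {measure set T -> \bar R}).

(** The obstacle is that [X] inherits from [M] only a weak continuity in time: trajectories come
    with no derivative, and [v] is determined only after averaging over the labels that share a
    position. Smoothing in space, with a small tilt, yields a strictly increasing C^1 bijection of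
    the line, so that each label obeys a genuine ordinary differential equation. The contraction
    survives e -> 0 because the law of Y_e has density d_x M_e on its range, which cancels the
    denominator of v_e: the bound does not depend on how small the density is. The limit of v_e(Y_e)
    must be tested against functions F of the label and not only against functions of the position:
    the force arises because F_i stays attached to its label while B_i(t) varies, and F_i is in
    general no function of X(t). Here 2 <= p enters, since F_i and v(X) have to be square integrable
    for F_i v and v^2 to be integrable. Test functions live in the open time interval, so the
    endpoints 0 and T are reached only at the end, through continuity of truncated inverses. *)

Lemma dominated_integrable (A : set T) (f g : T -> R) :
  measurable A -> measurable_fun A f -> mu.-integrable A (EFin \o g) ->
  (forall x, A x -> `|f x| <= g x) -> mu.-integrable A (EFin \o f).
Proof.
move=> mA mf ig fg; apply: (le_integrable mA _ _ ig); first exact/measurable_EFinP.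
by move=> x Ax /=; rewrite lee_fin (le_trans (fg x Ax))// ler_norm.
Qed.

Lemma bounded_integrable (A : set T) (f : T -> R) (C : R) :
  measurable A -> (mu A < +oo)%E -> measurable_fun A f ->
  (forall x, A x -> `|f x| <= C) -> mu.-integrable A (EFin \o f).
Proof.
move=> mA Afin mf fC; apply: measurable_bounded_integrable => //.
by exists C; split; [exact: num_real|move=> y /ltW Cy x Ax; exact: le_trans (fC x Ax) Cy].
Qed.

Lemma ge0_Rintegral_le (A : set T) (f : T -> R) (C : R) :
  measurable A -> measurable_fun A f -> (forall x, A x -> 0 <= f x) ->
  (\int[mu]_(x in A) (f x)%:E <= C%:E)%E ->
  mu.-integrable A (EFin \o f) /\ \int[mu]_(x in A) f x <= C.
Proof.
move=> mA mf f0 fC.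
have fi : mu.-integrable A (EFin \o f).
  apply/integrableP; split; first exact/measurable_EFinP.
  apply: le_lt_trans (ltry C); apply: le_trans fC.
  rewrite le_eqVlt; apply/orP; left; apply/eqP; apply: eq_integral => x /set_mem Ax /=.
  by rewrite ger0_norm ?f0.
split=> //; rewrite -lee_fin /Rintegral fineK//.
exact: integrable_fin_num.
Qed.

Lemma EFin_Rintegral (A : set T) (f : T -> R) :
  measurable A -> mu.-integrable A (EFin \o f) ->
  (\int[mu]_(x in A) (f x)%:E = (\int[mu]_(x in A) f x)%:E)%E.
Proof. by move=> mA fi; rewrite /Rintegral fineK//; exact: integrable_fin_num. Qed.

Lemma dominated_cvg_Rintegral (A : set T) (f_ : nat -> T -> R) (f g : T -> R) :
  measurable A -> (forall n, measurable_fun A (f_ n)) ->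
  (forall x, A x -> f_ ^~ x @ \oo --> f x) ->
  mu.-integrable A (EFin \o g) ->
  (forall n x, A x -> `|f_ n x| <= g x) ->
  mu.-integrable A (EFin \o f) /\
  \int[mu]_(x in A) f_ n x @[n --> \oo] --> \int[mu]_(x in A) f x.
Proof.
move=> mA mf_ f_f ig f_g.
have mf : measurable_fun A f by apply: (measurable_fun_cvg mf_ f_f).
have fg x : A x -> `|f x| <= g x.
  move=> Ax; have h := cvg_norm (f_f x Ax).
  have {}h : `|f_ n x| @[n --> \oo] --> `|f x| by exact: h.
  rewrite -(cvg_lim _ h)//; apply: limr_le; first by apply/cvg_ex; exists `|f x|.
  by apply: nearW => n; exact: f_g.
have fi := dominated_integrable mA mf ig fg.
split=> //.
apply: fine_cvg; rewrite -EFin_Rintegral//.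
apply: (@dominated_cvg _ _ _ mu A mA (fun n x => (f_ n x)%:E) _ (EFin \o g)) => //.
- by move=> n; exact/measurable_EFinP.
- by move=> x Ax; apply: cvg_EFin; [exact: nearW|exact: f_f].
Qed.

Lemma RintegrableZl (A : set T) (f : T -> R) (c : R) : measurable A ->
  mu.-integrable A (EFin \o f) -> mu.-integrable A (EFin \o (fun x => c * f x)).
Proof. by move=> mA fi; have := integrableZl mA c fi; apply: eq_integrable. Qed.

Lemma RintegrableZr (A : set T) (f : T -> R) (c : R) : measurable A ->
  mu.-integrable A (EFin \o f) -> mu.-integrable A (EFin \o (fun x => f x * c)).
Proof. by move=> mA fi; have := integrableZr mA c fi; apply: eq_integrable. Qed.

Lemma RintegrableD (A : set T) (f g : T -> R) : measurable A ->
  mu.-integrable A (EFin \o f) -> mu.-integrable A (EFin \o g) ->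
  mu.-integrable A (EFin \o (fun x => f x + g x)).
Proof. by move=> mA fi gi; have := integrableD mA fi gi; apply: eq_integrable. Qed.

Lemma RintegrableB (A : set T) (f g : T -> R) : measurable A ->
  mu.-integrable A (EFin \o f) -> mu.-integrable A (EFin \o g) ->
  mu.-integrable A (EFin \o (fun x => f x - g x)).
Proof. by move=> mA fi gi; have := integrableB mA fi gi; apply: eq_integrable. Qed.

Lemma integrable_measurableR (A : set T) (f : T -> R) :
  mu.-integrable A (EFin \o f) -> measurable_fun A f.
Proof. by move=> fi; exact/measurable_EFinP/(measurable_int mu). Qed.

End integral_tools.

(** * Tonelli and Fubini on product sets *)

Section fubini_tools.
Context (R : realType).
Notation RR := (measurableTypeR R).
Notation leb := (@lebesgue_measure R).

Lemma tonelli_on (A B : set RR) (f : R -> R -> R) :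
  measurable A -> measurable B ->
  measurable_fun (A `*` B) (fun z : RR * RR => f z.1 z.2) ->
  (forall x y, A x -> B y -> 0 <= f x y) ->
  (\int[leb]_(x in A) \int[leb]_(y in B) (f x y)%:E =
   \int[leb]_(y in B) \int[leb]_(x in A) (f x y)%:E)%E.
Proof.
move=> mA mB mf f0.
pose g : RR * RR -> \bar R := (fun z : RR * RR => (f z.1 z.2)%:E) \_ (A `*` B).
have mg : measurable_fun [set: RR * RR] g.
  by apply/(measurable_restrictT _ _).1; [exact: measurableX|exact/measurable_EFinP].
have g0 z : (0 <= g z)%E.
  by rewrite /g patchE; case: ifPn => // /set_mem[Az Bz]; rewrite lee_fin f0.
have := @fubini_tonelli _ _ _ _ _ leb leb g mg g0.
have -> : (\int[leb]_x \int[leb]_y g (x, y) = \int[leb]_(x in A) \int[leb]_(y in B) (f x y)%:E)%E.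
  rewrite [RHS]integral_mkcond; apply: eq_integral => x _; rewrite patchE.
  case: ifPn => [Ax|nAx].
    rewrite [RHS]integral_mkcond; apply: eq_integral => y _; rewrite /g !patchE.
    by rewrite in_setX Ax.
  by rewrite (eq_integral (cst 0%E)) ?integral0// => y _; rewrite /g patchE in_setX (negbTE nAx).
move=> ->.
rewrite [RHS]integral_mkcond; apply: eq_integral => y _; rewrite patchE.
case: ifPn => [By|nBy].
  rewrite [RHS]integral_mkcond; apply: eq_integral => x _; rewrite /g !patchE.
  by rewrite in_setX By andbT.
by rewrite (eq_integral (cst 0%E)) ?integral0// => x _; rewrite /g patchE in_setX (negbTE nBy) andbF.
Qed.

(** A product majorant [h x * k y] is integrable on [A * B], so Fubini applies to the extension of
    [f] by zero. The first conclusion concerns one order of integration only; callers that need both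
    inner integrals to be integrable invoke the lemma twice with the variables swapped. *)
Lemma fubini_dom (A B : set RR) (f : R -> R -> R) (h k : R -> R) :
  measurable A -> measurable B ->
  measurable_fun (A `*` B) (fun z : RR * RR => f z.1 z.2) ->
  leb.-integrable A (EFin \o h) -> leb.-integrable B (EFin \o k) ->
  (forall x y, A x -> B y -> `|f x y| <= h x * k y) ->
  leb.-integrable A (EFin \o (fun x => \int[leb]_(y in B) f x y)) /\
  \int[leb]_(x in A) (\int[leb]_(y in B) f x y) =
  \int[leb]_(y in B) (\int[leb]_(x in A) f x y).
Proof.
move=> mA mB mf ih ik fhk.
pose g : RR * RR -> \bar R := (fun z : RR * RR => (f z.1 z.2)%:E) \_ (A `*` B).
have mg : measurable_fun [set: RR * RR] g.
  by apply/(measurable_restrictT _ _).1; [exact: measurableX|exact/measurable_EFinP].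
have inner1 x : A x -> leb.-integrable B (EFin \o f x).
  move=> Ax; apply: (@dominated_integrable _ _ _ leb B _ (fun y => h x * k y)) => //.
    apply: (measurable_comp (F := A `*` B) (g := fun y => (x, y)) _ _ mf) => //.
    - exact: measurableX.
    - by move=> _ [y By <-].
    - exact/measurable_funTS/pair1_measurable.
  - by have := integrableZl mB (h x) ik; apply: eq_integrable => // z _; rewrite /= EFinM.
  - by move=> y By; exact: fhk.
have inner2 y : B y -> leb.-integrable A (EFin \o f^~ y).
  move=> By; apply: (@dominated_integrable _ _ _ leb A _ (fun x => h x * k y)) => //.
    apply: (measurable_comp (F := A `*` B) (g := fun x => (x, y)) _ _ mf) => //.
    - exact: measurableX.
    - by move=> _ [x Ax <-].
    - exact/measurable_funTS/pair2_measurable.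
  - by have := integrableZr mA (k y) ih; apply: eq_integrable => // z _; rewrite /= EFinM.
  - by move=> x Ax; exact: fhk.
have E1 x : (\int[leb]_y g (x, y) = ((fun x => (\int[leb]_(y in B) f x y)%:E) \_ A) x)%E.
  rewrite patchE; case: ifPn => [Ax|nAx].
    rewrite -EFin_Rintegral//; last exact/inner1/set_mem.
    rewrite [RHS]integral_mkcond; apply: eq_integral => y _; rewrite /g !patchE.
    by rewrite in_setX Ax.
  by rewrite (eq_integral (cst 0%E)) ?integral0// => y _; rewrite /g patchE in_setX (negbTE nAx).
have E2 y : (\int[leb]_x g (x, y) = ((fun y => (\int[leb]_(x in A) f x y)%:E) \_ B) y)%E.
  rewrite patchE; case: ifPn => [By|nBy].
    rewrite -EFin_Rintegral//; last exact/inner2/set_mem.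
    rewrite [RHS]integral_mkcond; apply: eq_integral => x _; rewrite /g !patchE.
    by rewrite in_setX By andbT.
  by rewrite (eq_integral (cst 0%E)) ?integral0// => x _; rewrite /g patchE in_setX (negbTE nBy) andbF.
have ig : (leb \x leb)%E.-integrable setT g.
  apply/(integrable12ltyP _ _ mg).2.
  pose K := (\int[leb]_(y in B) (`|k y|)%:E)%E.
  have nh : leb.-integrable A (EFin \o (fun x => `|h x|)) by exact: integrable_norm.
  have nk : leb.-integrable B (EFin \o (fun y => `|k y|)) by exact: integrable_norm.
  have Kfin : (K \is a fin_num)%E by exact: integrable_fin_num nk.
  have hK : leb.-integrable A (fun x => (`|h x|)%:E * K)%E.
    by rewrite -(fineK Kfin); exact: (integrableZr mA (fine K) nh).
  apply: (@le_lt_trans _ _ (\int[leb]_(x in A) ((`|h x|)%:E * K))%E); last first.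
    exact: integrable_lty hK.
  rewrite [leRHS]integral_mkcond; apply: ge0_le_integral => //.
  - by move=> x _; exact: integral_ge0.
  - apply: (@measurable_fun_fubini_tonelli_F _ _ _ _ _ leb (fun z => `|g z|%E)) => //.
    by apply: measurableT_comp.
  - by apply/(measurable_restrictT _ _).1 => //; exact: measurable_int hK.
  move=> x _; rewrite patchE; case: ifPn => [Ax|nAx].
    have -> : ((`|h x|)%:E * K = \int[leb]_(y in B) (`|h x| * `|k y|)%:E)%E.
      by under eq_integral do rewrite EFinM; rewrite integralZl.
    rewrite [leRHS]integral_mkcond; apply: ge0_le_integral => //.
    - apply: measurableT_comp => //.
      exact: (measurableT_comp mg).
    - apply/(measurable_restrictT _ _).1 => //.
      by apply/measurable_EFinP/measurable_funM => //; apply/measurable_EFinP/measurable_int; exact: nk.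
    move=> y _; rewrite /g !patchE in_setX Ax/=; case: ifPn => [By|]; last by move=> _; rewrite abse0.
    rewrite /= lee_fin (le_trans (fhk _ _ (set_mem Ax) (set_mem By)))//.
    by rewrite -normrM ler_norm.
  by rewrite (eq_integral (cst 0%E)) ?integral0// => y _; rewrite /g patchE in_setX (negbTE nAx) abse0.
split.
- apply/(integrable_mkcond _ _).2 => //.
  by rewrite (_ : _ \_ _ = fubini_F leb g); [exact: integrable_fubini_F|apply/funext => x; rewrite -E1].
- have := Fubini ig.
  rewrite (eq_integral _ _ (fun x _ => E1 x)) [X in _ = X -> _](eq_integral _ _ (fun x _ => E2 x)).
  by rewrite -!integral_mkcond /Rintegral => ->.
Qed.

End fubini_tools.

(** * Tangent lines of the power function *)

Section young.
Context (R : realType).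

(** Young's inequality for the factors [x] and [y ^ (p - 1)], with conjugate exponents [p] and
    [p / (p - 1)]. Multiplied by [p], it says that the graph of the [p]-th power lies above its
    tangent at [y]. *)
Lemma young_tangent (p x y : R) : 1 < p -> 0 <= x -> 0 <= y ->
  x * y `^ (p - 1) <= p^-1 * x `^ p + (1 - p^-1) * y `^ p.
Proof.
move=> p1 x0 y0.
have p0 : 0 < p by lra.
have pn : p != 0 by lra.
have pn1 : p - 1 != 0 by lra.
have q0 : 0 < p / (p - 1) by rewrite divr_gt0//; lra.
have := @conjugate_powR R x (y `^ (p - 1)) p (p / (p - 1)) x0 (powR_ge0 _ _) p0 q0.
rewrite -powRrM (_ : (p - 1) * (p / (p - 1)) = p); last by field; rewrite pn1.
rewrite (_ : (p / (p - 1))^-1 = 1 - p^-1); last by field; rewrite pn pn1.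
by move=> h; rewrite mulrC [X in _ <= X + _]mulrC [X in _ <= _ + X]mulrC mulrC; apply: h; ring.
Qed.

Lemma powR_le1D (p x : R) : 1 <= p -> 0 <= x -> x <= 1 + x `^ p.
Proof.
move=> p1 x0; have [x1|x1] := leP x 1; first by have := powR_ge0 x p; lra.
have : x `^ 1 <= x `^ p by apply: ler_powR => //; exact: ltW.
by rewrite powRr1//; lra.
Qed.

(** Convexity: the tangent at [x] lies below the value at [y]. Only the power of [x] occurs on the
    right, so a bound on [x] alone controls the increment. *)
Lemma powR_sub_le (p x y : R) : 1 < p -> 0 <= x -> 0 <= y ->
  x `^ p - y `^ p <= p * x `^ (p - 1) * `|x - y|.
Proof.
move=> p1 x0 y0.
have p0 : p != 0 by lra.
have := young_tangent p1 y0 x0.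
have xp : x `^ p = x `^ (p - 1) * x.
  rewrite -{3}(powRr1 x0) -powRD; first by congr (_ `^ _); ring.
  by apply/implyP => /eqP; lra.
move=> /(ler_wpM2l (ltW (lt_trans ltr01 p1))).
have -> : p * (p^-1 * y `^ p + (1 - p^-1) * x `^ p) = y `^ p + (p - 1) * x `^ p by field.
have : x `^ (p - 1) * (x - y) <= x `^ (p - 1) * `|x - y|.
  by rewrite ler_wpM2l ?powR_ge0 ?ler_norm.
move=> /(ler_wpM2l (ltW (lt_trans ltr01 p1))).
have -> : p * (x `^ (p - 1) * (x - y)) = p * x `^ p - p * (y * x `^ (p - 1)) by rewrite xp; ring.
rewrite mulrA; lra.
Qed.

End young.

(** * Jensen's inequality for powers *)

Section jensen.
Context d (T : measurableType d) (R : realType) (mu : {measure set T -> \bar R}).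

(* Jensen's inequality in tangent-line form: no division by the total mass
   [\int k] occurs, which may vanish. *)
Lemma jensen_powR (A : set T) (k g : T -> R) (p c r : R) :
  1 < p -> measurable A -> measurable_fun A g ->
  (forall x, A x -> 0 <= k x) -> mu.-integrable A (EFin \o k) ->
  mu.-integrable A (EFin \o (fun x => k x * `|g x| `^ p)) ->
  0 <= c -> \int[mu]_(x in A) k x <= r ->
  r * c <= \int[mu]_(x in A) (k x * `|g x|) ->
  r * c `^ p <= \int[mu]_(x in A) (k x * `|g x| `^ p).
Proof.
move=> p1 mA mg k0 ik ikgp c0 kr rc.
have p0 : 0 < p by lra.
have scale (a b : R) : 0 <= p^-1 * (b - a) -> a <= b.
  by rewrite pmulr_rge0 ?invr_gt0// subr_ge0.
have mk := integrable_measurableR ik.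
have ikg : mu.-integrable A (EFin \o (fun x => k x * `|g x|)).
  apply: (dominated_integrable mA _ (RintegrableD mA ik ikgp)).
    by apply: measurable_funM => //; exact: measurableT_comp.
  move=> x Ax; rewrite ger0_norm ?mulr_ge0 ?k0//.
  rewrite -{2}[k x]mulr1 -mulrDr ler_wpM2l ?k0// powR_le1D//; exact: ltW.
have cp : c `^ p = c * c `^ (p - 1).
  rewrite -{2}(powRr1 c0) -powRD; first by congr (_ `^ _); ring.
  by apply/implyP => /eqP; lra.
(* Multiplying [rc] by [c ^ (p - 1)] produces [r * c ^ p] on the left. The right side is bounded
   pointwise by [young_tangent] at [y = c], and the mass bound [kr] lets the share [1 - 1/p] of
   [r * c ^ p] be absorbed. *)
have /(ler_wpM2r (powR_ge0 c (p - 1))) := rc.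
rewrite -mulrA -cp -(RintegralZr _ mA ikg) => h.
have i1 := RintegrableZl p^-1 mA ikgp.
have i2 := RintegrableZl ((1 - p^-1) * c `^ p) mA ik.
have h2 : \int[mu]_(x in A) (k x * `|g x| * c `^ (p - 1)) <=
  \int[mu]_(x in A) (p^-1 * (k x * `|g x| `^ p) + (1 - p^-1) * c `^ p * k x).
  apply: (le_Rintegral mA (RintegrableZr _ mA ikg) (RintegrableD mA i1 i2)).
  move=> x Ax.
  have -> : p^-1 * (k x * `|g x| `^ p) + (1 - p^-1) * c `^ p * k x =
    k x * (p^-1 * `|g x| `^ p + (1 - p^-1) * c `^ p) by ring.
  by rewrite -[X in X <= _]mulrA; apply: ler_wpM2l (k0 x Ax) _ _ (young_tangent p1 (normr_ge0 (g x)) c0).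
rewrite (RintegralD mA i1 i2) (RintegralZl _ mA ikgp) (RintegralZl _ mA ik) in h2.
set I := \int[mu]_(x in A) (k x * `|g x| `^ p) in h2 *.
have h3 : (1 - p^-1) * c `^ p * \int[mu]_(x in A) k x <= (1 - p^-1) * c `^ p * r.
  rewrite ler_wpM2l// mulr_ge0 ?powR_ge0// subr_ge0 invf_le1//; exact: ltW.
have := le_trans h (le_trans h2 (lerD (lexx _) h3)).
rewrite -subr_ge0 (_ : _ - _ = p^-1 * (I - r * c `^ p)); last by ring.
exact: scale.
Qed.

End jensen.

(** * Fundamental theorem of calculus *)

Section ftc_tools.
Context (R : realType).
Notation leb := (@lebesgue_measure R).

Lemma is_derive1_continuous (F f : R -> R) : (forall x, is_derive x (1:R) F (f x)) ->
  continuous F.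
Proof. by move=> h x; apply/differentiable_continuous/derivable1_diffP; case: (h x). Qed.

Lemma continuous_itv_integrable (f : R -> R) (a b : R) : continuous f ->
  leb.-integrable `[a, b] (EFin \o f).
Proof.
move=> cf; apply: continuous_compact_integrable; first exact: segment_compact.
exact: continuous_subspaceT.
Qed.

Lemma is_derive_FTC2_on (f g : R -> R) (a b : R) : a <= b -> continuous g ->
  (forall x, a <= x <= b -> is_derive x (1:R) f (g x)) ->
  \int[leb]_(x in `[a, b]) g x = f b - f a.
Proof.
rewrite le_eqVlt => /predU1P[->|ab] cg df.
  by rewrite set_itv1 Rintegral_set1 subrr.
have cont x : a <= x <= b -> {for x, continuous f}.
  by move=> xab; apply/differentiable_continuous/derivable1_diffP; case: (df x xab).
rewrite /Rintegral (@continuous_FTC2 _ g f a b)//.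
- exact: continuous_subspaceT.
- split.
  + by move=> x; rewrite in_itv/= => xab; case: (df x ltac:(lra)).
  + by apply: cvg_at_right_filter; apply: cont; lra.
  + by apply: cvg_at_left_filter; apply: cont; lra.
- move=> x; rewrite in_itv/= => xab; rewrite derive1E.
  have h : is_derive x (1:R) f (g x) by apply: df; lra.
  exact: derive_val.
Qed.

Lemma is_derive_FTC2 (F f : R -> R) (a b : R) : a <= b -> continuous f ->
  (forall x, is_derive x (1:R) F (f x)) ->
  \int[leb]_(x in `[a, b]) f x = F b - F a.
Proof. by move=> ab cf dF; exact: is_derive_FTC2_on. Qed.

End ftc_tools.

(** * Generalized inverses and laws *)

Section generalized_inverse.
Context (R : realType).
Notation RR := (measurableTypeR R).
Notation leb := (@lebesgue_measure R).
Notation D01 := (`]0%R, 1%R[%classic : set RR).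

(* Both the left- and the right-continuous generalized inverse of [M] satisfy this;
   hence the mismatch between [<] and [<=]. *)
Definition galois (M X : R -> R) := forall m x, 0 < m < 1 ->
  (m < M x -> X m <= x) /\ (X m <= x -> m <= M x).

Lemma inR_ginv_galois (M : R -> R) : inR M -> galois M (ginv M).
Proof.
move=> [Mnd [Mrc [M0 M1]]] m x /andP[m0 m1].
have lbM : has_lbound [set x | m < M x].
  have [y [_ yP]] : \forall y \near -oo, M y < m by apply: cvgr_lt M0 _ _.
  exists (y - 1) => z /= mz; rewrite leNgt; apply/negP => zy.
  by have := Mnd _ _ (ltW zy); have := yP (y - 1) ltac:(lra); lra.
have [y [_ yP]] : \forall y \near +oo, m < M y by apply: cvgr_gt M1 _ _.
have M_neq0 : [set x | m < M x] !=set0 by exists (y + 1); apply: yP; lra.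
split=> [mMx|Xx]; first exact: ge_inf.
(* A point beyond the infimum has some [w] before it with [m < M w], and [M] is nondecreasing. Right
   continuity then lets [z] descend to [x]. *)
have above z : x < z -> m <= M z.
  move=> xz; have z0 : 0 < z - ginv M m by lra.
  have [w /= mw wz] := inf_adherent z0 (conj M_neq0 lbM).
  rewrite ltW// (lt_le_trans mw)// Mnd//; apply: ltW; apply: lt_le_trans wz _.
  by rewrite /ginv; lra.
have h := Mrc x.
rewrite -(cvg_lim _ h)//; apply: limr_ge; first by apply/cvg_ex; exists (M x).
by near=> z; apply: above.
Unshelve. all: by end_near. Qed.

Lemma ext01E (F : R -> R) (m : R) : 0 < m < 1 -> ext01 F m = F m.
Proof. by rewrite /ext01 => ->. Qed.

(** Since [galois] constrains labels in []0, 1[] only, the inverse may be set to 0 elsewhere; this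
    makes it measurable on the whole line, as pushforward measures require. *)
Lemma galois_ext01 (M X : R -> R) : galois M X -> galois M (ext01 X).
Proof. by move=> g m x m01; rewrite ext01E//; exact: g. Qed.

Lemma mD01 : measurable D01. Proof. exact: measurable_itv. Qed.

Lemma leb_D01 : leb D01 = 1%:E.
Proof. by rewrite lebesgue_measure_itv/= lte01 oppr0 adde0. Qed.

Lemma leb_D01_lty : (leb D01 < +oo)%E. Proof. by rewrite leb_D01 ltry. Qed.

Lemma D01E (m : R) : D01 m = (0 < m < 1).
Proof. by rewrite /= in_itv. Qed.

Lemma galois_nd (M X : R -> R) (a b : R) : galois M X ->
  0 < a < 1 -> 0 < b < 1 -> a <= b -> X a <= X b.
Proof.
move=> g a01 b01; rewrite le_eqVlt => /predU1P[->//|ab].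
apply: (g _ _ a01).1; apply: (lt_le_trans ab); exact: (g _ _ b01).2.
Qed.

Lemma galois_measurable (M X : R -> R) : galois M X -> measurable_fun D01 X.
Proof.
move=> g; apply: (measurability _ (RGenInftyO.measurableE R)).
move=> _ [_ [x ->] <-]; apply: is_interval_measurable => a b /= [].
rewrite !in_itv/= => a01 Xa [b01 Xb] c /andP[ac cb].
have c01 : 0 < c < 1 by lra.
split; rewrite ?in_itv//=.
exact: le_lt_trans (galois_nd g c01 b01 cb) Xb.
Qed.

Lemma ext01_patch (F : R -> R) : ext01 F = F \_ D01.
Proof. by apply/funext => m; rewrite /ext01 patchE mem_setE in_itv. Qed.

Lemma ext01_measurable (F : R -> R) : measurable_fun D01 F ->
  measurable_fun setT (ext01 F).
Proof. by move=> mF; rewrite ext01_patch; apply/(measurable_restrictT _ _).1 => //; exact: mD01. Qed.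

Lemma measurable_le_set (X : R -> R) (x : R) : measurable_fun D01 X ->
  measurable (D01 `&` [set m | X m <= x]).
Proof.
move=> mX; have := mX mD01 `]-oo, x]%classic (measurable_itv _).
by congr (measurable (_ `&` _)); apply/seteqP; split => m /=; rewrite in_itv.
Qed.

(** Within []0, 1[], the labels with [X m <= x] contain those with [m < M x] and are contained in
    those with [m <= M x]; the two bounds differ by one point. *)
Lemma galois_law_ray (M X : R -> R) (x : R) : galois M X -> 0 <= M x <= 1 ->
  leb (D01 `&` [set m | X m <= x]) = (M x)%:E.
Proof.
move=> g M01; have mX := galois_measurable g.
apply/eqP; rewrite eq_le; apply/andP; split.
  apply: (@le_trans _ _ (leb `]0, M x]%classic)).
    apply: le_measure; rewrite ?inE//; [exact: measurable_le_set|].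
    move=> m /= []; rewrite !in_itv/= => m01 Xm; rewrite (g _ _ m01).2//.
    by case/andP : m01 => ->.
  rewrite lebesgue_measure_itv/= lte_fin; case: ifPn => // _.
    by rewrite -EFinD subr0.
  by rewrite lee_fin; case/andP: M01.
apply: (@le_trans _ _ (leb `]0, M x[%classic)).
  rewrite lebesgue_measure_itv/= lte_fin; case: ifPn => // M0.
    by rewrite -EFinD subr0.
  by rewrite lee_fin leNgt.
apply: le_measure; rewrite ?inE//; [exact: measurable_le_set|].
move=> m /=; rewrite !in_itv/= => /andP[m0 mM].
have m01 : 0 < m < 1 by lra.
by rewrite m01; split => //; exact: (g _ _ m01).1.
Qed.

Lemma measure_ocitv_unique (m1 m2 : {measure set RR -> \bar R}) :
  (forall a b, m1 `]a, b]%classic = m2 `]a, b]%classic) ->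
  (forall a b, (m1 `]a, b]%classic < +oo)%E) ->
  forall A, measurable A -> m1 A = m2 A.
Proof.
move=> m12 m1fin; apply: (@measure_unique _ _ RR (@ocitv R) (fun n => `](- n%:R), n%:R]%classic)).
- by [].
- move=> A B oA oB; exact: ocitvI.
- by move=> n; exists (- n%:R, n%:R).
- apply/seteqP; split => // x _.
  have [n xn] : exists n : nat, `|x| < n%:R.
    by exists (Num.bound `|x|); apply: archi_boundP.
  exists n => //=; rewrite in_itv/=; move: xn; rewrite ltr_norml => /andP[-> /ltW ->]//.
- by move=> A [[a b] _ <-]; exact: m12.
- by move=> k; exact: m1fin.
Qed.

End generalized_inverse.

(** * Truncation, and distance of inverses versus distance of distribution functions *)

Section clip.
Context (R : realType).
Notation RR := (measurableTypeR R).
Notation leb := (@lebesgue_measure R).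
Notation D01 := (`]0%R, 1%R[%classic : set RR).

(** Local [L^1] information on distribution functions over [[-r, r]] says nothing about how far the
    inverses go outside that interval, so inverses are compared after projection onto it. *)
Definition clip (r x : R) : R := Num.max (- r) (Num.min r x).

Lemma clip_le (r x y : R) : x <= y -> clip r x <= clip r y.
Proof. by move=> xy; rewrite /clip; apply: le_max2 => //; exact: le_min2. Qed.

Lemma clip_bnd (r x : R) : 0 <= r -> - r <= clip r x <= r.
Proof.
move=> r0; rewrite /clip le_max lexx/= ge_max ge_min lexx/= andbT; lra.
Qed.

Lemma clip_id (r x : R) : `|x| <= r -> clip r x = x.
Proof.
rewrite ler_norml => /andP[a b]; rewrite /clip.
by rewrite (min_idPr b) (max_idPr a).
Qed.

Lemma clip_dist (r x y : R) : `|clip r x - clip r y| <= `|x - y|.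
Proof.
wlog xy : x y / x <= y.
  move=> h; have [|/ltW] := leP x y; first exact: h.
  by move=> yx; rewrite distrC [X in _ <= X]distrC; exact: h.
have := clip_le r xy => h; rewrite distrC [X in _ <= X]distrC.
rewrite !ger0_norm ?subr_ge0//.
rewrite /clip /Num.max /Num.min; repeat case: ifPn; rewrite -?leNgt => *; lra.
Qed.

Lemma continuous_clip (r : R) : continuous (clip r).
Proof.
move=> x; apply/cvgrPdist_le => e e0; near=> y.
apply: (le_trans (clip_dist r x y)).
by near: y; apply: cvgr_dist_le.
Unshelve. all: by end_near. Qed.

Lemma clip_measurable (r : R) (A : set RR) (X : R -> R) : measurable A ->
  measurable_fun A X -> measurable_fun A (fun m => clip r (X m)).
Proof.
move=> mA mX; apply: (measurableT_comp (f := clip r)) => //.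
exact: continuous_measurable_fun (@continuous_clip r).
Qed.

Lemma clip_le_inv (r x s : R) : s < r -> clip r x <= s -> x <= s.
Proof.
by rewrite /clip ge_max ge_min => sr /andP[_ /orP[|//]]; rewrite leNgt sr.
Qed.

Lemma lt_clip_inv (r y s : R) : - r <= s -> s < clip r y -> s < y.
Proof.
by rewrite /clip lt_max lt_min => rs /orP[|/andP[]//]; rewrite ltNge rs.
Qed.

Definition le_ind (x y : R) : R := if x <= y then 1 else 0.

Lemma measurable_le_ind (A : set (RR * RR)) (X Y : RR * RR -> R) :
  measurable A -> measurable_fun A X -> measurable_fun A Y ->
  measurable_fun A (fun z => le_ind (X z) (Y z)).
Proof.
move=> mA mX mY; rewrite /le_ind.
by apply: measurable_fun_if => //; exact: measurable_fun_ler.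
Qed.

Lemma measurable_fun1_X (A B : set RR) (f : R -> R) :
  measurable A -> measurable B -> measurable_fun A f ->
  measurable_fun (A `*` B) (fun z : RR * RR => f z.1).
Proof.
move=> mA mB mf; apply: (measurable_comp (F := A)) mf _ => //.
- by move=> _ [[a b] [? ?] <-].
- by apply: measurable_funTS; exact: measurable_fst.
Qed.

Lemma measurable_fun2_X (A B : set RR) (f : R -> R) :
  measurable A -> measurable B -> measurable_fun B f ->
  measurable_fun (A `*` B) (fun z : RR * RR => f z.2).
Proof.
move=> mA mB mf; apply: (measurable_comp (F := B)) mf _ => //.
- by move=> _ [[a b] [? ?] <-].
- by apply: measurable_funTS; exact: measurable_snd.
Qed.

(** As a function of [s], the integrand is the indicator of the half-open interval between [x] and
    [y], whose part inside [[-r, r]] has length [|clip r x - clip r y|]. *)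
Lemma clip_dist_le (r x y : R) : 0 <= r ->
  ((`|clip r x - clip r y|%R)%:E <=
    \int[leb]_(s in `[(- r)%R, r]) (`|le_ind x s - le_ind y s|%R)%:E)%E.
Proof.
move=> r0.
wlog xy : x y / x <= y.
  move=> h; have [|/ltW yx] := leP x y; first exact: h.
  rewrite distrC; apply: le_trans (h _ _ yx) _.
  by under eq_integral do rewrite distrC.
have cxy := clip_le r xy.
have [mx [xr my]] : - r <= clip r x /\ clip r x <= r /\ clip r y <= r.
  by have := clip_bnd x r0; have := clip_bnd y r0; lra.
have -> : (`|clip r x - clip r y|%:E = \int[leb]_(s in `[clip r x, clip r y[) (cst 1%E) s)%E.
  rewrite integral_cst//= mul1e lebesgue_measure_itv/= lte_fin.
  rewrite distrC ger0_norm ?subr_ge0//; case: ifPn => //.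
  by rewrite -leNgt => h; congr (_%:E); lra.
have ms : measurable_fun `[- r, r] (fun s => `|le_ind x s - le_ind y s|).
  apply: measurableT_comp => //; apply: measurable_funB.
    rewrite /le_ind; apply: nondecreasing_measurable => // a b ab.
    by case: (leP x a) => [xa|_]; [rewrite (le_trans xa ab)|case: ifP].
  rewrite /le_ind; apply: nondecreasing_measurable => // a b ab.
  by case: (leP y a) => [xa|_]; [rewrite (le_trans xa ab)|case: ifP].
have sub : `[clip r x, clip r y[ `<=` `[- r, r].
  by move=> s /=; rewrite !in_itv/=; lra.
apply: (@le_trans _ _ (\int[leb]_(s in `[clip r x, clip r y[) (`|le_ind x s - le_ind y s|%R)%:E)%E).
  apply: ge0_le_integral => //.
  - by apply/measurable_EFinP; exact: measurable_funS sub ms.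
  move=> s /=; rewrite in_itv/= => /andP[xs sy].
  have rs : - r <= s by lra.
  have sr : s < r by lra.
  rewrite /le_ind (clip_le_inv sr xs) ifF; last by rewrite leNgt (lt_clip_inv rs sy).
  by rewrite subr0 normr1.
by apply: ge0_subset_integral => //; apply/measurable_EFinP.
Qed.

(** The localized form of the identity between the 1-Wasserstein distance and the [L^1] distance of
    distribution functions. After [clip_dist_le] and Tonelli it remains to measure, for each
    position [s], the labels whose two particles lie on different sides of [s]. *)
Lemma galois_clip_dist (M N X Y : R -> R) (r : R) : 0 <= r ->
  galois M X -> galois N Y -> measurable_fun `[- r, r] M -> measurable_fun `[- r, r] N ->
  (\int[leb]_(m in D01) (`|clip r (X m) - clip r (Y m)|%R)%:E <=
   \int[leb]_(s in `[(- r)%R, r]) (`|M s - N s|%R)%:E)%E.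
Proof.
move=> r0 gX gY mM mN.
have mX := galois_measurable gX; have mY := galois_measurable gY.
have mI : measurable (`[- r, r] : set RR) by exact: measurable_itv.
have mF (A B : set RR) (x : R -> R) : measurable A -> measurable B -> measurable_fun A x ->
    measurable_fun (A `*` B) (fun z : RR * RR => le_ind (x z.1) z.2).
  move=> mA mB mx; apply: measurable_le_ind; first exact: measurableX.
    exact: measurable_fun1_X.
  exact: (@measurable_fun2_X _ _ id).
apply: (@le_trans _ _ (\int[leb]_(m in D01) \int[leb]_(s in `[(- r)%R, r])
    (`|le_ind (X m) s - le_ind (Y m) s|%R)%:E)%E).
  apply: ge0_le_integral => //.
  - apply/measurable_EFinP; apply: measurableT_comp => //.
    by apply: measurable_funB; apply: clip_measurable => //; exact: mD01.
  - pose g : RR * RR -> \bar R := (fun z : RR * RR => `|le_ind (X z.1) z.2 - le_ind (Y z.1) z.2|%:E) \_ (D01 `*` `[- r, r]).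
    have mg : measurable_fun [set: RR * RR] g.
      apply/(measurable_restrictT _ _).1; first by apply: measurableX => //; exact: mD01.
      apply/measurable_EFinP; apply: measurableT_comp => //.
      by apply: measurable_funB; apply: mF => //; exact: mD01.
    apply: (eq_measurable_fun (fubini_F leb g)); last first.
      apply: measurable_funTS; apply: measurable_fun_fubini_tonelli_F => //.
      by move=> z; rewrite /g patchE; case: ifPn => //; rewrite lee_fin.
    move=> m Dm; rewrite /fubini_F [RHS]integral_mkcond; apply: eq_integral => s _.
    by rewrite /g !patchE in_setX Dm.
  - by move=> m _; exact: clip_dist_le.
rewrite (@tonelli_on R D01 `[- r, r] (fun m s => `|le_ind (X m) s - le_ind (Y m) s|)) //; last first.
- by apply: measurableT_comp => //; apply: measurable_funB; apply: mF => //; exact: mD01.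
apply: ge0_le_integral => //.
- by move=> s _; apply: integral_ge0 => m _; rewrite lee_fin.
- pose g : RR * RR -> \bar R := (fun z : RR * RR => `|le_ind (X z.1) z.2 - le_ind (Y z.1) z.2|%:E) \_ (D01 `*` `[- r, r]).
  have mg : measurable_fun [set: RR * RR] g.
    apply/(measurable_restrictT _ _).1; first by apply: measurableX => //; exact: mD01.
    apply/measurable_EFinP; apply: measurableT_comp => //.
    by apply: measurable_funB; apply: mF => //; exact: mD01.
  apply: (eq_measurable_fun (fubini_G leb g)); last first.
    apply: measurable_funTS; apply: measurable_fun_fubini_tonelli_G => //.
    by move=> z; rewrite /g patchE; case: ifPn => //; rewrite lee_fin.
  move=> s Ds; rewrite /fubini_G [RHS]integral_mkcond; apply: eq_integral => m _.
  by rewrite /g !patchE in_setX Ds andbT.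
- by apply/measurable_EFinP; apply: measurableT_comp => //; exact: measurable_funB.
move=> s _.
(* A label [m] with [X m <= s < Y m] satisfies [N s <= m <= M s], and symmetrically. The
   intersection with [D01] accommodates distribution functions with values outside [[0, 1]], such as
   the tilted [mollM]. *)
pose lo := Num.min (M s) (N s); pose hi := Num.max (M s) (N s).
apply: (@le_trans _ _ (\int[leb]_(m in D01 `&` `[lo, hi]) (cst 1%E) m)%E); last first.
  rewrite integral_cst//=; last by apply: measurableI => //; exact: mD01.
  rewrite mul1e; apply: (@le_trans _ _ (leb `[lo, hi]%classic)).
    by apply: le_measure; rewrite ?inE//; apply: measurableI => //; exact: mD01.
  rewrite lebesgue_measure_itv/= lte_fin; case: ifPn => [|_]; last by rewrite lee_fin.
  rewrite -EFinD lee_fin /lo /hi /Num.max /Num.min; case: ifPn => h _.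
    by rewrite distrC ler_norm.
  by rewrite ler_norm.
rewrite [leRHS]integral_mkcondr; apply: ge0_le_integral => //.
- apply/measurable_EFinP; apply: measurableT_comp => //.
  have mle (x : R -> R) : measurable_fun D01 x -> measurable_fun D01 (fun m => le_ind (x m) s).
    by move=> mx; apply: measurable_fun_if => //; exact: measurable_fun_ler.
  by apply: measurable_funB; exact: mle.
- by apply: measurable_funTS; apply/(measurable_restrictT _ _).1.
move=> m; rewrite D01E => m01; rewrite patchE mem_setE in_itv/= /le_ind.
rewrite (_ : (if _ then cst 1%E m else 0%E) = (if lo <= m <= hi then 1 else 0 : R)%:E); last by case: ifP.
rewrite lee_fin.
have h0 : 0 <= if lo <= m <= hi then 1 else 0 :> R by case: ifP.
case: (leP (X m) s) => [xs|sx]; case: (leP (Y m) s) => [ys|sy]; rewrite ?subrr ?normr0 ?sub0r ?subr0 ?normrN ?normr1.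
- by case: ifP.
- have h1 := (gX _ _ m01).2 xs.
  have h2 : N s <= m by rewrite leNgt; apply/negP => h; have := (gY _ _ m01).1 h; lra.
  by rewrite ifT// /lo /hi ge_min le_max h1 h2 orbT.
- have h1 := (gY _ _ m01).2 ys.
  have h2 : M s <= m by rewrite leNgt; apply/negP => h; have := (gX _ _ m01).1 h; lra.
  by rewrite ifT// /lo /hi ge_min le_max h1 h2 orbT.
- by case: ifP.
Qed.

End clip.

(** * The measure as the law of the inverse *)

Section law.
Context (R : realType).
Notation RR := (measurableTypeR R).
Notation leb := (@lebesgue_measure R).
Notation D01 := (`]0%R, 1%R[%classic : set RR).

Lemma measure_ray_itv (rho : {measure set RR -> \bar R}) (M : R -> R) (a b : R) :
  is_deriv_measure M rho -> a <= b -> rho `]a, b]%classic = (M b - M a)%:E.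
Proof.
move=> rM ab; have : rho `]-oo, b]%classic = (rho `]-oo, a]%classic + rho `]a, b]%classic)%E.
  rewrite -measureU//; first by congr (rho _); rewrite -itv_bndbnd_setU.
  by apply/seteqP; split => // x [/=]; rewrite !in_itv/= => xa /andP[]; lra.
rewrite !rM; case: (rho `]a, b]%classic) => //= c [->]; congr (_%:E); ring.
Qed.

(** By [galois_law_ray], the pushforward of Lebesgue measure on []0, 1[] by [X] gives every ray the
    mass [M x]; two such measures agree on half-open intervals, which generate the Borel sets. *)
Lemma law_eq (rho : {measure set RR -> \bar R}) (M X : R -> R) :
  is_deriv_measure M rho -> (forall x, 0 <= M x <= 1) -> galois M X -> measurable_fun setT X ->
  forall A, measurable A -> rho A = leb (D01 `&` X @^-1` A).
Proof.
move=> rM M01 g mX.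
pose lam : {measure set RR -> \bar R} := mrestr leb (@mD01 R).
have mX' : measurable_fun [set: RR] (X : RR -> RR) := mX.
pose X' : {mfun RR >-> RR} := HB.pack_for {mfun RR >-> RR} (X : RR -> RR)
  (isMeasurableFun.Build _ _ RR RR (X : RR -> RR) mX').
pose nu0 : {measure set RR -> \bar R} := pushforward lam X'.
pose nu := nu0 mX'.
have nuE A : nu A = leb (D01 `&` X @^-1` A).
  by rewrite /nu /nu0 /pushforward /= /lam /mrestr setIC.
move=> A mA; rewrite -nuE; apply: measure_ocitv_unique => //.
- move=> a b; have [ab|ba] := leP a b; last first.
    by rewrite set_itv_ge ?measure0// -leNgt bnd_simp ltW.
  rewrite (measure_ray_itv rM ab); apply/esym.
  apply: measure_ray_itv ab => x.
  by rewrite nuE -(galois_law_ray g (M01 x)) (_ : X @^-1` _ = [set m | X m <= x]).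
- move=> a b; have [ab|ba] := leP a b; last first.
    by rewrite set_itv_ge ?measure0// -leNgt bnd_simp ltW.
  by rewrite (measure_ray_itv rM ab) ltry.
Qed.

Lemma law_ge0_integral (rho : {measure set RR -> \bar R}) (M X : R -> R) (f : R -> R) :
  is_deriv_measure M rho -> (forall x, 0 <= M x <= 1) -> galois M X -> measurable_fun setT X ->
  measurable_fun setT f -> (forall x, 0 <= f x) ->
  (\int[rho]_x (f x)%:E = \int[leb]_(m in D01) (f (X m))%:E)%E.
Proof.
move=> rM M01 g mX mf f0.
pose lam : {measure set RR -> \bar R} := mrestr leb (@mD01 R).
have mX' : measurable_fun [set: RR] (X : RR -> RR) := mX.
pose X' : {mfun RR >-> RR} := HB.pack_for {mfun RR >-> RR} (X : RR -> RR)
  (isMeasurableFun.Build _ _ RR RR (X : RR -> RR) mX').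
pose nu0 : {measure set RR -> \bar R} := pushforward lam X'.
pose nu := nu0 mX'.
rewrite (@eq_measure_integral _ _ _ _ nu); last first.
  move=> A mA _; rewrite (law_eq rM M01 g mX mA).
  by rewrite /nu /nu0 /pushforward /= /lam /mrestr setIC.
rewrite ge0_integral_pushforward//; last 2 first.
- exact/measurable_EFinP.
- by move=> x _; rewrite lee_fin.
rewrite preimage_setT.
(* [lam] is a measure on the whole line that does not charge the complement of []0, 1[]; discarding
   that complement turns it back into Lebesgue measure on []0, 1[]. *)
rewrite (@ge0_negligible_integral _ _ _ lam setT (~` D01))//; last 4 first.
- by apply: measurableC; exact: mD01.
- by apply/measurable_EFinP; exact: measurableT_comp.
- by move=> x _; rewrite lee_fin.
- by rewrite /lam /= /mrestr setICl measure0.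
rewrite setDE setCK setTI; apply: eq_measure_integral => A mA AD.
by rewrite /lam /= /mrestr (setIidl AD).
Qed.

Lemma law_integrable (rho : {measure set RR -> \bar R}) (M X : R -> R) (f : R -> R) :
  is_deriv_measure M rho -> (forall x, 0 <= M x <= 1) -> galois M X -> measurable_fun setT X ->
  measurable_fun setT f ->
  rho.-integrable setT (EFin \o f) <-> leb.-integrable D01 (EFin \o (f \o X)).
Proof.
move=> rM M01 g mX mf.
have e := law_ge0_integral rM M01 g mX (measurableT_comp (@normr_measurable R _) mf) (fun x => normr_ge0 (f x)).
split=> /integrableP[_ fi]; apply/integrableP; split.
- by apply/measurable_EFinP/measurable_funTS; exact: measurableT_comp.
- by move: fi => /=; rewrite e.
- exact/measurable_EFinP.
- by rewrite /= e.
Qed.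

Lemma law_integral (rho : {measure set RR -> \bar R}) (M X : R -> R) (f : R -> R) :
  is_deriv_measure M rho -> (forall x, 0 <= M x <= 1) -> galois M X -> measurable_fun setT X ->
  measurable_fun setT f -> leb.-integrable D01 (EFin \o (f \o X)) ->
  (\int[rho]_x (f x)%:E = (\int[leb]_(m in D01) f (X m))%:E)%E.
Proof.
move=> rM M01 g mX mf fi.
have mD := @mD01 R.
rewrite -EFin_Rintegral// [LHS]integralE [RHS]integralE.
have mp : measurable_fun setT (f^\+)%R by exact: measurable_funrpos.
have mn : measurable_fun setT (f^\-)%R by exact: measurable_funrneg.
have pE (h : R -> R) x : ((fun x => (h x)%:E)^\+ x)%E = ((h^\+)%R x)%:E.
  by rewrite funeposE /funrpos EFin_max.
have nE (h : R -> R) x : ((fun x => (h x)%:E)^\- x)%E = ((h^\-)%R x)%:E.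
  by rewrite funenegE /funrneg -EFinN EFin_max.
congr (_ - _)%E.
- have := law_ge0_integral rM M01 g mX mp (fun x => funrpos_ge0 f x).
  by under [X in X = _ -> _]eq_integral do rewrite -pE; move=> ->; apply: eq_integral => x _; rewrite pE.
- have := law_ge0_integral rM M01 g mX mn (fun x => funrneg_ge0 f x).
  by under [X in X = _ -> _]eq_integral do rewrite -nE; move=> ->; apply: eq_integral => x _; rewrite nE.
Qed.

End law.

(** * Layer-cake formula *)

Section layer_cake.
Context (R : realType).
Notation RR := (measurableTypeR R).
Notation leb := (@lebesgue_measure R).
Notation D01 := (`]0%R, 1%R[%classic : set RR).

Lemma primitive01E (G : R -> R) (z : R) : 0 <= z <= 1 ->
  leb.-integrable D01 (EFin \o G) ->
  primitive01 G z = \int[leb]_(m in `]0, z[) G m.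
Proof.
move=> /andP[z0 z1] iG; rewrite /primitive01 z0 /lint_on /Rintegral; congr fine.
have mG : measurable_fun `]0, z[ G.
  apply: measurable_funS (integrable_measurableR iG) => //.
  by move=> x /=; rewrite !in_itv/=; lra.
rewrite [LHS]integral_itv_bndoo.
  apply: eq_integral => x; rewrite mem_setE in_itv/= => /andP[x0 xz].
  by rewrite ext01E// x0 (lt_le_trans xz).
apply/measurable_EFinP; apply: eq_measurable_fun mG => x; rewrite mem_setE in_itv/= => /andP[x0 xz].
by rewrite ext01E// x0 (lt_le_trans xz).
Qed.

(** The sets [m < M x] and [X m <= x] of labels can differ only at [m = M x], a null set. This
    rewrites the Eulerian flux as an integral over the labels that sit at or to the left of [x]. *)
Lemma primitive01_galois (G M X : R -> R) (x : R) : galois M X -> 0 <= M x <= 1 ->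
  leb.-integrable D01 (EFin \o G) ->
  primitive01 G (M x) = \int[leb]_(m in D01) (G m * le_ind (X m) x).
Proof.
move=> g M01 iG; have mX := galois_measurable g.
have mG := integrable_measurableR iG.
have mle : measurable_fun D01 (fun m => le_ind (X m) x).
  by rewrite /le_ind; apply: measurable_fun_if => //; exact: measurable_fun_ler.
rewrite primitive01E// /Rintegral; congr fine.
have sub : `]0, M x[ `<=` (D01 : set R).
  by move=> m /=; rewrite !in_itv/=; lra.
have -> : (\int[leb]_(m in `]0%R, (M x)[) (G m)%:E = \int[leb]_(m in D01) (((fun m => (G m)%:E) \_ `]0%R, (M x)[) m))%E.
  by rewrite -integral_mkcondr setIidr.
apply: ae_eq_integral.
- exact: mD01.
- apply: measurable_funTS; apply/(measurable_restrictT _ _).1 => //; apply/measurable_EFinP.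
  exact: measurable_funS mG.
- by apply/measurable_EFinP; exact: measurable_funM.
exists [set M x]; split => //; first exact: lebesgue_measure_set1.
move=> m /= /not_implyP[]; rewrite in_itv/= => m01 h; apply: contrapT => mM; apply: h.
have mMx : m != M x by exact/eqP.
rewrite patchE mem_setE in_itv/= /le_ind.
have [mx|xm] := ltP m (M x).
  by rewrite ((g _ _ m01).1 mx) (andP m01).1/= mulr1.
rewrite andbF ifF ?mulr0//; apply/negbTE/negP => /(g _ _ m01).2 h.
by move: mMx; rewrite eq_le h xm.
Qed.

(** Insert [primitive01_galois] and exchange the integrals: a fixed label [m] contributes the
    integral of [psi] over positions at or to the right of [X m], which is [Psi r - Psi (X m)]. *)
Lemma layer_cake (G M X Psi psi : R -> R) (r : R) : 0 <= r ->
  galois M X -> (forall x, 0 <= M x <= 1) -> {homo M : x y / x <= y} ->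
  leb.-integrable D01 (EFin \o G) ->
  continuous psi -> (forall x, is_derive x (1:R) Psi (psi x)) ->
  (forall x, r <= `|x| -> psi x = 0) ->
  [/\ leb.-integrable setT (EFin \o (fun x => primitive01 G (M x) * psi x)),
   leb.-integrable D01 (EFin \o (fun m => G m * (Psi r - Psi (X m)))) &
  \int[leb]_x (primitive01 G (M x) * psi x) =
  \int[leb]_(m in D01) (G m * (Psi r - Psi (X m)))].
Proof.
move=> r0 g M01 Mnd iG cpsi dPsi psi0.
have mX := galois_measurable g; have mG := integrable_measurableR iG.
have mpsi : measurable_fun setT psi := continuous_measurable_fun cpsi.
have ipsi a b : leb.-integrable `[a, b] (EFin \o psi) := @continuous_itv_integrable R psi a b cpsi.
(* [Psi] is constant on each side of [[-r, r]], so the formula for the inner integral also holds for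
   particles that lie outside that interval. *)
have Psicst x y : (r <= x <= y) \/ (x <= y <= - r) -> Psi y = Psi x.
  move=> xy; have xley : x <= y by case: xy => /andP[]; lra.
  have := is_derive_FTC2 xley cpsi dPsi.
  rewrite (@eq_Rintegral _ _ _ _ _ (cst 0)); first by rewrite Rintegral_cst// mul0r; lra.
  move=> z; rewrite mem_setE in_itv/= => zxy; apply: psi0.
  by case: xy => xy; rewrite ler_normr; apply/orP; [left|right]; lra.
have inner m : \int[leb]_(x in `[- r, r]) (le_ind (X m) x * psi x) = Psi r - Psi (X m).
  have [Xr|rX] := leP (X m) r; last first.
    rewrite (Psicst r (X m)); last by left; rewrite lexx ltW.
    rewrite subrr (@eq_Rintegral _ _ _ _ _ (cst 0)); first by rewrite Rintegral_cst// mul0r.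
    move=> x; rewrite mem_setE in_itv/= => xr; rewrite /le_ind ifF ?mul0r//.
    by apply/negbTE; rewrite -ltNge; lra.
  pose c := Num.max (- r) (X m).
  have cr : c <= r by rewrite /c ge_max Xr andbT; lra.
  have rc : - r <= c by rewrite /c le_max lexx.
  transitivity (\int[leb]_(x in `[c, r]) psi x).
    have sub : `[c, r] `<=` `[- r, r]%classic.
      by move=> x /=; rewrite !in_itv/= => /andP[cx ->]; rewrite andbT; lra.
    transitivity (\int[leb]_(x in `[- r, r] `&` `[c, r]) psi x); last by rewrite setIidr.
    rewrite Rintegral_mkcondr; apply: eq_Rintegral => x; rewrite mem_setE in_itv/= => xr.
    rewrite patchE mem_setE in_itv/= /le_ind /c ge_max; case/andP: xr => -> ->.
    by rewrite /= andbT; case: ifP; rewrite ?mul1r ?mul0r.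
  rewrite (is_derive_FTC2 cr cpsi dPsi); congr (_ - _).
  rewrite /c; have [//|Xr'] := leP (- r) (X m).
  by apply: Psicst; right; rewrite lexx ltW.
have mD := @mD01 R.
have mI : measurable (`[- r, r] : set RR) by exact: measurable_itv.
have mleX : measurable_fun (D01 `*` `[- r, r]) (fun z : RR * RR => le_ind (X z.1) z.2).
  apply: measurable_le_ind; first exact: measurableX.
    exact: measurable_fun1_X.
  exact: (@measurable_fun2_X _ _ _ id).
have mf : measurable_fun (D01 `*` `[- r, r]) (fun z : RR * RR => G z.1 * (le_ind (X z.1) z.2 * psi z.2)).
  apply: measurable_funM; first exact: measurable_fun1_X.
  by apply: measurable_funM => //; apply: measurable_fun2_X => //; exact: measurable_funTS.
have nG : leb.-integrable D01 (EFin \o (fun m => `|G m|)) by exact: integrable_norm.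
have npsi : leb.-integrable `[- r, r] (EFin \o (fun m => `|psi m|)) by exact: integrable_norm.
have bnd m x : `|G m * (le_ind (X m) x * psi x)| <= `|G m| * `|psi x|.
  rewrite !normrM ler_wpM2l// -[leRHS]mul1r ler_wpM2r// /le_ind.
  by case: ifP; rewrite ?normr1 ?normr0.
have [i1 e1] := @fubini_dom R D01 `[- r, r] (fun m x => G m * (le_ind (X m) x * psi x))
   (fun m => `|G m|) (fun x => `|psi x|) mD mI mf nG npsi (fun m x _ _ => bnd m x).
have mf' : measurable_fun (`[- r, r] `*` D01) (fun z : RR * RR => G z.2 * (le_ind (X z.2) z.1 * psi z.1)).
  apply: measurable_funM; first exact: measurable_fun2_X.
  apply: measurable_funM; last by apply: measurable_fun1_X => //; exact: measurable_funTS.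
  apply: measurable_le_ind; first exact: measurableX.
    exact: measurable_fun2_X.
  exact: (@measurable_fun1_X _ _ _ id).
have [i2 _] := @fubini_dom R `[- r, r] D01 (fun x m => G m * (le_ind (X m) x * psi x))
   (fun x => `|psi x|) (fun m => `|G m|) mI mD mf' npsi nG
   (fun x m _ _ => le_trans (bnd m x) (eq_ind _ (fun z => _ <= z) (lexx _) _ (mulrC _ _))).
have ile x : leb.-integrable D01 (EFin \o (fun m => G m * le_ind (X m) x)).
  apply: (dominated_integrable mD _ nG).
    by apply: measurable_funM => //; rewrite /le_ind; apply: measurable_fun_if => //; exact: measurable_fun_ler.
  move=> m _; rewrite normrM -[leRHS]mulr1 ler_wpM2l// /le_ind.
  by case: ifP; rewrite ?normr1 ?normr0.
have E1 m : \int[leb]_(x in `[- r, r]) (G m * (le_ind (X m) x * psi x)) = G m * (Psi r - Psi (X m)).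
  rewrite RintegralZl ?inner//.
  apply: (dominated_integrable mI _ npsi).
    apply: measurable_funM => //; last exact: measurable_funTS.
    by rewrite /le_ind; apply: measurable_fun_if => //; exact: measurable_fun_ler.
  move=> x _; rewrite normrM -[leRHS]mul1r ler_wpM2r// /le_ind.
  by case: ifP; rewrite ?normr1 ?normr0.
have E2 x : \int[leb]_(m in D01) (G m * (le_ind (X m) x * psi x)) = primitive01 G (M x) * psi x.
  under eq_Rintegral do rewrite mulrA.
  by rewrite (RintegralZr _ mD (ile x)) (primitive01_galois g).
have E3 : (fun x => primitive01 G (M x) * psi x) = ((fun x => primitive01 G (M x) * psi x) \_ `[- r, r]).
  apply/funext => x; rewrite patchE mem_setE in_itv/= -ler_norml; case: ifPn => //.
  by rewrite -ltNge => /ltW/psi0 ->; rewrite mulr0.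
split.
- rewrite E3 -restrict_EFin; apply/(integrable_mkcond _ _).1 => //.
  by move: i2; apply: eq_integrable => // x _ /=; rewrite E2.
- by move: i1; apply: eq_integrable => // m _ /=; rewrite E1.
- rewrite E3 -Rintegral_mkcond.
  transitivity (\int[leb]_(x in `[- r, r]) \int[leb]_(m in D01) (G m * (le_ind (X m) x * psi x))).
    by apply: eq_Rintegral => x _; rewrite E2.
  by rewrite -e1; apply: eq_Rintegral => m _; rewrite E1.
Qed.

End layer_cake.

(** * Smooth test functions *)

Section derive_tools.
Context (R : realType).

Lemma is_derive_epsilon (f : R -> R) (x l : R) :
  (forall e : R, 0 < e -> exists2 d : R, 0 < d &
     forall h, h != 0 -> `|h| < d -> `|f (x + h) - f x - h * l| <= e * `|h|) ->
  is_derive x (1:R) f l.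
Proof.
move=> H.
have c : h^-1 *: ((f \o shift x) (h *: (1:R)) - f x) @[h --> (0:R)^'] --> l.
  apply/cvgrPdist_le => e e0; have [d d0 dP] := H e e0.
  near=> h.
  have h0 : h != 0 by near: h; exact: nbhs_dnbhs_neq.
  have hd : `|h| < d.
    near: h; apply: dnbhs0_lt => //.
  have -> : h^-1 *: ((f \o shift x) (h *: 1) - f x) = h^-1 * (f (x + h) - f x).
    by rewrite /= /GRing.scale /= mulr1 [h + x]addrC.
  have -> : l - h^-1 * (f (x + h) - f x) = - (h^-1 * (f (x + h) - f x - h * l)) by field.
  rewrite normrN normrM normfV ler_pdivrMl ?normr_gt0// [X in _ <= X]mulrC.
  exact: dP.
apply: DeriveDef; first by apply/cvg_ex; exists l.
exact: cvg_lim c.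
Unshelve. all: by end_near. Qed.

Lemma is_derive_ext (f g : R -> R) (x l : R) : (forall y, f y = g y) ->
  is_derive x (1:R) f l -> is_derive x (1:R) g l.
Proof. by move=> fg; rewrite (_ : f = g)//; exact/funext. Qed.

Lemma is_derive_near (f g : R -> R) (x l d : R) : 0 < d ->
  (forall y, `|y - x| < d -> f y = g y) ->
  is_derive x (1:R) f l -> is_derive x (1:R) g l.
Proof.
move=> d0 fg [df dl]; apply: DeriveDef.
  apply: near_eq_derivable df; near=> y; apply: fg; near: y.
  by apply: cvgr_distC_lt => //; exact: cvg_id.
rewrite -dl; apply: near_eq_derive.
by near=> y; apply/esym/fg; near: y; apply: cvgr_distC_lt => //; exact: cvg_id.
Unshelve. all: by end_near. Qed.

Lemma is_derive_chain (f g : R -> R) (x a b : R) : is_derive (g x) (1:R) f a ->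
  is_derive x (1:R) g b -> is_derive x (1:R) (fun y => f (g y)) (a * b).
Proof.
move=> df dg; have := @is_derive1_comp _ f g x a b df dg.
by rewrite (_ : f \o g = (fun y => f (g y))).
Qed.

Lemma is_derive_cmul (c : R) (f : R -> R) (x l : R) : is_derive x (1:R) f l ->
  is_derive x (1:R) (fun y => c * f y) (c * l).
Proof. by move=> df; apply: is_derive_eq; rewrite /GRing.scale /=. Qed.

Lemma is_derive_affine (f : R -> R) (a b x l : R) :
  is_derive (a * x + b) (1:R) f l -> is_derive x (1:R) (fun y => f (a * y + b)) (a * l).
Proof.
move=> df; have dg : is_derive x (1:R) (fun y : R => a * y + b) a.
  by apply: is_derive_eq; rewrite /GRing.scale /=; ring.
by rewrite mulrC; exact: (is_derive_chain (g := fun y => a * y + b)).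
Qed.

End derive_tools.

(** * An explicit smooth bump and its primitive *)

Section smooth_step.
Context (R : realType).
Notation leb := (@lebesgue_measure R).

(** Coefficient by coefficient, from [u ^ i / i! <= exp u]; hence the factorials in the constant. *)
Lemma poly_expRN_bounded (Q : {poly R}) :
  exists2 C : R, 0 <= C & forall u, 0 < u -> `|Q.[u]| * expR (- u) <= C.
Proof.
exists (\sum_(i < size Q) `|Q`_i| * i`!%:R).
  by apply: sumr_ge0 => i _; rewrite mulr_ge0.
move=> u u0; rewrite horner_coef.
apply: (le_trans (ler_wpM2r (expR_ge0 _) (ler_norm_sum _ _ _))).
rewrite mulr_suml; apply: ler_sum => i _.
rewrite normrM -mulrA ler_wpM2l// ger0_norm; last by rewrite exprn_ge0// ltW.
rewrite expRN -ler_pdivlMr ?invr_gt0 ?expR_gt0// invrK.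
case: (i : nat) => [|n]; first by rewrite fact0 mul1r expr0; have := expR_ge1Dx u; lra.
have := @expR_ge1Dxn R u n (ltW u0) => h.
have f0 : 0 < n.+1`!%:R :> R by rewrite ltr0n fact_gt0.
have : u ^+ n.+1 / n.+1`!%:R <= expR u by lra.
by rewrite ler_pdivrMr// mulrC.
Qed.

(** The functions [P(1/x) exp(-1/x)], cut off at 0. Allowing every polynomial [P] makes the family
    closed under differentiation, with [X^2 (P - P')] in place of [P]. *)
Definition flat (P : {poly R}) (x : R) : R :=
  if 0 < x then P.[x^-1] * expR (- x^-1) else 0.

Lemma flat_derive (P : {poly R}) (x : R) :
  is_derive x (1:R) (flat P) (flat ('X^2 * (P - P^`())) x).
Proof.
have [x0|x0|->] := ltgtP x 0.
- have -> : flat ('X^2 * (P - P^`())) x = 0 by rewrite /flat ltNge (ltW x0).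
  apply: (@is_derive_near _ (cst 0) _ _ _ (- x)); first lra.
  move=> y; rewrite ltr_norml => /andP[_ yx].
  by rewrite /flat ifF//; apply/negbTE; rewrite -leNgt; lra.
- apply: (@is_derive_near _ (fun y : R => P.[y^-1] * expR (- y^-1)) _ _ _ x) => //.
    move=> y; rewrite ltr_norml => /andP[xy _].
    by rewrite /flat ifT//; lra.
  have xn : x != 0 by rewrite gt_eqF.
  have dV : is_derive x (1:R) (fun y : R => y^-1) (- x ^- 2).
    have := @is_deriveV R id x 1 1 xn (is_derive_id _ _).
    by rewrite /GRing.scale /= mulr1.
  have dP : is_derive x (1:R) (fun y : R => P.[y^-1]) (P^`().[x^-1] * - x ^- 2).
    exact: (@is_derive_chain R (fun y => P.[y]) (fun y : R => y^-1) x _ _ (is_derive_poly P x^-1) dV).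
  have dE : is_derive x (1:R) (fun y : R => expR (- y^-1)) (expR (- x^-1) * x ^- 2).
    have := @is_derive_chain R expR (fun y : R => - y^-1) x _ _ (is_derive_expR _) (is_deriveN dV).
    by rewrite opprK.
  apply: is_derive_eq; rewrite /flat x0 /GRing.scale /=.
  rewrite hornerM hornerXn hornerD hornerN; field.
  by [].
- rewrite [X in is_derive _ _ _ X](_ : _ = 0); last by rewrite /flat ltxx.
  apply: is_derive_epsilon => e e0.
  (* With [u = 1/h], the factor [X^2] gives [|flat P h| <= C h^2], hence derivative 0 at the origin.
     The constant [C + 1] below keeps the quotient meaningful when [C = 0]. *)
  have [C C0 CP] := poly_expRN_bounded ('X^2 * P).
  exists (e / (C + 1)); first by rewrite divr_gt0//; lra.
  move=> h h0 hd; rewrite add0r mulr0 subr0 {2}/flat ltxx subr0 /flat.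
  case: ifPn => [hp|_]; last by rewrite normr0 mulr_ge0// ltW.
  have hV : 0 < h^-1 by rewrite invr_gt0.
  have := CP _ hV; rewrite hornerM hornerXn normrM.
  move=> le; rewrite normrM [X in _ * X <= _]ger0_norm ?expR_ge0//.
  have -> : `|P.[h^-1]| * expR (- h^-1) =
     (`|h^-1 ^+ 2| * `|P.[h^-1]| * expR (- h^-1)) * h ^+ 2.
    by rewrite [`|h^-1 ^+ 2|]ger0_norm ?sqr_ge0//; field.
  apply: (@le_trans _ _ (C * h ^+ 2)); first by rewrite ler_wpM2r ?sqr_ge0.
  rewrite gtr0_norm// expr2 mulrA ler_wpM2r ?(ltW hp)//.
  rewrite gtr0_norm// in hd.
  have : (C + 1) * h <= e by rewrite mulrC -ler_pdivlMr ?(ltW hd)//; lra.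
  by apply: le_trans; rewrite ler_wpM2r ?(ltW hp)//; lra.
Qed.

Lemma flatN (P : {poly R}) (x : R) : flat (- P) x = - flat P x.
Proof. by rewrite /flat hornerN mulNr; case: ifP; rewrite ?oppr0. Qed.

(** Carrying the whole sequence of derivatives as a witness reduces the mixed partial derivatives of
    a tensor product to a count of derivatives in each variable. *)
Definition smooth (f : R -> R) := exists D : nat -> R -> R, D 0%N = f /\
  forall n x, is_derive x (1:R) (D n) (D n.+1 x).

(** Finite sums of products, the first factor flat at 0 and the second flat at 1: a family that
    contains the bump and in which the Leibniz rule is an operation on lists of polynomials. *)
Fixpoint flatprod (l : seq ({poly R} * {poly R})) (x : R) : R :=
  if l is (P, Q) :: l' then flat P x * flat Q (1 - x) + flatprod l' x else 0.

Definition dpoly (P : {poly R}) : {poly R} := 'X^2 * (P - P^`()).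

Fixpoint dflatprod (l : seq ({poly R} * {poly R})) : seq ({poly R} * {poly R}) :=
  if l is (P, Q) :: l' then (dpoly P, Q) :: (P, - dpoly Q) :: dflatprod l' else [::].

Lemma flatprod_derive l (x : R) :
  is_derive x (1:R) (flatprod l) (flatprod (dflatprod l) x).
Proof.
elim: l => [|[P Q] l ih] /=; first exact: is_derive_cst.
have dP := flat_derive P x.
have dQ : is_derive x (1:R) (fun y => flat Q (1 - y)) (- flat (dpoly Q) (1 - x)).
  have := @is_derive_affine R (flat Q) (-1) 1 x (flat (dpoly Q) (1 - x)).
  rewrite mulN1r [- x + 1]addrC => /(_ (flat_derive Q (1 - x))).
  rewrite mulN1r; apply: is_derive_ext => y; congr (flat Q _); ring.
apply: is_derive_eq; rewrite /GRing.scale /= flatN -/(dpoly P); ring.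
Qed.

Definition bump0 : R -> R := flatprod [:: (1, 1)].

Lemma bump0E x : bump0 x = flat 1 x * flat 1 (1 - x).
Proof. by rewrite /bump0 /= addr0. Qed.

Lemma bump0_smooth : smooth bump0.
Proof.
exists (fun n => flatprod (iter n dflatprod [:: (1, 1)])); split => // n x.
exact: flatprod_derive.
Qed.

Lemma smooth_derive f : smooth f -> exists f', smooth f' /\ forall x, is_derive x (1:R) f (f' x).
Proof.
move=> [D [<- dD]]; exists (D 1%N); split; last exact: dD.
by exists (fun n => D n.+1); split.
Qed.

Lemma smooth_continuous f : smooth f -> continuous f.
Proof. by move=> /smooth_derive[f' [_ df]]; exact: is_derive1_continuous df. Qed.

Lemma flat1_ge0 x : 0 <= flat 1 x.
Proof. by rewrite /flat; case: ifP => // _; rewrite hornerC mul1r expR_ge0. Qed.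

Lemma bump0_ge0 x : 0 <= bump0 x.
Proof. by rewrite bump0E mulr_ge0 ?flat1_ge0. Qed.

Lemma bump0_eq0 x : x <= 0 \/ 1 <= x -> bump0 x = 0.
Proof.
rewrite bump0E => -[h|h].
  by rewrite {1}/flat ltNge h mul0r.
by rewrite {2}/flat ltNge (_ : 1 - x <= 0) ?mulr0//; lra.
Qed.

Definition bump_mass : R := \int[leb]_(x in `[0, 1]) bump0 x.

Lemma bump_mass_gt0 : 0 < bump_mass.
Proof.
have cb := smooth_continuous bump0_smooth.
have ib a b := @continuous_itv_integrable R bump0 a b cb.
(* On [[1/4, 3/4]] both [1/x] and [1/(1 - x)] are at most 4, so each factor of the bump is at least
   [exp (-4)]. *)
pose c : R := expR (- (4%:R)) ^+ 2.
have c0 : 0 < c by rewrite exprn_gt0// expR_gt0.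
have lb x : x \in `[4^-1:R, 3 / 4] -> c <= bump0 x.
  rewrite in_itv/= => /andP[x1 x2].
  rewrite bump0E /c expr2; apply: ler_pM; rewrite ?expR_ge0//.
    rewrite /flat ifT; last lra.
    rewrite hornerC mul1r ler_expR lerN2 invf_ple ?posrE; lra.
  rewrite /flat ifT; last lra.
  rewrite hornerC mul1r ler_expR lerN2 invf_ple ?posrE; lra.
have -> : bump_mass = \int[leb]_(x in `[0, 1]) bump0 x by [].
apply: (@lt_le_trans _ _ (\int[leb]_(x in `[4^-1, 3 / 4]) cst c x)).
  have m : leb `[4^-1, 3 / 4]%classic = (3 / 4 - 4^-1)%:E.
    by rewrite lebesgue_measure_itv/= lte_fin ifT//; lra.
  by rewrite Rintegral_cst// [X in fine X]m /= mulr_gt0//; lra.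
apply: (@le_trans _ _ (\int[leb]_(x in `[4^-1, 3 / 4]) bump0 x)).
  apply: le_Rintegral => //.
    by apply: continuous_itv_integrable; exact: cst_continuous.
have sub : `[4^-1, 3 / 4]%classic `<=` (`[0, 1]%classic : set R).
  by move=> x /=; rewrite !in_itv/=; lra.
rewrite -lee_fin -!EFin_Rintegral//.
apply: ge0_subset_integral => //.
  by apply/measurable_EFinP/measurable_funTS; exact: continuous_measurable_fun.
by move=> x _; rewrite lee_fin bump0_ge0.
Qed.

Definition bumpf (x : R) : R := bump_mass^-1 * bump0 x.

(** Starting at -1 rather than at 0, where the bump begins, makes 0 an interior point of the domain
    of integration, so that the fundamental theorem applies at every [x >= 0]. *)
Definition stepf (x : R) : R :=
  bump_mass^-1 * \int[leb]_(y in `[-1, x]) bump0 y.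

Lemma smooth_affine f (a b c : R) : smooth f -> smooth (fun x => c * f (a * x + b)).
Proof.
move=> [D [<- dD]]; exists (fun n x => c * (a ^+ n * D n (a * x + b))); split.
  by apply/funext => x; rewrite expr0 mul1r.
move=> n x; have h := is_derive_affine (dD n (a * x + b)).
by apply: is_derive_eq; rewrite /GRing.scale /= exprSr -!mulrA.
Qed.

Lemma smoothB f g : smooth f -> smooth g -> smooth (fun x => f x - g x).
Proof.
move=> [D [<- dD]] [E [<- dE]]; exists (fun n x => D n x - E n x); split => // n x.
have := dD n x; have := dE n x => ? ?; exact: is_deriveB.
Qed.

Lemma bump_smooth : smooth bumpf.
Proof.
have := smooth_affine 1 0 bump_mass^-1 bump0_smooth.
by rewrite (_ : (fun x => _) = bumpf)//; apply/funext => x; rewrite mul1r addr0.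
Qed.

Lemma bump_ge0 x : 0 <= bumpf x.
Proof. by rewrite mulr_ge0 ?bump0_ge0// invr_ge0 ltW// bump_mass_gt0. Qed.

Lemma bump_eq0 x : x <= 0 \/ 1 <= x -> bumpf x = 0.
Proof. by move=> h; rewrite /bumpf bump0_eq0 ?mulr0. Qed.

Lemma step_le0 x : x <= 0 -> stepf x = 0.
Proof.
move=> x0; rewrite /stepf (@eq_Rintegral _ _ _ _ _ (cst 0)).
  by rewrite Rintegral_cst// mul0r mulr0.
by move=> y; rewrite mem_setE in_itv/= => y0; rewrite bump0_eq0//; left; lra.
Qed.

Lemma step_derive (x : R) : is_derive x (1:R) stepf (bumpf x).
Proof.
have cb := smooth_continuous bump0_smooth.
have [x0|x0] := ltP x 0.
  rewrite bump_eq0; last by left; exact: ltW.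
  apply: (@is_derive_near _ (cst 0) _ _ _ (- x)); first lra.
  by move=> y; rewrite ltr_norml => /andP[_ yx]; rewrite step_le0//; lra.
have x1 : x < x + 1 by lra.
have i1 := @continuous_itv_integrable R bump0 (-1) (x + 1) cb.
have x2 : -1 < x by lra.
have [dF eF] := continuous_FTC1_closed x1 i1 x2 (cb x).
rewrite /stepf /bumpf.
have dF' : is_derive x (1:R) (fun x => \int[leb]_(y in `[-1, x]) bump0 y) (bump0 x).
  by apply: DeriveDef; [exact: dF|rewrite -derive1E; exact: eF].
exact: is_derive_cmul.
Qed.

Lemma step_ge1 x : 1 <= x -> stepf x = 1.
Proof.
move=> x1.
have cb := smooth_continuous bump_smooth.
have e a b (ab : a <= b) := is_derive_FTC2 ab cb step_derive.
have h1 : stepf 1 = 1.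
  have := e 0 1 ler01; rewrite (step_le0 (lexx _)) subr0 => <-.
  rewrite /bumpf RintegralZl//; last first.
    by apply: continuous_itv_integrable; exact: smooth_continuous bump0_smooth.
  by rewrite mulVf// gt_eqF// bump_mass_gt0.
have := e 1 x x1; rewrite (@eq_Rintegral _ _ _ _ _ (cst 0)).
  by rewrite Rintegral_cst// mul0r h1; lra.
by move=> y; rewrite mem_setE in_itv/= => y0; rewrite bump_eq0//; right; lra.
Qed.

Lemma step_smooth : smooth stepf.
Proof.
have [D [D0 dD]] := bump_smooth.
exists (fun n => if n is n'.+1 then D n' else stepf); split => // -[|n] x.
  by rewrite D0; exact: step_derive.
exact: dD.
Qed.

Lemma step_nd (x y : R) : x <= y -> stepf x <= stepf y.
Proof.
move=> xy; have cb := smooth_continuous bump_smooth.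
have := is_derive_FTC2 xy cb step_derive.
have : 0 <= \int[leb]_(z in `[x, y]) bumpf z by apply: Rintegral_ge0 => z _; exact: bump_ge0.
lra.
Qed.

Lemma step_itv x : 0 <= stepf x <= 1.
Proof.
have [x0|x0] := leP x 0; first by rewrite step_le0// lexx ler01.
have [x1|x1] := leP 1 x; first by rewrite step_ge1// ler01 lexx.
by rewrite -(step_le0 (lexx 0)) -(step_ge1 (lexx 1)) !step_nd// ltW.
Qed.

Lemma bump_lipschitz : exists2 K : R, 0 < K &
  (forall x, bumpf x <= K) /\ forall x y, `|bumpf x - bumpf y| <= K * `|x - y|.
Proof.
have [b' [sb' db]] := smooth_derive bump_smooth.
have bnd (f : R -> R) : continuous f -> exists K, forall x, x \in `[0:R, 1] -> `|f x| <= K.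
  move=> cf; have := @EVT_max R (fun x => `|f x|) 0 1 ler01.
  case; first by apply: continuous_subspaceT => x; apply: cvg_norm; exact: cf.
  by move=> c _ h; exists `|f c|.
have [K1 K1P] := bnd _ (smooth_continuous bump_smooth).
have [K2 K2P] := bnd _ (smooth_continuous sb').
have K10 : 0 <= K1 by apply: le_trans (K1P 0 _); rewrite ?normr_ge0// in_itv/= lexx ler01.
have K20 : 0 <= K2 by apply: le_trans (K2P 0 _); rewrite ?normr_ge0// in_itv/= lexx ler01.
exists (K1 + K2 + 1); first lra.
split.
  move=> x; have [h|h] := boolP (x \in `[0, 1]).
    by have := K1P x h; have := ler_norm (bumpf x); lra.
  rewrite bump_eq0; first lra.
  by move: h; rewrite in_itv/= negb_and -!ltNge => /orP[/ltW|/ltW]; [left|right].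
have lip01 x y : x \in `[0, 1] -> y \in `[0, 1] -> `|bumpf x - bumpf y| <= K2 * `|x - y|.
  wlog xy : x y / x <= y.
    move=> h x01 y01; have [xy|/ltW yx] := leP x y; first exact: h.
    by rewrite distrC [`|x - y|]distrC; exact: h.
  rewrite !in_itv/= => x01 y01.
  have [c cxy e] := MVT_segment xy (fun z _ => db z) (continuous_subspaceT (smooth_continuous bump_smooth)).
  rewrite distrC e normrM [`|x - y|]distrC ler_wpM2r// K2P//.
  by move: cxy; rewrite !in_itv/=; lra.
(* The mean value theorem with a compactness bound on the derivative works on [[0, 1]]. The
   retraction [cl] is 1-Lipschitz and leaves the bump unchanged, since the bump vanishes at both
   endpoints and beyond. *)
pose cl (x : R) := Num.max 0 (Num.min 1 x).
have cl01 x : cl x \in `[0, 1].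
  by rewrite in_itv/= /cl le_max lexx/= ge_max ge_min lexx ler01.
have bcl x : bumpf (cl x) = bumpf x.
  rewrite /cl; case: (leP 1 x) => [x1|x1].
    by rewrite (max_idPr ler01) !bump_eq0//; right.
  case: (leP 0 x) => [//|x0]; rewrite !bump_eq0//; left => //; exact: ltW.
have dcl x y : `|cl x - cl y| <= `|x - y|.
  rewrite /cl; case: (leP 1 x) => ?; case: (leP 1 y) => ?;
  rewrite ?(max_idPr ler01); repeat (case: (leP 0 _) => ?);
  rewrite ?ler_norml; have := ler_norm (x - y); have := ler_norm (y - x); rewrite (distrC y x); lra.
move=> x y; rewrite -(bcl x) -(bcl y).
apply: (le_trans (lip01 _ _ (cl01 x) (cl01 y))).
apply: (@le_trans _ _ (K2 * `|x - y|)); first exact: ler_wpM2l.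
by rewrite ler_wpM2r//; lra.
Qed.

(* The tensor products [f(t) g(x)] of smooth functions are the only test
   functions inserted into the entropy inequality. *)
Lemma smooth2_tensor (f g : R -> R) : smooth f -> smooth g ->
  smooth2 (fun t x => f t * g x).
Proof.
move=> [D [D0 dD]] [E [E0 dE]].
have H s : iter_pd s (fun t x => f t * g x) =
    fun t x => D (count id s) t * E (count (fun b => ~~ b) s) x.
  elim: s => [|b s ih] /=; first by rewrite D0 E0.
  rewrite ih; case: b => /=; rewrite ?add0n ?add1n; apply/funext => t; apply/funext => x.
    rewrite /pdt derive1E.
    have h : is_derive t (1:R) (fun s0 => D (count id s) s0 * E (count (fun b => ~~ b) s) x)
       (D (count id s).+1 t * E (count (fun b => ~~ b) s) x).
      have := dD (count id s) t => ?; apply: is_derive_eq.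
      by rewrite /GRing.scale /= mulr0 add0r mulrC.
    exact: derive_val.
  rewrite /pdx derive1E.
  have h : is_derive x (1:R) (fun s0 => D (count id s) t * E (count (fun b => ~~ b) s) s0)
     (D (count id s) t * E (count (fun b => ~~ b) s).+1 x).
    have := dE (count (fun b => ~~ b) s) x => ?; exact: is_deriveZ.
  exact: derive_val.
move=> s; rewrite H; split.
  move=> t x; split.
    by have := dD (count id s) t => ?; exact: ex_derive.
  by have := dE (count (fun b => ~~ b) s) x => ?; exact: ex_derive.
move=> [t x] /=; apply: (@cvgM _ _ _ _ (fun z : R * R => D _ z.1) (fun z : R * R => E _ z.2)).
  apply: (@cvg_comp _ _ _ fst (D (count id s))); first exact: cvg_fst.
  exact: (is_derive1_continuous (dD (count id s))).
apply: (@cvg_comp _ _ _ snd (E (count (fun b => ~~ b) s))); first exact: cvg_snd.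
exact: (is_derive1_continuous (dE _)).
Qed.

End smooth_step.

Section epsilon_delta.
Context (R : realType).

Lemma continuous_epsilon (f : R -> R) (s : R) :
  (forall e : R, 0 < e -> exists2 d : R, 0 < d &
     forall t, `|t - s| < d -> `|f t - f s| <= e) -> {for s, continuous f}.
Proof.
move=> H; apply/cvgrPdist_le => e e0; have [d d0 dP] := H e e0.
near=> t; rewrite distrC; apply: dP; rewrite distrC.
by near: t; apply: cvgr_dist_lt => //; exact: cvg_id.
Unshelve. all: by end_near. Qed.

Lemma epsilon_continuous (f : R -> R) (s e : R) : {for s, continuous f} -> 0 < e ->
  exists2 d : R, 0 < d & forall t, `|t - s| < d -> `|f t - f s| <= e.
Proof.
move=> cf e0; have /cvgrPdist_le/(_ e e0)[d /= d0 dP] := cf.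
by exists d => // t td; rewrite distrC; apply: dP; rewrite /= distrC.
Qed.

End epsilon_delta.

(** * Square-integrable functions on the unit interval *)

Section square_integrable.
Context (R : realType).
Notation RR := (measurableTypeR R).
Notation leb := (@lebesgue_measure R).
Notation D01 := (`]0%R, 1%R[%classic : set RR).

Definition L2 (f : R -> R) : Prop := measurable_fun D01 f /\
  leb.-integrable D01 (EFin \o (fun m => f m ^+ 2)).

Lemma bounded_D01_integrable (f : R -> R) (C : R) : measurable_fun D01 f ->
  (forall m, 0 < m < 1 -> `|f m| <= C) -> leb.-integrable D01 (EFin \o f).
Proof.
move=> mf fC; apply: (@bounded_integrable _ _ _ leb _ _ C) => //.
exact: leb_D01_lty.
Qed.

Lemma D01_cst_integrable (c : R) : leb.-integrable D01 (EFin \o (cst c)).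
Proof. by apply: (@bounded_D01_integrable _ `|c|). Qed.

Lemma primitive01_cst1 (z : R) : 0 <= z <= 1 -> primitive01 (cst 1) z = z.
Proof.
move=> z01; rewrite primitive01E//; last exact: D01_cst_integrable.
have l : leb `]0, z[%classic = z%:E.
  rewrite lebesgue_measure_itv/= lte_fin; case: ifPn; first by rewrite oppr0 adde0.
  by rewrite -leNgt => h; congr (_%:E); lra.
by rewrite Rintegral_cst// [X in fine X]l mul1r.
Qed.

Lemma Rintegral_D01_cst (c : R) : \int[leb]_(m in D01) cst c m = c.
Proof.
rewrite Rintegral_cst; last exact: mD01.
by rewrite [X in fine X]leb_D01 /= mulr1.
Qed.

Lemma L2_bounded (f : R -> R) (C : R) : measurable_fun D01 f ->
  (forall m, 0 < m < 1 -> `|f m| <= C) -> L2 f.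
Proof.
move=> mf fC; split=> //; apply: (@bounded_D01_integrable _ (C ^+ 2)).
  exact: measurable_funX.
move=> m m01; rewrite normrX ler_sqr ?nnegrE//; first exact: fC.
exact: le_trans (fC m m01).
Qed.

Lemma L2_cst (c : R) : L2 (cst c).
Proof. by apply: (@L2_bounded _ `|c|). Qed.

Lemma L2_mul (f g : R -> R) : L2 f -> L2 g ->
  leb.-integrable D01 (EFin \o (fun m => f m * g m)).
Proof.
move=> [mf f2] [mg g2].
apply: (dominated_integrable _ _ (RintegrableD _ f2 g2)) => //.
  exact: measurable_funM.
move=> m _; rewrite normrM; have := sqr_ge0 (`|f m| - `|g m|); rewrite -[f m ^+ 2]real_normK ?num_real// -[g m ^+ 2]real_normK ?num_real//.
have : 0 <= `|f m| * `|g m| by rewrite mulr_ge0.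
nra.
Qed.

Lemma L2_integrable (f : R -> R) : L2 f -> leb.-integrable D01 (EFin \o f).
Proof.
move=> hf; have := L2_mul hf (L2_cst 1).
by apply: eq_integrable => // m _ /=; rewrite mulr1.
Qed.

Lemma L2_mul_bounded (f h : R -> R) (C : R) : L2 f -> measurable_fun D01 h ->
  (forall m, 0 < m < 1 -> `|h m| <= C) -> L2 (fun m => f m * h m).
Proof.
move=> [mf f2] mh hC; split; first exact: measurable_funM.
apply: (dominated_integrable _ _ (RintegrableZl (C ^+ 2) _ f2)) => //.
  by apply: measurable_funX; exact: measurable_funM.
move=> m; rewrite D01E => m01.
rewrite ger0_norm ?sqr_ge0// exprMn mulrC ler_wpM2r ?sqr_ge0//.
have h1 := hC m m01; have h0 := le_trans (normr_ge0 _) h1.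
by rewrite -real_normK ?num_real// ler_sqr.
Qed.

Lemma L2Z (c : R) (f : R -> R) : L2 f -> L2 (fun m => c * f m).
Proof.
move=> hf; have := @L2_mul_bounded f (cst c) `|c| hf (measurable_cst _) (fun m _ => lexx _).
by congr L2; apply/funext => m; rewrite mulrC.
Qed.

Lemma L2D (f g : R -> R) : L2 f -> L2 g -> L2 (fun m => f m + g m).
Proof.
move=> hf hg; split; first by apply: measurable_funD; [case: hf|case: hg].
have h := RintegrableD (@mD01 R) (RintegrableD (@mD01 R) hf.2 hg.2) (RintegrableZl 2 (@mD01 R) (L2_mul hf hg)).
by apply: eq_integrable h => // m _; rewrite /= sqrrD; congr (_%:E); ring.
Qed.

Lemma L2_sum (n : nat) (f : 'I_n -> R -> R) : (forall i, L2 (f i)) ->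
  L2 (fun m => \sum_(i < n) f i m).
Proof.
elim: n f => [|n ih] f hf.
  by rewrite (_ : (fun _ => _) = cst 0); [exact: L2_cst|apply/funext => m; rewrite big_ord0].
rewrite (_ : (fun _ => _) = (fun m => \sum_(i < n) f (widen_ord (leqnSn n) i) m + f ord_max m)).
  by apply: L2D => //; apply: ih => i; exact: hf.
by apply/funext => m; rewrite big_ord_recr.
Qed.

(* AM-GM instead of Cauchy-Schwarz *)
Lemma L2_young (k : R) (f g : R -> R) : 0 < k -> L2 f -> L2 g ->
  \int[leb]_(m in D01) `|f m * g m| <=
  k * \int[leb]_(m in D01) (f m ^+ 2) + k^-1 * \int[leb]_(m in D01) (g m ^+ 2).
Proof.
move=> k0 hf hg; have mD := @mD01 R.
rewrite -(RintegralZl _ mD hf.2) -(RintegralZl _ mD hg.2) -RintegralD//; last 2 first.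
- exact: RintegrableZl hf.2.
- exact: RintegrableZl hg.2.
apply: le_Rintegral => //.
- exact: integrable_norm (L2_mul hf hg).
- by apply: RintegrableD => //; apply: RintegrableZl => //; [exact: hf.2|exact: hg.2].
move=> m _; rewrite normrM -[f m ^+ 2]real_normK ?num_real// -[g m ^+ 2]real_normK ?num_real//.
move: (normr_ge0 (f m)) (normr_ge0 (g m)); move: (`|f m|) (`|g m|) => a c a0 c0.
have := sqr_ge0 (k * a - c); rewrite -(pmulr_rge0 _ (_ : 0 < k^-1)) ?invr_gt0//.
have -> : k^-1 * (k * a - c) ^+ 2 = k * a ^+ 2 + k^-1 * c ^+ 2 - 2 * (a * c).
  by field; rewrite gt_eqF.
have : 0 <= a * c by rewrite mulr_ge0.
lra.
Qed.

End square_integrable.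

(** * Continuity in time of truncated inverses *)

Section clip_continuity.
Context (R : realType).
Notation RR := (measurableTypeR R).
Notation leb := (@lebesgue_measure R).
Notation D01 := (`]0%R, 1%R[%classic : set RR).

Definition clip_dist_int (r : R) (X Y : R -> R) : R :=
  \int[leb]_(m in D01) `|clip r (X m) - clip r (Y m)|.

Lemma clip_integrable (r : R) (X Y : R -> R) : 0 <= r ->
  measurable_fun D01 X -> measurable_fun D01 Y ->
  leb.-integrable D01 (EFin \o (fun m => `|clip r (X m) - clip r (Y m)|)).
Proof.
move=> r0 mX mY; apply: (@bounded_D01_integrable _ _ (2 * r)).
  apply: measurableT_comp => //; apply: measurable_funB; exact: clip_measurable.
move=> m _; rewrite normr_id ler_norml.
by have := clip_bnd (X m) r0; have := clip_bnd (Y m) r0; lra.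
Qed.

(** The square of [h (X m) - h (Y m)] is bounded by [2 C] for one factor and by the Lipschitz
    estimate for the other, so first-power control of the truncated distance suffices against a
    square-integrable weight. The free parameter [k] is chosen small before that distance. *)
Lemma clip_fun_dist (r L C : R) (h X Y f : R -> R) (k : R) : 0 <= r -> 0 < k ->
  measurable_fun D01 X -> measurable_fun D01 Y -> L2 f -> continuous h ->
  0 <= L -> (forall x, `|h x| <= C) ->
  (forall x y, `|h x - h y| <= L * `|clip r x - clip r y|) ->
  `|\int[leb]_(m in D01) (f m * h (X m)) - \int[leb]_(m in D01) (f m * h (Y m))| <=
  k * \int[leb]_(m in D01) (f m ^+ 2) + k^-1 * (2 * C * L * clip_dist_int r X Y).
Proof.
move=> r0 k0 mX mY hf ch L0 hC hL.
have mD := @mD01 R.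
have mh := continuous_measurable_fun ch.
have hmX : measurable_fun D01 (fun m => h (X m)) by exact: (measurableT_comp mh).
have hmY : measurable_fun D01 (fun m => h (Y m)) by exact: (measurableT_comp mh).
have LX : L2 (fun m => h (X m)) by exact: L2_bounded.
have LY : L2 (fun m => h (Y m)) by exact: L2_bounded.
have C0 : 0 <= C by exact: le_trans (hC 0).
rewrite -RintegralB//; [|exact: L2_mul..].
apply: (le_trans (le_normr_Rintegral mD (RintegrableB mD (L2_mul hf LX) (L2_mul hf LY)))).
have LXY : L2 (fun m => h (X m) - h (Y m)).
  by have := L2D LX (L2Z (-1) LY); congr L2; apply/funext => m; rewrite mulN1r.
have := L2_young k0 hf LXY.
under eq_Rintegral do rewrite mulrBr.
move=> /le_trans; apply; rewrite lerD2l ler_wpM2l ?invr_ge0 ?(ltW k0)//.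
rewrite /clip_dist_int -(RintegralZl _ mD (clip_integrable r0 mX mY)).
apply: le_Rintegral => //; first exact: LXY.2.
  exact: RintegrableZl (clip_integrable r0 mX mY).
move=> m _; rewrite -real_normK ?num_real// expr2 -mulrA.
apply: ler_pM => //.
by apply: (le_trans (ler_normB _ _)); have := hC (X m); have := hC (Y m); lra.
Qed.

(** The counterpart for inverses of the [L^1_loc] continuity of the distribution functions. *)
Definition clip_continuous (X : R -> R -> R) := forall r s e : R, 0 < r -> 0 < e ->
  exists2 d : R, 0 < d & forall t, `|t - s| < d -> clip_dist_int r (X t) (X s) < e.

Lemma clip_continuous_int (X : R -> R -> R) (f h : R -> R) (r L C : R) :
  0 < r -> 0 <= L -> (forall t, measurable_fun D01 (X t)) -> clip_continuous X ->
  L2 f -> continuous h -> (forall x, `|h x| <= C) ->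
  (forall x y, `|h x - h y| <= L * `|clip r x - clip r y|) ->
  continuous (fun t => \int[leb]_(m in D01) (f m * h (X t m))).
Proof.
move=> r0 L0 mX cX hf ch hC hL s; apply: continuous_epsilon => e e0.
set I2 := \int[leb]_(m in D01) (f m ^+ 2).
have I20 : 0 <= I2 by apply: Rintegral_ge0 => m _; exact: sqr_ge0.
have C0 : 0 <= C by exact: le_trans (hC 0).
(* [k] makes the weight term at most [e / 2], after which [e'] makes the distance term at most
   [e / 2]. The added units avoid division by zero. *)
pose k := e / (2 * (I2 + 1)).
have k0 : 0 < k by rewrite divr_gt0//; lra.
have kI : k * I2 <= e / 2.
  rewrite /k invfM mulrA mulrAC ler_pdivrMr; last lra.
  by rewrite ler_wpM2l//; lra.
pose e' := e * k / (4 * (C * L + 1)).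
have CL0 : 0 <= C * L by rewrite mulr_ge0.
have CL1 : 0 < 4 * (C * L + 1) by lra.
have e'0 : 0 < e' by rewrite divr_gt0// mulr_gt0.
have [d d0 dP] := cX r s e' r0 e'0.
exists d => // t td; rewrite distrC.
have := clip_fun_dist (ltW r0) k0 (mX s) (mX t) hf ch L0 hC hL.
move=> /le_trans; apply.
have cd : clip_dist_int r (X s) (X t) = clip_dist_int r (X t) (X s).
  by apply: eq_Rintegral => m _; rewrite distrC.
have h2 : k^-1 * (2 * C * L * clip_dist_int r (X s) (X t)) <= e / 2.
  rewrite ler_pdivrMl// cd.
  apply: (@le_trans _ _ (2 * (C * L + 1) * e')).
    have cd0 : 0 <= clip_dist_int r (X t) (X s) by apply: Rintegral_ge0.
    have h1 := ltW (dP t td).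
    by apply: ler_pM => //; lra.
  rewrite /e' le_eqVlt; apply/orP; left; apply/eqP; field.
  by rewrite gt_eqF//; lra.
by apply: le_trans (lerD kI h2) _; lra.
Qed.

End clip_continuity.

(** * From the weak form in time to increments *)

Section du_bois_reymond.
Context (R : realType).
Notation RR := (measurableTypeR R).
Notation leb := (@lebesgue_measure R).

(** The weight has total mass 1 and lives on [[s, s + d]], to the right of [s]: it is an approximate
    identity whose support stays inside the open time interval. *)
Lemma bump_average (c : R -> R) (s T : R) : continuous c -> 0 < s < T ->
  forall e : R, 0 < e -> exists2 d0 : R, 0 < d0 & forall d, 0 < d < d0 ->
  s + d < T /\
  `|\int[leb]_(t in `[0, T]) (d^-1 * bumpf ((t - s) / d) * c t) - c s| <= e.
Proof.
move=> cc /andP[s0 sT] e e0.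
have [d1 d10 dP] := epsilon_continuous (cc s) e0.
exists (Num.min d1 (T - s)); first by rewrite lt_min d10 subr_gt0.
move=> d /andP[dgt0]; rewrite lt_min => /andP[dd1 dT].
have dn : d != 0 by rewrite gt_eqF.
have T0 : 0 <= T by lra.
split; first lra.
pose k (t : R) := d^-1 * bumpf ((t - s) / d).
have cb := smooth_continuous (@bump_smooth R).
have aff (t : R) : d^-1 * t + - (s / d) = (t - s) / d by field.
have dk (t : R) : is_derive t (1:R) (fun t => stepf ((t - s) / d)) (k t).
  have := @is_derive_affine R (@stepf R) d^-1 (- (s / d)) t _ (step_derive _).
  rewrite aff; apply: is_derive_ext => y; by rewrite aff.
have ck : continuous k.
  have [b' [_ db]] := smooth_derive (@bump_smooth R).
  apply: (@is_derive1_continuous R _ (fun t => d^-1 * (d^-1 * b' ((t - s) / d)))) => t.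
  apply: is_derive_cmul.
  have := @is_derive_affine R (@bumpf R) d^-1 (- (s / d)) t _ (db _).
  rewrite aff; apply: is_derive_ext => y; by rewrite aff.
have ik : leb.-integrable `[0, T] (EFin \o k) by exact: continuous_itv_integrable.
have ikc : leb.-integrable `[0, T] (EFin \o (fun t => k t * c t)).
  by apply: continuous_itv_integrable => t; apply: cvgM; [exact: ck|exact: cc].
have mT : measurable (`[0, T] : set RR) by exact: measurable_itv.
have k1 : \int[leb]_(t in `[0, T]) k t = 1.
  rewrite (is_derive_FTC2 T0 ck dk) step_ge1 ?step_le0 ?subr0//.
    by rewrite pmulr_lle0 ?invr_gt0//; lra.
  by rewrite ler_pdivlMr//; lra.
have -> : \int[leb]_(t in `[0, T]) (d^-1 * bumpf ((t - s) / d) * c t) - c s =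
   \int[leb]_(t in `[0, T]) (k t * (c t - c s)).
  under [RHS]eq_Rintegral do rewrite mulrBr.
  rewrite RintegralB//; last exact: RintegrableZr.
  by rewrite [X in _ = _ - X]RintegralZr// k1 mul1r.
have ikcc : leb.-integrable `[0, T] (EFin \o (fun t => k t * (c t - c s))).
  by apply: continuous_itv_integrable => t; apply: cvgM; [exact: ck|apply: cvgB; [exact: cc|exact: cvg_cst]].
apply: (le_trans (le_normr_Rintegral mT ikcc)).
have -> : e = \int[leb]_(t in `[0, T]) (k t * e) by rewrite RintegralZr// k1 mul1r.
apply: le_Rintegral => //; [exact: integrable_norm|exact: RintegrableZr|].
move=> t _; have k0 : 0 <= k t by rewrite mulr_ge0 ?bump_ge0// invr_ge0 ltW.
rewrite normrM (ger0_norm k0).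
have [td|td] := ltP `|t - s| d1; first by rewrite ler_wpM2l// dP.
rewrite /k bump_eq0 ?mulr0 ?mul0r//.
move: td; rewrite ler_normr => /orP[h|h].
  by right; rewrite ler_pdivlMr//; lra.
by left; rewrite pmulr_lle0 ?invr_gt0//; lra.
Qed.

(** Subtracting from [a] a primitive of [j] leaves a function [c] that integrates to zero against
    every admissible [chi']. Taking for [chi'] an approximate Dirac mass at [s] minus one at [t]
    gives [c s = c t]. Only nonnegative [chi] are required because the entropy inequality accepts
    only these. *)
Lemma du_bois_reymond (a j : R -> R) (T : R) : 0 < T -> continuous a -> continuous j ->
  (forall chi chi' : R -> R, smooth chi -> (forall t, is_derive t (1:R) chi (chi' t)) ->
     continuous chi' -> (forall t, 0 <= chi t) ->
     (exists u w : R, [/\ 0 < u, w < T & forall t, t <= u \/ w <= t -> chi t = 0]) ->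
     \int[leb]_(t in `[0, T]) (chi' t * a t + chi t * j t) = 0) ->
  forall s t : R, 0 < s -> s <= t -> t < T -> a t - a s = \int[leb]_(r in `[s, t]) j r.
Proof.
move=> T0 ca cj H; move=> s t s0; rewrite le_eqVlt => /predU1P[<-|st] tT.
  by rewrite subrr set_itv1 Rintegral_set1.
have mT : measurable (`[0, T] : set RR) by exact: measurable_itv.
pose Jp (x : R) := \int[leb]_(r in `[-1, x]) j r.
have dJ (x : R) : -1 < x -> is_derive x (1:R) Jp (j x).
  move=> x1; have x2 : x < x + 1 by lra.
  have i1 := @continuous_itv_integrable R j (-1) (x + 1) cj.
  have [dF eF] := continuous_FTC1_closed x2 i1 x1 (cj x).
  by apply: DeriveDef; [exact: dF|rewrite -derive1E; exact: eF].
(* The primitive [Jp] is known to be differentiable only beyond -1; freezing the difference for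
   negative times gives continuity on the whole line, as [bump_average] demands. *)
have [c [cc cE]] : exists c : R -> R, continuous c /\ forall x, 0 <= x -> c x = a x - Jp x.
  exists (fun x => a (Num.max 0 x) - Jp (Num.max 0 x)); split; last first.
    by move=> x x0; rewrite (max_idPr x0).
  have cm : continuous (fun x : R => Num.max 0 x).
    move=> x; apply: continuous_epsilon => e e0; exists e => // y yx.
    apply: le_trans (ltW yx); rewrite /Num.max; case: ifPn; case: ifPn; rewrite -?leNgt => *;
    rewrite ?subrr ?normr0// ler_norml; have := ler_norm (y - x); have := ler_norm (x - y); rewrite (distrC x y); lra.
  move=> x; apply: cvgB; apply: (continuous_comp (g := fun y => _ y)) => //; try exact: cm.
    exact: ca.
  have h : -1 < Num.max 0 x by rewrite lt_max ltrN10.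
  by apply/differentiable_continuous/derivable1_diffP; case: (dJ _ h).
suff : c s = c t.
  rewrite !cE; [|lra..].
  have -> : Jp t = Jp s + \int[leb]_(r in `[s, t]) j r; last lra.
  have i1 := @continuous_itv_integrable R j (-1) t cj.
  have := Rintegral_itvB i1 (_ : (BLeft (-1) <= BRight s)%O) (_ : (BRight s <= BRight t)%O).
  rewrite !bnd_simp => /(_ ltac:(lra) ltac:(lra)).
  rewrite Rintegral_itv_obnd_cbnd; first by rewrite -/(Jp t) -/(Jp s); lra.
  by apply: integrableS i1 => //; apply: subset_itv; rewrite bnd_simp//; lra.
apply/eqP; rewrite -subr_eq0 -normr_le0; apply/ler_addgt0Pr => e e0.
have e20 : 0 < e / 2 by lra.
have s0T : 0 < s < T by lra.
have t0T : 0 < t < T by lra.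
have [d1 d10 dP1] := bump_average cc s0T e20.
have [d2 d20 dP2] := bump_average cc t0T e20.
pose d := Num.min d1 d2 / 2.
have m0 : 0 < Num.min d1 d2 by rewrite lt_min d10.
have [m1 m2] : Num.min d1 d2 <= d1 /\ Num.min d1 d2 <= d2 by rewrite !ge_min !lexx orbT.
have d0 : 0 < d by rewrite /d; lra.
have dn : d != 0 by rewrite gt_eqF.
have dd1 : 0 < d < d1 by rewrite d0/= /d; lra.
have dd2 : 0 < d < d2 by rewrite d0/= /d; lra.
have [_ h1] := dP1 d dd1.
have [tdT h2] := dP2 d dd2.
pose k (s t : R) := d^-1 * bumpf ((t - s) / d).
pose S (s t : R) := stepf ((t - s) / d).
have aff (u x : R) : d^-1 * x + - (u / d) = (x - u) / d by field.
have dk (u x : R) : is_derive x (1:R) (S u) (k u x).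
  have := @is_derive_affine R (@stepf R) d^-1 (- (u / d)) x _ (step_derive _).
  rewrite aff; apply: is_derive_ext => y; by rewrite aff.
have sS u : smooth (S u).
  have := smooth_affine d^-1 (- (u / d)) 1 (@step_smooth R).
  by congr smooth; apply/funext => x; rewrite mul1r aff.
have ck u : continuous (k u).
  have [k' [sk' dk']] := smooth_derive (sS u).
  have -> : k u = k'; last exact: smooth_continuous sk'.
  by apply/funext => x; rewrite -(@derive_val _ _ _ _ _ _ _ (dk u x)); apply: derive_val.
(* A smooth plateau: it rises just after [s] and falls just after [t]. It is nonnegative since the
   step is nondecreasing and [s < t]. *)
pose chi (x : R) := S s x - S t x; pose chi' (x : R) := k s x - k t x.
have dchi (x : R) : is_derive x (1:R) chi (chi' x) by have := dk s x; have := dk t x => ? ?; exact: is_deriveB.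
have cchi' : continuous chi' by move=> x; apply: cvgB; exact: ck.
have schi : smooth chi by exact: smoothB.
have chi0 x : 0 <= chi x.
  rewrite subr_ge0 /S; apply: step_nd; rewrite ler_wpM2r ?invr_ge0 ?(ltW d0)//; lra.
have schi0 x : x <= s \/ t + d <= x -> chi x = 0.
  move=> [xs|tx]; rewrite /chi /S.
    by rewrite !step_le0 ?subr0// pmulr_lle0 ?invr_gt0//; lra.
  by rewrite !step_ge1 ?subrr// ler_pdivlMr//; lra.
have := H chi chi' schi dchi cchi' chi0 (ex_intro _ s (ex_intro _ (t + d) (And3 s0 tdT schi0))).
have cchi := smooth_continuous schi.
have i1 : leb.-integrable `[0, T] (EFin \o (fun x => chi' x * a x)).
  by apply: continuous_itv_integrable => x; apply: cvgM; [exact: cchi'|exact: ca].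
have i2 : leb.-integrable `[0, T] (EFin \o (fun x => chi x * j x)).
  by apply: continuous_itv_integrable => x; apply: cvgM; [exact: cchi|exact: cj].
rewrite RintegralD//.
have LR (f g : R -> R) : (forall x, is_derive x (1:R) f (g x)) -> derivable_oo_LRcontinuous f 0 T.
  move=> df; have cf := is_derive1_continuous df.
  split; first by move=> x _; case: (df x).
    by apply: cvg_at_right_filter; exact: cf.
  by apply: cvg_at_left_filter; exact: cf.
have := @Rintegration_by_parts R chi Jp chi' j 0 T T0 (continuous_subspaceT cchi') (LR _ _ dchi).
have Jp_LR : derivable_oo_LRcontinuous Jp 0 T.
  have cJ (x : R) : -1 < x -> {for x, continuous Jp}.
    by move=> x1; apply/differentiable_continuous/derivable1_diffP; case: (dJ _ x1).
  split.
  - by move=> x; rewrite in_itv/= => /andP[x0 _]; case: (dJ x ltac:(lra)).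
  - by apply: cvg_at_right_filter; apply: cJ; lra.
  - by apply: cvg_at_left_filter; apply: cJ; lra.
have e1 : {in `]0, T[, chi^`()%classic =1 chi'}.
  by move=> x _; rewrite derive1E; apply: derive_val.
have e2 : {in `]0, T[, Jp^`()%classic =1 j}.
  move=> x; rewrite in_itv/= => /andP[x0 _]; rewrite derive1E; have := dJ x ltac:(lra) => ?; exact: derive_val.
move=> /(_ e1 (continuous_subspaceT cj) Jp_LR e2) ->.
rewrite (schi0 T); last by right; lra.
rewrite (schi0 0); last by left; lra.
rewrite !mul0r subrr sub0r => E.
have cE' x : `[0, T]%classic x -> chi' x * c x = chi' x * a x - chi' x * Jp x.
  by rewrite /= in_itv/= => /andP[x0 _]; rewrite cE// mulrBr.
have ic : leb.-integrable `[0, T] (EFin \o (fun x => chi' x * c x)).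
  by apply: continuous_itv_integrable => x; apply: cvgM; [exact: cchi'|exact: cc].
have i3 : leb.-integrable `[0, T] (EFin \o (fun x => chi' x * Jp x)).
  have := RintegrableB mT i1 ic.
  apply: eq_integrable => // x /set_mem xT /=; rewrite cE'//; congr (_%:E); ring.
have E2 : \int[leb]_(x in `[0, T]) (chi' x * c x) = 0.
  transitivity (\int[leb]_(x in `[0, T]) (chi' x * a x - chi' x * Jp x)).
    by apply: eq_Rintegral => x /set_mem; exact: cE'.
  by rewrite RintegralB//; lra.
have ikc u : leb.-integrable `[0, T] (EFin \o (fun x => k u x * c x)).
  by apply: continuous_itv_integrable => x; apply: cvgM; [exact: ck|exact: cc].
have E3 : \int[leb]_(x in `[0, T]) (k s x * c x) = \int[leb]_(x in `[0, T]) (k t x * c x).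
  have : \int[leb]_(x in `[0, T]) (k s x * c x - k t x * c x) = 0.
    by rewrite -[RHS]E2; apply: eq_Rintegral => x _; rewrite -mulrBl.
  by rewrite (RintegralB mT (ikc s) (ikc t)) => /eqP; rewrite subr_eq0 => /eqP.
have h1' : `|\int[leb]_(x in `[0, T]) (k s x * c x) - c s| <= e / 2 := h1.
have h2' : `|\int[leb]_(x in `[0, T]) (k t x * c x) - c t| <= e / 2 := h2.
rewrite add0r; move: h1' h2'; rewrite E3; move: (\int[leb]_(x in _) _) => I.
move=> h1' h2'; have := ler_normB (I - c t) (I - c s).
have -> : I - c t - (I - c s) = c s - c t by ring.
by move=> /le_trans; apply; rewrite [leRHS]splitr lerD.
Qed.

End du_bois_reymond.

(** * The mollification kernel in space *)

Section mollifier_kernel.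
Context (R : realType).

(** One-sided: as a function of [y] it vanishes outside []x - e, x[]. Correspondingly [stepk e x y]
    is 0 for [y >= x] and 1 for [y <= x - e], a smoothing of the indicator of [y <= x] from
    below. *)
Definition kern (e x y : R) : R := e^-1 * bumpf ((x - y) / e).
Definition stepk (e x y : R) : R := stepf ((x - y) / e).

Lemma kern_ge0 (e x y : R) : 0 < e -> 0 <= kern e x y.
Proof. by move=> e0; rewrite mulr_ge0 ?bump_ge0// invr_ge0 ltW. Qed.

Lemma kern_eq0 (e x y : R) : 0 < e -> x <= y \/ y <= x - e -> kern e x y = 0.
Proof.
move=> e0 [xy|yx]; rewrite /kern bump_eq0 ?mulr0//.
  by left; rewrite pmulr_lle0 ?invr_gt0//; lra.
by right; rewrite ler_pdivlMr//; lra.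
Qed.

Lemma stepk_eq0 (e x y : R) : 0 < e -> x <= y -> stepk e x y = 0.
Proof. by move=> e0 xy; rewrite /stepk step_le0// pmulr_lle0 ?invr_gt0//; lra. Qed.

Lemma stepk_eq1 (e x y : R) : 0 < e -> y <= x - e -> stepk e x y = 1.
Proof. by move=> e0 xy; rewrite /stepk step_ge1// ler_pdivlMr//; lra. Qed.

Lemma stepk_itv (e x y : R) : 0 <= stepk e x y <= 1. Proof. exact: step_itv. Qed.

Lemma kern_affine (e x y : R) : 0 < e -> (- e^-1) * y + x / e = (x - y) / e.
Proof. by move=> e0; field; rewrite gt_eqF. Qed.

Lemma kern_smooth (e x : R) : 0 < e -> smooth (kern e x).
Proof.
move=> e0; have := smooth_affine (- e^-1) (x / e) e^-1 (@bump_smooth R).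
by congr smooth; apply/funext => y; rewrite kern_affine.
Qed.

Lemma stepk_derive1 (e x y : R) : 0 < e -> is_derive y (1:R) (stepk e x) (- kern e x y).
Proof.
move=> e0; have := @is_derive_affine R (@stepf R) (- e^-1) (x / e) y _ (step_derive _).
rewrite kern_affine// mulNr; apply: is_derive_ext => z; by rewrite kern_affine.
Qed.

Lemma stepk_derive2 (e x y : R) : 0 < e -> is_derive x (1:R) (stepk e ^~ y) (kern e x y).
Proof.
move=> e0; have E (z : R) : e^-1 * z + (- (y / e)) = (z - y) / e by field; rewrite gt_eqF.
have := @is_derive_affine R (@stepf R) e^-1 (- (y / e)) x _ (step_derive _).
by rewrite E; apply: is_derive_ext => z; rewrite E.
Qed.

Lemma kern_lipschitz : exists2 K : R, 0 < K & forall e x x' y y' : R, 0 < e ->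
  kern e x y <= K / e /\
  `|kern e x y - kern e x' y'| <= K / e ^+ 2 * `|(x - y) - (x' - y')|.
Proof.
have [K K0 [bK lK]] := bump_lipschitz R.
exists K => // e x x' y y' e0; split.
  by rewrite /kern mulrC ler_wpM2r ?invr_ge0 ?(ltW e0)//.
rewrite /kern -mulrBr normrM (gtr0_norm (_ : 0 < e^-1)) ?invr_gt0//.
apply: (@le_trans _ _ (e^-1 * (K * `|(x - y) / e - (x' - y') / e|))).
  by rewrite ler_wpM2l// invr_ge0 ltW.
rewrite -mulrBl normrM (gtr0_norm (_ : 0 < e^-1)) ?invr_gt0//.
rewrite le_eqVlt; apply/orP; left; apply/eqP; field.
by rewrite gt_eqF.
Qed.

Lemma kern_continuous (e x : R) : 0 < e -> continuous (kern e x).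
Proof. by move=> e0; exact: smooth_continuous (kern_smooth x e0). Qed.

Lemma stepk_continuous (e x : R) : 0 < e -> continuous (stepk e x).
Proof. by move=> e0; exact: is_derive1_continuous (fun y => stepk_derive1 x y e0). Qed.

(** For fixed [x] the kernel only sees positions of modulus at most [|x| + e], so truncation at that
    level is invisible to it. This is how [clip_continuous] applies to integrals of [kern] and
    [stepk]. *)
Lemma kern_clip (e x y : R) : 0 < e -> kern e x (clip (`|x| + e) y) = kern e x y.
Proof.
move=> e0; have := ler_norm x; have := ler_norm (- x); rewrite normrN => nx px.
have [yr|yr] := leP (`|x| + e) y.
  by rewrite /clip (min_idPl yr) (max_idPr _) ?kern_eq0//; [left|left|]; lra.
have [ry|ry] := leP (- (`|x| + e)) y.
  by rewrite /clip (min_idPr (ltW yr)) (max_idPr ry).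
rewrite /clip (min_idPr (ltW yr)) (max_idPl (ltW ry)) !kern_eq0//; right; lra.
Qed.

Lemma stepk_clip (e x y : R) : 0 < e -> stepk e x (clip (`|x| + e) y) = stepk e x y.
Proof.
move=> e0; have := ler_norm x; have := ler_norm (- x); rewrite normrN => nx px.
have [yr|yr] := leP (`|x| + e) y.
  by rewrite /clip (min_idPl yr) (max_idPr _) ?stepk_eq0//; lra.
have [ry|ry] := leP (- (`|x| + e)) y.
  by rewrite /clip (min_idPr (ltW yr)) (max_idPr ry).
rewrite /clip (min_idPr (ltW yr)) (max_idPl (ltW ry)) !stepk_eq1//; lra.
Qed.

Lemma stepk_lipschitz (e x : R) : 0 < e -> exists2 L : R, 0 <= L & forall y z,
  `|stepk e x y - stepk e x z| <= L * `|y - z|.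
Proof.
move=> e0; have [K K0 KP] := kern_lipschitz.
exists (K / e); first by rewrite divr_ge0// ltW.
move=> y z; wlog yz : y z / y <= z.
  move=> h; have [yz|/ltW zy] := leP y z; first exact: h.
  by rewrite distrC [`|y - z|]distrC; exact: h.
have [c cyz E] := MVT_segment yz (fun w _ => stepk_derive1 x w e0)
  (continuous_subspaceT (@stepk_continuous e x e0)).
rewrite distrC E normrM [`|y - z|]distrC ler_wpM2r// normrN ger0_norm ?kern_ge0//.
by have [] := KP e x x c c e0.
Qed.

End mollifier_kernel.

(** * The weak formulation in Lagrangian coordinates *)

Section weak_formulation.
Context (R : realType).
Notation RR := (measurableTypeR R).
Notation leb := (@lebesgue_measure R).
Notation D01 := (`]0%R, 1%R[%classic : set RR).

Lemma inR_itv (M : R -> R) (x : R) : inR M -> 0 <= M x <= 1.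
Proof.
move=> [Mnd [_ [M0 M1]]]; apply/andP; split; rewrite leNgt; apply/negP => h.
  have [y [_ yP]] : \forall y \near -oo, M x < M y by apply: cvgr_gt M0 _ _.
  have xm : Num.min x (y - 1) <= x by rewrite ge_min lexx.
  have ym : Num.min x (y - 1) < y by rewrite gt_min; apply/orP; right; lra.
  by have := Mnd _ _ xm; have := yP _ ym; lra.
have [y [_ yP]] : \forall y \near +oo, M y < M x by apply: cvgr_lt M1 _ _.
have xm : x <= Num.max x (y + 1) by rewrite le_max lexx.
have ym : y < Num.max x (y + 1) by rewrite lt_max; apply/orP; right; lra.
by have := Mnd _ _ xm; have := yP _ ym; lra.
Qed.

(* Freezing time outside [0, T] makes [Xf] and [Gf] below continuous in time on the
   whole line. *)
Definition clampT (T t : R) : R := Num.max 0 (Num.min t T).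

Lemma clampT_itv T t : 0 <= T -> 0 <= clampT T t <= T.
Proof. by move=> T0; rewrite /clampT le_max lexx/= ge_max ge_min lexx orbT T0. Qed.

Lemma clampT_id T t : 0 <= t <= T -> clampT T t = t.
Proof. by move=> /andP[t0 tT]; rewrite /clampT (min_idPl tT) (max_idPr t0). Qed.

Lemma clampT_dist T t s : `|clampT T t - clampT T s| <= `|t - s|.
Proof.
wlog ts : t s / t <= s.
  move=> h; have [?|/ltW st] := leP t s; first exact: h.
  by rewrite distrC [leRHS]distrC; exact: h.
rewrite distrC [leRHS]distrC [leRHS]ger0_norm ?subr_ge0//.
rewrite /clampT /Num.max /Num.min; repeat case: ifPn; rewrite -?leNgt => *; rewrite ler_norml; lra.
Qed.

Lemma continuous_sum_bigop (n : nat) (f : 'I_n -> R -> R) : (forall i, continuous (f i)) ->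
  continuous (fun t => \sum_(i < n) f i t).
Proof.
move=> cf t; elim: n f cf => [|n ih] f cf.
  rewrite (_ : (fun _ => _) = cst 0); first exact: cvg_cst.
  by apply/funext => s; rewrite big_ord0.
rewrite (_ : (fun _ => _) = (fun s => \sum_(i < n) f (widen_ord (leqnSn n) i) s + f ord_max s)).
  by apply: cvgD; [apply: ih => i; exact: cf|exact: cf].
by apply/funext => s; rewrite big_ord_recr.
Qed.

Lemma inL1_integrable (T : R) (b : R -> R) : 0 <= T -> inL1 T b ->
  leb.-integrable `[0, T] (EFin \o b).
Proof.
move=> T0 [mb ib]; have mb' : measurable_fun `[0, T] b by exact: measurable_fun_itv_cc mb.
apply/integrableP; split; first exact/measurable_EFinP.
rewrite integral_itv_bndoo//.
by apply/measurable_EFinP; apply: measurableT_comp.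
Qed.

Lemma Bi_int (T t : R) (b : nat -> R -> R) (i : nat) : 0 <= t <= T ->
  Bi b i.+1 t = \int[leb]_(s in `[0, t]) b i.+1 s.
Proof. by move=> /andP[t0 _]; rewrite /Bi t0. Qed.

Lemma Bi_continuous (T : R) (b : nat -> R -> R) (i : nat) : 0 <= T ->
  ((0 < i)%N -> inL1 T (b i)) -> continuous (fun t => Bi b i (clampT T t)).
Proof.
case: i => [|i] T0 ib; first by move=> t; exact: cvg_cst.
have := parameterized_integral_continuous T0 (inL1_integrable T0 (ib isT)).
move=> /subspace_continuousP c s; apply: continuous_epsilon => e e0.
have zT := clampT_itv s T0.
have zT' : `[0, T]%classic (clampT T s) by rewrite /= in_itv.
have /cvgrPdist_le/(_ e e0)[d d0 dP] := c _ zT'.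
exists d => // t ts; rewrite distrC.
rewrite (Bi_int _ _ zT) (Bi_int _ _ (clampT_itv t T0)).
apply: dP; last by rewrite /= in_itv/= clampT_itv.
by rewrite /= distrC; apply: le_lt_trans ts; exact: clampT_dist.
Qed.

Context (T : R) (n : nat) (v0 M0 : R -> R) (F b : nat -> R -> R) (M : R -> R -> R).
Hypothesis T0 : 0 < T.
Hypothesis hF : forall i, (i <= n)%N -> L2 (Fi v0 M0 F i).
Hypothesis hb : forall i, (0 < i <= n)%N -> inL1 T (b i).
Hypothesis hM : forall t, 0 <= t <= T -> inR (M t).
Hypothesis ent : entropy_solution T (fluxU n v0 M0 F b) M0 M.

(* [Xf t m] is the position at time [t] of the particle labelled [m], and [Gf t m] is
   the derivative of the flux [U(t, .)] at [m]. *)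
Definition Xf (t : R) : R -> R := ext01 (ginv (M (clampT T t))).
Definition Gf (t m : R) : R := \sum_(i < n.+1) Bi b i (clampT T t) * Fi v0 M0 F i m.

Let hMc t : inR (M (clampT T t)).
Proof. by apply: hM; apply: clampT_itv; exact: ltW. Qed.

Lemma Xf_galois t : galois (M (clampT T t)) (Xf t).
Proof. exact/galois_ext01/inR_ginv_galois/hMc. Qed.

Lemma Xf_measurable t : measurable_fun setT (Xf t).
Proof. by apply: ext01_measurable; apply: galois_measurable (inR_ginv_galois (hMc t)). Qed.

Lemma Xf_measurable01 t : measurable_fun D01 (Xf t).
Proof. exact: galois_measurable (Xf_galois t). Qed.

Lemma Gf_L2 t : L2 (Gf t).
Proof.
have := @L2_sum R n.+1 (fun i m => Bi b i (clampT T t) * Fi v0 M0 F i m).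
by apply => i; apply: L2Z; apply: hF; rewrite -ltnS.
Qed.

Lemma BiT_continuous i : (i <= n)%N -> continuous (fun t => Bi b i (clampT T t)).
Proof. by move=> iN; apply: Bi_continuous => [|i0]; [exact: ltW|apply: hb; rewrite i0]. Qed.

Lemma M_measurable t : 0 <= t <= T -> measurable_fun setT (M t).
Proof. by move=> tT; apply: nondecreasing_measurable => //; exact: (hM tT).1. Qed.

(** [galois_clip_dist] transfers the continuity in [C([0, T]; L^1_loc)] contained in
    [entropy_solution] from [M] to its inverses. *)
Lemma Xf_clip_continuous : clip_continuous Xf.
Proof.
move=> r s e r0 e0; have [_ [_ [Hc _]]] := ent.
have [d [d0 dP]] := Hc r (clampT T s) r0 (clampT_itv s (ltW T0)) e e0.
exists d => // t ts.
have := dP (clampT T t) (clampT_itv t (ltW T0)) (le_lt_trans (clampT_dist T t s) ts).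
rewrite /lint_on => h; rewrite -lte_fin /clip_dist_int -EFin_Rintegral//; last first.
  by apply: clip_integrable; [exact: ltW|exact: Xf_measurable01..].
apply: le_lt_trans h; apply: galois_clip_dist; [exact: ltW|exact: Xf_galois|exact: Xf_galois|..];
by apply: measurable_funTS; apply: M_measurable; apply: clampT_itv; exact: ltW.
Qed.

(** [Gf] is a finite sum of products of a continuous function of time and a fixed square-integrable
    function of the label, so each term falls under [clip_continuous_int]. *)
Lemma Gf_int_continuous (h : R -> R) (r L C : R) :
  0 < r -> 0 <= L -> continuous h -> (forall x, `|h x| <= C) ->
  (forall x y, `|h x - h y| <= L * `|clip r x - clip r y|) ->
  continuous (fun t => \int[leb]_(m in D01) (Gf t m * h (Xf t m))).
Proof.
move=> r0 L0 ch hC hL.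
have mh := continuous_measurable_fun ch.
have LhX t : L2 (fun m => h (Xf t m)).
  by apply: (@L2_bounded _ _ C) => //; apply: (measurableT_comp mh); exact: Xf_measurable01.
have -> : (fun t => \int[leb]_(m in D01) (Gf t m * h (Xf t m))) =
  (fun t => \sum_(i < n.+1) (Bi b i (clampT T t) * \int[leb]_(m in D01) (Fi v0 M0 F i m * h (Xf t m)))).
  apply/funext => t.
  have ii (i : 'I_n.+1) : leb.-integrable D01 (EFin \o (fun m => Fi v0 M0 F i m * h (Xf t m))).
    by apply: L2_mul => //; apply: hF; rewrite -ltnS.
  rewrite /Rintegral; under eq_integral => m _.
    rewrite /Gf mulr_suml -sumEFin; over.
  rewrite integral_sum//; last first.
    move=> i; have := RintegrableZl (Bi b i (clampT T t)) (@mD01 R) (ii i).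
    by apply: eq_integrable => // m _ /=; rewrite mulrA.
  rewrite (eq_bigr (fun i : 'I_n.+1 => (Bi b i (clampT T t) * \int[leb]_(m in D01) (Fi v0 M0 F i m * h (Xf t m)))%:E)) ?sumEFin//.
  move=> i _; rewrite -RintegralZl// -EFin_Rintegral//; last exact: RintegrableZl.
  by apply: eq_integral => m _; rewrite mulrA.
apply: continuous_sum_bigop => i t; have iN : (i <= n)%N by rewrite -ltnS.
apply: cvgM; first exact: BiT_continuous.
exact: (clip_continuous_int r0 L0 Xf_measurable01 Xf_clip_continuous (hF iN) ch hC hL).
Qed.

End weak_formulation.

(** * From the entropy inequality to the mollified equation *)

Section weak_identity.
Context (R : realType).
Notation RR := (measurableTypeR R).
Notation leb := (@lebesgue_measure R).
Notation D01 := (`]0%R, 1%R[%classic : set RR).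

Context (T : R) (n : nat) (v0 M0 : R -> R) (F b : nat -> R -> R) (M : R -> R -> R).
Hypothesis T0 : 0 < T.
Hypothesis hF : forall i, (i <= n)%N -> L2 (Fi v0 M0 F i).
Hypothesis hb : forall i, (0 < i <= n)%N -> inL1 T (b i).
Hypothesis hM : forall t, 0 <= t <= T -> inR (M t).
Hypothesis ent : entropy_solution T (fluxU n v0 M0 F b) M0 M.

Notation X := (Xf T M).
Notation G := (Gf T n v0 M0 F b).

(** The layer-cake formula for the constant density 1, whose primitive is the identity on
    [[0, 1]]. *)
Lemma layer_cake_id (t r : R) (Psi psi : R -> R) : 0 <= t <= T -> 0 <= r ->
  continuous psi -> (forall x, is_derive x (1:R) Psi (psi x)) ->
  (forall x, r <= `|x| -> psi x = 0) ->
  leb.-integrable setT (EFin \o (fun x => M t x * psi x)) /\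
  \int[leb]_x (M t x * psi x) = \int[leb]_(m in D01) (Psi r - Psi (X t m)).
Proof.
move=> tT r0 cpsi dPsi psi0.
have iM := hM tT.
have g : galois (M t) (X t) by rewrite -{1}(clampT_id tT); exact: Xf_galois.
have [i1 i2 e] := layer_cake r0 g (fun x => inR_itv x iM) iM.1 (@D01_cst_integrable R 1) cpsi dPsi psi0.
have E x : primitive01 (cst 1) (M t x) * psi x = M t x * psi x.
  by rewrite primitive01_cst1//; exact: inR_itv.
split; first by apply: eq_integrable i1 => // x _ /=; rewrite E.
transitivity (\int[leb]_x (primitive01 (cst 1) (M t x) * psi x)).
  by apply: eq_Rintegral => x _; rewrite E.
by rewrite e; apply: eq_Rintegral => m _; rewrite mul1r.
Qed.

Lemma layer_cake_flux (t r : R) (psi psi' : R -> R) : 0 <= t <= T -> 0 <= r ->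
  continuous psi' -> (forall x, is_derive x (1:R) psi (psi' x)) -> continuous psi ->
  (forall x, r <= `|x| -> psi x = 0) -> (forall x, r <= `|x| -> psi' x = 0) ->
  leb.-integrable setT (EFin \o (fun x => fluxU n v0 M0 F b t (M t x) * psi' x)) /\
  \int[leb]_x (fluxU n v0 M0 F b t (M t x) * psi' x) = - \int[leb]_(m in D01) (G t m * psi (X t m)).
Proof.
move=> tT r0 cpsi' dpsi cpsi psi0 psi'0.
have iM := hM tT.
have g : galois (M t) (X t) by rewrite -{1}(clampT_id tT); exact: Xf_galois.
have iF (i : 'I_n.+1) : leb.-integrable D01 (EFin \o Fi v0 M0 F i).
  by apply: L2_integrable; apply: hF; rewrite -ltnS.
have LC (i : 'I_n.+1) := layer_cake r0 g (fun x => inR_itv x iM) iM.1 (iF i) cpsi' dpsi psi'0.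
have psir : psi r = 0 by apply: psi0; exact: ler_norm.
have [C CP] : exists C, forall x, `|psi x| <= C.
  have rr : - r <= r by lra.
  have [c _ cP] := EVT_max rr (continuous_subspaceT (fun x => cvg_norm (cpsi x)) : {within `[- r, r], continuous (fun x => `|psi x|)}).
  exists (`|psi c|) => x; have [h|h] := boolP (x \in `[- r, r]); first exact: cP.
  by rewrite psi0 ?normr0//; move: h; rewrite in_itv/= -ler_norml -ltNge => /ltW.
have LpsiX : L2 (fun m => psi (X t m)).
  apply: (@L2_bounded _ _ C) => //; apply: (measurableT_comp (continuous_measurable_fun cpsi)).
  exact: Xf_measurable01.
have iFp (i : 'I_n.+1) : leb.-integrable D01 (EFin \o (fun m => Fi v0 M0 F i m * psi (X t m))).
  by apply: L2_mul => //; apply: hF; rewrite -ltnS.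
have e1 (i : 'I_n.+1) : \int[leb]_x (primitive01 (Fi v0 M0 F i) (M t x) * psi' x) =
    - \int[leb]_(m in D01) (Fi v0 M0 F i m * psi (X t m)).
  have [_ _ ->] := LC i; rewrite psir -[RHS]mulN1r -RintegralZl//.
  by apply: eq_Rintegral => m _; rewrite sub0r mulrN mulN1r.
have E x : fluxU n v0 M0 F b t (M t x) * psi' x =
    \sum_(i < n.+1) (Bi b i t * (primitive01 (Fi v0 M0 F i) (M t x) * psi' x)).
  by rewrite /fluxU mulr_suml; apply: eq_bigr => i _; rewrite mulrA.
have ii (i : 'I_n.+1) : leb.-integrable setT (EFin \o (fun x => Bi b i t * (primitive01 (Fi v0 M0 F i) (M t x) * psi' x))).
  by apply: RintegrableZl => //; case: (LC i).
split.
  have := integrable_sum (@measurableT _ RR) (index_enum 'I_n.+1) (P := xpredT) (fun i _ => ii i).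
  by apply: eq_integrable => // x _ /=; rewrite E -sumEFin.
rewrite /Rintegral; under eq_integral => x _.
  rewrite E -sumEFin; over.
rewrite (integral_sum measurableT ii) /=.
rewrite (eq_bigr (fun i : 'I_n.+1 => (- (Bi b i t * \int[leb]_(m in D01) (Fi v0 M0 F i m * psi (X t m))))%:E)); last first.
  move=> i _; rewrite (@EFin_Rintegral _ _ _ leb) //.
  by rewrite RintegralZl//; [rewrite e1 mulrN|case: (LC i)].
rewrite sumEFin /= sumrN; congr (- _).
under [X in _ = fine X]eq_integral => m _.
  rewrite /Gf mulr_suml -sumEFin; over.
rewrite integral_sum//; last first.
  move=> i; have := RintegrableZl (Bi b i (clampT T t)) (@mD01 R) (iFp i).
  by apply: eq_integrable => // m _ /=; rewrite mulrA.
rewrite [X in _ = fine X](eq_bigr (fun i : 'I_n.+1 => (Bi b i t * \int[leb]_(m in D01) (Fi v0 M0 F i m * psi (X t m)))%:E)); last first.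
  move=> i _; rewrite -RintegralZl// -EFin_Rintegral//; last exact: RintegrableZl.
  by apply: eq_integral => m _; rewrite clampT_id// mulrA.
by rewrite sumEFin.
Qed.

(* Only levels [k < 0] and [k > 1] are inserted: there [|M - k|] and [sgn (M - k)] are
   affine in [M], and the two entropy inequalities sum up to the weak formulation. *)
Lemma entropy_weak (chi chi' psi psi' Psi : R -> R) (r : R) : 0 <= r ->
  smooth chi -> (forall t, is_derive t (1:R) chi (chi' t)) -> continuous chi' ->
  (forall t, 0 <= chi t) ->
  (exists u w : R, [/\ 0 < u, w < T & forall t, t <= u \/ w <= t -> chi t = 0]) ->
  smooth psi -> (forall x, is_derive x (1:R) psi (psi' x)) -> continuous psi' ->
  (forall x, 0 <= psi x) -> (forall x, is_derive x (1:R) Psi (psi x)) ->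
  (forall x, r <= `|x| -> psi x = 0) -> (forall x, r <= `|x| -> psi' x = 0) ->
  let a t := \int[leb]_(m in D01) (Psi r - Psi (X t m)) in
  let j t := - \int[leb]_(m in D01) (G t m * psi (X t m)) in
  continuous a -> continuous j ->
  \int[leb]_(t in `[0, T]) (chi' t * a t + chi t * j t) = 0.
Proof.
move=> r0 schi dchi cchi' chi0 [u [w [u0 wT chi_supp]]] spsi dpsi cpsi' psi_ge0 dPsi psi0 psi'0 a j ca cj.
have cchi := smooth_continuous schi; have cpsi := smooth_continuous spsi.
set I := \int[leb]_(t in `[0, T]) _.
have [_ [_ [_ [D [dD entD]]]]] := ent.
pose phi (t x : R) := chi t * psi x.
have s2 : smooth2 phi by exact: smooth2_tensor.
have tphi : test0T T phi.
  split=> //; exists w, (Num.max r T); split => // t x.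
  move=> [wt|[rt|rx]]; rewrite /phi.
  - by rewrite chi_supp ?mul0r//; right.
  - move: rt; rewrite ge_max => /andP[_ Tt].
    rewrite chi_supp ?mul0r//; have [t0|t0] := leP 0 t; last by left; lra.
    by right; rewrite (ger0_norm t0) in Tt; lra.
  - by move: rx; rewrite ge_max => /andP[rx _]; rewrite psi0 ?mulr0.
have phi_ge0 t x : 0 <= phi t x by rewrite mulr_ge0.
have pt t x : pdt phi t x = chi' t * psi x.
  rewrite /pdt derive1E; have h : is_derive t (1:R) (fun s => phi s x) (chi' t * psi x).
    have h := dchi t; apply: is_derive_eq; by rewrite /GRing.scale /= mulr0 add0r mulrC.
  exact: derive_val.
have px t x : pdx phi t x = chi t * psi' x.
  rewrite /pdx derive1E; have h : is_derive x (1:R) (fun y => phi t y) (chi t * psi' x).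
    by have h := dpsi x; exact: is_derive_cmul.
  exact: derive_val.
have itv01 : `]0, T[%classic `<=` (`[0, T]%classic : set R).
  by move=> t /=; rewrite !in_itv/=; lra.
have ccj : continuous (fun t => chi' t * a t + chi t * j t).
  by move=> t; apply: cvgD; apply: cvgM; [exact: cchi'|exact: ca|exact: cchi|exact: cj].
have psirr : psi r = 0 by apply: psi0; exact: ler_norm.
have psirN : psi (- r) = 0 by apply: psi0; rewrite normrN; exact: ler_norm.
have mI : measurable (`[- r, r] : set RR) by exact: measurable_itv.
have suppI (f : R -> R) : (forall x, r <= `|x| -> f x = 0) -> f = f \_ `[- r, r].
  move=> f0; apply/funext => x; rewrite patchE mem_setE in_itv/= -ler_norml; case: ifPn => //.
  by rewrite -ltNge => /ltW/f0.
have ipsi : leb.-integrable setT (EFin \o psi).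
  by rewrite (suppI _ psi0) -restrict_EFin; apply/(integrable_mkcond _ _).1 => //; exact: continuous_itv_integrable.
have ipsi' : leb.-integrable setT (EFin \o psi').
  by rewrite (suppI _ psi'0) -restrict_EFin; apply/(integrable_mkcond _ _).1 => //; exact: continuous_itv_integrable.
have int_psi' : \int[leb]_x psi' x = 0.
  rewrite (suppI _ psi'0) -Rintegral_mkcond (is_derive_FTC2 _ cpsi' dpsi); last lra.
  by rewrite psirr psirN subrr.
pose c0 := \int[leb]_x psi x.
(* [sg] is 1 for a level below 0 and -1 for a level above 1. The terms in [k] and [U(t, k)]
   disappear because [psi'] has integral zero and [chi] vanishes at both ends of the time interval;
   the initial term disappears because [chi 0 = 0]. *)
have key k sg : D k -> (forall t x, 0 < t < T -> `|M t x - k| = sg * (M t x - k)) ->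
    (forall t x, 0 < t < T -> sgnR (M t x - k) = sg) -> 0 <= sg * I.
  move=> Dk ksg ksgn; have := entD k Dk phi tphi phi_ge0.
  rewrite (_ : (\int[leb]_x _ = 0)%E) ?adde0; last first.
    rewrite (eq_integral (cst 0%E)) ?integral0// => x _.
    by rewrite /phi (chi_supp 0) ?mul0r ?mulr0//; left; exact: ltW.
  have inner t : `]0, T[%classic t -> (\int[leb]_x (`|M t x - k| * pdt phi t x +
      sgnR (M t x - k) * (fluxU n v0 M0 F b t (M t x) - fluxU n v0 M0 F b t k) * pdx phi t x)%:E =
      (sg * (chi' t * (a t - k * c0) + chi t * j t))%:E)%E.
    rewrite /= in_itv/= => tT; have tT' : 0 <= t <= T by lra.
    have [i1 e1] := layer_cake_id tT' r0 cpsi dPsi psi0.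
    have [i2 e2] := layer_cake_flux tT' r0 cpsi' dpsi cpsi psi0 psi'0.
    have i1k := RintegrableB measurableT i1 (RintegrableZl k measurableT ipsi).
    have i2k := RintegrableB measurableT i2 (RintegrableZl (fluxU n v0 M0 F b t k) measurableT ipsi').
    have ii := RintegrableD measurableT (RintegrableZl (sg * chi' t) measurableT i1k)
       (RintegrableZl (sg * chi t) measurableT i2k).
    rewrite (_ : (fun x => _) = (fun x => (sg * chi' t * (M t x * psi x - k * psi x) +
        sg * chi t * (fluxU n v0 M0 F b t (M t x) * psi' x - fluxU n v0 M0 F b t k * psi' x))%:E)); last first.
      apply/funext => x; rewrite ksg// ksgn// pt px; congr (_%:E); ring.
    rewrite EFin_Rintegral//; congr (_%:E).
    rewrite RintegralD//; last 2 first.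
    - exact: RintegrableZl.
    - exact: RintegrableZl.
    rewrite !RintegralZl// RintegralB//; last exact: RintegrableZl.
    rewrite [X in _ + sg * chi t * X]RintegralB//; last exact: RintegrableZl.
    rewrite !RintegralZl// e1 e2 int_psi' -/c0 -/(a t) -/(j t); ring.
  have -> : (\int[leb]_(t in (`]0%R, T[%classic : set RR)) (\int[leb]_x (`|M t x - k| * pdt phi t x +
      sgnR (M t x - k) * (fluxU n v0 M0 F b t (M t x) - fluxU n v0 M0 F b t k) * pdx phi t x)%:E) =
      \int[leb]_(t in (`]0%R, T[%classic : set RR)) (sg * (chi' t * (a t - k * c0) + chi t * j t))%:E)%E.
    by apply: eq_integral => t /set_mem; exact: inner.
  rewrite -(@integral_itv_bndoo _ _ _ _ true false); last first.
    apply/measurable_EFinP; apply: measurable_funTS; apply: continuous_measurable_fun => t.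
    apply: cvgM; first exact: cvg_cst.
    apply: cvgD; apply: cvgM; [exact: cchi'| |exact: cchi|exact: cj].
    by apply: cvgB; [exact: ca|exact: cvg_cst].
  have e t : sg * (chi' t * (a t - k * c0) + chi t * j t) =
     sg * (chi' t * a t + chi t * j t) - (sg * (k * c0)) * chi' t by ring.
  have ic : leb.-integrable `[0, T] (EFin \o (fun t => chi' t * a t + chi t * j t)) by exact: continuous_itv_integrable.
  have ich : leb.-integrable `[0, T] (EFin \o chi') by exact: continuous_itv_integrable.
  have mT : measurable (`[0, T] : set RR) by exact: measurable_itv.
  have i1 := RintegrableZl sg mT ic.
  have i2 := RintegrableZl (sg * (k * c0)) mT ich.
  under eq_integral do rewrite e.
  rewrite (@EFin_Rintegral _ _ _ leb) ?lee_fin//; last exact: RintegrableB.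
  rewrite RintegralB// !RintegralZl// (is_derive_FTC2 (ltW T0) cchi' dchi).
  rewrite !chi_supp ?subrr ?mulr0 ?subr0//; [left|right]; lra.
have M01 t x : 0 < t < T -> 0 <= M t x <= 1 by move=> tT; apply/inR_itv/hM; lra.
have [k1 [k1N Dk1]] : exists k, k < 0 /\ D k.
  have ne : [set x : R | x < 0] !=set0 by exists (-1); rewrite /= ltrN10.
  have o : open [set x : R | x < 0] by exact: open_lt.
  by have [k [/= k0 Dk]] := dD _ ne o; exists k.
have [k2 [k2N Dk2]] : exists k, 1 < k /\ D k.
  have ne : [set x : R | 1 < x] !=set0 by exists 2; rewrite /=; lra.
  have o : open [set x : R | 1 < x] by exact: open_gt.
  by have [k [/= k0 Dk]] := dD _ ne o; exists k.
have h1 : 0 <= 1 * I.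
  apply: (key k1) => // t x tT; have := M01 t x tT => h.
    by rewrite mul1r ger0_norm//; lra.
  by rewrite /sgnR gtr0_sg//; lra.
have h2 : 0 <= (-1) * I.
  apply: (key k2) => // t x tT; have := M01 t x tT => h.
    by rewrite mulN1r ltr0_norm//; lra.
  by rewrite /sgnR ltr0_sg//; lra.
lra.
Qed.

Lemma mollified_equation (e x s t : R) : 0 < e -> 0 < s -> s <= t -> t < T ->
  \int[leb]_(m in D01) stepk e x (X t m) - \int[leb]_(m in D01) stepk e x (X s m) =
  - \int[leb]_(r in `[s, t]) (\int[leb]_(m in D01) (G r m * kern e x (X r m))).
Proof.
move=> e0 s0 st tT.
pose r := `|x| + e; have r0 : 0 < r by rewrite ltr_wpDl.
(* This primitive of the kernel in [y] equals 1 at [r], so that [Psi r - Psi (X t m)] is exactly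
   [stepk e x (X t m)]. *)
pose Psi (y : R) := 1 - stepk e x y.
have [L L0 LP] := stepk_lipschitz x e0.
have [K K0 KP] := kern_lipschitz R.
have ck := @kern_continuous R e x e0; have cs := @stepk_continuous R e x e0.
have Psir : Psi r = 1.
  by rewrite /Psi stepk_eq0 ?subr0//; have := ler_norm x; rewrite /r; lra.
pose a t := \int[leb]_(m in D01) (Psi r - Psi (X t m)).
pose j t := - \int[leb]_(m in D01) (G t m * kern e x (X t m)).
have aE t' : a t' = \int[leb]_(m in D01) stepk e x (X t' m).
  by apply: eq_Rintegral => m _; rewrite Psir /Psi; ring.
have cA : continuous a.
  have := @clip_continuous_int R X (cst 1) (stepk e x) r L 1 r0 L0 (Xf_measurable01 T0 hM)
    (Xf_clip_continuous T0 hM ent) (L2_cst 1) cs.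
  rewrite (_ : (fun t => _) = a); last first.
    by apply/funext => t'; rewrite aE; apply: eq_Rintegral => m _; rewrite mul1r.
  apply; first by move=> y; have := stepk_itv e x y; rewrite ler_norml; lra.
  by move=> y z; rewrite -(stepk_clip x y e0) -(stepk_clip x z e0); exact: LP.
have cJ : continuous j.
  have := @Gf_int_continuous R T n v0 M0 F b M T0 hF hb hM ent (kern e x) r (K / e ^+ 2) (K / e) r0.
  move=> h t'; apply: cvgN; apply: h => //.
  - by rewrite divr_ge0 ?exprn_ge0// ltW.
  - by move=> y; rewrite ger0_norm ?kern_ge0//; have [] := KP e x x y y e0.
  - move=> y z; rewrite -(kern_clip x y e0) -(kern_clip x z e0) -/r.
    have [_] := KP e x x (clip r y) (clip r z) e0.
    by rewrite (_ : x - _ - _ = - (clip r y - clip r z)) ?normrN//; ring.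
have [k' [sk' dk']] := smooth_derive (kern_smooth x e0).
have ck' := smooth_continuous sk'.
have kern0 y : r <= `|y| -> kern e x y = 0.
  move=> ry; apply: kern_eq0 => //.
  have := ler_norm x; have := ler_norm (- x); rewrite normrN => h1 h2.
  by move: ry; rewrite /r ler_normr => /orP[h|h]; [left|right]; lra.
(* At [|y| = r] the kernel is known to vanish on one side only. Slightly further out it vanishes in
   a whole neighbourhood, hence so does [k'], and continuity brings this back to [y]. *)
have k'0 y : r <= `|y| -> k' y = 0.
  move=> ry; have h := dk' y.
  apply/eqP; rewrite -normr_le0; apply/ler_addgt0Pr => ep ep0; rewrite add0r.
  have [d d0 dP] := epsilon_continuous (ck' y) ep0.
  have [z [zy zr]] : exists z, `|z - y| < d /\ (exists2 dd : R, 0 < dd & forall w, `|w - z| < dd -> kern e x w = 0).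
    have [y0|y0] := leP 0 y.
      exists (y + d / 2); split; first by rewrite addrAC subrr add0r ger0_norm; lra.
      exists (d / 2); first lra.
      move=> w; rewrite ltr_norml => /andP[w1 w2]; apply: kern0.
      by rewrite (ger0_norm y0) in ry; rewrite ler_normr; apply/orP; left; lra.
    exists (y - d / 2); split; first by rewrite addrAC subrr add0r normrN ger0_norm; lra.
    exists (d / 2); first lra.
    move=> w; rewrite ltr_norml => /andP[w1 w2]; apply: kern0.
    by rewrite (ltr0_norm y0) in ry; rewrite ler_normr; apply/orP; right; lra.
  have kz : k' z = 0.
    have [dd dd0 ddP] := zr.
    have dz : is_derive z (1:R) (kern e x) 0.
      by apply: (@is_derive_near _ (cst 0) _ _ _ dd) => // w wz; rewrite ddP.
    by rewrite -(@derive_val _ _ _ _ _ _ _ (dk' z)) (@derive_val _ _ _ _ _ _ _ dz).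
  by have := dP z zy; rewrite kz sub0r normrN.
have dPsi y : is_derive y (1:R) Psi (kern e x y).
  have h := stepk_derive1 x y e0; apply: is_derive_eq; ring.
have := @du_bois_reymond R a j T T0 cA cJ _ s t s0 st tT.
rewrite !aE => ->.
  have cJN : continuous (fun t => - j t) by move=> t'; apply: cvgN; exact: cJ.
  have ij := @continuous_itv_integrable R _ s t cJN.
  have mst : measurable (`[s, t] : set RR) by exact: measurable_itv.
  rewrite -[RHS]mulN1r -[X in _ = _ * X](_ : \int[leb]_(r in `[s, t]) (- j r) = _); last first.
    by apply: eq_Rintegral => z _; rewrite /j opprK.
  by rewrite -(RintegralZl _ mst ij); apply: eq_Rintegral => z _; rewrite mulN1r opprK.
move=> chi chi' schi dchi cchi' chi0 chis.
exact: (entropy_weak (ltW r0) schi dchi cchi' chi0 chis (kern_smooth x e0) dk'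
  (smooth_continuous sk') (fun y => kern_ge0 x y e0) dPsi kern0 k'0 cA cJ).
Qed.

End weak_identity.

(** * Mollified flow *)

Lemma mvt_increment (R : realType) (f f' : R -> R) : (forall x, is_derive x (1:R) f (f' x)) ->
  forall x h, exists2 c, `|c - x| <= `|h| & f (x + h) - f x = h * f' c.
Proof.
move=> df x h; have cf := is_derive1_continuous df.
have [hp|hn] := leP 0 h.
  have xh : x <= x + h by lra.
  have [c cxh E] := MVT_segment xh (fun z _ => df z) (continuous_subspaceT cf).
  exists c; last by rewrite E mulrC; congr (_ * _); ring.
  move: cxh; rewrite in_itv/= => cxh; rewrite !ger0_norm//; lra.
have xh : x + h <= x by lra.
have [c cxh E] := MVT_segment xh (fun z _ => df z) (continuous_subspaceT cf).
exists c; last by rewrite -opprB E; ring.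
by move: cxh; rewrite in_itv/= => cxh; rewrite ler0_norm ?(ltr0_norm hn); lra.
Qed.

Lemma norm_powR_continuous (R : realType) (p : R) : 1 < p -> continuous (fun x : R => `|x| `^ p).
Proof.
move=> p1 s; apply: continuous_epsilon => ep ep0.
pose B := `|s| + 1; pose K := p * B `^ (p - 1) + 1.
have B0 : 0 <= B by rewrite addr_ge0.
have K0 : 0 < K by rewrite ltr_wpDl// mulr_ge0 ?powR_ge0//; lra.
exists (Num.min 1 (ep / K)); first by rewrite lt_min ltr01 divr_gt0.
move=> t; rewrite lt_min => /andP[t1 tK].
have tB : `|t| <= B.
  by have := ler_normD s (t - s); rewrite addrC subrK /B; move: t1; lra.
have sB : `|s| <= B by rewrite /B; lra.
have h (x y : R) : `|x| <= B -> `|y| <= B -> `|x| `^ p - `|y| `^ p <= K * `|x - y|.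
  move=> xB yB; apply: (le_trans (powR_sub_le p1 (normr_ge0 x) (normr_ge0 y))).
  apply: ler_pM; rewrite ?mulr_ge0 ?powR_ge0 ?ler_dist_dist//; first lra.
  rewrite /K; apply: (@le_trans _ _ (p * B `^ (p - 1))); last lra.
  by rewrite ler_wpM2l ?ge0_ler_powR ?nnegrE//; lra.
have K1 : K * `|t - s| <= ep by rewrite mulrC -ler_pdivlMr// ltW.
rewrite ler_norml; have := h t s tB sB; have := h s t sB tB; rewrite [`|s - t|]distrC.
by move: K1; lra.
Qed.

Lemma kern_measurable (R : realType) d (S : measurableType d) (D : set S) (e : R) (f g : S -> R) :
  measurable_fun D f -> measurable_fun D g -> measurable_fun D (fun s => kern e (f s) (g s)).
Proof.
move=> mf mg; rewrite /kern; apply: measurable_funM; first exact: measurable_cst.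
apply: (measurableT_comp (continuous_measurable_fun (smooth_continuous (@bump_smooth R)))).
by apply: measurable_funM; [exact: measurable_funB|exact: measurable_cst].
Qed.

Section mollified_inverse.
Context (R : realType).
Notation RR := (measurableTypeR R).
Notation leb := (@lebesgue_measure R).
Notation D01 := (`]0%R, 1%R[%classic : set RR).

Definition kern_bound (K : R) := forall e x x' y y' : R, 0 < e ->
  kern e x y <= K / e /\
  `|kern e x y - kern e x' y'| <= K / e ^+ 2 * `|x - y - (x' - y')|.
Definition mollA (e : R) (X : R -> R) (x : R) : R := \int[leb]_(m in D01) stepk e x (X m).
Definition mollJ (e : R) (X g : R -> R) (x : R) : R := \int[leb]_(m in D01) (g m * kern e x (X m)).
(* The term [e * x] makes the mollified distribution function a bijection of the
   line; its total mass being infinite is harmless, as only [m \in ]0, 1[] matters. *)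
Definition mollM (e : R) (X : R -> R) (x : R) : R := mollA e X x + e * x.
Definition mollr (e : R) (X : R -> R) (x : R) : R := mollJ e X (cst 1) x + e.
(* [mollM e X] solves a transport equation with velocity field [vel e X G], whose
   flow is [mollY e X]. *)
Definition vel (e : R) (X g : R -> R) (x : R) : R := mollJ e X g x / mollr e X x.
(** For [e > 0] and measurable [X] the default 0 never intervenes: [mollM e X] is onto the line, see
    [mollMK]. *)
Definition mollY (e : R) (X : R -> R) (m : R) : R := xget 0 [set x | mollM e X x = m].

Context (e : R) (X : R -> R).
Hypothesis e0 : 0 < e.
Hypothesis mX : measurable_fun D01 X.

Lemma stepkX_integrable x : leb.-integrable D01 (EFin \o (fun m => stepk e x (X m))).
Proof.
apply: (@bounded_D01_integrable _ _ 1).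
  exact: (measurableT_comp (continuous_measurable_fun (@stepk_continuous R e x e0))).
by move=> m _; have := stepk_itv e x (X m); rewrite ler_norml; lra.
Qed.

Lemma kernX_measurable x : measurable_fun D01 (fun m => kern e x (X m)).
Proof. exact: (measurableT_comp (continuous_measurable_fun (@kern_continuous R e x e0))). Qed.

Lemma kernX_integrable (g : R -> R) x : leb.-integrable D01 (EFin \o g) ->
  leb.-integrable D01 (EFin \o (fun m => g m * kern e x (X m))).
Proof.
move=> ig; have [K K0 KP] := kern_lipschitz R.
have mD := @mD01 R.
apply: (dominated_integrable mD _ (RintegrableZl (K / e) mD (integrable_norm ig))).
  by apply: measurable_funM; [exact: integrable_measurableR ig|exact: kernX_measurable].
move=> m _; rewrite normrM mulrC ler_wpM2r// ger0_norm ?kern_ge0//.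
by have [] := KP e x x (X m) (X m) e0.
Qed.

Lemma mollA_itv x : 0 <= mollA e X x <= 1.
Proof.
apply/andP; split.
  by apply: Rintegral_ge0 => m _; case/andP: (stepk_itv e x (X m)).
rewrite -[leRHS](@Rintegral_D01_cst R 1); apply: le_Rintegral => //.
- exact: stepkX_integrable.
- exact: D01_cst_integrable.
- by move=> m _; case/andP: (stepk_itv e x (X m)).
Qed.

Lemma mollJ_lipschitz (K : R) (g : R -> R) x x' : kern_bound K ->
  leb.-integrable D01 (EFin \o g) ->
  `|mollJ e X g x - mollJ e X g x'| <= K / e ^+ 2 * `|x - x'| * \int[leb]_(m in D01) `|g m|.
Proof.
move=> KP ig; have mD := @mD01 R.
have ix := kernX_integrable x ig; have ix' := kernX_integrable x' ig.
rewrite /mollJ -RintegralB//.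
apply: (le_trans (le_normr_Rintegral mD (RintegrableB mD ix ix'))).
have ng := integrable_norm ig.
rewrite -(RintegralZl _ mD ng).
apply: le_Rintegral => //.
- exact: integrable_norm (RintegrableB mD ix ix').
- exact: RintegrableZl.
move=> m _; rewrite -mulrBr normrM mulrC ler_wpM2r//.
have [_] := KP e x x' (X m) (X m) e0.
by rewrite (_ : x - X m - (x' - X m) = x - x')//; ring.
Qed.

Lemma mollJ_continuous (g : R -> R) : leb.-integrable D01 (EFin \o g) -> continuous (mollJ e X g).
Proof.
move=> ig s; apply: continuous_epsilon => ep ep0.
have [K K0 KP] := kern_lipschitz R.
pose L := K / e ^+ 2; have L0 : 0 < L by rewrite divr_gt0// exprn_gt0.
set I := \int[leb]_(m in D01) `|g m|.
have I0 : 0 <= I by exact: Rintegral_ge0.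
have L1 : 0 < L * (I + 1) by rewrite mulr_gt0//; lra.
exists (ep / (L * (I + 1))); first by rewrite divr_gt0.
move=> t ts; apply: (le_trans (mollJ_lipschitz t s KP ig)); rewrite -/I -/L.
apply: (@le_trans _ _ (L * (I + 1) * `|t - s|)); last first.
  by rewrite mulrC -ler_pdivlMr// ltW.
by rewrite -mulrA [`|_| * I]mulrC mulrA ler_wpM2r// ler_wpM2l ?(ltW L0)//; lra.
Qed.

(** Differentiation under the integral: the kernel is Lipschitz with a constant independent of the
    label, so the mean value theorem makes the remainder uniformly small in [m]. *)
Lemma mollA_derive x : is_derive x (1:R) (mollA e X) (mollJ e X (cst 1) x).
Proof.
have [K K0 KP] := kern_lipschitz R; have mD := @mD01 R.
have i1 := @D01_cst_integrable R 1.
apply: is_derive_epsilon => ep ep0.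
have Ke : 0 < K / e ^+ 2 by rewrite divr_gt0// exprn_gt0.
exists (ep / (K / e ^+ 2)); first by rewrite divr_gt0.
move=> h h0 hd.
have ik := kernX_integrable x i1.
rewrite /mollA /mollJ -(RintegralZl _ mD ik) -(RintegralB mD (stepkX_integrable (x + h)) (stepkX_integrable x)).
have iB := RintegrableB mD (stepkX_integrable (x + h)) (stepkX_integrable x).
have iZ := RintegrableZl h mD ik.
rewrite -(RintegralB mD iB iZ).
apply: (le_trans (le_normr_Rintegral mD (RintegrableB mD iB iZ))).
rewrite -[leRHS](@Rintegral_D01_cst R); apply: le_Rintegral => //.
- exact: integrable_norm (RintegrableB mD iB iZ).
- exact: D01_cst_integrable.
move=> m _; rewrite /= mul1r.
have [c cx ->] := mvt_increment (fun z => stepk_derive2 z (X m) e0) x h.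
rewrite -mulrBr normrM mulrC ler_wpM2r//.
have [_ h2] := KP e c x (X m) (X m) e0.
apply: (le_trans h2); rewrite (_ : c - X m - (x - X m) = c - x); last ring.
apply: (@le_trans _ _ (K / e ^+ 2 * `|h|)); first by rewrite ler_wpM2l// ltW.
by rewrite mulrC -ler_pdivlMr// ltW.
Qed.

Lemma mollM_derive x : is_derive x (1:R) (mollM e X) (mollr e X x).
Proof.
have h := mollA_derive x; apply: is_derive_eq.
by rewrite /GRing.scale /= mulr1.
Qed.

Lemma mollr_ge x : e <= mollr e X x.
Proof.
rewrite /mollr lerDr; apply: Rintegral_ge0 => m _.
by rewrite mul1r kern_ge0.
Qed.

Lemma mollr_gt0 x : 0 < mollr e X x.
Proof. exact: lt_le_trans (mollr_ge x). Qed.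

Lemma mollr_continuous : continuous (mollr e X).
Proof.
move=> x; apply: cvgD; last exact: cvg_cst.
exact: (mollJ_continuous (@D01_cst_integrable R 1)).
Qed.

Lemma mollM_continuous : continuous (mollM e X).
Proof. exact: is_derive1_continuous mollM_derive. Qed.

Lemma mollM_expand x y : x <= y -> e * (y - x) <= mollM e X y - mollM e X x.
Proof.
move=> xy; have [c _ ->] := MVT_segment xy (fun z _ => mollM_derive z) (continuous_subspaceT mollM_continuous).
by rewrite ler_wpM2r ?mollr_ge// subr_ge0.
Qed.

Lemma mollM_lt x y : x < y -> mollM e X x < mollM e X y.
Proof.
move=> xy; have := mollM_expand (ltW xy).
have : 0 < e * (y - x) by rewrite mulr_gt0// subr_gt0.
lra.
Qed.

Lemma mollM_le x y : (mollM e X x <= mollM e X y) = (x <= y).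
Proof.
have [xy|yx] := leP x y; last by apply/negbTE; rewrite -ltNge mollM_lt.
have h := mollM_expand xy; have : 0 <= e * (y - x) by rewrite mulr_ge0 ?(ltW e0)// subr_ge0.
by move=> h2; rewrite -subr_ge0; exact: le_trans h2 h.
Qed.

Lemma mollMK m : mollM e X (mollY e X m) = m.
Proof.
rewrite /mollY; case: xgetP => [//|].
have h0 := mollA_itv 0.
have mM x : e * x <= mollM e X x <= e * x + 1.
  by rewrite /mollM; move: (mollA e X x) (mollA_itv x) => A; lra.
(* Since [mollA] lies in [[0, 1]], [mollM] lies between [e x] and [e x + 1]; at these two points it
   therefore brackets [m]. *)
pose u := (m - 1) / e; pose w := m / e.
have uw : u <= w by rewrite /u /w ler_pM2r ?invr_gt0//; lra.
have [c _ cm] : exists2 c, c \in `[u, w] & mollM e X c = m.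
  apply: IVT => //; first exact: continuous_subspaceT mollM_continuous.
  rewrite ge_min le_max; apply/andP; split; apply/orP; [left|right].
    by have := mM u; rewrite /u mulrC divfK ?gt_eqF//; lra.
  by have := mM w; rewrite /w mulrC divfK ?gt_eqF//; lra.
by move=> /(_ c); case.
Qed.

Lemma mollYK x : mollY e X (mollM e X x) = x.
Proof. by apply/eqP; rewrite eq_le -mollM_le mollMK lexx -mollM_le mollMK lexx. Qed.

Lemma mollY_le m x : (mollY e X m <= x) = (m <= mollM e X x).
Proof. by rewrite -mollM_le mollMK. Qed.

Lemma mollY_galois : galois (mollM e X) (mollY e X).
Proof. by move=> m x _; rewrite mollY_le; split => // /ltW. Qed.

Lemma mollY_lipschitz m m' : `|mollY e X m - mollY e X m'| <= e^-1 * `|m - m'|.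
Proof.
wlog mm : m m' / mollY e X m <= mollY e X m'.
  move=> h; have [mm|/ltW mm] := leP (mollY e X m) (mollY e X m'); first exact: h.
  by rewrite distrC [`|m - m'|]distrC; exact: h.
have := mollM_expand mm; rewrite !mollMK => h.
have h2 : 0 <= m' - m by apply: le_trans h; rewrite mulr_ge0 ?(ltW e0)// subr_ge0.
rewrite distrC [`|m - m'|]distrC [X in X <= _]ger0_norm ?subr_ge0//.
by rewrite [X in _ * X]ger0_norm// ler_pdivlMl.
Qed.

Lemma mollY_continuous : continuous (mollY e X).
Proof.
move=> s; apply: continuous_epsilon => ep ep0.
exists (ep * e); first exact: mulr_gt0.
move=> t ts; apply: (le_trans (mollY_lipschitz t s)).
by rewrite ler_pdivrMl// mulrC ltW.
Qed.

(** Substitution [m = mollM x]: the law of [mollY] over []0, 1[] has density [mollr] between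
    [mollY 0] and [mollY 1]. This density cancels the denominator of [vel]. *)
Lemma mollY_integral (f : R -> R) : continuous f -> (forall x, 0 <= f x) ->
  \int[leb]_(m in D01) f (mollY e X m) =
  \int[leb]_(x in `[mollY e X 0, mollY e X 1]) (f x * mollr e X x).
Proof.
move=> cf f0.
set a := mollY e X 0; set c := mollY e X 1.
have ac : a <= c by rewrite mollY_le mollMK ler01.
have cY := mollY_continuous.
have cfY : continuous (fun m => f (mollY e X m)).
  by move=> m; apply: (continuous_comp (f := mollY e X)); [exact: cY|exact: cf].
have dM : (mollM e X)^`()%classic = mollr e X.
  by apply/funext => x; rewrite derive1E; have h := mollM_derive x; exact: derive_val.
have := @integration_by_substitution_increasing R (mollM e X) (f \o mollY e X) a c ac.
rewrite !mollMK dM => H.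
rewrite /Rintegral; congr fine.
rewrite -(@integral_itv_bndoo _ _ _ _ true false); last first.
  by apply/measurable_EFinP; apply: measurable_funTS; exact: continuous_measurable_fun cfY.
rewrite H.
- by apply: eq_integral => x _; rewrite /GRing.mul /= mollYK.
- by move=> x y _ _; exact: mollM_lt.
- by move=> x _; exact: mollr_continuous.
- by apply/cvg_ex; exists (mollr e X a); apply: cvg_at_right_filter; exact: mollr_continuous.
- by apply/cvg_ex; exists (mollr e X c); apply: cvg_at_left_filter; exact: mollr_continuous.
- split.
  + by move=> x _; case: (mollM_derive x).
  + by apply: cvg_at_right_filter; exact: mollM_continuous.
  + by apply: cvg_at_left_filter; exact: mollM_continuous.
- exact: continuous_subspaceT cfY.
Qed.

Lemma vel_continuous (g : R -> R) : leb.-integrable D01 (EFin \o g) -> continuous (vel e X g).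
Proof.
move=> ig x; apply: cvgM; first exact: mollJ_continuous.
by apply: cvgV; [rewrite gt_eqF// mollr_gt0|exact: mollr_continuous].
Qed.

(** The constant is of order [1 / e^2] and useless in the limit; it serves to justify integrability
    and exchanges of integrals at fixed [e]. *)
Lemma vel_bounded (K : R) (g : R -> R) x : 0 < K -> kern_bound K ->
  leb.-integrable D01 (EFin \o g) -> `|vel e X g x| <= K / e / e * \int[leb]_(m in D01) `|g m|.
Proof.
move=> K0 KP ig; have mD := @mD01 R; rewrite /vel normrM normfV (gtr0_norm (mollr_gt0 x)).
rewrite ler_pdivrMr ?mollr_gt0//.
have h1 : `|mollJ e X g x| <= K / e * \int[leb]_(m in D01) `|g m|.
  apply: (le_trans (le_normr_Rintegral mD (kernX_integrable x ig))).
  have ng := integrable_norm ig.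
  rewrite -(RintegralZl _ mD ng); apply: le_Rintegral => //.
  - exact: integrable_norm (kernX_integrable x ig).
  - exact: RintegrableZl.
  move=> m _; rewrite normrM mulrC ler_wpM2r// ger0_norm ?kern_ge0//.
  by have [] := KP e x x (X m) (X m) e0.
apply: (le_trans h1).
set I := \int[leb]_(m in D01) _; have I0 : 0 <= I by exact: Rintegral_ge0.
rewrite -[K / e / e * I]mulrA [e^-1 * I]mulrC mulrA -[leRHS]mulrA -[leLHS]mulr1.
rewrite ler_wpM2l ?mulr_ge0 ?invr_ge0 ?(ltW K0) ?(ltW e0)//.
by rewrite -ler_pdivrMl ?invr_gt0// invrK mulr1 mollr_ge.
Qed.

Lemma kern_continuousl y : continuous (kern e ^~ y).
Proof.
move=> s; apply: continuous_epsilon => ep ep0.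
have [K K0 KP] := kern_lipschitz R.
have Ke : 0 < K / e ^+ 2 by rewrite divr_gt0// exprn_gt0.
exists (ep / (K / e ^+ 2)); first by rewrite divr_gt0.
move=> t ts; have [_ h] := KP e t s y y e0; apply: (le_trans h).
rewrite (_ : t - y - (s - y) = t - s); last ring.
by rewrite mulrC -ler_pdivlMr// ltW.
Qed.

Lemma kern_int_le1 y a c : a <= c -> \int[leb]_(x in `[a, c]) kern e x y <= 1.
Proof.
move=> ac.
rewrite (is_derive_FTC2 ac (@kern_continuousl y) (fun x => stepk_derive2 x y e0)).
by have := stepk_itv e a y; have := stepk_itv e c y; lra.
Qed.

(** Fubini, and the fact that the kernel has mass at most 1 in [x] for each fixed label. *)
Lemma kern_integral_contract (h : R -> R) (a c : R) : a <= c ->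
  leb.-integrable D01 (EFin \o h) -> (forall m, 0 < m < 1 -> 0 <= h m) ->
  \int[leb]_(x in `[a, c]) mollJ e X h x <= \int[leb]_(m in D01) h m.
Proof.
move=> ac ih h0; have mD := @mD01 R.
have mI : measurable (`[a, c] : set RR) by exact: measurable_itv.
have mh := integrable_measurableR ih.
have [K K0 KP] := kern_lipschitz R.
have ik : leb.-integrable `[a, c] (EFin \o cst (K / e)) by apply: continuous_itv_integrable => x; exact: cvg_cst.
have mk : measurable_fun (`[a, c] `*` D01) (fun z : RR * RR => kern e z.1 (X z.2)).
  by apply: kern_measurable; [exact: (@measurable_fun1_X _ _ _ id)|exact: measurable_fun2_X].
have mf : measurable_fun (`[a, c] `*` D01) (fun z : RR * RR => h z.2 * kern e z.1 (X z.2)).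
  by apply: measurable_funM => //; exact: measurable_fun2_X.
have bnd x m : `|h m * kern e x (X m)| <= K / e * `|h m|.
  rewrite normrM mulrC ler_wpM2r// ger0_norm ?kern_ge0//.
  by have [] := KP e x x (X m) (X m) e0.
have nh := integrable_norm ih.
have [_ E] := @fubini_dom R `[a, c] D01 (fun x m => h m * kern e x (X m)) (cst (K / e)) (fun m => `|h m|)
   mI mD mf ik nh (fun x m _ _ => bnd x m).
rewrite /mollJ E.
have ii m : leb.-integrable `[a, c] (EFin \o (fun x => kern e x (X m))).
  by apply: continuous_itv_integrable; exact: kern_continuousl.
have mk' : measurable_fun (D01 `*` (`[a, c] : set RR)) (fun z : RR * RR => kern e z.2 (X z.1)).
  by apply: kern_measurable; [exact: (@measurable_fun2_X _ _ _ id)|exact: measurable_fun1_X].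
have mf' : measurable_fun (D01 `*` (`[a, c] : set RR)) (fun z : RR * RR => h z.1 * kern e z.2 (X z.1)).
  by apply: measurable_funM mk'; exact: measurable_fun1_X.
have [i2 _] := @fubini_dom R D01 `[a, c] (fun m x => h m * kern e x (X m)) (fun m => `|h m|) (cst (K / e))
   mD mI mf' nh ik (fun m x _ _ => le_trans (bnd x m) (eq_ind _ (fun z => _ <= z) (lexx _) _ (mulrC _ _))).
apply: (le_Rintegral mD i2 ih) => m; rewrite D01E => m01.
rewrite (RintegralZl _ mI (ii m)) -[leRHS]mulr1.
apply: (ler_wpM2l (h0 _ m01)); exact: kern_int_le1.
Qed.

(** [vel] is an average of [g] with weight [kern e x (X m)], divided by [mollr], which exceeds the
    total weight by [e]. The form of [jensen_powR] with an upper bound [r] on the mass absorbs this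
    excess. *)
Lemma vel_jensen (p : R) (g : R -> R) (x : R) : 1 < p -> measurable_fun D01 g ->
  leb.-integrable D01 (EFin \o (fun m => `|g m| `^ p)) ->
  mollr e X x * `|vel e X g x| `^ p <= mollJ e X (fun m => `|g m| `^ p) x.
Proof.
move=> p1 mg igp; have mD := @mD01 R.
have i1 := @D01_cst_integrable R 1.
have ig : leb.-integrable D01 (EFin \o g).
  apply: (dominated_integrable mD mg (RintegrableD mD i1 igp)) => m _.
  by apply: powR_le1D => //; exact: ltW.
have ik : leb.-integrable D01 (EFin \o (fun m => kern e x (X m))).
  by have := kernX_integrable x i1; apply: eq_integrable => // m _ /=; rewrite mul1r.
have ikg : leb.-integrable D01 (EFin \o (fun m => kern e x (X m) * `|g m| `^ p)).
  by have := kernX_integrable x igp; apply: eq_integrable => // m _ /=; rewrite mulrC.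
have h := @jensen_powR _ RR R leb D01 (fun m => kern e x (X m)) g p `|vel e X g x| (mollr e X x) p1 mD mg
  (fun m _ => kern_ge0 x (X m) e0) ik ikg (normr_ge0 _).
rewrite /mollJ; under [leRHS]eq_Rintegral do rewrite mulrC.
apply: h.
  rewrite /mollr /mollJ; under [X in _ <= X + _]eq_Rintegral do rewrite mul1r.
  by rewrite lerDl ltW.
rewrite /vel normrM normfV (gtr0_norm (mollr_gt0 x)) mulrC divfK ?gt_eqF ?mollr_gt0//.
apply: (le_trans (le_normr_Rintegral mD (kernX_integrable x ig))).
rewrite le_eqVlt; apply/orP; left; apply/eqP; apply: eq_Rintegral => m _.
by rewrite normrM mulrC (ger0_norm (kern_ge0 _ _ e0)).
Qed.

(** Change variables with [mollY_integral], apply [vel_jensen] at each position, and integrate the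
    kernel out with [kern_integral_contract]. No constant depends on [e]. *)
Lemma vel_contract (p : R) (g : R -> R) : 1 < p -> measurable_fun D01 g ->
  leb.-integrable D01 (EFin \o (fun m => `|g m| `^ p)) ->
  \int[leb]_(m in D01) (`|vel e X g (mollY e X m)| `^ p) <= \int[leb]_(m in D01) (`|g m| `^ p).
Proof.
move=> p1 mg igp; have mD := @mD01 R.
have ig : leb.-integrable D01 (EFin \o g).
  apply: (dominated_integrable mD mg (RintegrableD mD (@D01_cst_integrable R 1) igp)) => m _.
  by apply: powR_le1D => //; exact: ltW.
have cv : continuous (fun x => `|vel e X g x| `^ p).
  move=> x; apply: (continuous_comp (f := vel e X g) (g := fun y => `|y| `^ p)).
    exact: vel_continuous.
  exact: (@norm_powR_continuous R p p1).
rewrite (mollY_integral cv (fun x => powR_ge0 _ _)).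
set a := mollY e X 0; set c := mollY e X 1.
have ac : a <= c by rewrite mollY_le mollMK ler01.
apply: le_trans (kern_integral_contract ac igp (fun m _ => powR_ge0 _ _)).
apply: le_Rintegral => //.
- apply: continuous_itv_integrable => x; apply: cvgM; [exact: cv|exact: mollr_continuous].
- by apply: continuous_itv_integrable; exact: mollJ_continuous igp.
- by move=> x _; rewrite mulrC; exact: vel_jensen.
Qed.

End mollified_inverse.

(** * Distance between an inverse and its mollification *)

Section mollified_distance.
Context (R : realType).
Notation RR := (measurableTypeR R).
Notation leb := (@lebesgue_measure R).
Notation D01 := (`]0%R, 1%R[%classic : set RR).

Lemma stepk_measurable d (S : measurableType d) (D : set S) (e : R) (f g : S -> R) :
  measurable_fun D f -> measurable_fun D g -> measurable_fun D (fun s => stepk e (f s) (g s)).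
Proof.
move=> mf mg; apply: (measurableT_comp (continuous_measurable_fun (smooth_continuous (@step_smooth R)))).
by apply: measurable_funM; [exact: measurable_funB|exact: measurable_cst].
Qed.

Lemma galois_cdf (M X : R -> R) (x : R) : galois M X -> 0 <= M x <= 1 ->
  M x = \int[leb]_(m in D01) le_ind (X m) x.
Proof.
move=> gX Mx; rewrite -[LHS](primitive01_cst1 Mx) (primitive01_galois gX Mx (@D01_cst_integrable R 1)).
by apply: eq_Rintegral => m _; rewrite mul1r.
Qed.

Lemma le_ind_integrable (X : R -> R) (x : R) : measurable_fun D01 X ->
  leb.-integrable D01 (EFin \o (fun m => le_ind (X m) x)).
Proof.
move=> mX; apply: (@bounded_D01_integrable _ _ 1); last first.
  by move=> m _; rewrite /le_ind; case: ifP; rewrite ?normr1 ?normr0.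
rewrite /le_ind; apply: measurable_fun_if; rewrite ?ifT//.
- by apply: measurable_fun_ler => //; exact: measurable_cst.
Qed.

(** The smooth and the sharp step differ only on [[y, y + e]], and there by at most 1. *)
Lemma stepk_le_ind_dist (e r y : R) : 0 < e ->
  \int[leb]_(s in `[- r, r]) `|stepk e s y - le_ind y s| <= e.
Proof.
move=> e0; have mI : measurable (`[- r, r] : set RR) by exact: measurable_itv.
have mJ : measurable (`[y, y + e] : set RR) by exact: measurable_itv.
have mf : measurable_fun (`[- r, r] : set RR) (fun s => `|stepk e s y - le_ind y s|).
  apply: measurableT_comp => //; apply: measurable_funB.
    by apply: stepk_measurable => //; exact: measurable_cst.
  rewrite /le_ind; apply: measurable_fun_if; rewrite ?ifT//.
  by apply: measurable_fun_ler => //; exact: measurable_cst.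
apply: (proj2 (ge0_Rintegral_le mI mf (fun s _ => normr_ge0 _) _)).
apply: (@le_trans _ _ (\int[leb]_(s in `[(- r)%R, r]) (\1_(`[y, y + e] : set RR) s)%:E)%E).
  apply: ge0_le_integral => //.
  - exact/measurable_EFinP.
  - by apply/measurable_EFinP; apply: measurable_funTS; exact: measurable_indic.
  - move=> s _; rewrite lee_fin indicE /le_ind; have [ys|sy] := leP y s.
      have [se|se] := leP s (y + e).
        rewrite mem_set/=; last by rewrite in_itv/= ys se.
        by have := stepk_itv e s y; rewrite ler_norml; lra.
      by rewrite stepk_eq1 ?subrr ?normr0//; lra.
    by rewrite stepk_eq0 ?subrr ?normr0 ?(ltW sy).
rewrite integral_indic//; apply: (@le_trans _ _ (leb `[y, y + e]%classic)).
  by apply: le_measure; rewrite ?inE//; exact: measurableI.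
have l : leb (`[y, y + e] : set RR) = e%:E.
  rewrite lebesgue_measure_itv/= lte_fin ltrDl e0 EFinN -EFinB; congr (_%:E); ring.
by rewrite [leLHS]l.
Qed.

(** Smoothing the step costs [e] after integration over positions; the tilt [e s] is at most [e r]
    on an interval of length [2 r], which gives [2 e r^2]. *)
Lemma mollM_dist (M X : R -> R) (e r : R) : 0 < e -> 0 <= r -> galois M X ->
  measurable_fun setT M -> (forall x, 0 <= M x <= 1) ->
  leb.-integrable `[- r, r] (EFin \o (fun s => `|mollM e X s - M s|)) /\
  \int[leb]_(s in `[- r, r]) `|mollM e X s - M s| <= e * (1 + 2 * r ^+ 2).
Proof.
move=> e0 r0 gX mM M01; have mX := galois_measurable gX.
have mI : measurable (`[- r, r] : set RR) by exact: measurable_itv.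
have mD := @mD01 R.
pose f s m := `|stepk e s (X m) - le_ind (X m) s|.
have f1 s m : `|f s m| <= 1.
  rewrite normr_id; have := stepk_itv e s (X m).
  by rewrite /le_ind ler_norml; case: ifP => _; lra.
have mf : measurable_fun ((`[- r, r] : set RR) `*` D01) (fun z : RR * RR => f z.1 z.2).
  apply: measurableT_comp => //; apply: measurable_funB.
    by apply: stepk_measurable; [exact: (@measurable_fun1_X _ _ _ id)|exact: measurable_fun2_X].
  apply: measurable_le_ind; first exact: measurableX.
    exact: measurable_fun2_X.
  exact: (@measurable_fun1_X _ _ _ id).
have mf' : measurable_fun (D01 `*` (`[- r, r] : set RR)) (fun z : RR * RR => f z.2 z.1).
  apply: measurableT_comp => //; apply: measurable_funB.
    by apply: stepk_measurable; [exact: (@measurable_fun2_X _ _ _ id)|exact: measurable_fun1_X].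
  apply: measurable_le_ind; first exact: measurableX.
    exact: measurable_fun1_X.
  exact: (@measurable_fun2_X _ _ _ id).
have ic (c : R) : leb.-integrable `[- r, r] (EFin \o cst c).
  by apply: continuous_itv_integrable => x; exact: cvg_cst.
have i1 := @D01_cst_integrable R 1.
have b1 s m : `|f s m| <= 1 * 1 by rewrite mulr1.
have [iI EI] := fubini_dom mI mD mf (ic 1) i1 (fun s m _ _ => b1 s m).
have [iD _] := fubini_dom mD mI mf' i1 (ic 1) (fun m s _ _ => b1 s m).
have h s : - r <= s <= r -> `|mollM e X s - M s| <= \int[leb]_(m in D01) f s m + e * r.
  move=> sr.
  have k1 := stepkX_integrable e0 mX s; have k2 := le_ind_integrable s mX.
  rewrite (galois_cdf gX (M01 s)) /mollM /mollA addrAC -(RintegralB mD k1 k2).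
  apply: (le_trans (ler_normD _ _)); rewrite normrM (gtr0_norm e0); apply: lerD.
    exact: (le_normr_Rintegral mD (RintegrableB mD k1 k2)).
  by rewrite ler_wpM2l ?(ltW e0)// ler_norml.
have iR := RintegrableD mI iI (ic (e * r)).
have iL : leb.-integrable `[- r, r] (EFin \o (fun s => `|mollM e X s - M s|)).
  apply: (dominated_integrable mI _ iR).
    apply: measurable_funTS; apply: measurableT_comp => //; apply: measurable_funB => //.
    exact: continuous_measurable_fun (mollM_continuous e0 mX).
  by move=> s; rewrite /= in_itv/= normr_id; exact: h.
split => //.
apply: (@le_trans _ _ (\int[leb]_(s in `[- r, r]) (\int[leb]_(m in D01) f s m + cst (e * r) s))).
  by apply: (le_Rintegral mI iL iR) => s; rewrite /= in_itv/=; exact: h.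
rewrite (RintegralD mI iI (ic (e * r))) EI Rintegral_cst//.
have l : leb (`[- r, r] : set RR) = (2 * r)%:E.
  rewrite lebesgue_measure_itv/= lte_fin.
  have [rr|rr] := ltP (- r) r; first by rewrite EFinN -EFinB; congr (_%:E); ring.
  by have -> : r = 0; [move: rr r0; lra|rewrite mulr0].
rewrite [X in fine X]l /=.
rewrite (_ : e * r * (2 * r) = e * (2 * r ^+ 2)); last ring.
rewrite mulrDr mulr1 lerD2r.
rewrite -[leRHS](@Rintegral_D01_cst R e).
apply: (le_Rintegral mD iD (@D01_cst_integrable R e)) => m _.
exact: stepk_le_ind_dist.
Qed.

Lemma mollY_clip_dist (M X : R -> R) (e r : R) : 0 < e -> 0 <= r -> galois M X ->
  measurable_fun setT M -> (forall x, 0 <= M x <= 1) ->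
  clip_dist_int r (mollY e X) X <= e * (1 + 2 * r ^+ 2).
Proof.
move=> e0 r0 gX mM M01; have mX := galois_measurable gX; have mD := @mD01 R.
have cY := mollY_continuous e0 mX.
have mY : measurable_fun D01 (mollY e X) by apply: measurable_funTS; exact: continuous_measurable_fun.
rewrite /clip_dist_int -lee_fin -(EFin_Rintegral mD (clip_integrable r0 mY mX)).
have [i1 h1] := mollM_dist e0 r0 gX mM M01.
have mI : measurable (`[- r, r] : set RR) by exact: measurable_itv.
apply: (@le_trans _ _ (\int[leb]_(s in `[(- r)%R, r]) (`|mollM e X s - M s|%R)%:E)%E); last first.
  by rewrite (EFin_Rintegral mI i1) lee_fin.
apply: (galois_clip_dist r0 (mollY_galois e0 mX) gX).
  by apply: measurable_funTS; exact: continuous_measurable_fun (mollM_continuous e0 mX).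
exact: measurable_funTS.
Qed.

End mollified_distance.

Lemma mvt_points (R : realType) (f f' : R -> R) : (forall x, is_derive x (1:R) f (f' x)) ->
  forall x y, exists2 c, `|c - x| <= `|y - x| & f y - f x = (y - x) * f' c.
Proof.
by move=> df x y; have [c cx] := mvt_increment df x (y - x); rewrite subrKC; exists c.
Qed.

(** * Functions of time and position *)

Section joint_continuity.
Context (R : realType).
Notation leb := (@lebesgue_measure R).

Lemma continuous2_epsilon (f : R * R -> R) (z : R * R) :
  (forall e : R, 0 < e -> exists2 d : R, 0 < d & forall t x, `|t - z.1| < d -> `|x - z.2| < d ->
     `|f (t, x) - f z| <= e) -> {for z, continuous f}.
Proof.
move=> H; apply/cvgrPdist_le => e e0; have [d d0 dP] := H e e0.
exists (ball z.1 d, ball z.2 d); first by split; exact: nbhsx_ballx.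
move=> [t x] [/= h1 h2].
by rewrite distrC; apply: dP; rewrite distrC.
Qed.

Lemma epsilon_continuous2 (f : R * R -> R) (z : R * R) (e : R) : {for z, continuous f} -> 0 < e ->
  exists2 d : R, 0 < d & forall t x, `|t - z.1| < d -> `|x - z.2| < d -> `|f (t, x) - f z| <= e.
Proof.
move=> cf e0; have /cvgrPdist_le/(_ e e0)/nbhs_ballP[d /= d0 dP] := cf.
by exists d => // t x h1 h2; rewrite distrC; apply: dP; split; rewrite /ball/= distrC.
Qed.

Lemma joint_continuous (f : R -> R -> R) (L : R) :
  (forall t x x', `|f t x - f t x'| <= L * `|x - x'|) -> (forall x, continuous (f ^~ x)) ->
  continuous (fun z : R * R => f z.1 z.2).
Proof.
move=> Lf cf [t0 x0]; apply: continuous2_epsilon => e e0 /=.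
have L1 : 0 < `|L| + 1 by rewrite ltr_wpDl.
have [d d0 dP] := epsilon_continuous (cf x0 t0) (divr_gt0 e0 (@ltr0Sn R 1)).
exists (Num.min d (e / 2 / (`|L| + 1))); first by rewrite lt_min d0 !divr_gt0.
move=> t x; rewrite !lt_min => /andP[td _] /andP[_]; rewrite ltr_pdivlMr// => xd.
have h1 := dP t td; have h2 := Lf t x x0.
have h3 : L * `|x - x0| <= `|x - x0| * (`|L| + 1).
  by rewrite mulrC ler_wpM2l//; have := ler_norm L; lra.
have := ler_distD (f t x0) (f t x) (f t0 x0); lra.
Qed.

Lemma increment_derive (a j : R -> R) (T t : R) : continuous j ->
  (forall r s, 0 < r -> r <= s -> s < T -> a s - a r = - \int[leb]_(q in `[r, s]) j q) ->
  0 < t < T -> is_derive t (1:R) a (- j t).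
Proof.
move=> cj H tT; apply: is_derive_epsilon => e e0.
have [d d0 dP] := epsilon_continuous (cj t) e0.
have avg r s : r <= s -> (forall q, r <= q <= s -> `|q - t| < d) ->
    `|\int[leb]_(q in `[r, s]) j q - (s - r) * j t| <= e * (s - r).
  move=> rs rsd; have mI : measurable (`[r, s] : set (measurableTypeR R)) by exact: measurable_itv.
  have ij := continuous_itv_integrable r s cj.
  have ic (c : R) : leb.-integrable `[r, s] (EFin \o cst c).
    by apply: continuous_itv_integrable => x; exact: cvg_cst.
  have l : leb (`[r, s] : set (measurableTypeR R)) = (s - r)%:E.
    rewrite lebesgue_measure_itv/= lte_fin; move: rs; rewrite le_eqVlt => /predU1P[->|->].
      by rewrite ltxx subrr.
    by rewrite EFinN -EFinB.
  have E (c : R) : \int[leb]_(q in `[r, s]) cst c q = c * (s - r).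
    by rewrite Rintegral_cst// [X in fine X]l.
  rewrite [X in _ - X]mulrC -(E (j t)) -(RintegralB mI ij (ic _)).
  have iB := RintegrableB mI ij (ic (j t)).
  apply: (le_trans (le_normr_Rintegral mI iB)); rewrite -(E e).
  apply: (le_Rintegral mI (integrable_norm iB) (ic e)) => q /=; rewrite in_itv/= => rqs.
  by apply: dP; exact: rsd.
exists (Num.min d (Num.min t (T - t))); first by rewrite !lt_min d0; case/andP: tT => -> h; rewrite subr_gt0.
move=> h _; rewrite !lt_min => /and3P[hd ht hT].
have [h0|h0] := leP 0 h.
  rewrite (ger0_norm h0) in hd ht hT *.
  rewrite H; [|lra|lra|lra].
  have th : t <= t + h by lra.
  have hq q : t <= q <= t + h -> `|q - t| < d by move=> qq; rewrite ger0_norm; lra.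
  have := avg _ _ th hq.
  rewrite (_ : t + h - t = h); last ring.
  by rewrite -normrN; apply: le_trans; rewrite le_eqVlt; apply/orP; left; apply/eqP; congr (`|_|); ring.
rewrite (ltr0_norm h0) in hd ht hT *.
rewrite -[a (t + h) - a t]opprB H; [|lra|lra|lra].
have th : t + h <= t by lra.
have hq q : t + h <= q <= t -> `|q - t| < d by move=> qq; rewrite ler0_norm; lra.
have := avg _ _ th hq.
rewrite (_ : t - (t + h) = - h); last ring.
by apply: le_trans; rewrite le_eqVlt; apply/orP; left; apply/eqP; congr (`|_|); ring.
Qed.

Lemma epsilon_is_derive (f : R -> R) (x l e : R) : is_derive x (1:R) f l -> 0 < e ->
  exists2 d : R, 0 < d & forall h, `|h| < d -> `|f (x + h) - f x - h * l| <= e * `|h|.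
Proof.
move=> [df <-] e0; have /cvgrPdist_le/(_ e e0)[d /= d0 dP] := df.
exists d => // h hd; have [->|h0] := eqVneq h 0.
  by rewrite addr0 subrr mul0r subrr normr0 mulr0.
have := dP h; rewrite /= sub0r normrN => /(_ hd h0).
rewrite /GRing.scale /= mulr1 [h + x]addrC.
set L := lim _ => H.
have -> : f (x + h) - f x - h * L = - (h * (L - h^-1 * (f (x + h) - f x))) by field.
by rewrite normrN normrM mulrC ler_wpM2r.
Qed.

(** A chain rule from partial derivatives: [f s (Y s) - f t (Y s)] is handled by the mean value
    theorem in time and joint continuity of [ft], and [f t (Y s)] by the one-variable chain rule. *)
Lemma is_derive_two (f ft fx : R -> R -> R) (Y : R -> R) (t y' : R) :
  (forall s x, is_derive s (1:R) (f ^~ x) (ft s x)) -> (forall s x, is_derive x (1:R) (f s) (fx s x)) ->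
  continuous (fun z : R * R => ft z.1 z.2) -> is_derive t (1:R) Y y' ->
  is_derive t (1:R) (fun s => f s (Y s)) (ft t (Y t) + fx t (Y t) * y').
Proof.
move=> dt dx ct dY.
have d2 := @is_derive_chain R (f t) Y t _ _ (dx t (Y t)) dY.
have d1 : is_derive t (1:R) (fun s => f s (Y s) - f t (Y s)) (ft t (Y t)).
  apply: is_derive_epsilon => e e0.
  have [d d0 dP] := @epsilon_continuous2 _ (t, Y t) e (ct _) e0.
  have cY : {for t, continuous Y} by apply/differentiable_continuous/derivable1_diffP; case: dY.
  have [d' d'0 dP'] := epsilon_continuous cY (divr_gt0 d0 (@ltr0Sn R 1)).
  exists (Num.min d d'); first by rewrite lt_min d0.
  move=> h _; rewrite lt_min => /andP[hd hd'].
  have [c ct' ->] := mvt_increment (fun s => dt s (Y (t + h))) t h.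
  rewrite subrr subr0 -mulrBr normrM mulrC ler_wpM2r//.
  apply: (dP c (Y (t + h))) => /=; first exact: le_lt_trans hd.
  apply: le_lt_trans (dP' (t + h) _) _; last lra.
  by rewrite addrAC subrr add0r.
have := is_deriveD d1 d2; apply: is_derive_ext => s /=.
by rewrite /= subrK.
Qed.

End joint_continuity.

(** The algebra of implicit differentiation in [mollY_dt]: [a] and [b] are the smoothed masses left
    of the old position at the two times, [y] is the displacement over the time step [h], and [r] is
    the density at an intermediate point. *)
Lemma quotient_estimate (R : realType) (a b y h J r r0 e ep : R) : 0 < e -> 0 < ep -> e <= r ->
  a - b = y * r -> `|b - a - h * - J| <= ep * e / 2 * `|h| ->
  `|r^-1 - r0^-1| <= ep / (2 * (`|J| + 1)) -> `|y - h * (J / r0)| <= ep * `|h|.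
Proof.
move=> e0 ep0 er E h2 h1; have rp : 0 < r by exact: lt_le_trans er.
set D := b - a - h * - J in h2.
have -> : y - h * (J / r0) = - (D / r) + h * J * (r^-1 - r0^-1).
  rewrite (_ : y = (a - b) / r); last by rewrite E mulfK ?gt_eqF.
  by rewrite /D; ring.
apply: (le_trans (ler_normD _ _)); rewrite normrN !normrM normfV (gtr0_norm rp).
have k1 : `|D| / r <= ep / 2 * `|h|.
  rewrite ler_pdivrMr//; apply: (le_trans h2).
  rewrite [leRHS]mulrAC [ep * e / 2]mulrAC ler_wpM2r// ler_wpM2l// divr_ge0//.
  exact: ltW.
have k2 : `|h| * `|J| * `|r^-1 - r0^-1| <= ep / 2 * `|h|.
  rewrite -mulrA [leRHS]mulrC ler_wpM2l//.
  apply: (@le_trans _ _ ((`|J| + 1) * (ep / (2 * (`|J| + 1))))).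
    by apply: ler_pM => //; rewrite lerDl.
  have J1 : `|J| + 1 != 0 by rewrite gt_eqF// ltr_wpDl.
  by rewrite le_eqVlt; apply/orP; left; apply/eqP; field.
by apply: (le_trans (lerD k1 k2)); rewrite -mulrDl -splitr.
Qed.

(** * The ordinary differential equation of the mollified flow *)

Section flow.
Context (R : realType).
Notation RR := (measurableTypeR R).
Notation leb := (@lebesgue_measure R).
Notation D01 := (`]0%R, 1%R[%classic : set RR).

Lemma continuous_pair (f : R * R -> R) (g : R -> R) : continuous f -> continuous g ->
  continuous (fun t => f (t, g t)).
Proof.
move=> cf cg t; apply: continuous_epsilon => ep ep0.
have [d d0 dP] := epsilon_continuous2 (cf (t, g t)) ep0.
have [d' d'0 dP'] := epsilon_continuous (cg t) (divr_gt0 d0 (@ltr0Sn R 1)).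
exists (Num.min d d'); first by rewrite lt_min d0.
move=> s; rewrite lt_min => /andP[sd /dP' sd']; apply: dP => //=.
by apply: le_lt_trans sd' _; lra.
Qed.

Context (T CG : R) (X G : R -> R -> R).
Hypothesis mX : forall t, measurable_fun D01 (X t).
Hypothesis cX : clip_continuous X.
Hypothesis iG : forall t, leb.-integrable D01 (EFin \o G t).
Hypothesis GB : forall t, \int[leb]_(m in D01) `|G t m| <= CG.
Context (e : R).
Hypothesis e0 : 0 < e.
Hypothesis cJ : forall x, continuous (fun t => mollJ e (X t) (G t) x).
Hypothesis eqn : forall x s t, 0 < s -> s <= t -> t < T ->
  mollA e (X t) x - mollA e (X s) x = - \int[leb]_(r in `[s, t]) mollJ e (X r) (G r) x.

Lemma mollJ_joint : continuous (fun z : R * R => mollJ e (X z.1) (G z.1) z.2).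
Proof.
have [K K0 KP] := kern_lipschitz R.
apply: (@joint_continuous R (fun t x => mollJ e (X t) (G t) x) (K / e ^+ 2 * CG)); last exact: cJ.
move=> t x x'; apply: (le_trans (mollJ_lipschitz e0 (mX t) x x' KP (iG t))).
rewrite [leRHS]mulrAC ler_wpM2l ?GB//.
by rewrite mulr_ge0// divr_ge0 ?exprn_ge0// ltW.
Qed.

Lemma mollr_joint : continuous (fun z : R * R => mollr e (X z.1) z.2).
Proof.
have [K K0 KP] := kern_lipschitz R.
apply: (@joint_continuous R (fun t x => mollr e (X t) x) (K / e ^+ 2)).
  move=> t x x'; rewrite (_ : mollr e (X t) x - mollr e (X t) x' = mollJ e (X t) (cst 1) x - mollJ e (X t) (cst 1) x'); last first.
    by rewrite /mollr; move: (mollJ _ _ _ x) (mollJ _ _ _ x') => u u'; ring.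
  apply: (le_trans (mollJ_lipschitz e0 (mX t) x x' KP (@D01_cst_integrable R 1))).
  rewrite (_ : (\int[leb]_(m in D01) `|cst 1 m|) = 1) ?mulr1//.
  by rewrite -[RHS](@Rintegral_D01_cst R 1); apply: eq_Rintegral => m _; rewrite /= normr1.
move=> x t; apply: cvgD; last exact: cvg_cst.
have r0 : 0 < `|x| + e by rewrite ltr_wpDl.
have L0 : 0 <= K / e ^+ 2 by rewrite divr_ge0 ?exprn_ge0// ltW.
apply: (clip_continuous_int r0 L0 mX cX (@L2_cst R 1) (@kern_continuous R e x e0)) => [y|y z].
  by rewrite ger0_norm ?kern_ge0//; exact: (proj1 (KP e x x y y e0)).
rewrite -(kern_clip x y e0) -(kern_clip x z e0).
apply: (le_trans (proj2 (KP _ _ _ _ _ e0))).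
by rewrite opprB addrC addrA subrK distrC.
Qed.

Lemma vel_joint : continuous (fun z : R * R => vel e (X z.1) (G z.1) z.2).
Proof.
move=> z; apply: cvgM; first exact: mollJ_joint.
by exact: cvgV (lt0r_neq0 (mollr_gt0 (X z.1) e0 z.2)) (@mollr_joint z).
Qed.

Lemma mollM_tcontinuous x : continuous (fun t => mollM e (X t) x).
Proof.
have r0 : 0 < `|x| + e by rewrite ltr_wpDl.
have [L L0 LP] := stepk_lipschitz x e0.
rewrite (_ : (fun t => _) = (fun t => \int[leb]_(m in D01) (cst 1 m * stepk e x (X t m)) + e * x)); last first.
  by apply/funext => t; rewrite /mollM; congr (_ + _); apply: eq_Rintegral => m _; rewrite mul1r.
move=> t; apply: cvgD; last exact: cvg_cst.
apply: (clip_continuous_int r0 L0 mX cX (@L2_cst R 1) (@stepk_continuous R e x e0) (C := 1)) => [y|y z].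
  by have := stepk_itv e x y; rewrite ler_norml; lra.
by rewrite -(stepk_clip x y e0) -(stepk_clip x z e0); exact: LP.
Qed.

(** At the old position, [mollM] at the new time is close to the label [m]; the inverse at the new
    time is [1/e]-Lipschitz, uniformly in time. *)
Lemma mollY_tcontinuous m : continuous (fun t => mollY e (X t) m).
Proof.
move=> t; apply: continuous_epsilon => ep ep0.
pose x0 := mollY e (X t) m.
have [d d0 dP] := epsilon_continuous (@mollM_tcontinuous x0 t) (mulr_gt0 e0 ep0).
exists d => // s sd.
rewrite -/x0 -{1}(mollYK e0 (mX s) x0).
apply: (le_trans (mollY_lipschitz e0 (mX s) _ _)).
rewrite ler_pdivrMl// -{1}(mollMK e0 (mX t) m) -/x0 distrC.
exact: dP.
Qed.

Lemma mollY_joint : continuous (fun z : R * R => mollY e (X z.1) z.2).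
Proof.
apply: (@joint_continuous R (fun t m => mollY e (X t) m) e^-1) => [t m m'|m].
  exact: mollY_lipschitz.
exact: mollY_tcontinuous.
Qed.

(** Implicit differentiation of [mollM e (X s) (mollY e (X s) m) = m]. The time increment is taken
    at the old position, the space increment at the new time, and joint continuity of [mollr]
    reconciles them. *)
Lemma mollY_dt t m : 0 < t < T ->
  is_derive t (1:R) (fun s => mollY e (X s) m) (vel e (X t) (G t) (mollY e (X t) m)).
Proof.
move=> tT; set x0 := mollY e (X t) m; set J := mollJ e (X t) (G t) x0.
set r0 := mollr e (X t) x0.
have r00 : 0 < r0 := mollr_gt0 (X t) e0 x0.
have dA : is_derive t (1:R) (fun s => mollA e (X s) x0) (- J).
  exact: (@increment_derive R (fun s => mollA e (X s) x0) _ T t (@cJ x0) (fun r s => @eqn x0 r s) tT).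
apply: is_derive_epsilon => ep ep0.
have ep1 : 0 < ep / (2 * (`|J| + 1)) by rewrite divr_gt0// mulr_gt0// ltr_wpDl.
have cV : continuous (fun z : R * R => (mollr e (X z.1) z.2)^-1).
  by move=> z; exact: cvgV (lt0r_neq0 (mollr_gt0 (X z.1) e0 z.2)) (@mollr_joint z).
have [d d0 dP] := epsilon_continuous2 (cV (t, x0)) ep1.
have [d1 d10 dP1] := epsilon_continuous (@mollY_tcontinuous m t) (divr_gt0 d0 (@ltr0Sn R 1)).
have ep2 : 0 < ep * e / 2 by rewrite divr_gt0// mulr_gt0.
have [d2 d20 dP2] := epsilon_is_derive dA ep2.
exists (Num.min d (Num.min d1 d2)); first by rewrite !lt_min d0 d10.
move=> h _; rewrite !lt_min => /and3P[hd hd1 hd2].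
have th : t + h - t = h by ring.
have := dP1 (t + h); rewrite th => /(_ hd1) /=.
have Ey : mollM e (X (t + h)) (mollY e (X (t + h)) m) = m by exact: mollMK.
have Ex : mollM e (X t) x0 = m by exact: mollMK.
rewrite -/x0; move: (mollY e (X (t + h)) m) Ey => y Ey yx.
clearbody x0.
have [c cx E] := mvt_points (mollM_derive e0 (mX (t + h))) x0 y.
rewrite Ey in E.
have {}E : mollA e (X t) x0 - mollA e (X (t + h)) x0 = (y - x0) * mollr e (X (t + h)) c.
  by rewrite -E -Ex /mollM; move: (mollA _ _ x0) (mollA _ (X (t + h)) x0) => u w; ring.
have h2 := dP2 h hd2.
have h1 : `|(mollr e (X (t + h)) c)^-1 - r0^-1| <= ep / (2 * (`|J| + 1)).
  have dd : d / 2 < d by rewrite ltr_pdivrMr// ltr_pMr// ltr1n.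
  have k1 : `|t + h - t| < d by rewrite th.
  exact: (dP (t + h) c k1 (le_lt_trans cx (le_lt_trans yx dd))).
have rc := mollr_ge (X (t + h)) e0 c.
exact: (quotient_estimate e0 ep0 rc E h2 h1).
Qed.

Lemma flow_increment (f ft fx : R -> R -> R) (s t m : R) :
  (forall s x, is_derive s (1:R) (f ^~ x) (ft s x)) -> (forall s x, is_derive x (1:R) (f s) (fx s x)) ->
  continuous (fun z : R * R => ft z.1 z.2) -> continuous (fun z : R * R => fx z.1 z.2) ->
  0 < s -> s <= t -> t < T ->
  f t (mollY e (X t) m) - f s (mollY e (X s) m) =
  \int[leb]_(r in `[s, t]) (ft r (mollY e (X r) m) + fx r (mollY e (X r) m) * vel e (X r) (G r) (mollY e (X r) m)).
Proof.
move=> dt dx ct cx s0 st tT.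
have cY := @mollY_tcontinuous m.
symmetry; apply: (@is_derive_FTC2_on R (fun r => f r (mollY e (X r) m)) _ s t st).
- move=> r; apply: cvgD.
    exact: (@continuous_pair (fun z => ft z.1 z.2) (fun r => mollY e (X r) m)).
  apply: cvgM.
    exact: (@continuous_pair (fun z => fx z.1 z.2) (fun r => mollY e (X r) m)).
  exact: (@continuous_pair (fun z => vel e (X z.1) (G z.1) z.2) (fun r => mollY e (X r) m) vel_joint).
- move=> r rst; have rT : 0 < r < T by lra.
  exact: (is_derive_two dt dx ct (mollY_dt m rT)).
Qed.

End flow.

(** * Measurability of continuous functions of two variables *)

Section product_measurability.
Context (R : realType).
Notation RR := (measurableTypeR R).

Lemma open_measurable2 (U : set (R * R)) : open U -> measurable (U : set (RR * RR)).
Proof.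
move=> oU.
pose rect (q : (rat * rat) * (rat * rat)) : set (RR * RR) :=
  (`]ratr q.1.1, ratr q.1.2[%classic : set RR) `*` (`]ratr q.2.1, ratr q.2.2[%classic : set RR).
pose F q := if `[< rect q `<=` U >] then rect q else set0.
have -> : (U : set (RR * RR)) = \bigcup_q F q.
  apply/seteqP; split => [z Uz|z [q _]]; last by rewrite /F; case: ifPn => // /asboolP; apply.
  have := open_nbhs_nbhs (conj oU Uz).
  move=> [[A B] [/= /nbhs_ballP[d1 /= d10 h1] /nbhs_ballP[d2 /= d20 h2]] h].
  have [a _ +] : exists2 q : rat, True & ratr q \in `]z.1 - d1, z.1[.
    by have /rat_in_itvoo[q hq] : z.1 - d1 < z.1; [rewrite gtrBl|exists q].
  have [a' _ +] : exists2 q : rat, True & ratr q \in `]z.1, z.1 + d1[.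
    by have /rat_in_itvoo[q hq] : z.1 < z.1 + d1; [rewrite ltrDl|exists q].
  have [b _ +] : exists2 q : rat, True & ratr q \in `]z.2 - d2, z.2[.
    by have /rat_in_itvoo[q hq] : z.2 - d2 < z.2; [rewrite gtrBl|exists q].
  have [b' _ +] : exists2 q : rat, True & ratr q \in `]z.2, z.2 + d2[.
    by have /rat_in_itvoo[q hq] : z.2 < z.2 + d2; [rewrite ltrDl|exists q].
  rewrite !in_itv/= => hb' hb ha' ha.
  exists ((a, a'), (b, b')) => //; rewrite /F ifT; first by rewrite /rect; split; rewrite /= in_itv/=; lra.
  apply/asboolP => -[x y] [/=]; rewrite !in_itv/= => xa yb; apply: h; split => /=.
    by apply: h1; rewrite /ball/= ltr_norml; lra.
  by apply: h2; rewrite /ball/= ltr_norml; lra.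
apply: countable_bigcupT_measurable; first exact: countableP.
move=> q; rewrite /F; case: ifP => // _.
by apply: measurableX; exact: measurable_itv.
Qed.

Lemma continuous2_measurable (f : R * R -> R) : continuous f ->
  measurable_fun [set: RR * RR] (f : RR * RR -> RR).
Proof.
move=> /continuousP cf; apply: (measurability _ (RGenOpens.measurableE R)).
move=> _ [_ [a [b ->] <-]]; rewrite setTI; apply: open_measurable2.
exact/cf/interval_open.
Qed.

Lemma continuous_swap (f : R * R -> R) : continuous f -> continuous (fun z : R * R => f (z.2, z.1)).
Proof.
move=> cf z; apply: continuous2_epsilon => ep ep0.
have [d d0 dP] := epsilon_continuous2 (cf (z.2, z.1)) ep0.
by exists d => // t x td xd; exact: dP.
Qed.

End product_measurability.

Lemma norm_powR_measurable (R : realType) d (S : measurableType d) (D : set S) (p : R) (f : S -> R) :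
  measurable_fun D f -> measurable_fun D (fun x => `|f x| `^ p).
Proof.
move=> mf; apply: (measurableT_comp (measurable_powR p)).
exact: measurableT_comp.
Qed.

Lemma Rintegral_itv_cst (R : realType) (a b c : R) : a <= b ->
  \int[@lebesgue_measure R]_(x in `[a, b]) cst c x = c * (b - a).
Proof.
move=> ab; have l : lebesgue_measure (`[a, b] : set (measurableTypeR R)) = (b - a)%:E.
  rewrite lebesgue_measure_itv/= lte_fin; move: ab; rewrite le_eqVlt => /predU1P[->|->].
    by rewrite ltxx subrr.
  by rewrite EFinN -EFinB.
by rewrite Rintegral_cst ?[X in fine X]l//; exact: measurable_itv.
Qed.

(** * Power estimates for increments of the flow *)

Section flow_estimates.
Context (R : realType).
Notation RR := (measurableTypeR R).
Notation leb := (@lebesgue_measure R).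
Notation D01 := (`]0%R, 1%R[%classic : set RR).
Context (T CG : R) (X G : R -> R -> R).
Hypothesis mX : forall t, measurable_fun D01 (X t).
Hypothesis cX : clip_continuous X.
Hypothesis iG : forall t, leb.-integrable D01 (EFin \o G t).
Hypothesis GB : forall t, \int[leb]_(m in D01) `|G t m| <= CG.
Context (e : R).
Hypothesis e0 : 0 < e.
Hypothesis cJ : forall x, continuous (fun t => mollJ e (X t) (G t) x).
Hypothesis eqn : forall x s t, 0 < s -> s <= t -> t < T ->
  mollA e (X t) x - mollA e (X s) x = - \int[leb]_(r in `[s, t]) mollJ e (X r) (G r) x.

Notation Y := (fun r m => mollY e (X r) m).
Notation V := (fun r m => vel e (X r) (G r) (mollY e (X r) m)).

Lemma velY_joint : continuous (fun z : R * R => V z.1 z.2).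
Proof.
move=> z; apply: continuous2_epsilon => ep ep0 /=.
have [d d0 dP] := epsilon_continuous2 (@vel_joint R CG X G mX cX iG GB e e0 cJ (z.1, Y z.1 z.2)) ep0.
have [d1 d10 dP1] := epsilon_continuous2 (@mollY_joint R X mX cX e e0 z) (divr_gt0 d0 (@ltr0Sn R 1)).
exists (Num.min d d1); first by rewrite lt_min d0.
move=> t x; rewrite !lt_min => /andP[td td1] /andP[xd xd1].
have dd : d / 2 < d by rewrite ltr_pdivrMr// ltr_pMr// ltr1n.
exact: (dP t _ td (le_lt_trans (dP1 t x td1 xd1) dd)).
Qed.

Lemma vel_bound : exists2 C : R, 0 <= C & forall t x, `|vel e (X t) (G t) x| <= C.
Proof.
have [K K0 KP] := kern_lipschitz R.
have CG0 : 0 <= CG by apply: le_trans (GB 0); exact: Rintegral_ge0.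
have K1 : 0 <= K / e / e by rewrite !divr_ge0// ltW.
exists (K / e / e * CG); first exact: mulr_ge0.
move=> t x; apply: (le_trans (vel_bounded e0 (mX t) x K0 KP (iG t))).
exact: ler_wpM2l (GB t).
Qed.

Lemma mollY_increment s t m : 0 < s -> s <= t -> t < T ->
  Y t m - Y s m = \int[leb]_(r in `[s, t]) V r m.
Proof.
move=> s0 st tT.
have := @flow_increment R T CG X G mX cX iG GB e e0 cJ eqn (fun _ x => x) (fun _ _ => 0) (fun _ _ => 1) s t m.
have d1 : forall s x : R, is_derive s (1:R) (fun _ : R => x) 0 by move=> *; exact: is_derive_cst.
have d2 : forall s x : R, is_derive x (1:R) (fun x : R => x) 1 by move=> *; exact: is_derive_id.
have c c1 : continuous (fun z : R * R => cst c1 z.1 : R) by move=> z; exact: cvg_cst.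
move=> /(_ d1 d2 (c 0) (c 1) s0 st tT) ->.
by apply: eq_Rintegral => r _; rewrite add0r mul1r.
Qed.

(** Jensen's inequality in time with weight 1 on [[s, t]], applied to the average velocity of one
    label. *)
Lemma mollY_increment_power (p s t m : R) : 1 < p -> 0 < s -> s < t -> t < T ->
  `|Y t m - Y s m| `^ p <= (t - s) `^ (p - 1) * \int[leb]_(r in `[s, t]) (`|V r m| `^ p).
Proof.
move=> p1 s0 st tT.
have cV : continuous (fun r => V r m).
  by apply: (continuous_pair velY_joint (g := cst m)) => q; exact: cvg_cst.
have cfm : continuous (fun r => 1 * `|V r m| `^ p).
  move=> r; apply: cvgM; first exact: cvg_cst.
  apply: (continuous_comp (f := fun r => V r m) (g := fun y => `|y| `^ p)); first exact: cV.
  exact: (@norm_powR_continuous R p p1).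
have iV := continuous_itv_integrable s t cV.
have mV : measurable_fun (`[s, t] : set RR) (fun r => V r m).
  exact: measurable_funTS (continuous_measurable_fun cV).
have ts0 : 0 < t - s by rewrite subr_gt0.
have mI : measurable (`[s, t] : set RR) by exact: measurable_itv.
have i1 : leb.-integrable `[s, t] (EFin \o cst 1) by apply: continuous_itv_integrable => x; exact: cvg_cst.
have h := @jensen_powR _ RR R leb (`[s, t] : set RR) (cst 1) (fun r => V r m) p (`|Y t m - Y s m| / (t - s)) (t - s) p1
  mI mV (fun _ _ => ler01) i1 (continuous_itv_integrable s t cfm).
have {h} : (t - s) * (`|Y t m - Y s m| / (t - s)) `^ p <= \int[leb]_(r in `[s, t]) (cst 1 r * `|V r m| `^ p).
  apply: h.
  - exact: divr_ge0 (normr_ge0 _) (ltW ts0).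
  - by rewrite (Rintegral_itv_cst _ (ltW st)) mul1r.
  - rewrite mulrC divfK ?gt_eqF// (mollY_increment m s0 (ltW st) tT).
    apply: (le_trans (le_normr_Rintegral mI iV)).
    by rewrite le_eqVlt; apply/orP; left; apply/eqP; apply: eq_Rintegral => r _; rewrite mul1r.
rewrite (@eq_Rintegral _ _ _ leb _ (fun r => `|V r m| `^ p)); last by move=> r _; rewrite mul1r.
move=> h; rewrite -{1}[`|Y t m - Y s m|](divfK (lt0r_neq0 ts0)).
rewrite (powRM _ (divr_ge0 (normr_ge0 _) (ltW ts0)) (ltW ts0)) mulrC -(mulr_powRB1 (ltW ts0)); last lra.
by rewrite mulrAC mulrC ler_wpM2l ?powR_ge0// mulrC.
Qed.

(** After integration over the labels and an exchange with the time integral, [vel_contract] bounds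
    each instant by [K]; the remaining factor [t - s] completes the power [p]. *)
Lemma flow_power (p K s t : R) : 1 < p ->
  (forall r, 0 < r < T -> leb.-integrable D01 (EFin \o (fun m => `|G r m| `^ p)) /\
     \int[leb]_(m in D01) (`|G r m| `^ p) <= K) ->
  0 < s -> s < t -> t < T ->
  leb.-integrable D01 (EFin \o (fun m => `|Y t m - Y s m| `^ p)) /\
  \int[leb]_(m in D01) (`|Y t m - Y s m| `^ p) <= (t - s) `^ p * K.
Proof.
move=> p1 GK s0 st tT; have mD := @mD01 R.
have mI : measurable (`[s, t] : set RR) by exact: measurable_itv.
have ts0 : 0 < t - s by rewrite subr_gt0.
have [C C0 CP] := vel_bound.
pose f r m := `|V r m| `^ p.
have cf : continuous (fun z : R * R => f z.1 z.2).
  move=> z; apply: (continuous_comp (f := fun z => V z.1 z.2) (g := fun y => `|y| `^ p)).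
    exact: velY_joint.
  exact: (@norm_powR_continuous R p p1).
have mf := continuous2_measurable cf.
have f0 r m : 0 <= f r m by exact: powR_ge0.
have fC r m : `|f r m| <= C `^ p * 1.
  by rewrite mulr1 ger0_norm// ge0_ler_powR ?nnegrE//; lra.
have fC' m r : `|f r m| <= 1 * C `^ p by rewrite mul1r -[leRHS]mulr1.
have ic (c : R) : leb.-integrable `[s, t] (EFin \o cst c).
  by apply: continuous_itv_integrable => x; exact: cvg_cst.
have i1 := @D01_cst_integrable R 1.
have [iR ER] := fubini_dom mI mD (measurable_funTS mf) (ic (C `^ p)) i1 (fun r m _ _ => fC r m).
have mf' : measurable_fun (D01 `*` (`[s, t] : set RR)) (fun z : RR * RR => f z.2 z.1).
  exact: measurable_funTS (continuous2_measurable (continuous_swap cf)).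
have [iM _] := fubini_dom mD mI mf' i1 (ic (C `^ p)) (fun m r _ _ => fC' m r).
have iM' := RintegrableZl ((t - s) `^ (p - 1)) mD iM.
have mYt r : measurable_fun D01 (Y r) by apply: measurable_funTS; exact: continuous_measurable_fun (mollY_continuous e0 (mX r)).
have iY : leb.-integrable D01 (EFin \o (fun m => `|Y t m - Y s m| `^ p)).
  apply: (dominated_integrable mD _ iM').
    exact: norm_powR_measurable (measurable_funB (mYt t) (mYt s)).
  move=> m _; rewrite (ger0_norm (powR_ge0 _ _)); exact: (mollY_increment_power m p1 s0 st tT).
split; first exact: iY.
apply: (le_trans (le_Rintegral mD iY iM' (fun m _ => mollY_increment_power m p1 s0 st tT))).
rewrite (RintegralZl _ mD iM) -ER -(@mulr_powRB1 _ (t - s) p (ltW ts0) (lt_trans ltr01 p1)).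
rewrite [(t - s) * _]mulrC -mulrA [X in _ <= _ * X]mulrC; apply: (ler_wpM2l (powR_ge0 _ _)).
rewrite -(Rintegral_itv_cst _ (ltW st)).
apply: (le_Rintegral mI iR (ic K)) => r; rewrite /= in_itv/= => rst.
have rT : 0 < r < T by case/andP: rst => sr rt; rewrite (lt_le_trans s0 sr) (le_lt_trans rt tT).
have [ig gK] := GK r rT.
exact: le_trans (vel_contract e0 (mX r) p1 (integrable_measurableR (iG r)) ig) gK.
Qed.

End flow_estimates.

(** * Wasserstein estimate *)

Section power_tools.
Context (R : realType).
Notation RR := (measurableTypeR R).
Notation leb := (@lebesgue_measure R).
Notation D01 := (`]0%R, 1%R[%classic : set RR).

Lemma fatou_le d (S : measurableType d) (mu : {measure set S -> \bar R}) (D : set S)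
    (f_ : nat -> S -> R) (f : S -> R) (C : \bar R) :
  measurable D -> (forall n, measurable_fun D (f_ n)) -> (forall n x, D x -> 0 <= f_ n x) ->
  (forall x, D x -> f_ ^~ x @ \oo --> f x) ->
  (forall n, \int[mu]_(x in D) (f_ n x)%:E <= C)%E ->
  (\int[mu]_(x in D) (f x)%:E <= C)%E.
Proof.
move=> mD mf f0 cf fC.
have h := @fatou _ _ R mu D mD (fun n x => (f_ n x)%:E).
have /h{}h : forall n, measurable_fun D (fun x => (f_ n x)%:E) by move=> n; exact/measurable_EFinP.
have /h{}h : forall n x, D x -> (0 <= (f_ n x)%:E)%E by move=> n x Dx; rewrite lee_fin f0.
have E x : D x -> limn_einf (fun n => (f_ n x)%:E) = (f x)%:E.
  move=> Dx; have c : (f_ n x)%:E @[n --> \oo] --> (f x)%:E by apply: cvg_EFin; [exact: nearW|exact: cf].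
  by rewrite is_cvg_limn_einfE; [exact/cvg_lim|apply/cvg_ex; eexists; exact: c].
rewrite (eq_integral (fun x => limn_einf (fun n => (f_ n x)%:E))); last first.
  by move=> x; rewrite inE => Dx; rewrite E.
apply: (le_trans h); rewrite limn_einf_lim; apply: lime_le; first exact: is_cvg_einfs.
apply: nearW => n; apply: (@le_trans _ _ (\int[mu]_(x in D) (f_ n x)%:E)%E); last exact: fC.
by apply: ereal_inf_lbound; exists n => /=.
Qed.

Lemma clip_clip (r r' x : R) : 0 <= r -> r <= r' -> clip r (clip r' x) = clip r x.
Proof.
move=> r0 rr; rewrite /clip; have [h1|h1] := leP r' x; have [h2|h2] := leP r x; rewrite ?maxEle ?minEle.
all: repeat case: ifP; lra.
Qed.

(** Truncation makes the [p]-th power Lipschitz, with constant [p (2 r) ^ (p - 1)]. Hence a power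
    bound for [Z] passes to [X] at the cost of first-power truncated distances, which are all that
    is controlled. *)
Lemma clip_power_le (p r K : R) (Xt Xs Zt Zs : R -> R) : 1 < p -> 0 <= r ->
  measurable_fun D01 Xt -> measurable_fun D01 Xs -> measurable_fun D01 Zt -> measurable_fun D01 Zs ->
  leb.-integrable D01 (EFin \o (fun m => `|Zt m - Zs m| `^ p)) ->
  \int[leb]_(m in D01) (`|Zt m - Zs m| `^ p) <= K ->
  leb.-integrable D01 (EFin \o (fun m => `|clip r (Xt m) - clip r (Xs m)| `^ p)) /\
  \int[leb]_(m in D01) (`|clip r (Xt m) - clip r (Xs m)| `^ p) <=
  K + p * (2 * r) `^ (p - 1) * (clip_dist_int r Zt Xt + clip_dist_int r Zs Xs).
Proof.
move=> p1 r0 mXt mXs mZt mZs iZ ZK; have mD := @mD01 R.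
have mc (f : R -> R) : measurable_fun D01 f -> measurable_fun D01 (fun m => clip r (f m)).
  by move=> mf; exact: clip_measurable mD mf.
have ia := clip_integrable r0 mZt mXt; have ib := clip_integrable r0 mZs mXs.
have iab := RintegrableD mD ia ib.
set c := p * (2 * r) `^ (p - 1); have c0 : 0 <= c by rewrite mulr_ge0 ?powR_ge0//; lra.
have ic := RintegrableZl c mD iab.
have iS := RintegrableD mD iZ ic.
have bnd m : `|clip r (Xt m) - clip r (Xs m)| `^ p <=
    `|Zt m - Zs m| `^ p + c * (`|clip r (Zt m) - clip r (Xt m)| + `|clip r (Zs m) - clip r (Xs m)|).
  move: (Xt m) (Xs m) (Zt m) (Zs m) => x y z w.
  have h1 := powR_sub_le p1 (normr_ge0 (clip r x - clip r y)) (normr_ge0 (clip r z - clip r w)).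
  have h2 : `|clip r z - clip r w| `^ p <= `|z - w| `^ p.
    by rewrite ge0_ler_powR ?nnegrE ?clip_dist//; lra.
  have h3 : p * `|clip r x - clip r y| `^ (p - 1) <= c.
    rewrite ler_wpM2l//; first lra.
    rewrite ge0_ler_powR ?nnegrE//; [lra|lra|].
    by have := clip_bnd x r0; have := clip_bnd y r0; rewrite ler_norml; lra.
  have h4 : `|clip r x - clip r y - (clip r z - clip r w)| <=
      `|clip r z - clip r x| + `|clip r w - clip r y|.
    rewrite (_ : _ - _ = - (clip r z - clip r x) + (clip r w - clip r y)); last ring.
    by apply: (le_trans (ler_normD _ _)); rewrite normrN.
  have h5 := le_trans (ler_dist_dist _ _) h4.
  have := ler_pM (mulr_ge0 (le_trans ler01 (ltW p1)) (powR_ge0 _ _)) (normr_ge0 _) h3 h5.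
  lra.
have iL : leb.-integrable D01 (EFin \o (fun m => `|clip r (Xt m) - clip r (Xs m)| `^ p)).
  apply: (dominated_integrable mD _ iS); last by move=> m _; rewrite (ger0_norm (powR_ge0 _ _)); exact: bnd.
  by apply: norm_powR_measurable; exact: measurable_funB (mc _ mXt) (mc _ mXs).
split; first exact: iL.
apply: (le_trans (le_Rintegral mD iL iS (fun m _ => bnd m))).
rewrite (RintegralD mD iZ ic) (RintegralZl _ mD iab) (RintegralD mD ia ib).
exact: lerD.
Qed.

(** The image of Lebesgue measure on []0, 1[] under [m -> (X m, Y m)] is a coupling with the
    prescribed cost; an upper bound on the infimum is all that is required. *)
Lemma wasserstein_le (mu nu : {measure set RR -> \bar R}) (M N X Y : R -> R) (p c : R) : 0 < p -> 0 <= c ->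
  is_deriv_measure M mu -> (forall x, 0 <= M x <= 1) -> galois M X -> measurable_fun setT X ->
  is_deriv_measure N nu -> (forall x, 0 <= N x <= 1) -> galois N Y -> measurable_fun setT Y ->
  (\int[leb]_(m in D01) (`|X m - Y m| `^ p)%:E <= (c `^ p)%:E)%E ->
  (wasserstein p mu nu <= c%:E)%E.
Proof.
move=> p0 c0 Mmu M01 gX mX Nnu N01 gY mY h.
pose lam : {measure set RR -> \bar R} := mrestr leb (@mD01 R).
pose Z (m : RR) : RR * RR := (X m, Y m).
have mZ : measurable_fun [set: RR] Z by apply: measurable_fun_pair.
pose Z' : {mfun RR >-> (RR * RR)%type} := HB.pack_for {mfun RR >-> (RR * RR)%type} Z
  (isMeasurableFun.Build _ _ RR (RR * RR)%type Z mZ).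
pose pi0 : {measure set (RR * RR) -> \bar R} := pushforward lam Z'.
pose pi := pi0 mZ.
have piE A : pi A = leb (D01 `&` Z @^-1` A).
  by rewrite /pi /pi0 /pushforward /= /lam /mrestr setIC.
have cpl : coupling mu nu pi.
  move=> A mA; rewrite !piE (law_eq Mmu M01 gX mX mA) (law_eq Nnu N01 gY mY mA).
  have -> : Z @^-1` (A `*` [set: RR]) = X @^-1` A by apply/seteqP; split => [m []|m].
  by have -> : Z @^-1` ([set: RR] `*` A) = Y @^-1` A by apply/seteqP; split => [m []|m].
have I : (\int[pi]_(z in [set: RR * RR]) (`|z.1 - z.2| `^ p)%:E <= (c `^ p)%:E)%E.
  have mf : measurable_fun [set: RR * RR] (fun z : RR * RR => `|z.1 - z.2| `^ p).
    by apply: norm_powR_measurable; apply: measurable_funB; [exact: measurable_fst|exact: measurable_snd].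
  rewrite /pi /pi0 ge0_integral_pushforward//; last exact/measurable_EFinP.
  rewrite preimage_setT (@ge0_negligible_integral _ _ _ lam setT (~` D01))//; last 4 first.
  - by apply: measurableC; exact: mD01.
  - by apply/measurable_EFinP; exact: measurableT_comp mf mZ.
  - by move=> x _; rewrite lee_fin powR_ge0.
  - by rewrite /lam /= /mrestr setICl measure0.
  rewrite setDE setCK setTI; apply: le_trans h; rewrite le_eqVlt; apply/orP; left; apply/eqP.
  apply: eq_measure_integral => A mA AD.
  by rewrite /lam /= /mrestr (setIidl AD).
have -> : c%:E = poweR (c `^ p)%:E p^-1.
  by rewrite poweR_EFin -powRrM mulfV ?gt_eqF// powRr1.
rewrite /wasserstein; apply: gt0_ler_poweR.
- by rewrite invr_ge0 ltW.
- rewrite in_itv/= leey andbT; apply: le_ereal_inf_tmp => _ [g _ <-].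
  by apply: integral_ge0 => z _; rewrite lee_fin powR_ge0.
- by rewrite in_itv/= leey andbT lee_fin powR_ge0.
- by apply: le_trans I; apply: ereal_inf_lbound; exists pi.
Qed.

End power_tools.

Lemma exists_lt3 (R : realType) (a b c : R) : 0 < a -> 0 < b -> 0 < c ->
  exists d, [/\ 0 < d, d < a, d < b & d < c].
Proof.
move=> a0 b0 c0; exists (Num.min a (Num.min b c) / 2).
have m0 : 0 < Num.min a (Num.min b c) by rewrite !lt_min a0 b0.
have h : Num.min a (Num.min b c) / 2 < Num.min a (Num.min b c) by rewrite ltr_pdivrMr// ltr_pMr// ltr1n.
by move: (h); rewrite {2}/Num.min !lt_min; split; rewrite ?divr_gt0//; move: h; rewrite !lt_min => /and3P[].
Qed.

Lemma split_budget (R : realType) (c e : R) : 0 <= c -> 0 < e ->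
  c * (e / (2 * c + 1) + e / (2 * c + 1)) <= e.
Proof.
move=> c0 e0; have c1 : 0 < 2 * c + 1 by lra.
have q0 : 0 < e / (2 * c + 1) by exact: divr_gt0.
rewrite -[leRHS](divfK (lt0r_neq0 c1)); move: (e / _) q0 => q q0; lra.
Qed.

(** * Lipschitz estimate for the Lagrangian map *)

Section lagrangian.
Context (R : realType).
Notation RR := (measurableTypeR R).
Notation leb := (@lebesgue_measure R).
Notation D01 := (`]0%R, 1%R[%classic : set RR).
Context (T : R) (n : nat) (v0 M0 : R -> R) (F b : nat -> R -> R) (M : R -> R -> R).
Hypothesis T0 : 0 < T.
Hypothesis hF : forall i, (i <= n)%N -> L2 (Fi v0 M0 F i).
Hypothesis hb : forall i, (0 < i <= n)%N -> inL1 T (b i).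
Hypothesis hM : forall t, 0 <= t <= T -> inR (M t).
Hypothesis ent : entropy_solution T (fluxU n v0 M0 F b) M0 M.
Notation X := (Xf T M).
Notation G := (Gf T n v0 M0 F b).

Lemma BiT_bounded i : (i <= n)%N -> exists2 C : R, 0 <= C & forall t, `|Bi b i (clampT T t)| <= C.
Proof.
move=> iN; have cB := BiT_continuous T0 hb iN.
have cN : {within `[0, T], continuous (fun t => `|Bi b i (clampT T t)|)}.
  by apply: continuous_subspaceT => t; apply: cvg_norm; exact: cB.
have [c _ h] := EVT_max (ltW T0) cN.
exists `|Bi b i (clampT T c)| => // t.
have ct := clampT_itv t (ltW T0).
by rewrite -{1}(clampT_id ct); apply: h; rewrite in_itv.
Qed.

Lemma L2_norm (f : R -> R) : L2 f -> L2 (fun m => `|f m|).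
Proof.
move=> [mf f2]; split; first exact: measurableT_comp.
by apply: eq_integrable f2 => // m _; rewrite /= real_normK ?num_real.
Qed.

(** The coefficients are continuous functions of a clamped time, hence bounded, so a single
    square-integrable function dominates all times. *)
Lemma Gf_dominated : exists2 H : R -> R, L2 H & forall t m, `|G t m| <= H m.
Proof.
have h i : exists C : R, (i <= n)%N -> 0 <= C /\ forall t, `|Bi b i (clampT T t)| <= C.
  case: (leqP i n) => [iN|]; last by exists 0.
  by have [C C0 CP] := BiT_bounded iN; exists C.
have [C CP] := choice h.
exists (fun m => \sum_(i < n.+1) C i * `|Fi v0 M0 F i m|).
  by apply: L2_sum => i; apply: L2Z; apply: L2_norm; apply: hF; rewrite -ltnS.
move=> t m; apply: (le_trans (ler_norm_sum _ _ _)); apply: ler_sum => i _.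
have [C0 Ci] := CP i (ltnSE (ltn_ord i)).
by rewrite normrM ler_wpM2r.
Qed.

Let mX t : measurable_fun D01 (X t) := Xf_measurable01 T0 hM t.
Let cX : clip_continuous X := Xf_clip_continuous T0 hM ent.

Lemma Gf_integrable t : leb.-integrable D01 (EFin \o G t).
Proof. exact: L2_integrable (Gf_L2 _ _ hF t). Qed.

Lemma Gf_bounded : exists CG : R, forall t, \int[leb]_(m in D01) `|G t m| <= CG.
Proof.
have [H H2 GH] := Gf_dominated; exists (\int[leb]_(m in D01) H m) => t.
exact: (le_Rintegral (@mD01 R) (integrable_norm (Gf_integrable t)) (L2_integrable H2) (fun m _ => GH t m)).
Qed.

Lemma Gf_mollJ_continuous (e x : R) : 0 < e -> continuous (fun t => mollJ e (X t) (G t) x).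
Proof.
move=> e0; have [K K0 KP] := kern_lipschitz R.
have r0 : 0 < `|x| + e by rewrite ltr_wpDl.
have L0 : 0 <= K / e ^+ 2 by rewrite divr_ge0 ?exprn_ge0// ltW.
apply: (Gf_int_continuous T0 hF hb hM ent r0 L0 (@kern_continuous R e x e0)) => [y|y z].
  by rewrite ger0_norm ?kern_ge0//; exact: (proj1 (KP e x x y y e0)).
rewrite -(kern_clip x y e0) -(kern_clip x z e0).
apply: (le_trans (proj2 (KP _ _ _ _ _ e0))).
by rewrite opprB addrC addrA subrK distrC.
Qed.

Lemma mollA_increment (e x s t : R) : 0 < e -> 0 < s -> s <= t -> t < T ->
  mollA e (X t) x - mollA e (X s) x = - \int[leb]_(r in `[s, t]) mollJ e (X r) (G r) x.
Proof. by move=> e0 s0 st tT; rewrite (mollified_equation T0 hF hb hM ent x e0 s0 st tT). Qed.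

Lemma mollY_dist (e r t : R) : 0 < e -> 0 <= r ->
  clip_dist_int r (mollY e (X t)) (X t) <= e * (1 + 2 * r ^+ 2).
Proof.
move=> e0 r0; have tT := clampT_itv t (ltW T0).
exact: mollY_clip_dist e0 r0 (Xf_galois T0 hM t) (M_measurable hM tT) (fun x => inR_itv x (hM tT)).
Qed.

Context (p K : R).
Hypothesis p1 : 1 < p.
Let p0 : 0 < p := lt_trans ltr01 p1.
Hypothesis GK : forall r, 0 < r < T -> leb.-integrable D01 (EFin \o (fun m => `|G r m| `^ p)) /\
  \int[leb]_(m in D01) (`|G r m| `^ p) <= K.

Lemma clip_power_inner (r s t : R) : 0 <= r -> 0 < s -> s < t -> t < T ->
  leb.-integrable D01 (EFin \o (fun m => `|clip r (X t m) - clip r (X s m)| `^ p)) /\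
  \int[leb]_(m in D01) (`|clip r (X t m) - clip r (X s m)| `^ p) <= (t - s) `^ p * K.
Proof.
move=> r0 s0 st tT; have [CG GB] := Gf_bounded.
set c := p * (2 * r) `^ (p - 1); have c0 : 0 <= c := mulr_ge0 (ltW p0) (powR_ge0 _ _).
have main e : 0 < e -> leb.-integrable D01 (EFin \o (fun m => `|clip r (X t m) - clip r (X s m)| `^ p)) /\
  \int[leb]_(m in D01) (`|clip r (X t m) - clip r (X s m)| `^ p) <=
    (t - s) `^ p * K + c * (e * (1 + 2 * r ^+ 2) + e * (1 + 2 * r ^+ 2)).
  move=> e0.
  have [iY hY] := flow_power mX cX Gf_integrable GB e0 (fun x => @Gf_mollJ_continuous e x e0)
    (fun x s t => @mollA_increment e x s t e0) p1 GK s0 st tT.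
  have mY q : measurable_fun D01 (mollY e (X q)).
    exact: measurable_funTS (continuous_measurable_fun (mollY_continuous e0 (mX q))).
  have [i1 h1] := clip_power_le p1 r0 (mX t) (mX s) (mY t) (mY s) iY hY.
  split; first exact: i1.
  apply: (le_trans h1); rewrite lerD2l; apply: (ler_wpM2l c0).
  by apply: lerD; exact: mollY_dist.
split; first exact: (proj1 (main 1 ltr01)).
apply/ler_addgt0Pr => ep ep0.
(* With mollification scale [ep / k] the error is [ep * (k - 1) / k], below [ep]. *)
pose k := c * (2 * (1 + 2 * r ^+ 2)) + 1.
have r20 : 0 <= r ^+ 2 by exact: sqr_ge0.
have k0 : 0 < k by rewrite ltr_wpDl// mulr_ge0//; lra.
apply: (le_trans (proj2 (main (ep / k) (divr_gt0 ep0 k0)))); rewrite lerD2l.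
have -> : c * (ep / k * (1 + 2 * r ^+ 2) + ep / k * (1 + 2 * r ^+ 2)) = ep / k * (k - 1) by rewrite /k; ring.
by rewrite mulrAC ler_pdivrMr// ler_wpM2l ?(ltW ep0)// gerBl.
Qed.

Lemma GK0 : 0 <= K.
Proof.
have h : 0 < T / 2 < T by rewrite divr_gt0//= ltr_pdivrMr// ltr_pMr// ltr1n.
by apply: le_trans (proj2 (GK h)); apply: Rintegral_ge0 => m _; exact: powR_ge0.
Qed.

(** The mollified equation holds only strictly inside the time interval. The endpoints are reached
    by moving [s] and [t] inwards by [d] and using the continuity of truncated inverses up to 0 and
    [T]. *)
Lemma clip_power_closed (r s t : R) : 0 < r -> 0 <= s -> s <= t -> t <= T ->
  leb.-integrable D01 (EFin \o (fun m => `|clip r (X t m) - clip r (X s m)| `^ p)) /\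
  \int[leb]_(m in D01) (`|clip r (X t m) - clip r (X s m)| `^ p) <= (t - s) `^ p * K.
Proof.
move=> r0 s0 + tT; rewrite le_eqVlt => /predU1P[->|st].
  have z : (fun m => `|clip r (X t m) - clip r (X t m)| `^ p) = cst 0.
    by apply/funext => m; rewrite subrr normr0 powR0// gt_eqF.
  rewrite z subrr powR0 ?mul0r ?gt_eqF//.
  by split; [exact: D01_cst_integrable|rewrite Rintegral_D01_cst].
set c := p * (2 * r) `^ (p - 1); have c0 : 0 <= c := mulr_ge0 (ltW p0) (powR_ge0 _ _).
have c1 : 0 < 2 * c + 1 by rewrite ltr_wpDl// mulr_ge0.
have main ep : 0 < ep -> leb.-integrable D01 (EFin \o (fun m => `|clip r (X t m) - clip r (X s m)| `^ p)) /\
  \int[leb]_(m in D01) (`|clip r (X t m) - clip r (X s m)| `^ p) <= (t - s) `^ p * K + ep.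
  move=> ep0.
  have e0 : 0 < ep / (2 * c + 1) by exact: divr_gt0.
  have [d1 d10 dP1] := cX t r0 e0; have [d2 d20 dP2] := cX s r0 e0.
  have ts2 : 0 < (t - s) / 2 by rewrite divr_gt0// subr_gt0.
  have [d [d0 dd1 dd2 dts]] := exists_lt3 d10 d20 ts2.
  have s'0 : 0 < s + d by lra.
  have st' : s + d < t - d by lra.
  have tT' : t - d < T by lra.
  have dK : (t - d - (s + d)) `^ p <= (t - s) `^ p.
    by apply: ge0_ler_powR; rewrite ?nnegrE; [exact: ltW|lra|lra|lra].
  have [i1 h1] := clip_power_inner (ltW r0) s'0 st' tT'.
  have mc q : measurable_fun D01 (fun m => clip r (X q m)) := clip_measurable r (@mD01 R) (mX q).
  (* The comparison functions are the truncated inverses at the inner times; by [clip_clip] a second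
     truncation at the same level does not change them. *)
  have [i2 h2] := clip_power_le p1 (ltW r0) (mX t) (mX s) (mc (t - d)) (mc (s + d)) i1 h1.
  split; first exact: i2.
  have cc q q' : clip_dist_int r (fun m => clip r (X q m)) (X q') = clip_dist_int r (X q) (X q').
    by apply: eq_Rintegral => m _; rewrite clip_clip ?(ltW r0).
  apply: (le_trans h2); rewrite !cc; apply: lerD.
    exact: (ler_wpM2r GK0 dK).
  have k1 : clip_dist_int r (X (t - d)) (X t) <= ep / (2 * c + 1).
    by apply/ltW/dP1; rewrite addrAC subrr add0r normrN gtr0_norm.
  have k2 : clip_dist_int r (X (s + d)) (X s) <= ep / (2 * c + 1).
    by apply/ltW/dP2; rewrite addrAC subrr add0r gtr0_norm.
  apply: (le_trans (ler_wpM2l c0 (lerD k1 k2))).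
  exact: split_budget.
split; first exact: (proj1 (main 1 ltr01)).
by apply/ler_addgt0Pr => ep ep0; exact: (proj2 (main ep ep0)).
Qed.

(** The bound on truncations does not depend on the level, so Fatou's lemma removes it; at each
    label the truncations are eventually exact. *)
Lemma lagrangian_power (s t : R) : 0 <= s -> s <= t -> t <= T ->
  (\int[leb]_(m in D01) (`|X t m - X s m| `^ p)%:E <= ((t - s) `^ p * K)%:E)%E.
Proof.
move=> s0 st tT; have mD := @mD01 R.
have h k := clip_power_closed (ltr0Sn R k) s0 st tT.
apply: (@fatou_le R _ RR leb D01 (fun (k : nat) (m : RR) => `|clip k.+1%:R (X t m) - clip k.+1%:R (X s m)| `^ p)
  (fun m : RR => `|X t m - X s m| `^ p) ((t - s) `^ p * K)%:E mD).
- by move=> k; exact: integrable_measurableR (proj1 (h k)).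
- by move=> k m _; exact: powR_ge0.
- move=> m _; apply/cvgrPdist_le => ep ep0; near=> k.
  have kX : `|X t m| + `|X s m| <= k.+1%:R.
    by apply: (@le_trans _ _ k%:R); [near: k; exact: nbhs_infty_ger|rewrite ler_nat].
  have k1 : `|X t m| <= k.+1%:R by apply: le_trans kX; rewrite lerDl.
  have k2 : `|X s m| <= k.+1%:R by apply: le_trans kX; rewrite lerDr.
  by rewrite (clip_id k1) (clip_id k2) subrr normr0 ltW.
- by move=> k; rewrite (EFin_Rintegral mD (proj1 (h k))) lee_fin (proj2 (h k)).
Unshelve. all: by end_near. Qed.

End lagrangian.

(** * The velocity as a conditional expectation *)

Section bounded_class.
Context (R : realType).
Notation RR := (measurableTypeR R).

(** A functional monotone class theorem on the line: indicators of rays generate indicators of Borel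
    sets by Dynkin's lemma, and these generate bounded functions by uniform approximation. *)
Lemma bounded_class (P : (R -> R) -> Prop) :
  P (cst 1) -> (forall a, P (fun x => le_ind x a)) ->
  (forall f g, P f -> P g -> P (fun x => f x + g x)) ->
  (forall (c : R) f, P f -> P (fun x => c * f x)) ->
  (forall (f_ : nat -> R -> R) f (C : R), (forall n, P (f_ n)) -> (forall n x, `|f_ n x| <= C) ->
     (forall x, f_ ^~ x @ \oo --> f x) -> P f) ->
  forall (h : R -> R) (C : R), measurable_fun [set: RR] h -> (forall x, `|h x| <= C) -> P h.
Proof.
move=> P1 Pray PD PZ Plim.
have Pext f g : (forall x, f x = g x) -> P f -> P g by move=> fg; rewrite (_ : f = g)//; exact/funext.
have P0 : P (cst 0) by apply: (Pext (fun x => 0 * cst 1 x)) (PZ 0 _ P1) => x; rewrite mul0r.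
have PC A : P (\1_A : R -> R) -> P (\1_(~` A) : R -> R).
  move=> PA; apply: (Pext (fun x => cst 1 x + (-1) * \1_A x)); last exact: PD P1 (PZ _ _ PA).
  by move=> x; rewrite !indicE in_setC /=; case: (x \in A) => /=; ring.
have Pset A : measurable (A : set RR) -> P (\1_A : R -> R).
  rewrite [X in X -> _](_ : _ = (<<s @RGenOInfty.G R >>) A); last by rewrite RGenOInfty.measurableE.
  move: A; apply: (@dynkin_induction _ RR (@RGenOInfty.G R) (fun A => P (\1_A : R -> R))).
  - exact: RGenOInfty.measurableE.
  - move=> _ _ [x ->] [y ->]; exists (Num.max x y).
    by apply/seteqP; split => z /=; rewrite !in_itv/= !andbT gt_max => /andP.
  - by apply: Pext P1 => x; rewrite indicT.
  - move=> _ [x ->]; apply: (Pext (fun z => cst 1 z + (-1) * le_ind z x)); last exact: PD P1 (PZ _ _ (Pray x)).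
    move=> z; rewrite indicE /le_ind /=; have [zx|xz] := leP z x.
      by rewrite memNset/=; [ring|rewrite in_itv/= andbT; apply/negP; rewrite -leNgt].
    by rewrite mem_set/=; [ring|rewrite in_itv/= andbT].
  - by move=> A0 _; exact: PC.
  - move=> F mF tF PF.
    have PU k : P (\1_(\bigcup_(i < k) F i) : R -> R).
      elim: k => [|k IH]; first by apply: Pext P0 => x; rewrite bigcup_mkord big_ord0 indic0.
      apply: Pext (PD _ _ IH (PF k)) => x; rewrite !bigcup_mkord big_ord_recr /= !indicE -!bigcup_mkord.
      rewrite in_setU; case: (boolP (x \in F k)) => xk; rewrite ?orbT ?orbF ?addr0//.
      rewrite memNset ?add0r// => -[i /= ik Fi].
      have ne : F i `&` F k !=set0 by exists x; split => //; exact/set_mem.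
      by have := tF i k I I ne => E; move: ik; rewrite E ltnn.
    apply: (Plim _ _ 1 PU) => [k x|x].
      by rewrite indicE; case: (_ \in _); rewrite ?normr1 ?normr0.
    apply/cvgrPdist_le => e e0; case: (boolP (x \in \bigcup_i F i)) => [xF|xF].
      have [i _ Fi] := set_mem xF; near=> k.
      rewrite !indicE xF mem_set ?subrr ?normr0 ?ltW//; exists i => //=.
      by near: k; exact: nbhs_infty_gt.
    near=> k; rewrite !indicE (negbTE xF) memNset ?subrr ?normr0 ?ltW// => -[i _ Fi].
    by move/negP: xF; apply; apply/mem_set; exists i.
(* Binary expansion of the values: subtracting [C / 2] where [h >= C / 2] leaves a function with
   values in [[0, C / 2]], and the error halves at each stage. *)
have Ppos k (h : R -> R) (C : R) : measurable_fun [set: RR] h -> (forall x, 0 <= h x <= C) ->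
    exists2 f, P f & forall x, 0 <= h x - f x <= C / 2 ^+ k.
  elim: k h C => [|k IH] h C mh hC.
    by exists (cst 0) => // x; rewrite expr0 divr1 subr0.
  pose A : set R := [set x | C / 2 <= h x].
  have mA : measurable (A : set RR).
    rewrite -[A]setTI; exact: measurable_fun_le (measurable_cst _) mh.
  have h2 x : 0 <= h x - C / 2 * \1_A x <= C / 2.
    have := hC x; rewrite indicE; have [xA|xA] := boolP (x \in A).
      by move/set_mem: xA; rewrite /A/=; lra.
    have : ~ (C / 2 <= h x) by move=> h1; move/negP: xA; apply; exact/mem_set.
    by move/negP; rewrite -ltNge mulr0 subr0 => h1 /andP[-> _]; exact: ltW.
  have mh2 : measurable_fun [set: RR] (fun x => h x - C / 2 * \1_A x).
    apply: measurable_funB => //; apply: measurable_funM; first exact: measurable_cst.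
    exact: measurable_indic.
  have [f Pf hf] := IH _ _ mh2 h2.
  exists (fun x => C / 2 * \1_A x + f x); first exact: PD (PZ _ _ (Pset _ mA)) Pf.
  by move=> x; have := hf x; rewrite exprS invfM mulrA opprD addrA.
have Pge0 (h : R -> R) (C : R) : measurable_fun [set: RR] h -> (forall x, 0 <= h x <= C) -> P h.
  move=> mh hC.
  have /choice[f_ fP] : forall k, exists f, P f /\ forall x, 0 <= h x - f x <= C / 2 ^+ k.
    by move=> k; have [f] := Ppos k h C mh hC; exists f.
  have C0 : 0 <= C by have := hC 0; lra.
  have k1 k : C / 2 ^+ k <= C.
    by rewrite ler_pdivrMr ?exprn_gt0// ler_peMr// exprn_ege1// ler1n.
  apply: (Plim f_ h (C + C)) => [k|k x|x]; first exact: (proj1 (fP k)).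
    have := proj2 (fP k) x; have := hC x; have := k1 k; rewrite ler_norml; lra.
  apply/cvgrPdist_le => e e0; near=> k.
  have := proj2 (fP k) x => /andP[h0 h1]; rewrite ger0_norm//; apply: (le_trans h1).
  near: k.
  have c0 : C * (2^-1) ^+ k @[k --> \oo] --> (0 : R).
    rewrite -(mulr0 C); apply: cvgMr; apply: cvg_expr; by rewrite ger0_norm ?invr_ge0// invf_lt1// ltr1n.
  have /cvgrPdist_le/(_ e e0) := c0; apply: filterS => k.
  by rewrite sub0r normrN ger0_norm ?mulr_ge0 ?exprn_ge0 ?invr_ge0// exprVn.
move=> h C mh hC.
have C0 : 0 <= C by exact: le_trans (hC 0).
have mh' : measurable_fun [set: RR] (fun x => h x + C) by apply: measurable_funD => //; exact: measurable_cst.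
have h' x : 0 <= h x + C <= C + C by have := hC x; rewrite ler_norml; lra.
apply: Pext (PD _ _ (Pge0 _ _ mh' h') (PZ (- C) _ P1)) => x.
by rewrite /=; ring.
Unshelve. all: by end_near. Qed.

End bounded_class.

(** * Averages over labels with the same position *)

Section conditional_expectation.
Context (R : realType).
Notation RR := (measurableTypeR R).
Notation leb := (@lebesgue_measure R).
Notation D01 := (`]0%R, 1%R[%classic : set RR).
Context (rho : {measure set RR -> \bar R}) (M X G v U : R -> R).
Hypothesis rM : is_deriv_measure M rho.
Hypothesis M01 : forall x, 0 <= M x <= 1.
Hypothesis gX : galois M X.
Hypothesis mX : measurable_fun setT X.
Hypothesis iG : leb.-integrable D01 (EFin \o G).
(* With [RN], this says that [v \o X] is the conditional expectation of [G] given [X]. *)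
Hypothesis UE : forall x, U x = \int[leb]_(m in D01) (G m * le_ind (X m) x).
Hypothesis RN : is_RN_flux rho U v.

Let mX1 : measurable_fun D01 X. Proof. exact: measurable_funTS. Qed.
Let mD := @mD01 R.

Definition itv_ind (a c x : R) : R := le_ind x c - le_ind x a.

Lemma le_ind_measurable (a : R) : measurable_fun [set: RR] (fun x : RR => le_ind x a).
Proof.
rewrite /le_ind; apply: measurable_fun_if; rewrite ?ifT//.
by apply: measurable_fun_ler => //; exact: measurable_cst.
Qed.

Lemma itv_ind_measurable (a c : R) : measurable_fun [set: RR] (itv_ind a c : RR -> R).
Proof. exact: measurable_funB (le_ind_measurable _) (le_ind_measurable _). Qed.

Lemma itv_indE (a c x : R) : a <= c -> itv_ind a c x = \1_(`]a, c]%classic : set R) x.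
Proof.
move=> ac; rewrite /itv_ind /le_ind indicE.
have [xa|ax] := leP x a.
  by rewrite (le_trans xa ac) memNset ?subrr//= in_itv/= => /andP[h _]; move: h; rewrite ltNge xa.
have [xc|cx] := leP x c.
  by rewrite mem_set ?subr0//= in_itv/= ax.
by rewrite memNset ?subrr//= in_itv/= => /andP[_ h]; move: h; rewrite leNgt cx.
Qed.

Lemma itv_ind01 (a c x : R) : a <= c -> 0 <= itv_ind a c x <= 1.
Proof. by move=> ac; rewrite itv_indE// indicE; case: (_ \in _) => /=; rewrite ?lexx ?ler01. Qed.

Lemma RN_measurable : measurable_fun [set: RR] (v : RR -> R).
Proof.
have E : [set: RR] = \bigcup_(k : nat) (`](- k.+1%:R)%R, k.+1%:R]%classic : set RR).
  apply/seteqP; split => // x _; have [k kx] : exists k : nat, `|x| < k%:R.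
    by exists (Num.bound `|x|); exact: archi_boundP.
  exists k => //=; rewrite in_itv/=; move: kx; rewrite ltr_norml => /andP[h1 h2].
  by rewrite -natr1; lra.
rewrite E; apply/measurable_fun_bigcup => [k|k]; first exact: measurable_itv.
have k0 : - k.+1%:R < k.+1%:R :> R by apply: (@lt_trans _ _ 0); rewrite ?oppr_lt0 ltr0Sn.
exact: integrable_measurableR (proj1 (RN k0)).
Qed.

Lemma RN_itv (a c : R) : a < c ->
  leb.-integrable D01 (EFin \o (fun m => itv_ind a c (X m) * v (X m))) /\
  \int[leb]_(m in D01) (itv_ind a c (X m) * v (X m)) = \int[leb]_(m in D01) (itv_ind a c (X m) * G m).
Proof.
move=> ac; have [iv Ev] := RN ac; have mv := RN_measurable.
have mI : measurable (`]a, c]%classic : set RR) by exact: measurable_itv.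
have mf : measurable_fun [set: RR] (fun x : RR => itv_ind a c x * v x).
  by apply: measurable_funM => //; exact: itv_ind_measurable.
have Ef x : (itv_ind a c x * v x)%:E = ((EFin \o v) \_ (`]a, c]%classic)) x.
  rewrite patchE itv_indE ?(ltW ac)// indicE; case: ifP => _ /=; first by rewrite mul1r.
  by rewrite mul0r.
have irho : rho.-integrable setT (EFin \o (fun x => itv_ind a c x * v x)).
  have := iv; rewrite integrable_mkcond//; apply: eq_integrable => // x _.
  by rewrite -Ef.
have iD := (law_integrable rM M01 gX mX mf).1 irho.
split; first exact: iD.
have E1 : (\int[rho]_x (itv_ind a c x * v x)%:E = (U c - U a)%:E)%E.
  by rewrite -Ev [RHS]integral_mkcond; apply: eq_integral => x _; rewrite Ef.
have := law_integral rM M01 gX mX mf iD; rewrite E1 => -[] /esym ->.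
have il (x : R) : leb.-integrable D01 (EFin \o (fun m => G m * le_ind (X m) x)).
  apply: (dominated_integrable mD _ (integrable_norm iG)).
    apply: measurable_funM; first exact: integrable_measurableR iG.
    exact: measurableT_comp (le_ind_measurable x) mX1.
  move=> m _; rewrite normrM /le_ind; case: ifP => _; rewrite ?normr1 ?normr0 ?mulr1 ?mulr0 /=.
    exact: lexx.
  exact: normr_ge0.
rewrite !UE -(RintegralB mD (il c) (il a)); apply: eq_Rintegral => m _.
by rewrite /itv_ind -mulrBr mulrC.
Qed.

Lemma itv_ind_G_integrable (a c : R) (h : R -> R) (C : R) : a <= c ->
  measurable_fun [set: RR] (h : RR -> R) -> (forall x, `|h x| <= C) ->
  leb.-integrable D01 (EFin \o (fun m => h (X m) * (itv_ind a c (X m) * G m))).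
Proof.
move=> ac mh hC; apply: (dominated_integrable mD _ (RintegrableZl C mD (integrable_norm iG))).
  apply: measurable_funM; first exact: measurableT_comp mh mX1.
  apply: measurable_funM; first exact: measurableT_comp (itv_ind_measurable a c) mX1.
  exact: integrable_measurableR iG.
move=> m _; rewrite mulrA normrM ler_wpM2r// normrM.
have k1 : `|itv_ind a c (X m)| <= 1 by have := itv_ind01 (X m) ac; rewrite ler_norml; lra.
by rewrite -[leRHS]mulr1; apply: ler_pM.
Qed.

(** [is_RN_flux] gives the identity on half-open intervals, and [bounded_class] extends it to
    bounded functions of the position. The window [I] is present because [v] is integrable on
    bounded intervals only, so far. *)
Lemma cond_bounded (k : nat) (h : R -> R) (C : R) : measurable_fun [set: RR] (h : RR -> R) ->
  (forall x, `|h x| <= C) ->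
  let I := itv_ind (- k.+1%:R) k.+1%:R in
  leb.-integrable D01 (EFin \o (fun m => h (X m) * (I (X m) * v (X m)))) /\
  \int[leb]_(m in D01) (h (X m) * (I (X m) * v (X m))) = \int[leb]_(m in D01) (h (X m) * (I (X m) * G m)).
Proof.
move=> mh0 hC0 I.
have k0 : - k.+1%:R < k.+1%:R :> R by apply: (@lt_trans _ _ 0); rewrite ?oppr_lt0 ltr0Sn.
have [iv _] := RN_itv k0.
have iGI := itv_ind_G_integrable (ltW k0).
have ivI (f : R -> R) (C' : R) : measurable_fun [set: RR] (f : RR -> R) -> (forall x, `|f x| <= C') ->
    leb.-integrable D01 (EFin \o (fun m => f (X m) * (I (X m) * v (X m)))).
  move=> mf fC; apply: (dominated_integrable mD _ (RintegrableZl C' mD (integrable_norm iv))).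
    apply: measurable_funM; first exact: measurableT_comp mf mX1.
    exact: integrable_measurableR iv.
  by move=> m _; rewrite normrM ler_wpM2r.
split; first exact: ivI mh0 hC0.
pose P (f : R -> R) := [/\ measurable_fun [set: RR] (f : RR -> R), exists C', forall x, `|f x| <= C' &
  \int[leb]_(m in D01) (f (X m) * (I (X m) * v (X m))) = \int[leb]_(m in D01) (f (X m) * (I (X m) * G m))].
suff : P h by case.
apply: (@bounded_class R P _ _ _ _ _ h C mh0 hC0).
- split; [exact: measurable_cst|by exists 1 => x; rewrite normr1|].
  have [_ E] := RN_itv k0; rewrite (eq_Rintegral leb (g := fun m => I (X m) * v (X m))); last by move=> m _; rewrite mul1r.
  by rewrite E; apply: eq_Rintegral => m _; rewrite mul1r.
- move=> a; split; [exact: le_ind_measurable|exists 1 => x; rewrite /le_ind; case: ifP => _; rewrite ?normr1 ?normr0//|].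
  have [ak|ka] := leP a (- k.+1%:R).
    have z x : le_ind x a * I x = 0.
      rewrite /I itv_indE ?(ltW k0)// /le_ind indicE; case: ifP => xa; last by rewrite mul0r.
      by rewrite memNset ?mulr0//= in_itv/= => /andP[h1 _]; move: h1; rewrite ltNge (le_trans xa ak).
    by transitivity (\int[leb]_(m in D01) (cst 0 m : R)); [|symmetry]; apply: eq_Rintegral => m _; rewrite mulrA z mul0r.
  have kmin : - k.+1%:R < Num.min a k.+1%:R by rewrite lt_min ka.
  have z x : le_ind x a * I x = itv_ind (- k.+1%:R) (Num.min a k.+1%:R) x.
    rewrite /I !itv_indE ?(ltW k0) ?(ltW kmin)// /le_ind !indicE.
    case: ifP => xa; [rewrite mul1r|rewrite mul0r].
      by congr (_%:R); congr (nat_of_bool _); apply/idP/idP => /set_mem/=; rewrite in_itv/= => h1; apply/mem_set; rewrite /= in_itv/= le_min xa in h1 *.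
    by rewrite memNset//= in_itv/= le_min xa andbF.
  have [_ E] := RN_itv kmin.
  transitivity (\int[leb]_(m in D01) (itv_ind (- k.+1%:R) (Num.min a k.+1%:R) (X m) * v (X m))).
    by apply: eq_Rintegral => m _; rewrite mulrA z.
  by rewrite E; apply: eq_Rintegral => m _; rewrite mulrA z.
- move=> f g [mf [Cf fC] Ef] [mg [Cg gC] Eg]; split.
  + exact: measurable_funD.
  + by exists (Cf + Cg) => x; apply: (le_trans (ler_normD _ _)); exact: lerD.
  + transitivity (\int[leb]_(m in D01) (f (X m) * (I (X m) * v (X m)) + g (X m) * (I (X m) * v (X m)))).
      by apply: eq_Rintegral => m _; rewrite mulrDl.
    rewrite (RintegralD mD (ivI _ _ mf fC) (ivI _ _ mg gC)) Ef Eg -(RintegralD mD (iGI _ _ mf fC) (iGI _ _ mg gC)).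
    by apply: eq_Rintegral => m _; rewrite -mulrDl.
- move=> c f [mf [Cf fC] Ef]; split.
  + by apply: measurable_funM => //; exact: measurable_cst.
  + by exists (`|c| * Cf) => x; rewrite normrM ler_wpM2l.
  + transitivity (\int[leb]_(m in D01) (c * (f (X m) * (I (X m) * v (X m))))).
      by apply: eq_Rintegral => m _; rewrite -[LHS]mulrA.
    rewrite (RintegralZl _ mD (ivI _ _ mf fC)) Ef -(RintegralZl _ mD (iGI _ _ mf fC)).
    by apply: eq_Rintegral => m _; rewrite -[RHS]mulrA.
- move=> f_ f C' Pf fC cf.
  have mf : measurable_fun [set: RR] (f : RR -> R).
    by apply: (@measurable_fun_cvg _ _ _ _ (fun n => f_ n)) => [n|x _]; [case: (Pf n)|exact: cf].
  have fC' x : `|f x| <= C'.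
    have c : `|f_ n x| @[n --> \oo] --> `|f x| by apply: cvg_norm; exact: cf.
    rewrite -(cvg_lim _ c)//.
    by apply: limr_le; [apply/cvg_ex; eexists; exact: c|apply: nearW => n; exact: fC].
  split => //; first by exists C'.
  have lim (w : R -> R) : leb.-integrable D01 (EFin \o w) ->
      \int[leb]_(m in D01) (f_ n (X m) * w m) @[n --> \oo] --> \int[leb]_(m in D01) (f (X m) * w m).
    move=> iw; apply: (proj2 (dominated_cvg_Rintegral mD _ _ (RintegrableZl C' mD (integrable_norm iw)) _)).
    - move=> n; apply: measurable_funM; last exact: integrable_measurableR iw.
      by apply: measurableT_comp mX1; case: (Pf n).
    - by move=> m _; apply: cvgM; [exact: cf|exact: cvg_cst].
    - by move=> n m _; rewrite normrM ler_wpM2r.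
  have iGk : leb.-integrable D01 (EFin \o (fun m => I (X m) * G m)).
    have := iGI (cst 1) 1 (measurable_cst _) (fun _ => eq_ind_r (fun z => z <= 1) (lexx 1) (normr1 _)).
    by apply: eq_integrable => // m _; rewrite /= mul1r.
  apply: (cvg_unique _ (lim _ iv)) => //.
  rewrite (_ : (fun n => _) = (fun n => \int[leb]_(m in D01) (f_ n (X m) * (I (X m) * G m)))).
    exact: lim _ iGk.
  by apply/funext => n; case: (Pf n).
Qed.

Lemma itv_ind_eventually (x : R) : \forall k \near \oo, itv_ind (- k.+1%:R) k.+1%:R x = 1 :> R.
Proof.
near=> k; have kx : `|x| <= k%:R by near: k; exact: nbhs_infty_ger.
have k0 : - k.+1%:R <= k.+1%:R :> R by apply: (@le_trans _ _ 0); rewrite ?oppr_le0 ler0n.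
have k1 : k%:R < k.+1%:R :> R by rewrite ltr_nat.
rewrite itv_indE// indicE mem_set//= in_itv/=.
by move: kx; rewrite ler_norml => /andP[h1 h2]; apply/andP; split; [apply: lt_le_trans h1; rewrite ltrN2|exact: le_trans h2 (ltW k1)].
Unshelve. all: by end_near. Qed.

(* Conditional Jensen inequality, through the tangent line of [x `^ p] at [|v|]; the
   truncation is needed because [v] is not yet known to be integrable. *)
Lemma cond_power_trunc (k : nat) (p : R) : 1 < p -> leb.-integrable D01 (EFin \o (fun m => `|G m| `^ p)) ->
  let I := itv_ind (- k.+1%:R) k.+1%:R in
  leb.-integrable D01 (EFin \o (fun m => I (X m) * `|clip k.+1%:R (v (X m))| `^ p)) /\
  \int[leb]_(m in D01) (I (X m) * `|clip k.+1%:R (v (X m))| `^ p) <= \int[leb]_(m in D01) (`|G m| `^ p).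
Proof.
move=> p1 iGp I; set N : R := k.+1%:R; have N0 : 0 <= N by exact: ler0n.
have p0 : 0 < p by lra.
have I01 m : 0 <= I (X m) <= 1 by apply: itv_ind01; apply: (@le_trans _ _ 0); rewrite ?oppr_le0.
have mv := RN_measurable.
pose u x := `|clip N (v x)|.
have uN x : u x <= N by have := clip_bnd (v x) N0; rewrite /u ler_norml.
have uv x : u x <= `|v x|.
  by have := clip_dist N (v x) 0; rewrite (clip_id (x := 0)) ?normr0// !subr0.
have mu : measurable_fun [set: RR] (u : RR -> R).
  by apply: measurableT_comp => //; exact: clip_measurable.
have mup : measurable_fun [set: RR] ((fun x => u x `^ p) : RR -> R).
  exact: (measurableT_comp (measurable_powR p)).
(* The test function [h] is the derivative of the [p]-th power, up to the factor [p], at the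
   truncated velocity: bounded, hence admissible in [cond_bounded], and [h v] dominates the
   truncated power. *)
pose s x : R := if 0 <= v x then 1 else -1.
pose h x := s x * u x `^ (p - 1).
have mh : measurable_fun [set: RR] (h : RR -> R).
  apply: measurable_funM; last exact: (measurableT_comp (measurable_powR _)).
  apply: measurable_fun_if => //.
  by apply: measurable_fun_ler => //; exact: measurable_cst.
have hE x : `|h x| = u x `^ (p - 1).
  by rewrite normrM (ger0_norm (powR_ge0 _ _)) /s; case: ifP => _; rewrite ?normrN normr1 mul1r.
have hN x : `|h x| <= N `^ (p - 1).
  by rewrite hE; apply: ge0_ler_powR; rewrite ?nnegrE ?normr_ge0//; lra.
have hv x : u x `^ p <= h x * v x.
  have -> : h x * v x = u x `^ (p - 1) * `|v x|.
    rewrite /h /s; have [v0|v0] := leP 0 (v x); rewrite mulrAC.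
      by rewrite mul1r mulrC ger0_norm.
    by rewrite mulN1r mulrC ltr0_norm.
  rewrite -(mulr_powRB1 (normr_ge0 _) p0) mulrC.
  exact: (ler_wpM2l (powR_ge0 _ _) (uv x)).
have [ihv Ehv] := cond_bounded k mh hN.
have iup : leb.-integrable D01 (EFin \o (fun m => I (X m) * u (X m) `^ p)).
  apply: (@bounded_D01_integrable _ _ (N `^ p)).
    apply: measurable_funM; first exact: measurableT_comp (itv_ind_measurable _ _) mX1.
    exact: measurableT_comp mup mX1.
  move=> m _; have /andP[I0 I1] := I01 m.
  rewrite normrM (ger0_norm I0) (ger0_norm (powR_ge0 _ _)) -[leRHS]mul1r.
  apply: ler_pM; [exact: I0|exact: powR_ge0|exact: I1|].
  by apply: ge0_ler_powR; rewrite ?nnegrE ?normr_ge0 ?(ltW p0).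
split; first exact: iup.
set A := \int[leb]_(m in D01) (I (X m) * _); set B := \int[leb]_(m in D01) (`|G m| `^ p).
have iR := RintegrableD mD (RintegrableZl p^-1 mD iGp) (RintegrableZl (1 - p^-1) mD iup).
have p10 : 0 <= 1 - p^-1 by rewrite subr_ge0 invf_le1// ltW.
(* The tangent inequality leaves a multiple of [A] on the right; [A] is finite by truncation, so it
   can be absorbed. *)
have AB : A <= p^-1 * B + (1 - p^-1) * A.
  rewrite -(RintegralZl _ mD iGp) -(RintegralZl _ mD iup).
  rewrite -(RintegralD mD (RintegrableZl p^-1 mD iGp) (RintegrableZl (1 - p^-1) mD iup)).
  apply: (@le_trans _ _ (\int[leb]_(m in D01) (h (X m) * (I (X m) * v (X m))))).
    apply: (le_Rintegral mD iup ihv) => m _; have /andP[I0 _] := I01 m.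
    by apply: (le_trans (ler_wpM2l I0 (hv (X m)))); rewrite [leRHS]mulrCA.
  have k0 : - k.+1%:R <= k.+1%:R :> R by apply: (@le_trans _ _ 0); rewrite ?oppr_le0 ler0n.
  rewrite Ehv; apply: (le_Rintegral mD (itv_ind_G_integrable k0 mh hN) iR) => m _.
  have /andP[I0 I1] := I01 m.
  rewrite mulrCA; apply: (le_trans (ler_norm _)); rewrite normrM (ger0_norm I0) normrM hE.
  have y := young_tangent p1 (normr_ge0 (G m)) (normr_ge0 (clip N (v (X m)))).
  rewrite mulrC in y; apply: (le_trans (ler_wpM2l I0 y)); rewrite mulrDr; apply: lerD.
    rewrite -[leRHS]mul1r; apply: (ler_wpM2r _ I1).
    by rewrite mulr_ge0 ?invr_ge0 ?powR_ge0// ltW.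
  by rewrite mulrCA.
have : p^-1 * A <= p^-1 * B by lra.
by rewrite ler_pM2l// invr_gt0.
Qed.

(** Fatou's lemma as window and truncation level grow together. The finiteness of the power of [v]
    is part of the conclusion. *)
Lemma cond_power (p : R) : 1 < p -> leb.-integrable D01 (EFin \o (fun m => `|G m| `^ p)) ->
  leb.-integrable D01 (EFin \o (fun m => `|v (X m)| `^ p)) /\
  \int[leb]_(m in D01) (`|v (X m)| `^ p) <= \int[leb]_(m in D01) (`|G m| `^ p).
Proof.
move=> p1 iGp; have mv := RN_measurable.
apply: (ge0_Rintegral_le mD).
- exact: norm_powR_measurable (measurableT_comp mv mX1).
- by move=> m _; exact: powR_ge0.
apply: (@fatou_le R _ RR leb D01 (fun (k : nat) (m : RR) => itv_ind (- k.+1%:R) k.+1%:R (X m) * `|clip k.+1%:R (v (X m))| `^ p)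
  (fun m : RR => `|v (X m)| `^ p) _ mD).
- by move=> k; exact: integrable_measurableR (proj1 (cond_power_trunc k p1 iGp)).
- move=> k m _; rewrite mulr_ge0 ?powR_ge0//.
  have k0 : - k.+1%:R <= k.+1%:R :> R by apply: (@le_trans _ _ 0); rewrite ?oppr_le0 ler0n.
  by case/andP: (itv_ind01 (X m) k0).
- move=> m _; apply/cvgrPdist_le => ep ep0; near=> k.
  have -> : itv_ind (- k.+1%:R) k.+1%:R (X m) = 1 by near: k; exact: itv_ind_eventually.
  have kv : `|v (X m)| <= k.+1%:R.
    by apply: (@le_trans _ _ k%:R); [near: k; exact: nbhs_infty_ger|rewrite ler_nat].
  by rewrite (clip_id kv) mul1r subrr normr0 ltW.
- by move=> k; have [i1 h1] := cond_power_trunc k p1 iGp; rewrite (EFin_Rintegral mD i1) lee_fin.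
Unshelve. all: by end_near. Qed.

Lemma cond_expect (h : R -> R) (C : R) : leb.-integrable D01 (EFin \o (v \o X)) ->
  measurable_fun [set: RR] (h : RR -> R) -> (forall x, `|h x| <= C) ->
  \int[leb]_(m in D01) (h (X m) * v (X m)) = \int[leb]_(m in D01) (h (X m) * G m).
Proof.
move=> ivX mh hC.
have lim (w : R -> R) : leb.-integrable D01 (EFin \o w) ->
    \int[leb]_(m in D01) (h (X m) * (itv_ind (- k.+1%:R) k.+1%:R (X m) * w m)) @[k --> \oo] -->
    \int[leb]_(m in D01) (h (X m) * w m).
  move=> iw; have mw := integrable_measurableR iw.
  apply: (proj2 (dominated_cvg_Rintegral mD _ _ (RintegrableZl C mD (integrable_norm iw)) _)).
  - move=> k; apply: measurable_funM; first exact: measurableT_comp mh mX1.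
    by apply: measurable_funM => //; exact: measurableT_comp (itv_ind_measurable _ _) mX1.
  - move=> m _; apply/cvgrPdist_le => ep ep0; near=> k.
    have -> : itv_ind (- k.+1%:R) k.+1%:R (X m) = 1 by near: k; exact: itv_ind_eventually.
    by rewrite mul1r subrr normr0 ltW.
  - move=> k m _; have k0 : - k.+1%:R <= k.+1%:R :> R by apply: (@le_trans _ _ 0); rewrite ?oppr_le0 ler0n.
    have /andP[I0 I1] := itv_ind01 (X m) k0.
    rewrite mulrA !normrM (ger0_norm I0); apply: (ler_wpM2r (normr_ge0 _)).
    by rewrite -[leRHS]mulr1; apply: ler_pM.
apply: (cvg_unique _ (lim _ ivX)) => //.
rewrite (_ : (fun k => _) = (fun k => \int[leb]_(m in D01) (h (X m) * (itv_ind (- k.+1%:R) k.+1%:R (X m) * G m)))).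
  exact: lim _ iG.
by apply/funext => k; case: (cond_bounded k mh hC).
Unshelve. all: by end_near. Qed.

End conditional_expectation.

Lemma clip_sub_le (R : realType) (r y : R) : 0 <= r -> `|y - clip r y| <= `|y|.
Proof.
move=> r0; have h1 := ler_norm y; have h2 := ler_norm (- y); rewrite normrN in h2.
rewrite ler_norml /clip; have [ry|ry] := leP r y.
  by have [k|k] := leP (- r) r; move: ry k; lra.
by have [k|k] := leP (- r) y; move: ry k; lra.
Qed.

(** * Convergence of the mollified velocity *)

Section lipschitz_density.
Context (R : realType).
Notation RR := (measurableTypeR R).
Notation leb := (@lebesgue_measure R).
Notation D01 := (`]0%R, 1%R[%classic : set RR).

Definition bounded_lipschitz (u : R -> R) (C L : R) :=
  (forall x, `|u x| <= C) /\ (forall x y, `|u x - u y| <= L * `|x - y|).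

Lemma bounded_lipschitz_ge0 (u : R -> R) (C L : R) : bounded_lipschitz u C L -> 0 <= C /\ 0 <= L.
Proof.
move=> [uC uL]; split; first exact: le_trans (uC 0).
by have := uL 1 0; rewrite subr0 normr1 mulr1; exact: le_trans.
Qed.

Lemma bounded_lipschitz_continuous (u : R -> R) (C L : R) : bounded_lipschitz u C L -> continuous u.
Proof.
move=> bu x; have [_ L0] := bounded_lipschitz_ge0 bu; have [_ uL] := bu.
apply: continuous_epsilon => e e0; have L1 : 0 < L + 1 by rewrite ltr_wpDl.
exists (e / (L + 1)); first exact: divr_gt0.
move=> t; rewrite ltr_pdivlMr// => tx; apply: (le_trans (uL t x)); apply: le_trans (ltW tx).
by rewrite mulrC ler_wpM2l// lerDl.
Qed.

Context (X : R -> R).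
Hypothesis mX : measurable_fun D01 X.
Let mD := @mD01 R.

Lemma comp_bounded_integrable (f : R -> R) (C : R) : measurable_fun [set: RR] (f : RR -> R) ->
  (forall x, `|f x| <= C) -> leb.-integrable D01 (EFin \o (fun m => f (X m))).
Proof.
move=> mf fC; apply: (@bounded_D01_integrable _ _ C) => //; exact: measurableT_comp mf mX.
Qed.

Lemma comp_dist_cvg (f_ : nat -> R -> R) (f : R -> R) (C : R) :
  (forall n, measurable_fun [set: RR] (f_ n : RR -> R)) -> measurable_fun [set: RR] (f : RR -> R) ->
  (forall n x, `|f_ n x| <= C) -> (forall x, `|f x| <= C) -> (forall x, f_ ^~ x @ \oo --> f x) ->
  forall e, 0 < e -> exists n, \int[leb]_(m in D01) `|f (X m) - f_ n (X m)| <= e.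
Proof.
move=> mf_ mf f_C fC cf e e0.
have c : \int[leb]_(m in D01) `|f (X m) - f_ n (X m)| @[n --> \oo] --> \int[leb]_(m in D01) (cst 0 m : R).
  apply: (proj2 (dominated_cvg_Rintegral mD _ _ (@D01_cst_integrable R (C + C)) _)).
  - move=> n; apply: measurableT_comp => //.
    by apply: measurable_funB; [exact: measurableT_comp mf mX|exact: measurableT_comp (mf_ n) mX].
  - move=> m _; have : `|f (X m) - f_ n (X m)| @[n --> \oo] --> `|f (X m) - f (X m)|.
      by apply: cvg_norm; apply: cvgB; [exact: cvg_cst|exact: cf].
    by rewrite subrr normr0.
  - move=> n m _; rewrite normr_id; apply: (le_trans (ler_normB _ _)); exact: lerD.
rewrite Rintegral_D01_cst in c.
have /cvgrPdist_le/(_ e e0)[n _ h] := c.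
exists n; have := h n (leqnn n); rewrite sub0r normrN; exact: le_trans (ler_norm _).
Qed.

(** The functions that bounded Lipschitz functions approximate in [L^1] of the law of [X] form a
    class to which [bounded_class] applies; only indicators of rays require a construction. *)
Lemma lipschitz_dense (h : R -> R) (C : R) : measurable_fun [set: RR] (h : RR -> R) ->
  (forall x, `|h x| <= C) -> forall e : R, 0 < e ->
  exists u Cu L, bounded_lipschitz u Cu L /\ \int[leb]_(m in D01) `|h (X m) - u (X m)| <= e.
Proof.
move=> mh hC.
pose P (f : R -> R) := [/\ measurable_fun [set: RR] (f : RR -> R), exists C', forall x, `|f x| <= C' &
  forall e : R, 0 < e -> exists u Cu L, bounded_lipschitz u Cu L /\
     \int[leb]_(m in D01) `|f (X m) - u (X m)| <= e].
suff : P h by case.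
have int0 (f : R -> R) : \int[leb]_(m in D01) `|f (X m) - f (X m)| = 0.
  transitivity (\int[leb]_(m in D01) (cst 0 m : R)); last exact: Rintegral_D01_cst.
  by apply: eq_Rintegral => m _; rewrite subrr normr0.
have mbl u Cu L : bounded_lipschitz u Cu L -> measurable_fun [set: RR] (u : RR -> R).
  by move=> /bounded_lipschitz_continuous/continuous_measurable_fun.
have tri (f g k : R -> R) (e1 e2 : R) :
   measurable_fun [set: RR] (f : RR -> R) -> (exists C', forall x, `|f x| <= C') ->
   measurable_fun [set: RR] (g : RR -> R) -> (exists C', forall x, `|g x| <= C') ->
   measurable_fun [set: RR] (k : RR -> R) -> (exists C', forall x, `|k x| <= C') ->
   \int[leb]_(m in D01) `|f (X m) - g (X m)| <= e1 -> \int[leb]_(m in D01) `|g (X m) - k (X m)| <= e2 ->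
   \int[leb]_(m in D01) `|f (X m) - k (X m)| <= e1 + e2.
  move=> mf [Cf fC] mg [Cg gC] mk [Ck kC] h1 h2.
  have jf := comp_bounded_integrable mf fC; have jg := comp_bounded_integrable mg gC.
  have jk := comp_bounded_integrable mk kC.
  have j1 := integrable_norm (RintegrableB mD jf jg); have j2 := integrable_norm (RintegrableB mD jg jk).
  apply: le_trans (lerD h1 h2); rewrite -(RintegralD mD j1 j2).
  apply: (le_Rintegral mD (integrable_norm (RintegrableB mD jf jk)) (RintegrableD mD j1 j2)) => m _.
  exact: ler_distD.
apply: (@bounded_class R P _ _ _ _ _ h C mh hC).
- split; [exact: measurable_cst|by exists 1 => x; rewrite normr1|move=> e e0].
  exists (cst 1), 1, 0; split; last by rewrite int0 ltW.
  by split=> [x|x y]; rewrite ?normr1// subrr normr0 mul0r.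
- move=> a; split; [exact: le_ind_measurable|exists 1 => x; rewrite /le_ind; case: ifP => _; rewrite ?normr1 ?normr0//|].
  (* The step is shifted to the right by its own width so that it equals 1 up to and including [a];
     it then converges to the closed ray at every point, an atom at [a] included. *)
  move=> e e0; pose f_ (n : nat) (x : R) := stepk (n.+1%:R^-1) (a + n.+1%:R^-1) x.
  have n0 (n : nat) : 0 < n.+1%:R^-1 :> R by rewrite invr_gt0 ltr0n.
  have f1 n x : `|f_ n x| <= 1 by have := stepk_itv n.+1%:R^-1 (a + n.+1%:R^-1) x; rewrite ler_norml /f_; lra.
  have mf n : measurable_fun [set: RR] (f_ n : RR -> R).
    exact: continuous_measurable_fun (@stepk_continuous R _ _ (n0 n)).
  have le1 x : `|le_ind x a| <= 1 :> R by rewrite /le_ind; case: ifP => _; rewrite ?normr1 ?normr0.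
  have cf x : f_ ^~ x @ \oo --> le_ind x a.
    rewrite /le_ind; have [xa|ax] := leP x a.
      apply: cvg_near_cst; near=> n; apply: stepk_eq1; first exact: n0.
      by rewrite addrK.
    have c := @cvg_harmonic R.
    have xa0 : 0 < x - a by rewrite subr_gt0.
    have /cvgrPdist_lt/(_ _ xa0) := c; rewrite /harmonic => nn.
    apply: cvg_near_cst; apply: filterS nn => n; rewrite sub0r normrN (gtr0_norm (n0 n)) => nx.
    by apply: stepk_eq0; [exact: n0|rewrite -lerBrDl; exact: ltW].
  have [n hn] := comp_dist_cvg mf (@le_ind_measurable R a) f1 le1 cf e0.
  have [L L0 LP] := stepk_lipschitz (a + n.+1%:R^-1) (n0 n).
  by exists (f_ n), 1, L.
- move=> f g [mf [Cf fC] Ef] [mg [Cg gC] Eg]; split; first exact: measurable_funD.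
    by exists (Cf + Cg) => x; apply: (le_trans (ler_normD _ _)); exact: lerD.
  move=> e e0; have e2 : 0 < e / 2 by exact: divr_gt0.
  have [u [Cu [L [bu hu]]]] := Ef _ e2; have [u' [Cu' [L' [bu' hu']]]] := Eg _ e2.
  have [uC uL] := bu; have [uC' uL'] := bu'.
  exists (fun x => u x + u' x), (Cu + Cu'), (L + L'); split.
    split=> [x|x y]; first by apply: (le_trans (ler_normD _ _)); exact: lerD.
    rewrite opprD addrACA mulrDl; apply: (le_trans (ler_normD _ _)); exact: lerD.
  have j1 := RintegrableB mD (comp_bounded_integrable mf fC) (comp_bounded_integrable (mbl _ _ _ bu) uC).
  have j2 := RintegrableB mD (comp_bounded_integrable mg gC) (comp_bounded_integrable (mbl _ _ _ bu') uC').
  have j := RintegrableD mD (integrable_norm j1) (integrable_norm j2).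
  rewrite (splitr e); apply: le_trans (lerD hu hu').
  rewrite -(RintegralD mD (integrable_norm j1) (integrable_norm j2)).
  have bnd m : `|f (X m) + g (X m) - (u (X m) + u' (X m))| <= `|f (X m) - u (X m)| + `|g (X m) - u' (X m)|.
    by rewrite opprD addrACA; exact: ler_normD.
  have j3 : leb.-integrable D01 (EFin \o (fun m => `|f (X m) + g (X m) - (u (X m) + u' (X m))|)).
    apply: (dominated_integrable mD _ j); last by move=> m _; rewrite normr_id.
    apply: measurableT_comp => //.
    apply: measurable_funB; apply: measurable_funD; apply: measurableT_comp mX => //; exact: mbl.
  exact: (le_Rintegral mD j3 j (fun m _ => bnd m)).
- move=> c f [mf [Cf fC] Ef]; split.
  + by apply: measurable_funM => //; exact: measurable_cst.
  + by exists (`|c| * Cf) => x; rewrite normrM ler_wpM2l.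
  + move=> e e0; have c1 : 0 < `|c| + 1 by rewrite ltr_wpDl.
    have [u [Cu [L [bu hu]]]] := Ef _ (divr_gt0 e0 c1); have [uC uL] := bu.
    exists (fun x => c * u x), (`|c| * Cu), (`|c| * L); split.
      split=> [x|x y]; first by rewrite normrM ler_wpM2l.
      by rewrite -mulrBr normrM -mulrA ler_wpM2l.
    have j1 := integrable_norm (RintegrableB mD (comp_bounded_integrable mf fC) (comp_bounded_integrable (mbl _ _ _ bu) uC)).
    have -> : \int[leb]_(m in D01) `|c * f (X m) - c * u (X m)| = `|c| * \int[leb]_(m in D01) `|f (X m) - u (X m)|.
      by rewrite -(RintegralZl _ mD j1); apply: eq_Rintegral => m _; rewrite -mulrBr normrM.
    apply: (le_trans (ler_wpM2l (normr_ge0 c) hu)).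
    by rewrite mulrCA ler_piMr ?(ltW e0)// ler_pdivrMr// mul1r lerDl.
- move=> f_ f C' Pf fC cf.
  have mf_ n : measurable_fun [set: RR] (f_ n : RR -> R) by case: (Pf n).
  have mf : measurable_fun [set: RR] (f : RR -> R).
    by apply: (@measurable_fun_cvg _ _ _ _ (fun n => f_ n)) => // x _; exact: cf.
  have fC' x : `|f x| <= C'.
    have c : `|f_ n x| @[n --> \oo] --> `|f x| by apply: cvg_norm; exact: cf.
    rewrite -(cvg_lim _ c)//.
    by apply: limr_le; [apply/cvg_ex; eexists; exact: c|apply: nearW => n; exact: fC].
  split => //; first by exists C'.
  move=> e e0; have e2 : 0 < e / 2 by exact: divr_gt0.
  have [n hn] := comp_dist_cvg mf_ mf fC fC' cf e2.
  have [_ [Cn fCn] /(_ _ e2)[u [Cu [L [bu hu]]]]] := Pf n.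
  exists u, Cu, L; split => //; rewrite (splitr e).
  apply: (tri _ (f_ n)) hn hu => //; [by exists C'|by exists Cn|exact: mbl bu|by exists Cu; case: bu].
Unshelve. all: by end_near. Qed.

(** Truncate [v] at [N], approximate the truncation in [L^1], and truncate the approximation at [N]
    too: between functions bounded by [N], the squared distance is at most [2 N] times the
    distance. *)
Lemma lipschitz_dense_L2 (v : R -> R) : measurable_fun [set: RR] (v : RR -> R) ->
  L2 (fun m => v (X m)) -> forall e : R, 0 < e ->
  exists u Cu L, bounded_lipschitz u Cu L /\ \int[leb]_(m in D01) ((v (X m) - u (X m)) ^+ 2) <= e.
Proof.
move=> mv [mvX iv2] e e0.
have e4 : 0 < e / 4 by exact: divr_gt0.
have [N hN] : exists N : nat, \int[leb]_(m in D01) ((v (X m) - clip N%:R (v (X m))) ^+ 2) <= e / 4.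
  have c : \int[leb]_(m in D01) ((v (X m) - clip N%:R (v (X m))) ^+ 2) @[N --> \oo] -->
      \int[leb]_(m in D01) (cst 0 m : R).
    apply: (proj2 (dominated_cvg_Rintegral mD _ _ iv2 _)).
    - by move=> N; apply: measurable_funX; apply: measurable_funB => //; exact: clip_measurable.
    - move=> m _; apply/cvgrPdist_le => ep ep0; near=> N.
      have vN : `|v (X m)| <= N%:R by near: N; exact: nbhs_infty_ger.
      by rewrite (clip_id vN) !subrr expr0n/= subrr normr0 ltW.
    - move=> N m _; rewrite ger0_norm ?sqr_ge0// -[leRHS]real_normK ?num_real// -[leLHS]real_normK ?num_real//.
      rewrite ler_sqr ?nnegrE//; move: (v (X m)) => y.
      exact: clip_sub_le (ler0n R N).
  rewrite Rintegral_D01_cst in c.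
  have /cvgrPdist_le/(_ _ e4)[N _ h] := c.
  by exists N; have := h N (leqnn N); rewrite sub0r normrN; exact: le_trans (ler_norm _).
have N0 : 0 <= N%:R :> R by exact: ler0n.
have N8 : 0 < 8 * (N%:R + 1) :> R by lra.
have mc : measurable_fun [set: RR] (fun x : RR => clip N%:R (v x)) by exact: clip_measurable.
have bc x : `|clip N%:R (v x)| <= N%:R by have := clip_bnd (v x) N0; rewrite ler_norml.
(* The truncation error enters with factor 2 and contributes [e / 2]; the approximation error enters
   with factor [4 N], hence the tolerance [e / (8 (N + 1))]. *)
have [u [Cu [L [[uC uL] hu]]]] := lipschitz_dense mc bc (divr_gt0 e0 N8).
have cu x y : `|clip N%:R (u x) - clip N%:R (u y)| <= L * `|x - y|.
  by apply: (le_trans (clip_dist _ _ _)); exact: uL.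
have bu' x : `|clip N%:R (u x)| <= N%:R by have := clip_bnd (u x) N0; rewrite ler_norml.
exists (fun x => clip N%:R (u x)), N%:R, L; split; first by [].
have cont : measurable_fun [set: RR] (u : RR -> R).
  exact: continuous_measurable_fun (bounded_lipschitz_continuous (conj uC uL)).
have j0 := integrable_norm (RintegrableB mD (comp_bounded_integrable mc bc) (comp_bounded_integrable cont uC)).
have mvc : measurable_fun D01 (fun m => v (X m) - clip N%:R (v (X m))).
  by apply: measurable_funB => //; exact: clip_measurable.
have j1 : leb.-integrable D01 (EFin \o (fun m => (v (X m) - clip N%:R (v (X m))) ^+ 2)).
  have [_] : L2 (fun m => v (X m) - clip N%:R (v (X m))); last by [].
  apply: (L2D (conj mvX iv2)).
  by apply: (@L2_bounded _ _ N%:R) => [|m _]; [apply: measurableT_comp => //; exact: clip_measurable|rewrite normrN].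
have j2 := RintegrableD mD (RintegrableZl 2 mD j1) (RintegrableZl (4 * N%:R) mD j0).
have bnd m : (v (X m) - clip N%:R (u (X m))) ^+ 2 <=
    2 * (v (X m) - clip N%:R (v (X m))) ^+ 2 + 4 * N%:R * `|clip N%:R (v (X m)) - u (X m)|.
  set a := v (X m); set c := clip N%:R a; set y := u (X m); set d := clip N%:R y.
  have h1 : (a - d) ^+ 2 <= 2 * (a - c) ^+ 2 + 2 * (c - d) ^+ 2.
    have : 0 <= ((a - c) - (c - d)) ^+ 2 by exact: sqr_ge0.
    lra.
  have cN : `|c| <= N%:R by exact: bc.
  have h2 : `|c - d| <= `|c - y| by rewrite -{1}(clip_id cN); exact: clip_dist.
  have h3 : `|c - d| <= 2 * N%:R.
    by apply: (le_trans (ler_normB _ _)); have := bu' (X m); rewrite -/y -/d; lra.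
  have h4 : (c - d) ^+ 2 <= 2 * N%:R * `|c - y|.
    by rewrite -real_normK ?num_real// expr2; apply: ler_pM.
  lra.
have j3 : leb.-integrable D01 (EFin \o (fun m => (v (X m) - clip N%:R (u (X m))) ^+ 2)).
  apply: (dominated_integrable mD _ j2); last by move=> m _; rewrite ger0_norm ?sqr_ge0.
  apply: measurable_funX; apply: measurable_funB => //; apply: clip_measurable => //.
  exact: measurableT_comp cont mX.
apply: (le_trans (le_Rintegral mD j3 j2 (fun m _ => bnd m))).
rewrite (RintegralD mD (RintegrableZl 2 mD j1) (RintegrableZl (4 * N%:R) mD j0)) (RintegralZl _ mD j1) (RintegralZl _ mD j0).
have h5 : 4 * N%:R * (\int[leb]_(m in D01) `|clip N%:R (v (X m)) - u (X m)|) <= e / 2.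
  apply: (@le_trans _ _ (4 * N%:R * (e / (8 * (N%:R + 1))))); first by rewrite ler_wpM2l// mulr_ge0.
  rewrite mulrA ler_pdivrMr//; have := mulr_ge0 N0 (ltW e0); lra.
lra.
Unshelve. all: by end_near. Qed.

End lipschitz_density.

(** * Mollified velocity of a Lipschitz function of the position *)

Section velocity_limit.
Context (R : realType).
Notation RR := (measurableTypeR R).
Notation leb := (@lebesgue_measure R).
Notation D01 := (`]0%R, 1%R[%classic : set RR).
Let mD := @mD01 R.

Lemma L2_young_bounded (F f h : R -> R) (C k : R) : L2 F -> L2 f -> measurable_fun D01 h ->
  (forall m, 0 < m < 1 -> `|h m| <= C) -> 0 < k ->
  leb.-integrable D01 (EFin \o (fun m => F m * (f m * h m))) /\
  `|\int[leb]_(m in D01) (F m * (f m * h m))| <=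
  C * (k * \int[leb]_(m in D01) (F m ^+ 2) + k^-1 * \int[leb]_(m in D01) (f m ^+ 2)).
Proof.
move=> hF hf mh hC k0; have i1 := L2_mul hF (L2_mul_bounded hf mh hC).
split; first exact: i1.
have C0 : 0 <= C by apply: le_trans (hC (1 / 2) _); rewrite ?normr_ge0//; lra.
apply: (le_trans (le_normr_Rintegral mD i1)).
apply: le_trans (ler_wpM2l C0 (L2_young k0 hF hf)).
have i2 := integrable_norm (L2_mul hF hf).
rewrite -(RintegralZl _ mD i2).
apply: (le_Rintegral mD (integrable_norm i1) (RintegrableZl C mD i2)) => m; rewrite D01E => m01.
by rewrite /= mulrA normrM mulrC; apply: (ler_wpM2r (normr_ge0 _)); exact: hC.
Qed.

Context (X : R -> R) (e : R).
Hypothesis e0 : 0 < e.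
Hypothesis mX : measurable_fun D01 X.
Notation Y := (mollY e X).

Let mY : measurable_fun D01 Y.
Proof. exact: measurable_funTS (continuous_measurable_fun (mollY_continuous e0 mX)). Qed.

Lemma mollJB (g g' : R -> R) x : leb.-integrable D01 (EFin \o g) -> leb.-integrable D01 (EFin \o g') ->
  mollJ e X (fun m => g m - g' m) x = mollJ e X g x - mollJ e X g' x.
Proof.
move=> ig ig'; rewrite /mollJ -(RintegralB mD (kernX_integrable e0 mX x ig) (kernX_integrable e0 mX x ig')).
by apply: eq_Rintegral => m _; rewrite mulrBl.
Qed.

Lemma velB (g g' : R -> R) x : leb.-integrable D01 (EFin \o g) -> leb.-integrable D01 (EFin \o g') ->
  vel e X (fun m => g m - g' m) x = vel e X g x - vel e X g' x.
Proof. by move=> ig ig'; rewrite /vel (mollJB x ig ig') mulrBl. Qed.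

Lemma kern_near (x y : R) (u : R -> R) (C L : R) : bounded_lipschitz u C L ->
  `|(u y - u x) * kern e x y| <= L * e * kern e x y.
Proof.
move=> bu; have [_ L0] := bounded_lipschitz_ge0 bu; have [_ uL] := bu.
rewrite normrM (ger0_norm (kern_ge0 x y e0)).
have [xy|yx] := leP x y; first by rewrite kern_eq0 ?mulr0//; left.
have [ye|ey] := leP y (x - e); first by rewrite kern_eq0 ?mulr0//; right.
apply: (ler_wpM2r (kern_ge0 _ _ e0)); apply: (le_trans (uL y x)); apply: (ler_wpM2l L0).
by rewrite ler_norml; lra.
Qed.

(** The first term comes from the width [e] of the kernel, the second from the tilt [e] in the
    denominator. The ratio [e / mollr] need not be small where few particles are present; it becomes
    small only after integration along the flow. *)
Lemma vel_lipschitz_dist (u : R -> R) (C L : R) x : bounded_lipschitz u C L ->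
  `|vel e X (fun m => u (X m)) x - u x| <= L * e + C * (e / mollr e X x).
Proof.
move=> bu; have [C0 L0] := bounded_lipschitz_ge0 bu; have [uC uL] := bu.
have mu := continuous_measurable_fun (bounded_lipschitz_continuous bu).
have iu := comp_bounded_integrable mX mu uC.
have i1 := @D01_cst_integrable R 1.
have r0 := mollr_gt0 X e0 x.
have k1 := kernX_integrable e0 mX x iu; have k2 := kernX_integrable e0 mX x i1.
have E : vel e X (fun m => u (X m)) x - u x =
    (mollJ e X (fun m => u (X m)) x - u x * mollJ e X (cst 1) x - u x * e) / mollr e X x.
  rewrite /vel /mollr; move: r0; rewrite /mollr; move: (mollJ _ _ _ x) (mollJ _ _ _ x) => a c ce.
  by field; rewrite gt_eqF.
have h1 : `|mollJ e X (fun m => u (X m)) x - u x * mollJ e X (cst 1) x| <= L * e * mollJ e X (cst 1) x.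
  rewrite /mollJ -(RintegralZl _ mD k2) -(RintegralB mD k1 (RintegrableZl (u x) mD k2)).
  have kB := RintegrableB mD k1 (RintegrableZl (u x) mD k2).
  apply: (le_trans (le_normr_Rintegral mD kB)).
  rewrite -(RintegralZl _ mD k2); apply: (le_Rintegral mD (integrable_norm kB) (RintegrableZl (L * e) mD k2)) => m _.
  by rewrite /= !mul1r -mulrBl; exact: kern_near bu.
rewrite E normrM normfV (gtr0_norm r0).
have k3 : mollJ e X (cst 1) x <= mollr e X x by rewrite /mollr lerDl ltW.
have Le : 0 <= L * e by rewrite mulr_ge0// ltW.
have h2 : `|u x * e| <= C * e by rewrite normrM (gtr0_norm e0) ler_wpM2r ?(ltW e0).
have h3 := le_trans (ler_normB (mollJ e X (fun m => u (X m)) x - u x * mollJ e X (cst 1) x) (u x * e))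
   (lerD (le_trans h1 (ler_wpM2l Le k3)) h2).
have ri : 0 <= (mollr e X x)^-1 by rewrite invr_ge0 ltW.
apply: (le_trans (ler_wpM2r ri h3)).
by rewrite mulrDl mulfK ?gt_eqF// -mulrA.
Qed.

Lemma vel_measurable (g : R -> R) : leb.-integrable D01 (EFin \o g) ->
  measurable_fun D01 (fun m => vel e X g (Y m)).
Proof.
move=> ig; exact: measurableT_comp (continuous_measurable_fun (vel_continuous e0 mX ig)) mY.
Qed.

Lemma sqr_powR (x : R) : `|x| `^ 2 = x ^+ 2.
Proof. by rewrite powR_mulrn// real_normK ?num_real. Qed.

Lemma vel_L2 (g : R -> R) : L2 g -> L2 (fun m => vel e X g (Y m)) /\
  \int[leb]_(m in D01) (vel e X g (Y m) ^+ 2) <= \int[leb]_(m in D01) (g m ^+ 2).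
Proof.
move=> hg; have ig := L2_integrable hg; have [mg ig2] := hg.
have [K K0 KP] := kern_lipschitz R; split.
  exact: (L2_bounded (vel_measurable ig) (fun m _ => vel_bounded e0 mX (Y m) K0 KP ig)).
have := @vel_contract R e X e0 mX 2 g _ mg _.
under eq_Rintegral do rewrite sqr_powR; under [X in _ <= X]eq_Rintegral do rewrite sqr_powR.
apply; first by rewrite ltr1n.
by apply: eq_integrable ig2 => // m _; rewrite /= sqr_powR.
Qed.

(** The change of variables of [mollY_integral] multiplies by [mollr] and cancels the ratio, leaving
    [e] times an integral of [psi] over a bounded set: labels in sparse regions are few. *)
Lemma mollr_ratio_integral (psi : R -> R) (C r : R) : continuous psi -> (forall x, 0 <= psi x <= C) ->
  0 <= r -> (forall x, r <= `|x| -> psi x = 0) ->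
  leb.-integrable D01 (EFin \o (fun m => psi (Y m) * (e / mollr e X (Y m)))) /\
  \int[leb]_(m in D01) (psi (Y m) * (e / mollr e X (Y m))) <= e * (C * (2 * r)).
Proof.
move=> cpsi psiC r0 psi0.
have C0 : 0 <= C by have := psiC 0; lra.
have cf : continuous (fun x => psi x * (e / mollr e X x)).
  move=> x; apply: cvgM; first exact: cpsi.
  apply: cvgM; first exact: cvg_cst.
  exact: cvgV (lt0r_neq0 (mollr_gt0 X e0 x)) (@mollr_continuous R e X e0 mX x).
have f0 x : 0 <= psi x * (e / mollr e X x).
  by rewrite mulr_ge0 ?divr_ge0 ?(ltW e0) ?(ltW (mollr_gt0 X e0 x))//; case/andP: (psiC x).
split.
  apply: (@bounded_D01_integrable _ _ C).
    exact: measurableT_comp (continuous_measurable_fun cf) mY.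
  move=> m _; rewrite ger0_norm//; have /andP[p0 p1] := psiC (Y m).
  rewrite -[leRHS]mulr1; apply: ler_pM => //.
    by rewrite divr_ge0 ?(ltW e0) ?(ltW (mollr_gt0 X e0 _)).
  by rewrite ler_pdivrMr ?mollr_gt0// mul1r mollr_ge.
rewrite (mollY_integral e0 mX cf f0); set a := Y 0; set c := Y 1.
have mI : measurable (`[a, c] : set RR) by exact: measurable_itv.
have mr : measurable (`[- r, r] : set RR) by exact: measurable_itv.
have -> : \int[leb]_(x in `[a, c]) (psi x * (e / mollr e X x) * mollr e X x) = \int[leb]_(x in `[a, c]) (e * psi x).
  by apply: eq_Rintegral => x _; rewrite -mulrA divfK ?gt_eqF ?mollr_gt0// mulrC.
have ip := continuous_itv_integrable a c cpsi.
rewrite (RintegralZl _ mI ip); apply: (ler_wpM2l (ltW e0)).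
have mp : measurable_fun (`[a, c] : set RR) psi by exact: measurable_funTS (continuous_measurable_fun cpsi).
apply: (proj2 (ge0_Rintegral_le mI mp _ _)); first by move=> x _; case/andP: (psiC x).
apply: (@le_trans _ _ (\int[leb]_(x in `[a, c]) (C%:E * (\1_(`[(- r)%R, r]%classic : set RR) x)%:E))%E).
  apply: ge0_le_integral => //.
  - by move=> x _; rewrite lee_fin; case/andP: (psiC x).
  - exact/measurable_EFinP.
  - by apply/measurable_EFinP/measurable_funTS; apply: measurable_funM => //; exact: measurable_indic.
  - move=> x _; rewrite -EFinM lee_fin indicE; have [h|h] := leP r `|x|.
      by rewrite psi0// mulr_ge0.
    rewrite mem_set ?mulr1; first by case/andP: (psiC x).
    by rewrite /= in_itv/= -ler_norml ltW.
rewrite ge0_integralZl//; last by apply/measurable_EFinP/measurable_funTS; exact: measurable_indic.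
rewrite integral_indic// EFinM; apply: lee_wpmul2l; first by rewrite lee_fin.
apply: (@le_trans _ _ (leb (`[- r, r]%classic : set RR))).
  by apply: le_measure; rewrite ?inE//; exact: measurableI.
have l : (leb (`[(- r)%R, r]%classic : set RR) <= (2 * r)%:E)%E.
  rewrite lebesgue_measure_itv/= lte_fin; case: ifP => _; last by rewrite lee_fin mulr_ge0.
  by rewrite EFinN -EFinB lee_fin; lra.
exact: l.
Qed.

Context (F : R -> R).
Hypothesis hF : L2 F.

Lemma vel_lipschitz_error (u psi : R -> R) (Cu L C Lp r k : R) :
  bounded_lipschitz u Cu L -> bounded_lipschitz psi C Lp -> 0 <= r ->
  (forall x, r <= `|x| -> psi x = 0) -> 0 < k ->
  leb.-integrable D01 (EFin \o (fun m => F m * ((vel e X (fun m => u (X m)) (Y m) - u (Y m)) * psi (Y m)))) /\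
  `|\int[leb]_(m in D01) (F m * ((vel e X (fun m => u (X m)) (Y m) - u (Y m)) * psi (Y m)))| <=
  L * e * C * \int[leb]_(m in D01) `|F m| +
  Cu * (k * \int[leb]_(m in D01) (F m ^+ 2) + k^-1 * (C * (e * (C * (2 * r))))).
Proof.
move=> bu bp r0 psi0 k0.
have [Cu0 L0] := bounded_lipschitz_ge0 bu; have [uC uL] := bu.
have [C0 Lp0] := bounded_lipschitz_ge0 bp; have [pC pL] := bp.
have mu := continuous_measurable_fun (bounded_lipschitz_continuous bu).
have mp := continuous_measurable_fun (bounded_lipschitz_continuous bp).
have iu := comp_bounded_integrable mX mu uC.
have hu : L2 (fun m => u (X m)) by apply: (@L2_bounded _ _ Cu) => //; exact: measurableT_comp mu mX.
have hV : L2 (fun m => vel e X (fun m => u (X m)) (Y m) - u (Y m)).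
  have [h1 _] := vel_L2 hu; apply: (L2D h1).
  apply: (@L2_bounded _ _ Cu) => [|m _]; last by rewrite normrN.
  by apply: measurableT_comp => //; exact: measurableT_comp mu mY.
have mpY : measurable_fun D01 (fun m => psi (Y m)) by exact: measurableT_comp mp mY.
have [i1 _] := L2_young_bounded hF hV mpY (fun m _ => pC (Y m)) k0.
split; first exact: i1.
(* The ratio is at most 1, so [q <= C] and [q^2 <= C q]; the integral of [q] of order [e] thus
   controls the square needed against [F]. *)
pose q m := `|psi (Y m)| * (e / mollr e X (Y m)).
have cn : continuous (fun x => `|psi x|).
  by move=> x; apply: cvg_norm; exact: (bounded_lipschitz_continuous bp).
have nC x : 0 <= `|psi x| <= C by rewrite normr_ge0 pC.
have n0 x : r <= `|x| -> `|psi x| = 0 by move=> /psi0 ->; rewrite normr0.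
have [iq hq] := mollr_ratio_integral cn nC r0 n0.
have ratio01 m : 0 <= e / mollr e X (Y m) <= 1.
  by rewrite divr_ge0 ?(ltW e0) ?(ltW (mollr_gt0 X e0 _))//= ler_pdivrMr ?mollr_gt0// mul1r mollr_ge.
have q0C m : 0 <= q m <= C.
  have /andP[a1 a2] := ratio01 m; have /andP[b1 b2] := nC (Y m).
  by rewrite /q mulr_ge0//= -[leRHS]mulr1; apply: ler_pM.
have mq := integrable_measurableR iq.
have hq2 : L2 q.
  by apply: (L2_bounded mq) => m _; have /andP[a1 a2] := q0C m; rewrite ger0_norm//; exact: a2.
have iF := integrable_norm (L2_integrable hF).
have iFq := integrable_norm (L2_mul hF hq2).
have iR := RintegrableD mD (RintegrableZl (L * e * C) mD iF) (RintegrableZl Cu mD iFq).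
apply: (le_trans (le_normr_Rintegral mD i1)).
apply: (@le_trans _ _ (L * e * C * (\int[leb]_(m in D01) `|F m|) + Cu * \int[leb]_(m in D01) `|F m * q m|)).
  rewrite -(RintegralZl _ mD iF) -(RintegralZl _ mD iFq).
  rewrite -(RintegralD mD (RintegrableZl (L * e * C) mD iF) (RintegrableZl Cu mD iFq)).
  apply: (le_Rintegral mD (integrable_norm i1) iR) => m _.
  rewrite /= 2!normrM [`|F m * q m|]normrM (ger0_norm (proj1 (andP (q0C m)))).
  have h := vel_lipschitz_dist (Y m) bu.
  have h2 := ler_wpM2l (normr_ge0 (F m)) (ler_wpM2r (normr_ge0 (psi (Y m))) h).
  apply: (le_trans h2); rewrite mulrDl mulrDr; apply: lerD.
    rewrite [leRHS]mulrC; apply: (ler_wpM2l (normr_ge0 _)); apply: ler_wpM2l => //.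
    by rewrite mulr_ge0// ltW.
  by rewrite /q; move: (psi (Y m)) (mollr _ _ _) (F m) => a1 a2 a3; rewrite le_eqVlt; apply/orP; left; apply/eqP; ring.
rewrite lerD2l; apply: (ler_wpM2l Cu0); apply: (le_trans (L2_young k0 hF hq2)); rewrite lerD2l.
have k'0 : 0 <= k^-1 by rewrite invr_ge0 ltW.
apply: (ler_wpM2l k'0); apply: le_trans (ler_wpM2l C0 hq).
rewrite -(RintegralZl _ mD iq); apply: (le_Rintegral mD (proj2 hq2) (RintegrableZl C mD iq)) => m _.
by have /andP[a1 a2] := q0C m; rewrite expr2; exact: ler_wpM2r.
Qed.

End velocity_limit.

Lemma inv_budget (R : realType) (C k eta D : R) : 0 <= C -> 0 < k -> 0 < eta ->
  D <= eta * k / (8 * (C + 1)) -> 2 * (C * (k^-1 * D)) <= eta / 4.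
Proof.
move=> C0 k0 eta0 hD; have C8 : 0 < 8 * (C + 1) by lra.
have h : k^-1 * D <= eta / (8 * (C + 1)) by rewrite ler_pdivrMl// mulrA [k * _]mulrC.
have h1 := ler_wpM2l C0 h; have q0 : 0 < eta / (8 * (C + 1)) by exact: divr_gt0.
have E : eta / (8 * (C + 1)) * (8 * (C + 1)) = eta by rewrite divfK// gt_eqF.
move: (eta / _) q0 h1 E => q q0 h1 E; lra.
Qed.

(** * Weak convergence of the velocity along the flow *)

Section velocity_convergence.
Context (R : realType).
Notation RR := (measurableTypeR R).
Notation leb := (@lebesgue_measure R).
Notation D01 := (`]0%R, 1%R[%classic : set RR).
Let mD := @mD01 R.

Lemma bounded_lipschitzM (u w : R -> R) (C L C' L' : R) : bounded_lipschitz u C L ->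
  bounded_lipschitz w C' L' -> bounded_lipschitz (fun x => u x * w x) (C * C') (C * L' + C' * L).
Proof.
move=> bu bw; have [C0 L0] := bounded_lipschitz_ge0 bu; have [C'0 L'0] := bounded_lipschitz_ge0 bw.
have [uC uL] := bu; have [wC wL] := bw; split=> [x|x y]; first by rewrite normrM; exact: ler_pM.
rewrite (_ : u x * w x - u y * w y = u x * (w x - w y) + w y * (u x - u y)); last ring.
apply: (le_trans (ler_normD _ _)); rewrite !normrM mulrDl -!mulrA.
by apply: lerD; apply: ler_pM.
Qed.

Lemma lipschitz_clip (h : R -> R) (C L r : R) : bounded_lipschitz h C L -> 0 <= r ->
  (forall x, r <= `|x| -> h x = 0) ->
  forall x y, `|h x - h y| <= L * `|clip r x - clip r y|.
Proof.
move=> [_ hL] r0 h0 x y.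
have hc z : h (clip r z) = h z.
  have [zr|rz] := leP `|z| r; first by rewrite clip_id.
  rewrite [RHS]h0 ?(ltW rz)// h0// /clip.
  have [z1|z1] := leP r z; first by rewrite max_r ?ger0_norm// ge0_cp// lerNl (le_trans _ r0)// oppr_le0.
  have z2 : z < - r by move: rz; rewrite ltr_normr => /orP[|]; lra.
  by rewrite max_l ?(ltW z2)// normrN ger0_norm.
by rewrite -(hc x) -(hc y); exact: hL.
Qed.

Context (M X G v F : R -> R).
Hypothesis gX : galois M X.
Hypothesis mM : measurable_fun setT M.
Hypothesis M01 : forall x, 0 <= M x <= 1.
Hypothesis mX : measurable_fun setT X.
Hypothesis hG : L2 G.
Hypothesis mv : measurable_fun [set: RR] (v : RR -> R).
Hypothesis hv : L2 (fun m => v (X m)).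
Hypothesis cond : forall (h : R -> R) (C : R), measurable_fun [set: RR] (h : RR -> R) -> (forall x, `|h x| <= C) ->
  \int[leb]_(m in D01) (h (X m) * v (X m)) = \int[leb]_(m in D01) (h (X m) * G m).
Hypothesis hF : L2 F.

Let mX1 : measurable_fun D01 X. Proof. exact: measurable_funTS. Qed.

(** For fixed [x] the kernel is a bounded function of the position, so it cannot distinguish [G]
    from its conditional expectation. *)
Lemma vel_cond (e x : R) : 0 < e -> vel e X G x = vel e X (fun m => v (X m)) x.
Proof.
move=> e0; rewrite /vel; congr (_ / _); rewrite /mollJ.
have [K K0 KP] := kern_lipschitz R.
have mk := continuous_measurable_fun (@kern_continuous R e x e0).
have kC y : `|kern e x y| <= K / e.
  by rewrite ger0_norm ?kern_ge0//; exact: (proj1 (KP e x x y y e0)).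
have := cond mk kC => h.
transitivity (\int[leb]_(m in D01) (kern e x (X m) * G m)); first by apply: eq_Rintegral => m _; rewrite mulrC.
by rewrite -h; apply: eq_Rintegral => m _; rewrite mulrC.
Qed.

Lemma comp_mollY_dist (h : R -> R) (C L r e k : R) : bounded_lipschitz h C L -> 0 <= r ->
  (forall x, r <= `|x| -> h x = 0) -> 0 < e -> 0 < k ->
  `|\int[leb]_(m in D01) (F m * h (mollY e X m)) - \int[leb]_(m in D01) (F m * h (X m))| <=
  k * \int[leb]_(m in D01) (F m ^+ 2) + k^-1 * (2 * C * L * (e * (1 + 2 * r ^+ 2))).
Proof.
move=> bh r0 h0 e0 k0; have [C0 L0] := bounded_lipschitz_ge0 bh; have [hC _] := bh.
have mY : measurable_fun D01 (mollY e X).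
  exact: measurable_funTS (continuous_measurable_fun (mollY_continuous e0 mX1)).
apply: (le_trans (clip_fun_dist r0 k0 mY mX1 hF (bounded_lipschitz_continuous bh) L0 hC (lipschitz_clip bh r0 h0))).
rewrite lerD2l; apply: ler_wpM2l; first by rewrite invr_ge0 ltW.
apply: ler_wpM2l; first by rewrite !mulr_ge0.
exact: mollY_clip_dist e0 r0 gX mM M01.
Qed.

(* The error splits into the contraction applied to [v - u] for a Lipschitz [u] close
   to [v] in L^2, plus a term of order [e] for [u] itself. *)
Lemma velocity_decomp (psi u : R -> R) (C Lp Cu L r e k1 k2 : R) :
  bounded_lipschitz psi C Lp -> bounded_lipschitz u Cu L -> 0 <= r ->
  (forall x, r <= `|x| -> psi x = 0) -> 0 < e -> 0 < k1 -> 0 < k2 ->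
  `|\int[leb]_(m in D01) (F m * (vel e X G (mollY e X m) * psi (mollY e X m))) -
    \int[leb]_(m in D01) (F m * (v (X m) * psi (X m)))| <=
  2 * (C * (k1 * \int[leb]_(m in D01) (F m ^+ 2) + k1^-1 * \int[leb]_(m in D01) ((v (X m) - u (X m)) ^+ 2))) +
  (Cu + 1) * (k2 * \int[leb]_(m in D01) (F m ^+ 2)) +
  e * (L * C * \int[leb]_(m in D01) `|F m| + Cu * (k2^-1 * (C * (C * (2 * r)))) +
       k2^-1 * (2 * (Cu * C) * (Cu * Lp + C * L) * (1 + 2 * r ^+ 2))).
Proof.
move=> bp bu r0 psi0 e0 k10 k20.
have [Cu0 L0] := bounded_lipschitz_ge0 bu; have [uC uL] := bu.
have [C0 Lp0] := bounded_lipschitz_ge0 bp; have [pC pL] := bp.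
have mu := continuous_measurable_fun (bounded_lipschitz_continuous bu).
have mp := continuous_measurable_fun (bounded_lipschitz_continuous bp).
pose Y := mollY e X.
have mY : measurable_fun D01 Y.
  exact: measurable_funTS (continuous_measurable_fun (mollY_continuous e0 mX1)).
have muX : measurable_fun D01 (fun m => u (X m)) by exact: measurableT_comp mu mX1.
have muY : measurable_fun D01 (fun m => u (Y m)) by exact: measurableT_comp mu mY.
have mpX : measurable_fun D01 (fun m => psi (X m)) by exact: measurableT_comp mp mX1.
have mpY : measurable_fun D01 (fun m => psi (Y m)) by exact: measurableT_comp mp mY.
have hu : L2 (fun m => u (X m)) by apply: (@L2_bounded _ _ Cu).
have huY : L2 (fun m => u (Y m)) by apply: (@L2_bounded _ _ Cu).
have hvu : L2 (fun m => v (X m) - u (X m)).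
  by apply: (L2D hv); apply: (@L2_bounded _ _ Cu) => [|m _]; [exact: measurableT_comp|rewrite normrN].
set D := \int[leb]_(m in D01) ((v (X m) - u (X m)) ^+ 2).
set I2 := \int[leb]_(m in D01) (F m ^+ 2).
have iv := L2_integrable hv; have iu := L2_integrable hu.
have [hV hVD] := vel_L2 e0 mX1 hvu.
have [ia ha] := L2_young_bounded hF hV mpY (fun m _ => pC (Y m)) k10.
have [id hd] := L2_young_bounded hF hvu mpX (fun m _ => pC (X m)) k10.
have [ib hb] := vel_lipschitz_error e0 mX1 hF bu bp r0 psi0 k20.
have bup := bounded_lipschitzM bu bp.
have up0 x : r <= `|x| -> u x * psi x = 0 by move=> /psi0 ->; rewrite mulr0.
have hc := comp_mollY_dist bup r0 up0 e0 k20.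
have [ic _] := L2_young_bounded hF huY mpY (fun m _ => pC (Y m)) k10.
have [ic' _] := L2_young_bounded hF hu mpX (fun m _ => pC (X m)) k10.
have [iw _] := L2_young_bounded hF hv mpX (fun m _ => pC (X m)) k10.
set Ta := \int[leb]_(m in D01) _ in ha; set Td := \int[leb]_(m in D01) _ in hd; set Tb := \int[leb]_(m in D01) _ in hb.
set Tc := \int[leb]_(m in D01) _ in hc; set Tc' := \int[leb]_(m in D01) _ in hc.
have E1 : \int[leb]_(m in D01) (F m * (vel e X G (Y m) * psi (Y m))) = Ta + Tb + Tc.
  rewrite /Ta /Tb /Tc -(RintegralD mD ia ib) -(RintegralD mD (RintegrableD mD ia ib) ic).
  apply: eq_Rintegral => m _; rewrite (vel_cond _ e0) (velB e0 mX1 _ iv iu) -/Y.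
  by move: (vel _ _ _ _) (vel _ _ _ _) => a c; ring.
have E2 : \int[leb]_(m in D01) (F m * (v (X m) * psi (X m))) = Td + Tc'.
  rewrite /Td /Tc' -(RintegralD mD id ic'); apply: eq_Rintegral => m _; ring.
rewrite -/Y E1 E2.
have hVD' : C * (k1 * I2 + k1^-1 * \int[leb]_(m in D01) (vel e X (fun m => v (X m) - u (X m)) (Y m) ^+ 2)) <=
    C * (k1 * I2 + k1^-1 * D).
  by apply: (ler_wpM2l C0); rewrite lerD2l; apply: ler_wpM2l hVD; rewrite invr_ge0 ltW.
have {}ha := le_trans ha hVD'.
have -> : Ta + Tb + Tc - (Td + Tc') = Ta + Tb + (Tc - Tc') - Td by ring.
apply: (le_trans (ler_normB _ _)); apply: (le_trans (lerD (ler_normD _ _) (lexx _))).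
apply: (le_trans (lerD (lerD (ler_normD _ _) (lexx _)) (lexx _))).
apply: (le_trans (lerD (lerD (lerD ha hb) hc) hd)).
rewrite le_eqVlt; apply/orP; left; apply/eqP; rewrite /= -/I2 -/D.
by move: (\int[leb]_(m in D01) `|F m|) => I1; ring.
Qed.

Lemma velocity_limit (psi : R -> R) (C Lp r eta : R) : bounded_lipschitz psi C Lp -> 0 <= r ->
  (forall x, r <= `|x| -> psi x = 0) -> 0 < eta ->
  exists2 e1 : R, 0 < e1 & forall e, 0 < e -> e <= e1 ->
  `|\int[leb]_(m in D01) (F m * (vel e X G (mollY e X m) * psi (mollY e X m))) -
    \int[leb]_(m in D01) (F m * (v (X m) * psi (X m)))| <= eta.
Proof.
move=> bp r0 psi0 eta0; have [C0 Lp0] := bounded_lipschitz_ge0 bp.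
set I2 := \int[leb]_(m in D01) (F m ^+ 2).
have I20 : 0 <= I2 by apply: Rintegral_ge0 => m _; exact: sqr_ge0.
have d1 : 0 < 8 * (C + 1) * (I2 + 1) by rewrite !mulr_gt0// ltr_wpDl.
(* The order of choices matters: [k1] fixes how well [u] approximates [v], the bound [Cu] of [u]
   then fixes [k2], and [e] comes last since [Gam] involves the Lipschitz constant of [u]. Each of
   the four error terms gets [eta / 4]. *)
pose k1 := eta / (8 * (C + 1) * (I2 + 1)).
have k10 : 0 < k1 by exact: divr_gt0.
have C8 : 0 < 8 * (C + 1) by rewrite mulr_gt0// ltr_wpDl.
have [u [Cu [L [bu hu]]]] := lipschitz_dense_L2 mX1 mv hv (divr_gt0 (mulr_gt0 eta0 k10) C8).
have [Cu0 L0] := bounded_lipschitz_ge0 bu.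
have d2 : 0 < 4 * (Cu + 1) * (I2 + 1) by rewrite !mulr_gt0// ltr_wpDl.
pose k2 := eta / (4 * (Cu + 1) * (I2 + 1)).
have k20 : 0 < k2 by exact: divr_gt0.
set Gam := L * C * \int[leb]_(m in D01) `|F m| + Cu * (k2^-1 * (C * (C * (2 * r)))) +
       k2^-1 * (2 * (Cu * C) * (Cu * Lp + C * L) * (1 + 2 * r ^+ 2)).
exists (eta / (4 * (`|Gam| + 1))); first by rewrite divr_gt0// mulr_gt0// ltr_wpDl.
move=> e e0 ee1; apply: (le_trans (velocity_decomp bp bu r0 psi0 e0 k10 k20)).
rewrite -/I2 -/Gam.
have h1 : 2 * (C * (k1 * I2)) <= eta / 4.
  have : C * I2 <= (C + 1) * (I2 + 1) by apply: ler_pM => //; rewrite lerDl.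
  have : k1 * (8 * (C + 1) * (I2 + 1)) = eta by rewrite /k1 divfK// gt_eqF.
  move: k10; rewrite -/k1; move: (k1) => k k0 E.
  move=> /(ler_wpM2l (ltW k0)); lra.
have h2 : 2 * (C * (k1^-1 * \int[leb]_(m in D01) ((v (X m) - u (X m)) ^+ 2))) <= eta / 4.
  exact: inv_budget.
have h3 : (Cu + 1) * (k2 * I2) <= eta / 4.
  have : (Cu + 1) * I2 <= (Cu + 1) * (I2 + 1) by rewrite ler_wpM2l ?lerDl ?addr_ge0.
  have : k2 * (4 * (Cu + 1) * (I2 + 1)) = eta by rewrite /k2 divfK// gt_eqF.
  move: k20; rewrite -/k2; move: (k2) => k k0 E.
  move=> /(ler_wpM2l (ltW k0)); lra.
have h4 : e * Gam <= eta / 4.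
  have G1 : 0 < 4 * (`|Gam| + 1) by rewrite mulr_gt0// ltr_wpDl.
  move: ee1; rewrite ler_pdivlMr// => ee1.
  have := ler_wpM2l (ltW e0) (ler_norm Gam); move: ee1; move: (`|Gam|) => g; lra.
rewrite mulrDr mulrDr; lra.
Qed.

End velocity_convergence.

(** * Transport of functions of the label *)

Section test_functions.
Context (R : realType).
Notation RR := (measurableTypeR R).

Lemma Rintegral_sum d (S : measurableType d) (mu : {measure set S -> \bar R}) (D : set S)
    (I : Type) (s : seq I) (f : I -> S -> R) : measurable D ->
  (forall i, mu.-integrable D (EFin \o f i)) ->
  mu.-integrable D (EFin \o (fun x => \sum_(i <- s) f i x)) /\
  \int[mu]_(x in D) (\sum_(i <- s) f i x) = \sum_(i <- s) \int[mu]_(x in D) f i x.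
Proof.
move=> mD fi; elim: s => [|i s [i1 e1]].
  split; first by apply: (eq_integrable mD (cst 0%E)); [by move=> x _; rewrite /= big_nil|exact: integrable0].
  rewrite big_nil /Rintegral (eq_integral (cst 0%E)) ?integral0//.
  by move=> x _; rewrite big_nil.
have iD := RintegrableD mD (fi i) i1.
split; first by apply: eq_integrable iD => // x _ /=; rewrite big_cons.
rewrite big_cons -e1 -(RintegralD mD (fi i) i1).
by apply: eq_Rintegral => x _; rewrite big_cons.
Qed.

Lemma rectangle_bounded (f : R * R -> R) (a b c d : R) : continuous f ->
  exists C, forall t x, a <= t <= b -> c <= x <= d -> `|f (t, x)| <= C.
Proof.
move=> cf.
have cK : compact (f @` (`[a, b]%classic `*` `[c, d]%classic)).
  apply: continuous_compact; first exact: continuous_subspaceT.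
  by apply: compact_setX; exact: segment_compact.
have [N [_ hN]] := compact_bounded cK.
exists (N + 1) => t x tab xcd; apply: (hN (N + 1)); first by rewrite ltrDl.
by exists (t, x) => //; split; rewrite /= in_itv.
Qed.

Lemma smooth2_derive (phi : R -> R -> R) (s : seq bool) : smooth2 phi ->
  [/\ forall t x, is_derive t (1:R) (fun u => iter_pd s phi u x) (iter_pd (true :: s) phi t x),
      forall t x, is_derive x (1:R) (iter_pd s phi t) (iter_pd (false :: s) phi t x) &
      continuous (fun z : R * R => iter_pd s phi z.1 z.2)].
Proof.
move=> h; have [dx cx] := h s; split => // t x.
  have [dt _] := dx t x; apply: DeriveDef; first exact: dt.
  by rewrite /= /pdt derive1E.
have [_ dy] := dx t x; apply: DeriveDef; first exact: dy.
by rewrite /= /pdx derive1E.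
Qed.

Lemma is_derive_zero (f : R -> R) (x l d : R) : 0 < d -> (forall y, `|y - x| < d -> f y = 0) ->
  is_derive x (1:R) f l -> l = 0.
Proof.
move=> d0 f0 df; have dc : is_derive x (1:R) f 0.
  by apply: (@is_derive_near R (cst 0) f x 0 d d0) => y /f0 ->.
by rewrite -(@derive_val _ _ _ _ _ _ _ df) (@derive_val _ _ _ _ _ _ _ dc).
Qed.

Context (T : R) (phi : R -> R -> R).
Hypothesis tphi : testO T phi.

(** Strict inequalities describe an open set, on which vanishing is inherited by all partial
    derivatives. *)
Lemma test_support : exists a c r : R, [/\ 0 < a, c < T, 0 < r & forall (s : seq bool) t x,
  t < a \/ c < t \/ r < `|x| -> iter_pd s phi t x = 0].
Proof.
have [sm [a [c [r [a0 [cT phi0]]]]]] := tphi.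
exists a, c, (`|r| + 1); split => //.
elim=> [|b s IH] t x h /=.
  apply: phi0; case: h => [h|[h|h]]; [left; exact: ltW|right; left; exact: ltW|right; right].
  by have := ler_norm r; lra.
have [dt dx _] := smooth2_derive s sm.
have gap (u w : R) : u < w -> exists2 d, 0 < d & forall y, `|y - w| < d -> u < y.
  by move=> uw; exists (w - u); [rewrite subr_gt0|move=> y; rewrite ltr_norml; lra].
case: b.
  have := dt t x; rewrite /=; case: h => [h|[h|h]] D.
  - have ta : - a < - t by rewrite ltrN2.
    have [d d0 dP] := gap _ _ ta; apply: (is_derive_zero d0 _ D) => y yt.
    by apply: IH; left; have := dP (- y); rewrite -opprD normrN => /(_ yt); lra.
  - have [d d0 dP] := gap _ _ h; apply: (is_derive_zero d0 _ D) => y yt.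
    by apply: IH; right; left; exact: dP.
  - by apply: (is_derive_zero ltr01 _ D) => y _; apply: IH; right; right.
have := dx t x; rewrite /=; case: h => [h|[h|h]] D.
- by apply: (is_derive_zero ltr01 _ D) => y _; apply: IH; left.
- by apply: (is_derive_zero ltr01 _ D) => y _; apply: IH; right; left.
- have [d d0 dP] := gap _ _ h; apply: (is_derive_zero d0 _ D) => y yx.
  by apply: IH; right; right; apply: dP; exact: le_lt_trans (ler_dist_dist _ _) yx.
Qed.

Lemma test_bounded (s : seq bool) : exists2 C : R, 0 <= C & forall t x, `|iter_pd s phi t x| <= C.
Proof.
have [sm _] := tphi; have [a [c [r [a0 cT r0 phi0]]]] := test_support.
have [_ _ cs] := smooth2_derive s sm.
have [C CP] := rectangle_bounded a c (- r) r cs.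
exists (Num.max C 0); first by rewrite le_max lexx orbT.
move=> t x; have [h|] := boolP ((a <= t <= c) && (- r <= x <= r)).
  by case/andP: h => h1 h2; rewrite le_max (CP t x h1 h2).
rewrite negb_and !negb_and -!ltNge => h.
rewrite phi0 ?normr0 ?le_max ?lexx ?orbT//.
case/orP: h => /orP[h|h]; [by left|by right; left|right; right|right; right]; rewrite ltr_normr.
  by apply/orP; right; lra.
by rewrite h.
Qed.

Lemma test_lipschitz (s : seq bool) : exists C L : R, forall t, bounded_lipschitz (iter_pd s phi t) C L.
Proof.
have [sm _] := tphi; have [C C0 CP] := test_bounded s; have [L L0 LP] := test_bounded (false :: s).
exists C, L => t; split=> [x|x y]; first exact: CP.
have [_ dx _] := smooth2_derive s sm.
have [c _ ->] := mvt_points (dx t) y x.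
by rewrite normrM mulrC; apply: ler_wpM2r => //; exact: LP.
Qed.

End test_functions.

(** * Passage to the limit under time integrals *)

Section time_limit.
Context (R : realType).
Notation RR := (measurableTypeR R).
Notation leb := (@lebesgue_measure R).
Notation D01 := (`]0%R, 1%R[%classic : set RR).
Let mD := @mD01 R.

Lemma continuous_second (f g : R * R -> R) : continuous f -> continuous g ->
  continuous (fun z : R * R => f (z.1, g z)).
Proof.
move=> cf cg z; apply: continuous2_epsilon => ep ep0 /=.
have [d d0 dP] := epsilon_continuous2 (cf (z.1, g z)) ep0.
have [d1 d10 dP1] := epsilon_continuous2 (cg z) (divr_gt0 d0 (@ltr0Sn R 1)).
exists (Num.min d d1); first by rewrite lt_min d0.
move=> t x; rewrite !lt_min => /andP[td td1] /andP[xd xd1].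
have dd : d / 2 < d by rewrite ltr_pdivrMr// ltr_pMr// ltr1n.
exact: (dP t _ td (le_lt_trans (dP1 t x td1 xd1) dd)).
Qed.

Lemma time_fubini (F : R -> R) (W : R -> R -> R) (C s t : R) : leb.-integrable D01 (EFin \o F) ->
  continuous (fun z : R * R => W z.1 z.2) -> (forall r m, `|W r m| <= C) ->
  [/\ leb.-integrable `[s, t] (EFin \o (fun r => \int[leb]_(m in D01) (F m * W r m))),
      leb.-integrable D01 (EFin \o (fun m => F m * \int[leb]_(r in `[s, t]) W r m)) &
      \int[leb]_(m in D01) (F m * \int[leb]_(r in `[s, t]) W r m) =
      \int[leb]_(r in `[s, t]) \int[leb]_(m in D01) (F m * W r m)].
Proof.
move=> iF cW WC; have nF := integrable_norm iF; have mF := integrable_measurableR iF.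
have mI : measurable (`[s, t] : set RR) by exact: measurable_itv.
have ic : leb.-integrable `[s, t] (EFin \o cst C).
  by apply: continuous_itv_integrable => x; exact: cvg_cst.
have m1 : measurable_fun ((`[s, t] : set RR) `*` D01) (fun z : RR * RR => F z.2 * W z.1 z.2).
  by apply: measurable_funM; [exact: measurable_fun2_X|exact: measurable_funTS (continuous2_measurable cW)].
have m2 : measurable_fun (D01 `*` (`[s, t] : set RR)) (fun z : RR * RR => F z.1 * W z.2 z.1).
  by apply: measurable_funM; [exact: measurable_fun1_X|exact: measurable_funTS (continuous2_measurable (continuous_swap cW))].
have b1 r m : `|F m * W r m| <= C * `|F m|.
  by rewrite normrM mulrC; exact: ler_wpM2r.
have b2 m r : `|F m * W r m| <= `|F m| * C by rewrite [leRHS]mulrC.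
have [i1 E1] := @fubini_dom R `[s, t] D01 (fun r m => F m * W r m) (cst C) (fun m => `|F m|) mI mD m1 ic nF (fun r m _ _ => b1 r m).
have [i2 _] := @fubini_dom R D01 `[s, t] (fun m r => F m * W r m) (fun m => `|F m|) (cst C) mD mI m2 nF ic (fun m r _ _ => b2 m r).
have iW m : leb.-integrable `[s, t] (EFin \o (fun r => W r m)).
  apply: continuous_itv_integrable => r.
  apply: (@continuous_pair R (fun z => W z.1 z.2) (cst m) cW) => q; exact: cvg_cst.
have E m : F m * (\int[leb]_(r in `[s, t]) W r m) = \int[leb]_(r in `[s, t]) (F m * W r m).
  by rewrite (RintegralZl _ mI (iW m)).
split; first exact: i1.
  by apply: eq_integrable i2 => // m _; rewrite /= E.
by rewrite E1; apply: eq_Rintegral => m _; rewrite E.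
Qed.

Lemma time_limit (F : R -> R) (W : nat -> R -> R -> R) (Z : R -> R) (B s t : R) :
  leb.-integrable D01 (EFin \o F) ->
  (forall j, continuous (fun z : R * R => W j z.1 z.2)) ->
  (forall j, exists C, forall r m, `|W j r m| <= C) ->
  (forall r, s <= r <= t -> \int[leb]_(m in D01) (F m * W j r m) @[j --> \oo] --> Z r) ->
  (forall j r, s <= r <= t -> `|\int[leb]_(m in D01) (F m * W j r m)| <= B) ->
  leb.-integrable `[s, t] (EFin \o Z) /\
  \int[leb]_(m in D01) (F m * \int[leb]_(r in `[s, t]) W j r m) @[j --> \oo] --> \int[leb]_(r in `[s, t]) Z r.
Proof.
move=> iF cW WC cZ WB; have mI : measurable (`[s, t] : set RR) by exact: measurable_itv.
have ic : leb.-integrable `[s, t] (EFin \o cst B).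
  by apply: continuous_itv_integrable => x; exact: cvg_cst.
have h j : leb.-integrable `[s, t] (EFin \o (fun r => \int[leb]_(m in D01) (F m * W j r m))) /\
    \int[leb]_(m in D01) (F m * \int[leb]_(r in `[s, t]) W j r m) =
    \int[leb]_(r in `[s, t]) \int[leb]_(m in D01) (F m * W j r m).
  by have [C CP] := WC j; have [] := time_fubini s t iF (cW j) CP.
have [i1 c1] := @dominated_cvg_Rintegral _ _ R leb (`[s, t] : set RR)
  (fun j r => \int[leb]_(m in D01) (F m * W j r m)) Z (cst B) mI (fun j => integrable_measurableR (proj1 (h j)))
  cZ ic WB.
split; first exact: i1.
by rewrite (_ : (fun j => _) = (fun j => \int[leb]_(r in `[s, t]) \int[leb]_(m in D01) (F m * W j r m)))//; apply/funext => j; case: (h j).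
Qed.

End time_limit.

(** * Evolution of label functions along the limit flow *)

Section transport.
Context (R : realType).
Notation RR := (measurableTypeR R).
Notation leb := (@lebesgue_measure R).
Notation D01 := (`]0%R, 1%R[%classic : set RR).
Context (T : R) (n : nat) (v0 M0 : R -> R) (F b : nat -> R -> R) (M : R -> R -> R).
Context (rho : R -> {measure set RR -> \bar R}) (v : R -> R -> R).
Hypothesis T0 : 0 < T.
Hypothesis hF : forall i, (i <= n)%N -> L2 (Fi v0 M0 F i).
Hypothesis hb : forall i, (0 < i <= n)%N -> inL1 T (b i).
Hypothesis hM : forall t, 0 <= t <= T -> inR (M t).
Hypothesis ent : entropy_solution T (fluxU n v0 M0 F b) M0 M.
Hypothesis rM : forall t, 0 <= t <= T -> is_deriv_measure (M t) (rho t).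
Hypothesis RN : forall t, 0 <= t <= T -> is_RN_flux (rho t) (fun x => fluxU n v0 M0 F b t (M t x)) (v t).
Notation X := (Xf T M).
Notation G := (Gf T n v0 M0 F b).
Let mD := @mD01 R.
Let mX t : measurable_fun setT (X t) := Xf_measurable T0 hM t.
Let mX1 t : measurable_fun D01 (X t) := Xf_measurable01 T0 hM t.
Let cX : clip_continuous X := Xf_clip_continuous T0 hM ent.

Lemma Xf_galois_on t : 0 <= t <= T -> galois (M t) (X t).
Proof. by move=> tT; rewrite -{1}(clampT_id tT); exact: Xf_galois. Qed.

Lemma fluxU_quantile t x : 0 <= t <= T ->
  fluxU n v0 M0 F b t (M t x) = \int[leb]_(m in D01) (G t m * le_ind (X t m) x).
Proof.
move=> tT; have gX := Xf_galois_on tT; have M01 := inR_itv x (hM tT).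
have iF (i : 'I_n.+1) : leb.-integrable D01 (EFin \o Fi v0 M0 F i).
  by apply: L2_integrable; apply: hF; rewrite -ltnS.
have iFl (i : 'I_n.+1) : leb.-integrable D01 (EFin \o (fun m => Bi b i t * (Fi v0 M0 F i m * le_ind (X t m) x))).
  apply: (RintegrableZl _ mD); apply: (dominated_integrable mD _ (integrable_norm (iF i))).
    apply: measurable_funM; first exact: integrable_measurableR (iF i).
    exact: measurableT_comp (le_ind_measurable x) (mX1 t).
  move=> m _; rewrite normrM /le_ind; case: ifP => _; rewrite ?normr1 ?normr0 ?mulr1 ?mulr0 /=.
    exact: lexx.
  exact: normr_ge0.
have [_ E] := Rintegral_sum (index_enum 'I_n.+1) mD iFl.
transitivity (\int[leb]_(m in D01) (\sum_(i < n.+1) Bi b i t * (Fi v0 M0 F i m * le_ind (X t m) x))).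
  rewrite E; apply: eq_bigr => i _; rewrite (primitive01_galois gX M01 (iF i)).
  rewrite (RintegralZl _ mD)//; apply: (dominated_integrable mD _ (integrable_norm (iF i))).
    apply: measurable_funM; first exact: integrable_measurableR (iF i).
    exact: measurableT_comp (le_ind_measurable x) (mX1 t).
  move=> m _; rewrite normrM /le_ind; case: ifP => _; rewrite ?normr1 ?normr0 ?mulr1 ?mulr0 /=.
    exact: lexx.
  exact: normr_ge0.
apply: eq_Rintegral => m _; rewrite /Gf mulr_suml; apply: eq_bigr => i _.
by rewrite clampT_id// mulrA.
Qed.

Lemma v_measurable t : 0 <= t <= T -> measurable_fun [set: RR] (v t : RR -> R).
Proof. by move=> tT; exact: RN_measurable (RN tT). Qed.

Lemma v_power t p : 0 <= t <= T -> 1 < p -> leb.-integrable D01 (EFin \o (fun m => `|G t m| `^ p)) ->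
  leb.-integrable D01 (EFin \o (fun m => `|v t (X t m)| `^ p)) /\
  \int[leb]_(m in D01) (`|v t (X t m)| `^ p) <= \int[leb]_(m in D01) (`|G t m| `^ p).
Proof.
move=> tT p1 iGp; exact: (cond_power (rM tT) (fun x => inR_itv x (hM tT)) (Xf_galois_on tT) (mX t)
  (Gf_integrable T b hF t) (fun x => fluxU_quantile x tT) (RN tT) p1 iGp).
Qed.

Lemma v_L2 t : 0 <= t <= T -> L2 (fun m => v t (X t m)).
Proof.
move=> tT; have [mG iG2] := Gf_L2 T b hF t.
have iGp : leb.-integrable D01 (EFin \o (fun m => `|G t m| `^ 2)).
  by apply: eq_integrable iG2 => // m _; rewrite /= sqr_powR.
have p2 : 1 < 2 :> R by rewrite ltr1n.
have [iv _] := v_power tT p2 iGp; split.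
  exact: measurableT_comp (v_measurable tT) (mX1 t).
by apply: eq_integrable iv => // m _; rewrite /= sqr_powR.
Qed.

Lemma v_expect t (h : R -> R) (C : R) : 0 <= t <= T -> measurable_fun [set: RR] (h : RR -> R) ->
  (forall x, `|h x| <= C) ->
  \int[leb]_(m in D01) (h (X t m) * v t (X t m)) = \int[leb]_(m in D01) (h (X t m) * G t m).
Proof.
move=> tT mh hC; exact: (cond_expect (rM tT) (fun x => inR_itv x (hM tT)) (Xf_galois_on tT) (mX t)
  (Gf_integrable T b hF t) (fun x => fluxU_quantile x tT) (RN tT) (L2_integrable (v_L2 tT)) mh hC).
Qed.

Context (phi : R -> R -> R) (f : R -> R).
Hypothesis tphi : testO T phi.
Hypothesis hf : L2 f.

(** [f] is a function of the label, hence constant along trajectories; in general it is no function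
    of the position [X t m]. *)
Definition pairX (g : R -> R -> R) (t : R) : R := \int[leb]_(m in D01) (f m * g t (X t m)).
Definition pairV (g : R -> R -> R) (t : R) : R := \int[leb]_(m in D01) (f m * (v t (X t m) * g t (X t m))).

Let ej (j : nat) : R := j.+1%:R^-1.
Let ej0 j : 0 < ej j. Proof. by rewrite invr_gt0 ltr0n. Qed.

Lemma harmonic_le (e : R) : 0 < e -> \forall j \near \oo, ej j <= e.
Proof.
move=> e0; have /cvgrPdist_le/(_ e e0) := @cvg_harmonic R; apply: filterS => j.
by rewrite sub0r normrN ger0_norm// ltW.
Qed.

Lemma pairX_limit (s : seq bool) t : 0 <= t <= T ->
  \int[leb]_(m in D01) (f m * iter_pd s phi t (mollY (ej j) (X t) m)) @[j --> \oo] --> pairX (iter_pd s phi) t.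
Proof.
move=> tT; apply/cvgrPdist_le => e e0.
have [C [L bl]] := test_lipschitz tphi s; have [a [c [r [a0 cT r0 phi0]]]] := test_support tphi.
have [C0 L0] := bounded_lipschitz_ge0 (bl 0).
(* The derivatives of [phi] are known to vanish strictly beyond [r]; the radius [r + 1] gives the
   non-strict form that [comp_mollY_dist] expects. *)
have r1 : 0 <= r + 1 by lra.
have z x : r + 1 <= `|x| -> iter_pd s phi t x = 0 by move=> h; apply: phi0; right; right; lra.
set I2 := \int[leb]_(m in D01) (f m ^+ 2).
have I20 : 0 <= I2 by apply: Rintegral_ge0 => m _; exact: sqr_ge0.
have I21 : 0 < 2 * (I2 + 1) by lra.
pose k := e / (2 * (I2 + 1)); have k0 : 0 < k by exact: divr_gt0.
pose Q := k^-1 * (2 * C * L * (1 + 2 * (r + 1) ^+ 2)).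
have Q0 : 0 <= Q.
  apply: mulr_ge0; first by rewrite invr_ge0 ltW.
  by rewrite !mulr_ge0// addr_ge0// mulr_ge0// sqr_ge0.
have Q1 : 0 < 2 * (Q + 1) by lra.
near=> j; have je : ej j <= e / (2 * (Q + 1)) by near: j; apply: harmonic_le; exact: divr_gt0.
rewrite distrC.
have := comp_mollY_dist (Xf_galois_on tT) (M_measurable hM tT) (fun x => inR_itv x (hM tT)) (mX t) hf (bl t) r1 z (ej0 j) k0.
move=> h; apply: (le_trans h); rewrite -/I2.
have -> : k^-1 * (2 * C * L * (ej j * (1 + 2 * (r + 1) ^+ 2))) = ej j * Q by rewrite /Q; ring.
have h1 : k * I2 <= e / 2.
  have E : k * (2 * (I2 + 1)) = e by rewrite /k divfK// gt_eqF.
  by move: (k) k0 E => q q0 E; lra.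
have h2 : ej j * Q <= e / 2.
  move: je; rewrite ler_pdivlMr//; have := ej0 j; move: (ej j) => q q0 je.
  lra.
by rewrite [leRHS]splitr lerD.
Unshelve. all: by end_near. Qed.

Lemma pairV_limit (s : seq bool) t : 0 <= t <= T ->
  \int[leb]_(m in D01) (f m * (vel (ej j) (X t) (G t) (mollY (ej j) (X t) m) * iter_pd s phi t (mollY (ej j) (X t) m)))
    @[j --> \oo] --> pairV (iter_pd s phi) t.
Proof.
move=> tT; apply/cvgrPdist_le => e e0.
have [C [L bl]] := test_lipschitz tphi s; have [a [c [r [a0 cT r0 phi0]]]] := test_support tphi.
have r1 : 0 <= r + 1 by lra.
have z x : r + 1 <= `|x| -> iter_pd s phi t x = 0 by move=> h; apply: phi0; right; right; lra.
have [e1 e10 h] := velocity_limit (Xf_galois_on tT) (M_measurable hM tT) (fun x => inR_itv x (hM tT)) (mX t)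
  (v_measurable tT) (v_L2 tT) (fun h C => @v_expect t h C tT) hf (bl t) r1 z e0.
near=> j; rewrite distrC; apply: (h _ (ej0 j)).
by near: j; exact: harmonic_le.
Unshelve. all: by end_near. Qed.

Let WX (s : seq bool) j r m := iter_pd s phi r (mollY (ej j) (X r) m).
Let WV (s : seq bool) j r m := vel (ej j) (X r) (G r) (mollY (ej j) (X r) m) * iter_pd s phi r (mollY (ej j) (X r) m).

Let cWX s j : continuous (fun z : R * R => WX s j z.1 z.2).
Proof.
have [sm _] := tphi; have [_ _ cs] := smooth2_derive s sm.
exact: (continuous_second cs (mollY_joint mX1 cX (ej0 j))).
Qed.

Let cWV s j : continuous (fun z : R * R => WV s j z.1 z.2).
Proof.
have [CG GB] := Gf_bounded T0 hF hb.
move=> z; apply: cvgM; last exact: (@cWX s j z).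
exact: (@velY_joint R CG X G mX1 cX (Gf_integrable T b hF) GB (ej j) (ej0 j)
  (fun x => @Gf_mollJ_continuous R T n v0 M0 F b M T0 hF hb hM ent (ej j) x (ej0 j)) z).
Qed.

Let mWX s j r : measurable_fun D01 (WX s j r).
Proof.
have h : continuous (fun m => WX s j r m).
  move=> m; apply: continuous_epsilon => e e0.
  have [d d0 dP] := epsilon_continuous2 (@cWX s j (r, m)) e0.
  by exists d => // m' mm; apply: (dP r m') => //=; rewrite subrr normr0.
exact: measurable_funTS (continuous_measurable_fun h).
Qed.

Let bWX s j : exists C, forall r m, `|WX s j r m| <= C.
Proof. by have [C _ CP] := test_bounded tphi s; exists C => r m; exact: CP. Qed.

Let bWV s j : exists C, forall r m, `|WV s j r m| <= C.
Proof.
have [C C0 CP] := test_bounded tphi s; have [CG GB] := Gf_bounded T0 hF hb.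
have [C' C'0 CP'] := @vel_bound R CG X G mX1 (Gf_integrable T b hF) GB (ej j) (ej0 j).
by exists (C' * C) => r m; rewrite normrM; apply: ler_pM.
Qed.

Lemma pairX_time (sq : seq bool) s t : 0 <= s -> t <= T ->
  leb.-integrable `[s, t] (EFin \o pairX (iter_pd sq phi)) /\
  \int[leb]_(m in D01) (f m * \int[leb]_(r in `[s, t]) WX sq j r m) @[j --> \oo] -->
    \int[leb]_(r in `[s, t]) pairX (iter_pd sq phi) r.
Proof.
move=> s0 tT; have [C C0 CP] := test_bounded tphi sq; have i1 := L2_integrable hf.
apply: (@time_limit R f (WX sq) _ (C * \int[leb]_(m in D01) `|f m|) s t i1 (@cWX sq) (@bWX sq)).
  by move=> r rst; apply: pairX_limit; lra.
move=> j r _.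
have mW := mWX sq j r.
have i2 : leb.-integrable D01 (EFin \o (fun m => f m * WX sq j r m)).
  apply: (dominated_integrable mD _ (RintegrableZl C mD (integrable_norm i1))).
    by apply: measurable_funM => //; exact: integrable_measurableR i1.
  by move=> m _; rewrite normrM mulrC; apply: (ler_wpM2r (normr_ge0 _)); exact: CP.
apply: (le_trans (le_normr_Rintegral mD i2)); rewrite -(RintegralZl _ mD (integrable_norm i1)).
apply: (le_Rintegral mD (integrable_norm i2) (RintegrableZl C mD (integrable_norm i1))) => m _.
by rewrite /= normrM mulrC; apply: (ler_wpM2r (normr_ge0 _)); exact: CP.
Qed.

(** Dominated convergence in time needs a bound uniform in the scale [j]. It comes from the
    contraction in [L^2] and the majorant [H] of [G], since [vel_bounded] degenerates as [j]
    grows. *)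
Lemma pairV_time (sq : seq bool) s t : 0 <= s -> t <= T ->
  leb.-integrable `[s, t] (EFin \o pairV (iter_pd sq phi)) /\
  \int[leb]_(m in D01) (f m * \int[leb]_(r in `[s, t]) WV sq j r m) @[j --> \oo] -->
    \int[leb]_(r in `[s, t]) pairV (iter_pd sq phi) r.
Proof.
move=> s0 tT; have [C C0 CP] := test_bounded tphi sq; have i1 := L2_integrable hf.
have [H H2 GH] := Gf_dominated T0 hF hb.
apply: (@time_limit R f (WV sq) _ (C * (1 * \int[leb]_(m in D01) (f m ^+ 2) + 1^-1 * \int[leb]_(m in D01) (H m ^+ 2)))
   s t i1 (@cWV sq) (@bWV sq)).
  by move=> r rst; apply: pairV_limit; lra.
move=> j r _.
have [hV hVG] := vel_L2 (ej0 j) (mX1 r) (Gf_L2 T b hF r).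
have mW := mWX sq j r.
have [_ h] := L2_young_bounded hf hV mW (fun m _ => CP r _) ltr01.
apply: (le_trans h); apply: (ler_wpM2l C0); rewrite lerD2l invr1 !mul1r; apply: (le_trans hVG).
apply: (le_Rintegral mD (proj2 (Gf_L2 T b hF r)) (proj2 H2)) => m _.
by rewrite -[leLHS]real_normK ?num_real// ler_sqr ?nnegrE ?normr_ge0//; exact: le_trans (normr_ge0 _) (GH r m).
Qed.

Lemma transport_identity s t : 0 < s -> s <= t -> t < T ->
  pairX phi t - pairX phi s =
  \int[leb]_(r in `[s, t]) pairX (pdt phi) r + \int[leb]_(r in `[s, t]) pairV (pdx phi) r.
Proof.
move=> s0 st tT; have [sm _] := tphi; have i1 := L2_integrable hf.
have mI : measurable (`[s, t] : set RR) by exact: measurable_itv.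
have [CG GB] := Gf_bounded T0 hF hb.
have [_ c1] := pairX_time [:: true] (ltW s0) (ltW tT).
have [_ c2] := pairV_time [:: false] (ltW s0) (ltW tT).
have s0T : 0 <= s <= T by lra.
have t0T : 0 <= t <= T by lra.
have c3 := @pairX_limit [::] t t0T; have c4 := @pairX_limit [::] s s0T.
have iWr (W : R -> R -> R) m : continuous (fun z : R * R => W z.1 z.2) -> leb.-integrable `[s, t] (EFin \o (fun r => W r m)).
  move=> cW; apply: continuous_itv_integrable.
  by apply: (@continuous_pair R (fun z => W z.1 z.2) (cst m) cW) => q; exact: cvg_cst.
(* At a fixed scale the flow is classical: the identity holds label by label and is integrated
   against [f]. Only the limits of both sides remain to be compared. *)
have E j : \int[leb]_(m in D01) (f m * WX [::] j t m) - \int[leb]_(m in D01) (f m * WX [::] j s m) =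
    \int[leb]_(m in D01) (f m * \int[leb]_(r in `[s, t]) WX [:: true] j r m) +
    \int[leb]_(m in D01) (f m * \int[leb]_(r in `[s, t]) WV [:: false] j r m).
  have [C1 CP1] := bWX [:: true] j; have [C2 CP2] := bWV [:: false] j.
  have [_ j1 _] := time_fubini s t i1 (@cWX [:: true] j) CP1.
  have [_ j2 _] := time_fubini s t i1 (@cWV [:: false] j) CP2.
  have [C CP] := bWX [::] j.
  have i0 r : leb.-integrable D01 (EFin \o (fun m => f m * WX [::] j r m)).
    apply: (dominated_integrable mD _ (RintegrableZl C mD (integrable_norm i1))).
      apply: measurable_funM; first exact: integrable_measurableR i1.
      exact: mWX.
    by move=> m _; rewrite normrM mulrC; apply: (ler_wpM2r (normr_ge0 _)); exact: CP.
  rewrite -(RintegralB mD (i0 t) (i0 s)) -(RintegralD mD j1 j2).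
  apply: eq_Rintegral => m _; rewrite -mulrBr -mulrDr; congr (_ * _).
  have [dt dx _] := smooth2_derive [::] sm.
  have [_ _ ct] := smooth2_derive [:: true] sm; have [_ _ cx] := smooth2_derive [:: false] sm.
  have := @flow_increment R T CG X G mX1 cX (Gf_integrable T b hF) GB (ej j) (ej0 j)
    (fun x => @Gf_mollJ_continuous R T n v0 M0 F b M T0 hF hb hM ent (ej j) x (ej0 j))
    (fun x s t => @mollA_increment R T n v0 M0 F b M T0 hF hb hM ent (ej j) x s t (ej0 j))
    phi _ _ s t m dt dx ct cx s0 st tT.
  rewrite /WX /= => ->.
  rewrite -(RintegralD mI (iWr _ m (@cWX [:: true] j)) (iWr _ m (@cWV [:: false] j))).
  by apply: eq_Rintegral => r _; rewrite /WX /WV /= [X in _ + X]mulrC.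
have l1 : \int[leb]_(m in D01) (f m * WX [::] j t m) - \int[leb]_(m in D01) (f m * WX [::] j s m)
    @[j --> \oo] --> pairX phi t - pairX phi s by exact: cvgB.
have l2 : \int[leb]_(m in D01) (f m * \int[leb]_(r in `[s, t]) WX [:: true] j r m) +
    \int[leb]_(m in D01) (f m * \int[leb]_(r in `[s, t]) WV [:: false] j r m)
    @[j --> \oo] --> \int[leb]_(r in `[s, t]) pairX (pdt phi) r + \int[leb]_(r in `[s, t]) pairV (pdx phi) r.
  exact: cvgD c1 c2.
have := cvg_unique _ l1; apply => //.
by rewrite (funext E).
Qed.

End transport.

(** * Mass and momentum equations *)

Section integration_by_parts.
Context (R : realType).
Notation RR := (measurableTypeR R).
Notation leb := (@lebesgue_measure R).

Lemma Rintegral_support (A B : set RR) (f g : R -> R) :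
  (forall x, A x -> B x /\ g x = f x) -> (forall x, B x -> ~ A x -> g x = 0) ->
  \int[leb]_(x in A) f x = \int[leb]_(x in B) g x.
Proof.
move=> h1 h2; rewrite [LHS]Rintegral_mkcond [RHS]Rintegral_mkcond.
apply: eq_Rintegral => x _; rewrite !patchE.
case: (boolP (x \in A)) => [/set_mem Ax|nA].
  by have [Bx ->] := h1 x Ax; rewrite mem_set.
case: ifPn => // /set_mem Bx; rewrite h2// => Ax.
by move/negP: nA; apply; exact/mem_set.
Qed.

Context (a c T : R) (Z Xi : R -> R).
Hypothesis a0 : 0 < a.
Hypothesis cT : c < T.
Hypothesis T0 : 0 < T.
Hypothesis iZ : leb.-integrable `[0, T] (EFin \o Z).
Hypothesis Z0 : forall t, t < a \/ c < t -> Z t = 0.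
Hypothesis Xi0 : forall t, t < a \/ c < t -> Xi t = 0.
Hypothesis XiZ : forall s t, 0 < s -> s <= t -> t < T -> Xi t - Xi s = \int[leb]_(r in `[s, t]) Z r.

Let mI : measurable (`[0, T] : set RR). Proof. exact: measurable_itv. Qed.

(** The increment of [Xi] is taken from [s] to a time beyond the support, where [Xi] vanishes. *)
Lemma tail_integral s : 0 < s < T -> \int[leb]_(t in `[0, T]) (le_ind s t * Z t) = - Xi s.
Proof.
move=> /andP[s0 sT].
(* A time after both [s] and [c] and still before [T], where the increment formula applies. *)
pose t1 := Num.max s ((Num.max c 0 + T) / 2).
have cT0 : Num.max c 0 < T by rewrite gt_max cT.
have h1 : (Num.max c 0 + T) / 2 < T by move: cT0; move: (Num.max c 0) => q; lra.
have h2 : Num.max c 0 < (Num.max c 0 + T) / 2 by move: cT0; move: (Num.max c 0) => q; lra.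
have st1 : s <= t1 by rewrite le_max lexx.
have t1T : t1 < T by rewrite gt_max sT h1.
have ct1 : c < t1.
  by rewrite lt_max; apply/orP; right; apply: le_lt_trans h2; rewrite le_max lexx.
have -> : - Xi s = Xi t1 - Xi s by rewrite (Xi0 (or_intror ct1)) sub0r.
rewrite (XiZ s0 st1 t1T); symmetry.
apply: Rintegral_support => x /=; rewrite !in_itv/=.
  move=> /andP[sx xt]; rewrite /le_ind sx mul1r; split => //.
  by rewrite (le_trans (ltW s0) sx) (le_trans xt (ltW t1T)).
move=> /andP[x0 xT] nx; rewrite /le_ind; case: ifP => sx; last by rewrite mul0r.
rewrite mul1r; apply: Z0; right; apply: (lt_trans ct1); rewrite ltNge; apply/negP => xt.
by apply: nx; rewrite sx.
Qed.

Lemma full_integral : \int[leb]_(t in `[0, T]) Z t = 0.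
Proof.
pose s := Num.min (a / 2) (T / 2).
have sa : s < a by rewrite gt_min; apply/orP; left; rewrite ltr_pdivrMr// ltr_pMr// ltr1n.
have sT : 0 < s < T.
  rewrite lt_min !divr_gt0//= gt_min; apply/orP; right.
  by rewrite ltr_pdivrMr// ltr_pMr// ltr1n.
transitivity (\int[leb]_(t in `[0, T]) (le_ind s t * Z t)); last by rewrite (tail_integral sT) (Xi0 (or_introl sa)) oppr0.
apply: eq_Rintegral => t _; rewrite /le_ind; case: ifPn; first by rewrite mul1r.
by rewrite -ltNge => ts; rewrite Z0 ?mulr0//; left; exact: lt_trans ts sa.
Qed.

(** [b] is merely integrable, so its primitive has no pointwise derivative to work with. Fubini on
    the triangle [s <= t] replaces the product rule, and [tail_integral] evaluates the inner
    integral. *)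
Lemma parts_integral (b : R -> R) : leb.-integrable `[0, T] (EFin \o b) ->
  leb.-integrable `]0, T[ (EFin \o (fun s => b s * Xi s)) /\
  \int[leb]_(t in `[0, T]) ((\int[leb]_(s in `[0, t]) b s) * Z t) = - \int[leb]_(s in `]0, T[) (b s * Xi s).
Proof.
move=> ib; have mb := integrable_measurableR ib; have mZ := integrable_measurableR iZ.
have nb := integrable_norm ib; have nZ := integrable_norm iZ.
pose f t s := b s * (le_ind s t * Z t).
have le1 (x y : R) : `|le_ind x y| <= 1 by rewrite /le_ind; case: ifP => _; rewrite ?normr1 ?normr0.
have mlt (t : R) : measurable_fun (`[0, T] : set RR) (fun s => le_ind s t).
  exact: measurable_funTS (le_ind_measurable t).
have mls (s : R) : measurable_fun (`[0, T] : set RR) (fun t => le_ind s t).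
  rewrite /le_ind; apply: measurable_funTS; apply: measurable_fun_if; rewrite ?ifT//.
  by apply: measurable_fun_ler => //; exact: measurable_cst.
have m1 : measurable_fun ((`[0, T] : set RR) `*` (`[0, T] : set RR)) (fun z : RR * RR => f z.1 z.2).
  apply: measurable_funM; first exact: measurable_fun2_X.
  apply: measurable_funM; last exact: measurable_fun1_X.
  apply: measurable_le_ind; first exact: measurableX.
    exact: (@measurable_fun2_X _ _ _ id).
  exact: (@measurable_fun1_X _ _ _ id).
have b1 t s : `|f t s| <= `|Z t| * `|b s|.
  rewrite !normrM mulrC; apply: (ler_wpM2r (normr_ge0 _)).
  by rewrite -[leRHS]mul1r; exact: (ler_wpM2r (normr_ge0 _)).
have [_ E] := @fubini_dom R `[0, T] `[0, T] f (fun t => `|Z t|) (fun s => `|b s|) mI mI m1 nZ nb (fun t s _ _ => b1 t s).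
have b2 s t : `|f t s| <= `|b s| * `|Z t| by rewrite mulrC.
have m2 : measurable_fun ((`[0, T] : set RR) `*` (`[0, T] : set RR)) (fun z : RR * RR => f z.2 z.1).
  apply: measurable_funM; first exact: measurable_fun1_X.
  apply: measurable_funM; last exact: measurable_fun2_X.
  apply: measurable_le_ind; first exact: measurableX.
    exact: (@measurable_fun1_X _ _ _ id).
  exact: (@measurable_fun2_X _ _ _ id).
have [i2 _] := @fubini_dom R `[0, T] `[0, T] (fun s t => f t s) (fun s => `|b s|) (fun t => `|Z t|) mI mI m2 nb nZ (fun s t _ _ => b2 s t).
have mJ : measurable (`]0, T[ : set RR) by exact: measurable_itv.
have JI : (`]0, T[%classic : set RR) `<=` `[0, T]%classic by apply: subset_itv; rewrite bnd_simp.
have i3 := integrableS mI mJ JI i2.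
have iz s : leb.-integrable `[0, T] (EFin \o (fun t => le_ind s t * Z t)).
  apply: (dominated_integrable mI _ nZ); first by apply: measurable_funM.
  by move=> t _; rewrite normrM -[leRHS]mul1r; apply: (ler_wpM2r (normr_ge0 _)).
have E3 s : `]0, T[%classic s -> \int[leb]_(t in `[0, T]) f t s = - (b s * Xi s).
  by rewrite /= in_itv/= => sT; rewrite (RintegralZl _ mI (iz s)) (tail_integral sT) mulrN.
have ibX : leb.-integrable `]0, T[ (EFin \o (fun s => b s * Xi s)).
  have := RintegrableZl (-1) mJ i3; apply: eq_integrable => // s; rewrite inE => sT.
  by rewrite /= E3// mulN1r opprK.
split; first exact: ibX.
transitivity (\int[leb]_(t in `[0, T]) \int[leb]_(s in `[0, T]) f t s).
  apply: eq_Rintegral => t; rewrite inE/= in_itv/= => /andP[t0 tT].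
  have il : leb.-integrable `[0, T] (EFin \o (fun s => b s * le_ind s t)).
    apply: (dominated_integrable mI _ nb); first by apply: measurable_funM.
    by move=> s _; rewrite normrM -[leRHS]mulr1; apply: (ler_wpM2l (normr_ge0 _)).
  transitivity (Z t * \int[leb]_(s in `[0, T]) (b s * le_ind s t)).
    rewrite mulrC; congr (_ * _); apply: Rintegral_support => s /=; rewrite !in_itv/=.
      by move=> /andP[s0 st]; rewrite s0 (le_trans st tT) /le_ind st mulr1.
    by move=> /andP[s0 _] ns; rewrite /le_ind; case: ifP => st; [exfalso; apply: ns; rewrite s0|rewrite mulr0].
  rewrite -(RintegralZl _ mI il); apply: eq_Rintegral => s _; rewrite /f; ring.
rewrite E -[RHS]mulN1r -(RintegralZl _ mJ ibX).
transitivity (\int[leb]_(s in `]0, T[) \int[leb]_(t in `[0, T]) f t s); last first.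
  by apply: eq_Rintegral => s; rewrite inE => sT; rewrite E3// mulN1r.
rewrite /Rintegral; congr fine; rewrite [LHS]integral_itv_bndoo//.
exact: measurable_int i3.
Qed.

End integration_by_parts.

(** * Evaluation of the distributional pairings *)

Section pairings.
Context (R : realType).
Notation RR := (measurableTypeR R).
Notation leb := (@lebesgue_measure R).
Notation D01 := (`]0%R, 1%R[%classic : set RR).
Context (T : R) (n : nat) (v0 M0 : R -> R) (F b : nat -> R -> R) (M : R -> R -> R).
Context (rho : R -> {measure set RR -> \bar R}) (v : R -> R -> R).
Hypothesis T0 : 0 < T.
Hypothesis hF : forall i, (i <= n)%N -> L2 (Fi v0 M0 F i).
Hypothesis hb : forall i, (0 < i <= n)%N -> inL1 T (b i).
Hypothesis hM : forall t, 0 <= t <= T -> inR (M t).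
Hypothesis ent : entropy_solution T (fluxU n v0 M0 F b) M0 M.
Hypothesis rM : forall t, 0 <= t <= T -> is_deriv_measure (M t) (rho t).
Hypothesis RN : forall t, 0 <= t <= T -> is_RN_flux (rho t) (fun x => fluxU n v0 M0 F b t (M t x)) (v t).
Notation X := (Xf T M).
Notation G := (Gf T n v0 M0 F b).
Let mD := @mD01 R.
Let mX t : measurable_fun setT (X t) := Xf_measurable T0 hM t.
Let mX1 t : measurable_fun D01 (X t) := Xf_measurable01 T0 hM t.
Let mI : measurable (`[0, T] : set RR). Proof. exact: measurable_itv. Qed.
Let itvW (t : R) : 0 < t < T -> 0 <= t <= T.
Proof. by move=> /andP[t0 tT]; rewrite !ltW. Qed.
Let hv t (tT : 0 <= t <= T) : L2 (fun m => v t (X t m)) := v_L2 T0 hF hM rM RN tT.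

Lemma rho_integral t (h : R -> R) : 0 <= t <= T -> measurable_fun [set: RR] (h : RR -> R) ->
  leb.-integrable D01 (EFin \o (fun m => h (X t m))) ->
  (\int[rho t]_(x in [set: RR]) (h x)%:E = (\int[leb]_(m in D01) h (X t m))%:E)%E.
Proof.
move=> tT mh ih.
exact: (law_integral (rM tT) (fun x => inR_itv x (hM tT)) (Xf_galois_on T0 hM tT) (mX t) mh ih).
Qed.

(** The test function [v h] is unbounded, so one factor [v] is truncated first; [v^2] and [v G] are
    integrable and dominated convergence removes the truncation. This is what linearizes the
    quadratic flux. *)
Lemma v_expect_sqr t (h : R -> R) (C : R) : 0 <= t <= T -> measurable_fun [set: RR] (h : RR -> R) ->
  (forall x, `|h x| <= C) ->
  \int[leb]_(m in D01) (v t (X t m) * (v t (X t m) * h (X t m))) =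
  \int[leb]_(m in D01) (G t m * (v t (X t m) * h (X t m))).
Proof.
move=> tT mh hC; have mv := v_measurable RN tT; have L2v := hv tT.
have lim (w : R -> R) : L2 w ->
    \int[leb]_(m in D01) ((clip N%:R (v t (X t m)) * h (X t m)) * w m) @[N --> \oo] -->
    \int[leb]_(m in D01) (w m * (v t (X t m) * h (X t m))).
  move=> hw; have iw := integrable_norm (L2_mul L2v hw).
  apply: (proj2 (dominated_cvg_Rintegral mD _ _ (RintegrableZl C mD iw) _)).
  - move=> N; apply: measurable_funM; last by case: hw.
    apply: measurable_funM; last exact: measurableT_comp mh (mX1 t).
    by apply: clip_measurable => //; exact: measurableT_comp mv (mX1 t).
  - move=> m _; apply/cvgrPdist_le => e e0; near=> N.
    have vN : `|v t (X t m)| <= N%:R by near: N; exact: nbhs_infty_ger.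
    by rewrite (clip_id vN) mulrC subrr normr0 ltW.
  - move=> N m _ /=; rewrite !normrM.
    have N0 : 0 <= N%:R :> R by exact: ler0n.
    have cv : `|clip N%:R (v t (X t m))| <= `|v t (X t m)|.
      have z : clip N%:R 0 = 0 :> R by rewrite clip_id ?normr0.
      by have := clip_dist N%:R (v t (X t m)) 0; rewrite z !subr0.
    rewrite [X in X * _]mulrC -mulrA; apply: ler_pM => //; exact: (ler_wpM2r (normr_ge0 _)).
have l1 := lim _ L2v; have l2 := lim _ (Gf_L2 T b hF t).
have := cvg_unique _ l1; apply => //.
rewrite (_ : (fun N : nat => _) = (fun N => \int[leb]_(m in D01) ((clip N%:R (v t (X t m)) * h (X t m)) * G t m))) //.
apply/funext => N; have N0 : 0 <= N%:R :> R by exact: ler0n.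
apply: (@v_expect R T n v0 M0 F b M rho v T0 hF hM rM RN t (fun x => clip N%:R (v t x) * h x) (N%:R * C) tT).
  by apply: measurable_funM => //; exact: clip_measurable.
move=> x; rewrite normrM; apply: ler_pM => //.
by have := clip_bnd (v t x) N0; rewrite ler_norml.
Unshelve. all: by end_near. Qed.

Lemma time_integral (h : R -> \bar R) (g : R -> R) :
  (forall t, 0 < t < T -> h t = (g t)%:E) -> leb.-integrable `[0, T] (EFin \o g) ->
  (\int[leb]_(t in (`]0%R, T[%classic : set RR)) h t = (\int[leb]_(t in `[0, T]) g t)%:E)%E.
Proof.
move=> hg ig; rewrite -(EFin_Rintegral mI ig).
transitivity (\int[leb]_(t in (`]0%R, T[%classic : set RR)) (g t)%:E)%E.
  by apply: eq_integral => t; rewrite inE/= in_itv/=; exact: hg.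
rewrite -(@integral_itv_bndoo _ _ _ _ true false)//.
apply: (measurable_funS mI _ (measurable_int _ ig)).
by apply: subset_itv; rewrite bnd_simp.
Qed.

Context (phi : R -> R -> R).
Hypothesis tphi : testO T phi.

Let mphi (s : seq bool) t : measurable_fun [set: RR] (iter_pd s phi t : RR -> R).
Proof.
have [C [L bl]] := test_lipschitz tphi s.
exact: continuous_measurable_fun (bounded_lipschitz_continuous (bl t)).
Qed.

Lemma pair_integrable (f : R -> R) (s : seq bool) t : L2 f ->
  leb.-integrable D01 (EFin \o (fun m => f m * iter_pd s phi t (X t m))).
Proof.
move=> hf; have [C _ CP] := test_bounded tphi s; apply: (L2_mul hf).
by apply: (@L2_bounded _ _ C) => //; exact: measurableT_comp (mphi s t) (mX1 t).
Qed.

Lemma pairv_integrable (f : R -> R) (s : seq bool) t : 0 <= t <= T -> L2 f ->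
  leb.-integrable D01 (EFin \o (fun m => f m * (v t (X t m) * iter_pd s phi t (X t m)))).
Proof.
move=> tT hf; have [C _ CP] := test_bounded tphi s; apply: (L2_mul hf).
by apply: (L2_mul_bounded (C := C) (hv tT)) => //; exact: measurableT_comp (mphi s t) (mX1 t).
Qed.

Section one_function.
Context (f : R -> R).
Hypothesis hf : L2 f.

Let Z t := pairX T M f (pdt phi) t + pairV T M v f (pdx phi) t.

Lemma pairX_integrable : leb.-integrable `[0, T] (EFin \o pairX T M f (pdt phi)).
Proof. by have [] := pairX_time T0 hM ent tphi hf [:: true] (lexx 0) (lexx T). Qed.

Lemma pairV_integrable : leb.-integrable `[0, T] (EFin \o pairV T M v f (pdx phi)).
Proof. by have [] := pairV_time T0 hF hb hM ent rM RN tphi hf [:: false] (lexx 0) (lexx T). Qed.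

Lemma pairing_parts : exists a c : R, [/\ 0 < a, c < T,
  (forall t, t < a \/ c < t -> Z t = 0),
  (forall t, t < a \/ c < t -> pairX T M f phi t = 0) &
  forall s t, 0 < s -> s <= t -> t < T -> pairX T M f phi t - pairX T M f phi s = \int[leb]_(r in `[s, t]) Z r].
Proof.
have [a [c [r [a0 cT r0 phi0]]]] := test_support tphi.
have zero (g : R -> R) : (forall m, g m = 0) -> \int[leb]_(m in D01) g m = 0.
  by move=> g0; rewrite (eq_Rintegral leb (g := cst 0)) ?Rintegral_D01_cst// => m _; rewrite g0.
have nz (sq : seq bool) t x : t < a \/ c < t -> iter_pd sq phi t x = 0.
  by case=> h; apply: phi0; [left|right; left].
exists a, c; split => //.
- move=> t tac; rewrite /Z /pairX /pairV !zero ?addr0// => m.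
    by rewrite (nz [:: false] _ _ tac : pdx phi t (X t m) = 0) !mulr0.
  by rewrite (nz [:: true] _ _ tac : pdt phi t (X t m) = 0) mulr0.
- by move=> t tac; rewrite /pairX zero// => m; rewrite (nz [::] _ _ tac : phi t (X t m) = 0) mulr0.
- move=> s t s0 st tT; rewrite (transport_identity T0 hF hb hM ent rM RN tphi hf s0 st tT).
  have mst : measurable (`[s, t] : set RR) by exact: measurable_itv.
  have [i1 _] := pairX_time T0 hM ent tphi hf [:: true] (ltW s0) (ltW tT).
  have [i2 _] := pairV_time T0 hF hb hM ent rM RN tphi hf [:: false] (ltW s0) (ltW tT).
  by rewrite -(RintegralD mst i1 i2).
Qed.

End one_function.

Lemma pair_mass_eq0 : pair_mass T rho v phi = 0%E.
Proof.
have h1 := @L2_cst R 1; have [a [c [a0 cT Z0 X0 XZ]]] := pairing_parts h1.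
have iX := pairX_integrable h1; have iV := pairV_integrable h1.
rewrite /pair_mass (time_integral _ iX); last first.
  move=> t tT; have tT' := itvW tT.
  rewrite (rho_integral tT' (mphi [:: true] t)).
    by congr (_%:E); apply: eq_Rintegral => m _; rewrite /= mul1r.
  have := pair_integrable [:: true] t h1; apply: eq_integrable => // m _.
  by rewrite /= mul1r.
rewrite (time_integral _ iV); last first.
  move=> t tT; have tT' := itvW tT.
  rewrite (rho_integral tT').
  - by congr (_%:E); apply: eq_Rintegral => m _; rewrite /= mul1r.
  - have mv := v_measurable RN tT'; have mx := mphi [:: false] t; exact: measurable_funM.
  - have := pairv_integrable [:: false] tT' h1; apply: eq_integrable => // m _.
    by rewrite /= mul1r.
rewrite -EFinD -(RintegralD mI iX iV) (full_integral a0 cT T0 Z0 X0 XZ).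
by rewrite oppe0.
Qed.



Lemma Gf_pairing t (h : R -> R) : 0 <= t <= T ->
  (forall f, L2 f -> leb.-integrable D01 (EFin \o (fun m => f m * h m))) ->
  \int[leb]_(m in D01) (G t m * h m) =
  \sum_(i < n.+1) Bi b i (clampT T t) * \int[leb]_(m in D01) (Fi v0 M0 F i m * h m).
Proof.
move=> tT ih; have ii (i : 'I_n.+1) := ih _ (hF (ltn_ord i : (i <= n)%N)).
transitivity (\int[leb]_(m in D01) \sum_(i < n.+1) Bi b i (clampT T t) * (Fi v0 M0 F i m * h m)).
  by apply: eq_Rintegral => m _; rewrite /Gf mulr_suml; apply: eq_bigr => i _; rewrite mulrA.
have ic (i : 'I_n.+1) := RintegrableZl (Bi b i (clampT T t)) mD (ii i).
rewrite (Rintegral_sum (index_enum 'I_n.+1) mD ic).2; apply: eq_bigr => i _.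
exact: (RintegralZl _ mD (ii i)).
Qed.

Lemma BiT_integrable i (g : R -> R) : (i <= n)%N -> leb.-integrable `[0, T] (EFin \o g) ->
  leb.-integrable `[0, T] (EFin \o (fun t => Bi b i (clampT T t) * g t)).
Proof.
move=> iN ig; have [C C0 CP] := BiT_bounded T0 hb iN.
apply: (dominated_integrable mI _ (RintegrableZl C mI (integrable_norm ig))).
  apply: measurable_funM; last exact: integrable_measurableR ig.
  exact: measurable_funTS (continuous_measurable_fun (BiT_continuous T0 hb iN)).
by move=> t _ /=; rewrite normrM; exact: ler_pM.
Qed.

(** For [i = 0] the coefficient is 1 and the integrand is a total time derivative, which is why the
    initial velocity contributes no force. For larger [i] the coefficient is a primitive of [b i]
    and the force comes from integration by parts. *)
Lemma momentum_component i (iN : (i <= n)%N) :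
  \int[leb]_(t in `[0, T]) (Bi b i (clampT T t) *
     (pairX T M (Fi v0 M0 F i) (pdt phi) t + pairV T M v (Fi v0 M0 F i) (pdx phi) t)) =
  if i is j.+1 then - \int[leb]_(t in `]0, T[) (b j.+1 t * pairX T M (F j.+1) phi t) else 0.
Proof.
have hf := hF iN; have [a [c [a0 cT Z0 X0 XZ]]] := pairing_parts hf.
have iZ := RintegrableD mI (pairX_integrable hf) (pairV_integrable hf).
case: i iN hf a0 cT Z0 X0 XZ iZ => [|i] iN hf a0 cT Z0 X0 XZ iZ.
  rewrite -[RHS](full_integral a0 cT T0 Z0 X0 XZ).
  by apply: eq_Rintegral => t _; rewrite /Bi mul1r.
have ib := inL1_integrable (ltW T0) (hb (iN : (0 < i.+1 <= n)%N)).
rewrite -(parts_integral cT T0 iZ Z0 X0 XZ ib).2.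
apply: eq_Rintegral => t; rewrite inE/= in_itv/= => tT.
by have [t0 _] := andP tT; rewrite clampT_id// t0.
Qed.

Lemma force_integrable i : (0 < i <= n)%N ->
  leb.-integrable `]0, T[ (EFin \o (fun t => b i t * pairX T M (F i) phi t)).
Proof.
case: i => // i iN; have hf : L2 (F i.+1) := hF iN.
have [a [c [a0 cT Z0 X0 XZ]]] := pairing_parts hf.
have iZ := RintegrableD mI (pairX_integrable hf) (pairV_integrable hf).
have [h _] := parts_integral cT T0 iZ Z0 X0 XZ (inL1_integrable (ltW T0) (hb iN)).
exact: h.
Qed.

(** Conditioning replaces one factor [v] by [G], in [v phi_t] as well as in [v^2 phi_x]. Both terms
    then become linear in the [F_i], and each component is a pairing along the flow with a time
    coefficient. *)
Lemma pair_momentumE : pair_momentum T rho v phi =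
  (\sum_(i < n) \int[leb]_(t in `]0, T[) (b i.+1 t * pairX T M (F i.+1) phi t))%:E.
Proof.
have iX (i : 'I_n.+1) := BiT_integrable (ltn_ord i) (pairX_integrable (hF (ltn_ord i : (i <= n)%N))).
have iV (i : 'I_n.+1) := BiT_integrable (ltn_ord i) (pairV_integrable (hF (ltn_ord i : (i <= n)%N))).
pose PX (i : 'I_n.+1) := \int[leb]_(t in `[0, T]) (Bi b i (clampT T t) * pairX T M (Fi v0 M0 F i) (pdt phi) t).
pose PV (i : 'I_n.+1) := \int[leb]_(t in `[0, T]) (Bi b i (clampT T t) * pairV T M v (Fi v0 M0 F i) (pdx phi) t).
pose Q j := \int[leb]_(t in `]0, T[) (b j.+1 t * pairX T M (F j.+1) phi t).
have [jX eX] := Rintegral_sum (index_enum 'I_n.+1) mI iX.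
have [jV eV] := Rintegral_sum (index_enum 'I_n.+1) mI iV.
have EX : (\int[leb]_(t in (`]0%R, T[%classic : set RR)) \int[rho t]_(x in [set: RR]) (v t x * pdt phi t x)%:E =
    (\sum_(i < n.+1) PX i)%:E)%E.
  apply: (etrans _ (congr1 EFin eX)); apply: (time_integral _ jX) => t tT; have tT' := itvW tT.
  have mv := v_measurable RN tT'; have mt := mphi [:: true] t.
  have [C _ CP] := test_bounded tphi [:: true].
  rewrite (rho_integral tT'); last 2 first.
  - exact: measurable_funM.
  - exact: (pair_integrable [:: true] t (hv tT')).
  congr (_%:E); rewrite -(Gf_pairing tT' (fun f hf => pair_integrable [:: true] t hf)).
  transitivity (\int[leb]_(m in D01) (pdt phi t (X t m) * v t (X t m))).
    by apply: eq_Rintegral => m _; rewrite mulrC.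
  rewrite (v_expect T0 hF hM rM RN tT' mt (CP t)).
  by apply: eq_Rintegral => m _; rewrite mulrC.
have EV : (\int[leb]_(t in (`]0%R, T[%classic : set RR)) \int[rho t]_(x in [set: RR]) (v t x ^+ 2 * pdx phi t x)%:E =
    (\sum_(i < n.+1) PV i)%:E)%E.
  apply: (etrans _ (congr1 EFin eV)); apply: (time_integral _ jV) => t tT; have tT' := itvW tT.
  have mv := v_measurable RN tT'; have mx := mphi [:: false] t.
  have [C _ CP] := test_bounded tphi [:: false].
  have ie : leb.-integrable D01 (EFin \o (fun m => v t (X t m) ^+ 2 * pdx phi t (X t m))).
    have := pairv_integrable [:: false] tT' (hv tT'); apply: eq_integrable => // m _.
    by rewrite /= expr2 mulrA.
  rewrite (rho_integral tT' _ ie); last first.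
    by apply: measurable_funM => //; exact: measurable_funX.
  congr (_%:E); rewrite -(Gf_pairing tT' (fun f hf => pairv_integrable [:: false] tT' hf)).
  rewrite -(v_expect_sqr tT' mx (CP t)).
  by apply: eq_Rintegral => m _; rewrite expr2 mulrA.
have E (i : 'I_n.+1) : PX i + PV i = if val i is j.+1 then - Q j else 0.
  rewrite -(RintegralD mI (iX i) (iV i)) /Q -(momentum_component (ltn_ord i : (i <= n)%N)).
  by apply: eq_Rintegral => t _; rewrite mulrDr.
change (pair_momentum T rho v phi = (\sum_(i < n) Q i)%:E).
transitivity (- ((\sum_(i < n.+1) PX i)%:E + (\sum_(i < n.+1) PV i)%:E))%E.
  by congr (- (_ + _))%E; [exact: EX|exact: EV].
move: PX PV Q E {EX EV eX eV jX jV iX iV} => PX PV Q E.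
rewrite -EFinD -EFinN -big_split/= (eq_bigr _ (fun i _ => E i)) big_ord_recl/= add0r -sumrN; congr (_%:E).
by apply: eq_bigr => i _; rewrite opprK.
Qed.

(** The layer-cake formula at each time, with [phi] as a primitive of [pdx phi]; its value at
    [r + 1] is zero, which leaves the pairing with a minus sign. *)
Lemma pair_forceE : pair_force T n F b M phi =
  (\sum_(i < n) \int[leb]_(t in `]0, T[) (b i.+1 t * pairX T M (F i.+1) phi t))%:E.
Proof.
have mJ : measurable (`]0, T[ : set RR) by exact: measurable_itv.
have iF (i : 'I_n) := force_integrable (ltn_ord i : (0 < i.+1 <= n)%N).
have [jF eF] := Rintegral_sum (index_enum 'I_n) mJ iF.
have jF' := RintegrableZl (-1) mJ jF.
have [a [c [r [a0 cT r0 phi0]]]] := test_support tphi.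
rewrite /pair_force.
transitivity (- (\int[leb]_(t in (`]0%R, T[%classic : set RR))
    (-1 * \sum_(i < n) b i.+1 t * pairX T M (F i.+1) phi t)%:E))%E; last first.
  rewrite (EFin_Rintegral mJ jF') (RintegralZl _ mJ jF) -eF -EFinN; congr (_%:E).
  by rewrite mulN1r opprK.
congr (- _)%E; apply: eq_integral => t; rewrite inE/= in_itv/= => tT.
have tT' := itvW tT.
have sm := tphi.1; have [_ dphi _] := smooth2_derive [::] sm; have [_ _ cx] := smooth2_derive [:: false] sm.
have cphi : continuous (pdx phi t).
  by have [C [L bl]] := test_lipschitz tphi [:: false]; exact: bounded_lipschitz_continuous (bl t).
have phix0 x : r + 1 <= `|x| -> pdx phi t x = 0.
  by move=> rx; apply: (phi0 [:: false]); right; right; lra.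
have phir : phi t (r + 1) = 0.
  by apply: (phi0 [::]); right; right; rewrite ger0_norm; lra.
have r1 : 0 <= r + 1 by lra.
have LC (i : 'I_n) := layer_cake r1 (Xf_galois_on T0 hM tT') (fun x => inR_itv x (hM tT')) (hM tT').1
  (L2_integrable (hF (ltn_ord i : (i.+1 <= n)%N))) cphi (dphi t) phix0.
have iL (i : 'I_n) : leb.-integrable setT (EFin \o (fun x => b i.+1 t * (primitive01 (F i.+1) (M t x) * pdx phi t x))).
  by have [h _ _] := LC i; apply: RintegrableZl => //; exact: h.
have [jL eL] := Rintegral_sum (index_enum 'I_n) measurableT iL.
transitivity (\int[leb]_(x in setT) (\sum_(i < n) b i.+1 t * (primitive01 (F i.+1) (M t x) * pdx phi t x))%:E)%E.
  apply: eq_integral => x _; congr (_%:E); rewrite big_add1 big_mkord.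
  by apply: eq_bigr => i _; rewrite mulrA.
rewrite (EFin_Rintegral measurableT jL) eL mulN1r -sumrN; congr (_%:E).
apply: eq_bigr => i _; have [h1 h2 h3] := LC i.
rewrite (RintegralZl _ measurableT h1) h3 -mulrN; congr (_ * _).
rewrite -mulN1r -(RintegralZl _ mD (pair_integrable [::] t (hF (ltn_ord i : (i.+1 <= n)%N)))).
by apply: eq_Rintegral => m _; rewrite (phir : iter_pd [::] phi t (r + 1) = 0) sub0r mulN1r mulrN.
Qed.

End pairings.

(** * Norms *)

Section cdf.
Context (R : realType).
Notation RR := (measurableTypeR R).

(* Carries the probability structure needed for the library's lemmas on [cdf]. *)
Definition prob_fun (mu : {measure set RR -> \bar R}) (mu1 : is_prob mu) : set RR -> \bar R := mu.

Section prob_fun.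
Context (mu : {measure set RR -> \bar R}) (mu1 : is_prob mu).
HB.instance Definition _ := Measure.copy (prob_fun mu1) mu.
HB.instance Definition _ := Measure_isProbability.Build _ RR R (prob_fun mu1) mu1.
End prob_fun.

Lemma cdf_of_inR (mu : {measure set RR -> \bar R}) : is_prob mu ->
  inR (cdf_of mu) /\ is_deriv_measure (cdf_of mu) mu.
Proof.
move=> mu1.
pose P : probability RR R := prob_fun mu1.
pose X : {mfun RR >-> R} := HB.pack_for {mfun RR >-> R} (idfun : RR -> R)
  (isMeasurableFun.Build _ _ RR R idfun (@measurable_id _ RR setT)).
have cE x : cdf (X : {RV P >-> R}) x = mu `]-oo, x]%classic by [].
have fE x : mu `]-oo, x]%classic \is a fin_num.
  by rewrite -cE; apply: fin_num_measure.
have E x : cdf (X : {RV P >-> R}) x = (cdf_of mu x)%:E by rewrite cE /cdf_of fineK.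
have EF : cdf (X : {RV P >-> R}) = EFin \o cdf_of mu by apply/funext.
split; last by move=> x; rewrite -E.
split; first by move=> x y xy; rewrite -lee_fin -!E; exact: cdf_nondecreasing.
split; first by move=> x; have := @cdf_right_continuous _ _ _ P X x; rewrite EF => /fine_cvgP[_].
split; first by have := @cvg_cdfNy0 _ _ _ P X; rewrite EF => /fine_cvgP[_].
by have := @cvg_cdfy1 _ _ _ P X; rewrite EF => /fine_cvgP[_].
Qed.

End cdf.

(** * Norms of fluxes, label functions and coefficients *)

Section norms.
Context (R : realType).
Notation RR := (measurableTypeR R).
Notation leb := (@lebesgue_measure R).
Notation D01 := (`]0%R, 1%R[%classic : set RR).

Lemma LnormZ_measurable (p c : R) (f : R -> R) : 0 < p -> measurable_fun [set: RR] (f : RR -> R) ->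
  (Lnorm leb p%:E (EFin \o (fun x => (c * f x)%R)) = `|c|%:E * Lnorm leb p%:E (EFin \o f))%E.
Proof.
move=> p0 mf; rewrite unlock /=.
transitivity ((\int[leb]_x ((`|c| `^ p)%:E * `|(f x)%:E| `^ p)) `^ p^-1)%E.
  by congr (_ `^ _)%E; apply: eq_integral => x _; rewrite normrM powRM// EFinM.
have m : measurable_fun [set: RR] (fun x : RR => (`|(f x)%:E| `^ p)%E).
  apply/measurable_EFinP; exact: norm_powR_measurable.
rewrite ge0_integralZl//; last by move=> x _; rewrite poweR_ge0.
rewrite poweRM ?lee_fin ?powR_ge0 ?integral_ge0//; last by move=> x _; rewrite poweR_ge0.
by rewrite poweR_EFin -powRrM mulfV ?gt_eqF// powRr1.
Qed.

Lemma Lnorm_sum_le (p : R) (I : Type) (s : seq I) (c : I -> R) (f : I -> R -> R) : 1 <= p ->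
  (forall i, measurable_fun [set: RR] (f i : RR -> R)) ->
  (Lnorm leb p%:E (EFin \o (fun x => (\sum_(i <- s) c i * f i x)%R)) <=
   \sum_(i <- s) `|c i|%:E * Lnorm leb p%:E (EFin \o f i))%E.
Proof.
move=> p1 mf; have p0 : 0 < p by exact: lt_le_trans ltr01 p1.
have ms r : measurable_fun [set: RR] (fun x : RR => \sum_(i <- r) c i * f i x : R).
  apply: measurable_sum => i; apply: measurable_funM => //; exact: measurable_cst.
elim: s => [|i s IH].
  rewrite big_nil (_ : _ \o _ = cst 0%E); last by apply/funext => x /=; rewrite big_nil.
  by rewrite Lnorm0// eqe gt_eqF.
rewrite big_cons -LnormZ_measurable//.
apply: le_trans (leeD2l _ IH).
rewrite (_ : (fun x => _) = ((fun x => (c i * f i x)%R) \+ (fun x => (\sum_(j <- s) c j * f j x)%R))%R); last first.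
  by apply/funext => x; rewrite big_cons.
apply: minkowski_EFin => //; apply: measurable_funM => //; exact: measurable_cst.
Qed.

Lemma normLp01E (p : R) (F : R -> R) : 0 < p ->
  (normLp01 p F = (\int[leb]_(m in D01) (`|F m| `^ p)%:E) `^ p^-1)%E.
Proof.
move=> p0; rewrite /normLp01 Lnorm.unlock.
apply: (congr1 (fun x => poweR x p^-1)).
rewrite [RHS]integral_mkcond; apply: eq_integral => x _.
rewrite /ext01 patchE mem_setE in_itv /=; case: ifP => // _.
by rewrite normr0 powR0// gt_eqF.
Qed.

Lemma inLp01_norm (p : R) (F : R -> R) : 0 < p -> inLp01 p F -> normLp01 p F \is a fin_num.
Proof.
move=> p0 [mF iF]; rewrite normLp01E// fin_num_poweR// ge0_fin_numE//.
by apply: integral_ge0 => m _; rewrite lee_fin powR_ge0.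
Qed.

(** On the unit interval [x^2 <= 1 + x^p]; this is where [2 <= p] is used. *)
Lemma inLp01_L2 (p : R) (F : R -> R) : 2 <= p -> inLp01 p F -> L2 F.
Proof.
move=> p2 [mF iF]; split => //.
have mp : measurable_fun D01 (fun m => `|F m| `^ p) by exact: norm_powR_measurable.
have ip : leb.-integrable D01 (EFin \o (fun m => `|F m| `^ p)).
  apply/integrableP; split; first exact/measurable_EFinP.
  apply: le_lt_trans iF; rewrite le_eqVlt; apply/orP; left; apply/eqP.
  by apply: eq_integral => m _; rewrite /= ger0_norm// powR_ge0.
apply: (dominated_integrable (@mD01 R) _ (RintegrableD (@mD01 R) (@D01_cst_integrable R 1) ip)).
  exact: measurable_funX.
move=> m _; rewrite ger0_norm ?sqr_ge0// -sqr_powR.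
have q1 : 1 <= p / 2 by rewrite ler_pdivlMr// mul1r.
have := powR_le1D q1 (powR_ge0 `|F m| 2).
by rewrite -powRrM mulrCA mulfV ?mulr1// pnatr_eq0.
Qed.

Lemma inLp01_comp (p : R) (mu : {measure set RR -> \bar R}) (M X u : R -> R) :
  is_deriv_measure M mu -> inR M -> galois M X -> inLp p mu u -> inLp01 p (u \o X).
Proof.
move=> muM iM g [mu1 iu].
have gX := galois_ext01 g.
have mX : measurable_fun [set: RR] (ext01 X : RR -> R) by exact: ext01_measurable (galois_measurable g).
split; first exact: measurableT_comp mu1 (galois_measurable g).
have M01 x := inR_itv x iM.
apply: le_lt_trans iu; rewrite (law_ge0_integral muM M01 gX mX (norm_powR_measurable p mu1) (fun x => powR_ge0 _ _)).
rewrite le_eqVlt; apply/orP; left; apply/eqP; apply: eq_integral => m; rewrite inE/= in_itv/= => m01.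
by rewrite ext01E.
Qed.

(** If [|B r|] exceeded the essential supremum, continuity would make [|B|] exceed it on an interval
    around [r] inside []0, T[], which has positive measure. *)
Lemma norm_le_normLinf (T : R) (B : R -> R) (r : R) : {for r, continuous B} -> 0 < r < T ->
  (`|B r|%:E <= normLinf0T T B)%E.
Proof.
move=> cB /andP[r0 rT]; have lT : (0 < leb [set: R])%E by rewrite -set_itvNyy lebesgue_measure_itv/= ltey.
rewrite /normLinf0T unlock lT leNgt; apply/negP; set y := ess_sup _ _ => yB.
have y0 : (0 <= y)%E by apply: ess_sup_gee => //; apply: nearW => x; exact: abse_ge0.
have yf : y \is a fin_num by rewrite ge0_fin_numE// (lt_trans yB)// ltry.
have yB' : fine y < `|B r| by rewrite -lte_fin fineK.
have [d /= d0 dP] : \forall x \near r, fine y < `|B x|.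
  exact: (cvgr_gt _ (cvg_norm cB) _ yB').
have [A [mA A0 AP]] := ess_sup_ge leb (abse \o (fun t => (B t * \1_(`]0, T[%classic) t)%:E)).
pose a := Num.max 0 (r - d); pose c := Num.min T (r + d).
have ar : a < r by rewrite gt_max r0/=; lra.
have rc : r < c by rewrite lt_min rT/=; lra.
have sub : `]a, c[ `<=` A.
  move=> x /=; rewrite in_itv/= gt_max lt_min => /andP[/andP[x0 xa] /andP[xT xc]].
  apply: AP => /=; rewrite -/y -[y in (_ <= y)%E]fineK// lee_fin indicE mem_set ?mulr1; last by rewrite /= in_itv/= x0.
  apply/negP; rewrite -ltNge; apply: dP => /=; rewrite ltr_norml; apply/andP; split; lra.
have mI : measurable (`]a, c[%classic : set RR) by exact: measurable_itv.
have : (leb `]a, c[%classic <= leb A)%E by apply: le_measure; rewrite ?inE.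
by rewrite A0 lebesgue_measure_itv/= lte_fin (lt_trans ar rc) -EFinB lee_fin leNgt subr_gt0 (lt_trans ar rc).
Qed.

End norms.

(** * Assembly of the estimates *)

Section main.
Context (R : realType).
Notation RR := (measurableTypeR R).
Notation leb := (@lebesgue_measure R).
Notation D01 := (`]0%R, 1%R[%classic : set RR).
Context (p T : R) (rho0 : {measure set RR -> \bar R}) (v0 : R -> R) (n : nat) (F b : nat -> R -> R).
Context (M : R -> R -> R) (rho : R -> {measure set RR -> \bar R}) (v : R -> R -> R).
Notation M0 := (cdf_of rho0).
Hypothesis p2 : 2 <= p.
Hypothesis T0 : 0 < T.
Hypothesis rho0p : inPp p rho0.
Hypothesis v0p : inLp p rho0 v0.
Hypothesis Fp : forall i, (1 <= i <= n)%N -> inLp01 p (F i).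
Hypothesis hb : forall i, (1 <= i <= n)%N -> inL1 T (b i).
Hypothesis hMp : forall t, 0 <= t <= T -> inRp p (M t).
Hypothesis ent : entropy_solution T (fluxU n v0 M0 F b) M0 M.
Hypothesis rM : forall t, 0 <= t <= T -> is_deriv_measure (M t) (rho t).
Hypothesis RN : forall t, 0 <= t <= T -> is_RN_flux (rho t) (fun x => fluxU n v0 M0 F b t (M t x)) (v t).
Notation X := (Xf T M).
Notation G := (Gf T n v0 M0 F b).
Notation f i := (Fi v0 M0 F i).

Let mD := @mD01 R.
Let p0 : 0 < p. Proof. exact: lt_le_trans p2. Qed.
Let p1 : 1 < p. Proof. by apply: lt_le_trans p2; rewrite ltr1n. Qed.
Let hM t : 0 <= t <= T -> inR (M t). Proof. by move=> tT; case: (hMp tT). Qed.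

(** For [i = 0] the assumption concerns [v0] under [rho0]; since [rho0] is the law of the inverse of
    its distribution function, the power integral is the same. *)
Lemma Fi_Lp i : (i <= n)%N -> inLp01 p (f i).
Proof.
case: i => [|i] iN; last exact: Fp.
have [iM0 dM0] := cdf_of_inR rho0p.1.
exact: inLp01_comp dM0 iM0 (inR_ginv_galois iM0) v0p.
Qed.

Let hF i : (i <= n)%N -> L2 (f i).
Proof. by move=> iN; exact: inLp01_L2 p2 (Fi_Lp iN). Qed.

Lemma Fi_norm_fin i : (i <= n)%N -> normLp01 p (f i) \is a fin_num.
Proof. by move=> iN; exact: inLp01_norm p0 (Fi_Lp iN). Qed.

Lemma norm_ge0 i : (0 <= normLp01 p (f i))%E.
Proof. exact: Lnorm_ge0. Qed.

Lemma Gf_norm_le t : (normLp01 p (G t) <=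
  \sum_(i < n.+1) `|Bi b i (clampT T t)|%:E * normLp01 p (f i))%E.
Proof.
have mf (i : 'I_n.+1) : measurable_fun [set: RR] (ext01 (f i) : RR -> R).
  by apply: ext01_measurable; exact: (hF (ltn_ord i : (i <= n)%N)).1.
have := @Lnorm_sum_le R p _ (index_enum 'I_n.+1) (fun i => Bi b i (clampT T t)) (fun i => ext01 (f i)) (ltW p1) mf.
apply: le_trans; rewrite le_eqVlt; apply/orP; left; apply/eqP.
apply: eq_Lnorm => m; rewrite /= /ext01; case: ifP => // _.
by rewrite big1// => i _; rewrite mulr0.
Qed.

Lemma Gf_Lp t (K : R) : 0 <= K -> (normLp01 p (G t) <= K%:E)%E ->
  leb.-integrable D01 (EFin \o (fun m => `|G t m| `^ p)) /\
  \int[leb]_(m in D01) (`|G t m| `^ p) <= K `^ p.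
Proof.
move=> K0 GK; have [mG _] := Gf_L2 T b hF t.
have I0 : (0 <= \int[leb]_(m in D01) (`|G t m| `^ p)%:E)%E.
  by apply: integral_ge0 => m _; rewrite lee_fin powR_ge0.
have IK : (\int[leb]_(m in D01) (`|G t m| `^ p)%:E <= (K `^ p)%:E)%E.
  have N0 : (0 <= normLp01 p (G t))%E by exact: Lnorm_ge0.
  have := gt0_ler_poweR (ltW p0) _ _ GK.
  rewrite normLp01E// -poweRrM mulVf ?gt_eqF// poweRe1// poweR_EFin; apply.
    by rewrite -normLp01E// in_itv/= N0 leey.
  by rewrite in_itv/= leey lee_fin K0.
have ip : leb.-integrable D01 (EFin \o (fun m => `|G t m| `^ p)).
  apply/integrableP; split; first by apply/measurable_EFinP; exact: norm_powR_measurable.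
  apply: (@le_lt_trans _ _ (K `^ p)%:E); last by rewrite ltry.
  apply: le_trans IK; rewrite le_eqVlt; apply/orP; left; apply/eqP.
  by apply: eq_integral => m _; rewrite /= ger0_norm// powR_ge0.
split; first exact: ip.
by rewrite -lee_fin -EFin_Rintegral.
Qed.

Lemma Gf_norm_fin t : normLp01 p (G t) \is a fin_num.
Proof.
have h := Gf_norm_le t; rewrite ge0_fin_numE ?Lnorm_ge0//; apply: (le_lt_trans h).
rewrite -ge0_fin_numE; last by apply: sume_ge0 => i _; rewrite mule_ge0// norm_ge0.
by apply/sum_fin_numP => i _ _; rewrite fin_numM// Fi_norm_fin// -ltnS ltn_ord.
Qed.

Lemma v_norm_le t : 0 <= t <= T -> inLp p (rho t) (v t) /\
  (normLp p (rho t) (v t) <= \sum_(i < n.+1) `|Bi b i t|%:E * normLp01 p (f i))%E.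
Proof.
move=> tT; have mv := v_measurable RN tT.
have N0 : 0 <= fine (normLp01 p (G t)) by apply: fine_ge0; exact: Lnorm_ge0.
have GN : (normLp01 p (G t) <= (fine (normLp01 p (G t)))%:E)%E by rewrite fineK// Gf_norm_fin.
have [iG _] := Gf_Lp N0 GN.
have [iv vG] := v_power T0 hF hM rM RN tT p1 iG.
have E : (\int[rho t]_x (`|v t x| `^ p)%:E = (\int[leb]_(m in D01) (`|v t (X t m)| `^ p))%:E)%E.
  rewrite (law_ge0_integral (rM tT) (fun x => inR_itv x (hM tT)) (Xf_galois_on T0 hM tT) (Xf_measurable T0 hM t)
    (norm_powR_measurable p mv) (fun x => powR_ge0 _ _)).
  exact: EFin_Rintegral.
split; first by split => //; rewrite E ltry.
have := Gf_norm_le t; rewrite clampT_id//; apply: le_trans.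
rewrite normLp01E// /normLp unlock.
rewrite (EFin_Rintegral mD iG).
have -> : (\int[rho t]_x `|(EFin \o v t) x| `^ p)%E = (\int[leb]_(m in D01) (`|v t (X t m)| `^ p))%:E.
  by rewrite -E; apply: eq_integral.
have q0 : 0 <= p^-1 by rewrite invr_ge0 ltW.
have a0 : \int[leb]_(m in D01) (`|v t (X t m)| `^ p) \is Num.nneg.
  by rewrite nnegrE; apply: Rintegral_ge0 => m _; exact: powR_ge0.
have c0 : \int[leb]_(m in D01) (`|G t m| `^ p) \is Num.nneg.
  by rewrite nnegrE; apply: Rintegral_ge0 => m _; exact: powR_ge0.
rewrite !poweR_EFin lee_fin; exact: (ge0_ler_powR q0 a0 c0 vG).
Qed.

Lemma rho_Pp t : 0 <= t <= T -> inPp p (rho t).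
Proof.
move=> tT; split; last by have [_] := hMp tT; apply; exact: rM.
rewrite /is_prob (law_eq (rM tT) (fun x => inR_itv x (hM tT)) (Xf_galois_on T0 hM tT) (Xf_measurable T0 hM t) measurableT).
by rewrite preimage_setT setIT leb_D01.
Qed.

Lemma normLinf_Bi_fin i : (i <= n)%N -> (0 <= normLinf0T T (Bi b i))%E /\ normLinf0T T (Bi b i) \is a fin_num.
Proof.
move=> iN; have [C C0 CP] := BiT_bounded T0 hb iN.
have h0 : (0 <= normLinf0T T (Bi b i))%E by exact: Lnorm_ge0.
split; first exact: h0.
rewrite ge0_fin_numE//; apply: (@le_lt_trans _ _ C%:E); last by rewrite ltry.
rewrite /normLinf0T unlock; case: ifP => _; last by rewrite lee_fin.
apply/ess_supP; apply: nearW => t /=; rewrite lee_fin indicE.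
case: (boolP (t \in _)) => [|_]; last by rewrite mulr0 normr0.
rewrite inE/= in_itv/= mulr1 => /andP[t0 tT].
by have := CP t; rewrite clampT_id// !ltW.
Qed.

Lemma Bi_le_normLinf i r : (i <= n)%N -> 0 < r < T -> (`|Bi b i r|%:E <= normLinf0T T (Bi b i))%E.
Proof.
move=> iN rT; apply: norm_le_normLinf => //.
have c : Bi b i (clampT T x) @[x --> r] --> Bi b i (clampT T r) by have h := @BiT_continuous R T n b T0 hb i iN; exact: (@h r).
have rT' : 0 <= r <= T by case/andP: rT => r0 r1; rewrite !ltW.
(* Continuity was proved for the coefficient of clamped time; near an interior time clamping does
   nothing. *)
rewrite [in X in _ --> X](clampT_id rT') in c; move: c; apply: cvg_trans; apply: near_eq_cvg.
have : \forall x \near r, x \in `]0, T[ by apply: near_in_itvoo; rewrite in_itv/=.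
apply: filterS => x; rewrite in_itv/= => /andP[x0 xT].
by rewrite clampT_id// !ltW.
Qed.

(** By Minkowski's inequality the norm of [G] at each interior time is at most the sum [S], so the
    Lagrangian estimate applies with [K = S ^ p], and the root in the Wasserstein distance returns
    [S] itself. *)
Lemma wasserstein_lipschitz s t : 0 <= s -> s <= t -> t <= T ->
  (wasserstein p (rho t) (rho s) <= `|t - s|%:E *
     \sum_(i < n.+1) (normLp01 p (f i) * normLinf0T T (Bi b i)))%E.
Proof.
move=> s0 st tT.
have sT : 0 <= s <= T by rewrite s0 (le_trans st).
have tT' : 0 <= t <= T by rewrite tT (le_trans s0).
set S := (\sum_(i < n.+1) _)%E.
have Sf : S \is a fin_num.
  apply/sum_fin_numP => i _ _; have iN : (i <= n)%N by rewrite -ltnS ltn_ord.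
  by rewrite fin_numM ?Fi_norm_fin//; have [] := normLinf_Bi_fin iN.
have S0 : (0 <= S)%E.
  apply: sume_ge0 => i _; have iN : (i <= n)%N by rewrite -ltnS ltn_ord.
  by rewrite mule_ge0 ?norm_ge0//; have [] := normLinf_Bi_fin iN.
have S0' : 0 <= fine S by exact: fine_ge0.
have GK r : 0 < r < T -> (normLp01 p (G r) <= (fine S)%:E)%E.
  move=> rT; rewrite fineK//; apply: (le_trans (Gf_norm_le r)).
  have rT' : 0 <= r <= T by case/andP: rT => r0 r1; rewrite !ltW.
  rewrite clampT_id//; apply: lee_sum => i _; have iN : (i <= n)%N by rewrite -ltnS ltn_ord.
  by rewrite muleC; apply: lee_wpmul2l; [exact: norm_ge0|exact: Bi_le_normLinf].
have ts0 : 0 <= t - s by rewrite subr_ge0.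
rewrite ger0_norm// -(fineK Sf) -EFinM.
apply: (wasserstein_le p0 (mulr_ge0 ts0 S0') (rM tT') (fun x => inR_itv x (hM tT')) (Xf_galois_on T0 hM tT')
  (Xf_measurable T0 hM t) (rM sT) (fun x => inR_itv x (hM sT)) (Xf_galois_on T0 hM sT) (Xf_measurable T0 hM s)).
rewrite powRM//.
apply: (@lagrangian_power R T n v0 M0 F b M T0 hF hb hM ent p (fine S `^ p) p1 _ s t s0 st tT).
by move=> r rT; exact: Gf_Lp S0' (GK r rT).
Qed.

Lemma distributional : distributional_solution T n F b M rho v.
Proof.
move=> phi tphi; split; first exact: (pair_mass_eq0 T0 hF hb hM ent rM RN tphi).
rewrite (pair_momentumE T0 hF hb hM ent rM RN tphi).
by rewrite (pair_forceE T0 hF hb hM ent rM RN tphi).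
Qed.

End main.

Theorem theorem4p14 (R : realType) (p T : R)
    (rho0 : {measure set (measurableTypeR R) -> \bar R}) (v0 : R -> R)
    (n : nat) (F b : nat -> R -> R)
    (M : R -> R -> R) (rho : R -> {measure set (measurableTypeR R) -> \bar R})
    (v : R -> R -> R) :
  2 <= p -> 0 < T ->
  inPp p rho0 -> inLp p rho0 v0 ->
  (forall i, (1 <= i <= n)%N -> inLp01 p (F i)) ->
  (forall i, (1 <= i <= n)%N -> inL1 T (b i)) ->
  let M0 := cdf_of rho0 in
  let U := fluxU n v0 M0 F b in
  (* M is the entropy solution, with M(t,.) in R_p *)
  (forall t, 0 <= t <= T -> inRp p (M t)) ->
  entropy_solution T U M0 M ->
  (* rho(t) = d_x M(t,.) *)
  (forall t, 0 <= t <= T -> is_deriv_measure (M t) (rho t)) ->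
  (* v(t,.) = U'_M(t,.) *)
  (forall t, 0 <= t <= T -> is_RN_flux (rho t) (fun x => U t (M t x)) (v t)) ->
  (forall t, 0 < t < T -> inTp p (rho t) (v t)) /\
  distributional_solution T n F b M rho v /\
  (forall t, 0 < t <= T -> inPp p (rho t) /\ inLp p (rho t) (v t)) /\
  (\forall t \ae (@lebesgue_measure R), 0 < t < T ->
      (normLp p (rho t) (v t)
       <= \sum_(i < n.+1) (`|Bi b i t|%:E * normLp01 p (Fi v0 M0 F i)))%E) /\
  (forall s t, 0 <= s -> s <= t -> t <= T ->
      (wasserstein p (rho t) (rho s)
       <= `|t - s|%:E * \sum_(i < n.+1)
              (normLp01 p (Fi v0 M0 F i) * normLinf0T T (Bi b i)))%E).
Proof.
move=> p2 T0 r0 v0p Fp hb M0 U hMp ent rM RN.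
have Pp t : 0 <= t <= T -> inPp p (rho t) := rho_Pp T0 hMp rM (t := t).
have V t (tT : 0 <= t <= T) := v_norm_le p2 T0 r0 v0p Fp hMp rM RN tT.
split; [|split; [|split; [|split]]].
- move=> t /andP[t0 tT]; have tT' : 0 <= t <= T by rewrite !ltW.
  by split; [exact: Pp|exact: (V t tT').1].
- exact: (distributional p2 T0 r0 v0p Fp hb hMp ent rM RN).
- move=> t /andP[t0 tT]; have tT' : 0 <= t <= T by rewrite ltW.
  by split; [exact: Pp|exact: (V t tT').1].
(* The velocity is prescribed at every time, so the norm bound holds everywhere in []0, T[] and in
   particular almost everywhere. *)
- apply: aeW => t /andP[t0 tT]; have tT' : 0 <= t <= T by rewrite !ltW.
  exact: (V t tT').2.
- move=> s t; exact: (wasserstein_lipschitz p2 T0 r0 v0p Fp hb hMp ent rM).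
Qed.
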